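(* Consider the single sample split estimators $\hat\psi^{\mathrm{INT}}_{k_1,k_2}$, $\hat\psi^{\mathrm{MC}}_{k_1,k_2}$, $\hat\psi^{\mathrm{IF}}_{k_1,k_2}$ of $\psi(\mathbb P)=\mathbb E_{\mathbb P}[\mathrm{Cov}_{\mathbb P}(A,Y\mid X)]$ over $\mathcal P_{(\alpha,\beta)}$ defined in the context. The following hold: (1) $\hat\psi^{\mathrm{INT}}_{k_1,k_2}$ requires undersmoothing $k_1$ when $\beta<\alpha\wedge\frac d2$ and requires undersmoothing $k_2$ when $\alpha<\beta\wedge\frac d2$ to achieve its best rate for estimating $\psi(\mathbb P)$ (i.e. $n^{-1}$ when $\frac{\alpha+\beta}2\ge\frac d2$ and $n^{-\frac{2\alpha+2\beta}{\alpha+\beta+d}}$ when $\frac{\alpha+\beta}2<\frac d2$). (2) $\hat\psi^{\mathrm{MC}}_{k_1,k_2}$ requires undersmoothing $k_1$ when $\beta<\alpha\wedge\frac d2$ and requires undersmoothing $k_2$ when $\alpha<\beta\wedge\frac d2$ to achieve its best rate for estimating $\psi(\mathbb P)$ (i.e. $n^{-1}$ when $\frac{\alpha+\beta}2\ge\frac d2$ and $n^{-\frac{2\alpha+2\beta}{\alpha+\beta+d}}$ when $\frac{\alpha+\beta}2<\frac d2$). (3) $\hat\psi^{\mathrm{IF}}_{k_1,k_2}$ requires undersmoothing $k_{\ell_1}$ and oversmoothing $k_{\ell_2}$ ($\ell_1,\ell_2\in\{1,2\}$, $\ell_1\ne\ell_2$) when $\alpha\vee\beta<\frac d2$ to achieve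 its best rate for estimating $\psi(\mathbb P)$ (i.e. the minimax rate $n^{-1}$ when $\frac{\alpha+\beta}2\ge\frac d4$ and $n^{-\frac{4\alpha+4\beta}{2\alpha+2\beta+d}}$ when $\frac{\alpha+\beta}2<\frac d4$).
   Context: Notation. $a\vee b=\max(a,b)$, $a\wedge b=\min(a,b)$; integrals are over $[0,1]^d$. For nonnegative sequences, $a_n\lesssim b_n$ means there is a constant $C>0$ with $a_n\le Cb_n$ for all $n\ge n_0$; $a_n\gtrsim b_n$ means $b_n\lesssim a_n$; $a_n\asymp b_n$ means both; $a_n\ll b_n$ means $a_n/b_n\to0$; $a_n\gg b_n$ means $a_n/b_n\to\infty$. Resolutions $k_1,k_2$ are sequences that may depend on $n$. Wavelets. Fix a compactly supported Cohen–Daubechies–Vial type orthonormal wavelet basis $\{\Phi_{J_0m},\Psi^{\iota}_{lm'}: m\in\mathcal Z_{J_0},\,m'\in\mathcal Z_l,\,\iota\in\{0,1\}^d\setminus\{0\},\,l\ge J_0\}$ of $L^2([0,1]^d)$ of regularity $S\ge1$, $S>\alpha\vee\beta$, with $2^{J_0}\ge S$, $|\mathcal Z_l|\asymp 2^{ld}$. For $j\ge J_0$ let $V_j=\mathrm{span}\{\Phi_{jm}:m\in\mathcal Z_j\}$ ($\{\Phi_{jm}\}_m$ the orthonormal scaling functions at level $j$; the $V_j$ are nested). A resolution is a number $k=2^{jd}$, $j\ge J_0$ (so prescribed values such as $c\,n^a$ are understood up to bounded constant factors); write $V_k,\Phi_{km},\mathcal Z_k$ for $V_j,\Phi_{jm},\mathcal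 Z_j$. Standard properties: $|\Phi_{km}|\lesssim\sqrt k$ uniformly with support in a set of Lebesgue measure $O(1/k)$; $V_k$ contains all polynomials of degree at most $S-1$. The projection kernel is $K_{V_k}(x,y)=\sum_{m\in\mathcal Z_k}\Phi_{km}(x)\Phi_{km}(y)$. Hölder ball. $H(\alpha,M)$ is the set of uniformly continuous $h:[0,1]^d\to\mathbb R$ with $2^{J_0(\alpha+d/2)}\max_m|\langle h,\Phi_{J_0m}\rangle|+\sup_{l\ge J_0,m\in\mathcal Z_l,\iota}2^{l(\alpha+d/2)}|\langle h,\Psi^\iota_{lm}\rangle|\le M$. Model. $\mathcal P_{(\alpha,\beta)}$ is the set of distributions $\mathbb P$ of $(X,A,Y)\in[0,1]^d\times\mathbb R\times\mathbb R$ with $X\sim\mathrm{Uniform}([0,1]^d)$, $A,Y\in[C_1,C_2]$ a.s., $p(x):=\mathbb E_{\mathbb P}[A\mid X=x]\in H(\alpha,M)$ and $b(x):=\mathbb E_{\mathbb P}[Y\mid X=x]\in H(\beta,M)$, where $C_1,C_2\in\mathbb R$, $\alpha,\beta,M>0$ are fixed known constants. The functional is $\psi(\mathbb P)=\mathbb E_{\mathbb P}[\mathrm{Cov}_{\mathbb P}(A,Y\mid X)]$. Estimators. I.i.d. observations from $\mathbb P$ are split into disjoint subsamples $\mathcal D_1,\mathcal D_2,\dots$, each of size $n$. Put $\hat p^{(j)}_k(x)=\frac1n\sum_{i\in\mathcal D_j}A_iK_{V_k}(X_i,x)$ and $\hat b^{(j)}_k(x)=\frac1n\sum_{i\in\mathcal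 D_j}Y_iK_{V_k}(X_i,x)$. With single sample splitting: $\hat\psi^{\mathrm{INT}}_{k_1,k_2}=\frac1n\sum_{i\in\mathcal D_2}A_iY_i-\int\hat p^{(1)}_{k_1}(x)\hat b^{(1)}_{k_2}(x)\,dx$; $\hat\psi^{\mathrm{MC}}_{k_1,k_2}=\frac1n\sum_{i\in\mathcal D_2}A_iY_i-\frac1n\sum_{i\in\mathcal D_3}\hat p^{(1)}_{k_1}(X_i)\hat b^{(1)}_{k_2}(X_i)$; $\hat\psi^{\mathrm{IF}}_{k_1,k_2}=\frac1n\sum_{i\in\mathcal D_2}(A_i-\hat p^{(1)}_{k_1}(X_i))(Y_i-\hat b^{(1)}_{k_2}(X_i))$. Rates and tuning. For an estimator $\hat\psi$ with given resolution sequences let $R_n=\sup_{\mathbb P\in\mathcal P_{(\alpha,\beta)}}\mathbb E_{\mathbb P}[(\hat\psi-\psi(\mathbb P))^2]$. Its best rate is $r_n$ if some choice of resolutions gives $R_n\lesssim r_n$ while every choice gives $R_n\gtrsim r_n$; a choice achieves the best rate if it gives $R_n\lesssim r_n$. The prediction-optimal resolutions are $k_1^{\mathrm{pred}}=c_1n^{\frac d{2\alpha+d}}$ and $k_2^{\mathrm{pred}}=c_2n^{\frac d{2\beta+d}}$ for fixed $c_1,c_2>0$. Undersmoothing (oversmoothing) $k_\ell$ means choosing $k_\ell\gg k_\ell^{\mathrm{pred}}$ ($k_\ell\ll k_\ell^{\mathrm{pred}}$). ''Requires undersmoothing $k_\ell$ to achieve its best rate'' means every choice of resolutions achieving the best rate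 satisfies $k_\ell\gg k_\ell^{\mathrm{pred}}$. ''Requires undersmoothing $k_{\ell_1}$ and oversmoothing $k_{\ell_2}$ ($\ell_1\neq\ell_2$)'' means that in every choice achieving the best rate one of the two resolutions is undersmoothed and the other is oversmoothed; if which of the two is larger is allowed to vary with $n$, this is read as $\max\{\min(k_1/k_1^{\mathrm{pred}},k_2^{\mathrm{pred}}/k_2),\min(k_2/k_2^{\mathrm{pred}},k_1^{\mathrm{pred}}/k_1)\}\to\infty$.
   Formalization: It is additionally assumed that C_1 < C_2 and that the class of distributions is nonempty already for some Hölder radius M' < M; otherwise (e.g. C_1 = C_2 = 0, where every risk is 0) the lower bound ''every choice gives R_n ≳ r_n'' fails. *)

(* Defs.v *)
From HB Require Import structures.
From mathcomp Require Import all_boot all_order all_algebra.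
From mathcomp Require Import all_classical all_reals all_analysis.
Set Implicit Arguments.
Unset Strict Implicit.
Unset Printing Implicit Defensive.
Import Order.TTheory GRing.Theory Num.Theory.
Import numFieldNormedType.Exports.
Local Open Scope classical_set_scope.
Local Open Scope ring_scope.

Section product_measure.
Context {disp : measure_display} {T : measurableType disp} {R : realType}.

Definition tcons n (w : T * n.-tuple T) : n.+1.-tuple T := [tuple of w.1 :: w.2].

Lemma measurable_tcons n : measurable_fun setT (@tcons n).
Proof. exact: measurable_cons. Qed.

HB.instance Definition _ n :=
  isMeasurableFun.Build _ _ _ _ (@tcons n) (@measurable_tcons n).

(* The law of n i.i.d. draws from P. *)
Fixpoint iid (P : probability T R) (n : nat) : probability (n.-tuple T) R :=
  if n is n'.+1 then distribution (P \x iid P n')%E (@tcons n')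
  else @dirac _ (0.-tuple T) [tuple] R.

End product_measure.

Section uniform01.
Context {R : realType}.

(* [uniform_prob] lives on [measurableTypeR R], a copy of R with the same
   measurable sets as R itself. *)
Definition to_R (x : measurableTypeR R) : R := x.

Lemma measurable_to_R : measurable_fun setT to_R.
Proof. by move=> _ B mB; rewrite setTI. Qed.

HB.instance Definition _ := isMeasurableFun.Build _ _ _ _ to_R measurable_to_R.

Definition uniform01 : probability R R :=
  distribution (uniform_prob (@ltr01 R)) to_R.

End uniform01.

Section unit_cube.
Context {R : realType} (d : nat).

Definition cube : set (d.-tuple R) :=
  [set x | forall i, 0 <= tnth x i <= 1].

(* Uniform([0,1]^d), which on subsets of [0,1]^d is Lebesgue measure; all
   integrals over [0,1]^d are taken with respect to it. *)
Definition unif : probability (d.-tuple R) R := iid uniform01 d.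

Definition ip (f g : d.-tuple R -> R) : R := \int[unif]_(x in cube) (f x * g x).

Definition ucont_cube (f : d.-tuple R -> R) : Prop :=
  forall e, 0 < e -> exists2 t, 0 < t & forall x y, cube x -> cube y ->
    (forall i, `|tnth x i - tnth y i| < t) -> `|f x - f y| < e.

End unit_cube.
Arguments cube {R} d.
Arguments unif {R} d.

Definition orientation (d : nat) := {i : {ffun 'I_d -> bool} | [exists r, i r]}.

(* Functions on [0,1]^d are represented by functions on R^d; wavelets are
   extended by 0 outside the cube (see [cdv_off] below). *)
Record wavelets (R : realType) (d : nat) := Wavelets {
  idx : nat -> finType;
  phi : forall j, idx j -> d.-tuple R -> R;
  psi : forall l, orientation d -> idx l -> d.-tuple R -> R }.
Arguments phi {R d} w j m x.
Arguments psi {R d} w l i m x.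

Section wavelet_theory.
Context {R : realType} {d : nat} (W : wavelets R d).

Definition resol (j : nat) : R := 2 ^+ (j * d).

Definition in_V (j : nat) (f : d.-tuple R -> R) : Prop :=
  exists c : idx W j -> R, forall x, f x = \sum_m c m * phi W j m x.

Definition in_detail (l : nat) (f : d.-tuple R -> R) : Prop :=
  exists c : orientation d -> idx W l -> R,
    forall x, f x = \sum_i \sum_m c i m * psi W l i m x.

Definition kernel (j : nat) (x y : d.-tuple R) : R :=
  \sum_m phi W j m x * phi W j m y.

(* Orthonormal multiresolution wavelet bases of L^2([0,1]^d) of
   Cohen-Daubechies-Vial type.  [cdv_local] is compact support at scale 2^-l:
   for the tensor-product construction loc m is the dyadic point 2^-l m.  The
   regularity S enters through polynomial reproduction; of the smoothness of
   the wavelets only continuity on [0,1]^d is assumed, so that bases of class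
   C^S and bases with S vanishing moments are both covered. *)
Record cdv_basis (J0 S : nat) : Prop := CDVBasis {
  cdv_off : forall j, (J0 <= j)%N -> forall m x, ~ cube d x ->
    phi W j m x = 0 /\ forall i, psi W j i m x = 0;
  cdv_continuous : forall j, (J0 <= j)%N -> forall m,
    ucont_cube (phi W j m) /\ forall i, ucont_cube (psi W j i m);
  cdv_card : exists c C : R, [/\ 0 < c, 0 < C & forall j, (J0 <= j)%N ->
    c * resol j <= #|idx W j|%:R <= C * resol j];
  cdv_bound : exists2 C : R, 0 < C & forall j, (J0 <= j)%N -> forall m x,
    `|phi W j m x| <= C * Num.sqrt (resol j) /\
    forall i, `|psi W j i m x| <= C * Num.sqrt (resol j);
  cdv_local : exists (C : R) (N : nat), 0 < C /\
    forall j, (J0 <= j)%N -> exists loc : idx W j -> d.-tuple R,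
    let near m x := [forall r, `|tnth x r - tnth (loc m) r| <= C / 2 ^+ j] in
    (forall m x, (phi W j m x != 0 -> near m x) /\
                 forall i, psi W j i m x != 0 -> near m x) /\
    (forall x, (#|[pred m | near m x]| <= N)%N);
  cdv_phi_orthonormal : forall j, (J0 <= j)%N -> forall m m',
    ip (phi W j m) (phi W j m') = (m == m')%:R;
  cdv_phi_psi : forall l, (J0 <= l)%N -> forall m i m',
    ip (phi W J0 m) (psi W l i m') = 0;
  cdv_psi_orthonormal : forall l, (J0 <= l)%N -> forall i m i' m',
    ip (psi W l i m) (psi W l i' m') = ((i == i') && (m == m'))%:R;
  cdv_psi_levels : forall l l', (J0 <= l)%N -> (J0 <= l')%N -> l != l' ->
    forall i m i' m', ip (psi W l i m) (psi W l' i' m') = 0;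
  cdv_multiresolution : forall j, (J0 <= j)%N -> forall f,
    in_V j.+1 f <->
    exists g h, [/\ in_V j g, in_detail j h & forall x, f x = g x + h x];
  cdv_complete : forall f : d.-tuple R -> R, measurable_fun (cube d) f ->
    (\int[unif d]_(x in cube d) (f x ^+ 2)%:E < +oo)%E ->
    forall e : R, 0 < e -> exists2 j, (J0 <= j)%N & exists2 g, in_V j g &
    (\int[unif d]_(x in cube d) ((f x - g x) ^+ 2)%:E < e%:E)%E;
  (* V_j contains the polynomials of total degree at most S - 1 *)
  cdv_polynomials : forall j, (J0 <= j)%N -> forall a : {ffun 'I_d -> nat},
    (\sum_r a r < S)%N -> exists2 f, in_V j f &
    forall x, cube d x -> f x = \prod_r tnth x r ^+ a r }.

Definition holder_ball (J0 : nat) (a M : R) (h : d.-tuple R -> R) : Prop :=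
  ucont_cube h /\
  ((2 `^ (J0%:R * (a + d%:R / 2)) *
      \big[Num.max/0]_(m : idx W J0) `|ip h (phi W J0 m)|)%:E +
   ereal_sup [set r | exists (l : nat) (i : orientation d) (m : idx W l),
     (J0 <= l)%N /\
     r = (2 `^ (l%:R * (a + d%:R / 2)) * `|ip h (psi W l i m)|)%:E]
   <= M%:E)%E.

End wavelet_theory.

(* (X, A, Y), and (D1, D2, D3) for [data] *)
Notation obs R d := (d.-tuple R * R * R)%type.
Notation subsample R d n := (n.-tuple (obs R d)).
Notation data R d n :=
  (subsample R d n * subsample R d n * subsample R d n)%type.

Section model.
Context {R : realType} {d : nat}.

Definition obsX (w : obs R d) : d.-tuple R := w.1.1.
Definition obsA (w : obs R d) : R := w.1.2.
Definition obsY (w : obs R d) : R := w.2.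

(* g is a version of x |-> E_P[Z | X = x] *)
Definition is_cond_exp (P : probability (obs R d) R) (Z : obs R d -> R)
    (g : d.-tuple R -> R) : Prop :=
  [/\ measurable_fun setT g,
      P.-integrable setT (fun w => (g (obsX w))%:E)
    & forall B, measurable B ->
      (\int[P]_(w in obsX @^-1` B) (Z w)%:E =
       \int[P]_(w in obsX @^-1` B) (g (obsX w))%:E)%E].

Definition cond_exp (P : probability (obs R d) R) (Z : obs R d -> R) :
  d.-tuple R -> R := xget (fun=> 0) [set g | is_cond_exp P Z g].

Definition cond_cov (P : probability (obs R d) R) : d.-tuple R -> R :=
  cond_exp P (fun w => (obsA w - cond_exp P obsA (obsX w)) *
                       (obsY w - cond_exp P obsY (obsX w))).

Definition psi_fun (P : probability (obs R d) R) : R :=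
  \int[P]_w cond_cov P (obsX w).

Definition model (W : wavelets R d) (J0 : nat) (C1 C2 alpha beta M : R) :
    set (probability (obs R d) R) :=
  [set P : probability (obs R d) R | [/\ forall B, measurable B -> P (obsX @^-1` B) = unif d B,
     {ae P, forall w, C1 <= obsA w <= C2 /\ C1 <= obsY w <= C2},
     exists2 p, holder_ball W J0 alpha M p &
       {ae unif d, forall x, cond_exp P obsA x = p x}
   & exists2 b, holder_ball W J0 beta M b &
       {ae unif d, forall x, cond_exp P obsY x = b x}]].

(* The class P_(alpha,beta) is nonempty for some radius M' < M, so that its
   regression functions can be perturbed.  This is automatic when
   C1 <= 0 <= C2; otherwise the class is empty for small M, or can be reduced to
   degenerate laws, and no lower bound on the risk can hold. *)
Definition nondegenerate_class (W : wavelets R d) (J0 : nat)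
    (C1 C2 alpha beta M : R) : Prop :=
  C1 < C2 /\ exists2 M', M' < M & model W J0 C1 C2 alpha beta M' !=set0.

End model.

(* A resolution k = 2^(j d) is represented by its level j. *)

Section estimators.
Context {R : realType} {d : nat} (W : wavelets R d).

Definition data_law (P : probability (obs R d) R) (n : nat) :
  probability (data R d n) R := (iid P n \x iid P n \x iid P n)%E.

Definition avg n (D : subsample R d n) (f : obs R d -> R) : R :=
  n%:R^-1 * \sum_(i < n) f (tnth D i).

Definition p_hat (j : nat) n (D : subsample R d n) (x : d.-tuple R) : R :=
  avg D (fun w => obsA w * kernel W j (obsX w) x).

Definition b_hat (j : nat) n (D : subsample R d n) (x : d.-tuple R) : R :=
  avg D (fun w => obsY w * kernel W j (obsX w) x).

Definition estimator := forall (j1 j2 n : nat), data R d n -> R.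

Definition psi_INT : estimator := fun j1 j2 n D => let: (D1, D2, _) := D in
  avg D2 (fun w => obsA w * obsY w) - ip (p_hat j1 D1) (b_hat j2 D1).

Definition psi_MC : estimator := fun j1 j2 n D => let: (D1, D2, D3) := D in
  avg D2 (fun w => obsA w * obsY w) -
  avg D3 (fun w => p_hat j1 D1 (obsX w) * b_hat j2 D1 (obsX w)).

Definition psi_IF : estimator := fun j1 j2 n D => let: (D1, D2, _) := D in
  avg D2 (fun w => (obsA w - p_hat j1 D1 (obsX w)) *
                   (obsY w - b_hat j2 D1 (obsX w))).

End estimators.

Section rates.
Context {R : realType}.

Definition lesssim (a b : nat -> \bar R) : Prop :=
  exists C : R, 0 < C /\ exists n0, forall n, (n0 <= n)%N ->
    (a n <= C%:E * b n)%E.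

Definition muchgreater (a b : nat -> R) : Prop :=
  a n / b n @[n --> \oo] --> +oo.

Context {d : nat}.

Definition max_risk (Pm : set (probability (obs R d) R)) (n : nat)
    (T : data R d n -> R) : \bar R :=
  ereal_sup [set (\int[data_law P n]_D ((T D - psi_fun P) ^+ 2)%:E)%E | P in Pm].

Definition risk (Pm : set (probability (obs R d) R)) (psi_hat : estimator)
    (j1 j2 : nat -> nat) (n : nat) : \bar R :=
  max_risk Pm (@psi_hat (j1 n) (j2 n) n).

Definition levels (J0 : nat) (j : nat -> nat) : Prop := forall n, (J0 <= j n)%N.

Definition achieves Pm (psi_hat : estimator) (r : nat -> R)
    (j1 j2 : nat -> nat) : Prop :=
  lesssim (risk Pm psi_hat j1 j2) (EFin \o r).

Definition best_rate J0 Pm (psi_hat : estimator) (r : nat -> R) : Prop :=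
  (exists j1 j2, [/\ levels J0 j1, levels J0 j2 & achieves Pm psi_hat r j1 j2]) /\
  (forall j1 j2, levels J0 j1 -> levels J0 j2 ->
     lesssim (EFin \o r) (risk Pm psi_hat j1 j2)).

(* r is the minimax rate for estimation from the three subsamples. *)
Definition minimax_rate (Pm : set (probability (obs R d) R)) (r : nat -> R) :
    Prop :=
  let rstar n := ereal_inf [set @max_risk Pm n T | T in measurable_fun setT] in
  lesssim rstar (EFin \o r) /\ lesssim (EFin \o r) rstar.

Definition k_pred (c a : R) (n : nat) : R :=
  c * n%:R `^ (d%:R / (2 * a + d%:R)).

Definition k_seq (j : nat -> nat) (n : nat) : R := @resol R d (j n).

Definition requires_undersmoothing1 J0 Pm (psi_hat : estimator) r c a : Prop :=
  forall j1 j2, levels J0 j1 -> levels J0 j2 -> achieves Pm psi_hat r j1 j2 ->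
    muchgreater (k_seq j1) (k_pred c a).

Definition requires_undersmoothing2 J0 Pm (psi_hat : estimator) r c a : Prop :=
  forall j1 j2, levels J0 j1 -> levels J0 j2 -> achieves Pm psi_hat r j1 j2 ->
    muchgreater (k_seq j2) (k_pred c a).

(* Which of the two resolutions is the larger one may vary with n. *)
Definition requires_under_and_oversmoothing J0 Pm (psi_hat : estimator) r
    c1 a1 c2 a2 : Prop :=
  forall j1 j2, levels J0 j1 -> levels J0 j2 -> achieves Pm psi_hat r j1 j2 ->
    Num.max (Num.min (k_seq j1 n / k_pred c1 a1 n) (k_pred c2 a2 n / k_seq j2 n))
            (Num.min (k_seq j2 n / k_pred c2 a2 n) (k_pred c1 a1 n / k_seq j1 n))
      @[n --> \oo] --> +oo.

Definition rate_plugin (alpha beta : R) (n : nat) : R :=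
  if d%:R / 2 <= (alpha + beta) / 2 then n%:R^-1
  else n%:R `^ (- ((2 * alpha + 2 * beta) / (alpha + beta + d%:R))).

Definition rate_IF (alpha beta : R) (n : nat) : R :=
  if d%:R / 4 <= (alpha + beta) / 2 then n%:R^-1
  else n%:R `^ (- ((4 * alpha + 4 * beta) / (2 * alpha + 2 * beta + d%:R))).

End rates.

(* Main.v *)
Require Import Defs.
From HB Require Import structures.
From mathcomp Require Import all_boot all_order all_algebra.
From mathcomp Require Import all_classical all_reals all_analysis.
From mathcomp Require Import measurable_realfun ring lra.
Set Implicit Arguments.
Unset Strict Implicit.
Unset Printing Implicit Defensive.
Import Order.TTheory GRing.Theory Num.Theory.
Import numFieldNormedType.Exports.
Local Open Scope classical_set_scope.
Local Open Scope ring_scope.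

(** All three estimators have explicit expectations.  Integrating a product of two
    projection kernels leaves the kernel of the smaller space, so the bias of the
    INT and MC estimators is the part of [<p, b>] beyond the smaller resolution plus
    [1/n] times the moment of [A Y K(X, X)], where [K] is the kernel of the smaller
    space; for the IF estimator the approximation error is the part of [<p, b>]
    beyond the larger resolution, and the diagonal moment still comes from the smaller
    one ([bias_INT], [Ex_psi_MC], [bias_IF]).  Over the class the approximation error
    is of order [k ^ (- (alpha + beta) / d)] ([dot_tail]) and the diagonal moment is of
    order [k] ([Ex_kernel_diag]).

    Upper bounds: with equal resolutions the fluctuations of the INT and MC estimators
    are of order [n ^ (-1/2)] and [k / n] ([psi_INT_mse], [psi_MC_mse]).  For the IF
    estimator the smaller resolution is kept bounded, which removes the fluctuation
    [k / n] and leaves a variance of order [1 / n + k / n ^ 2] in the larger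
    resolution ([psi_IF_mse]).  Balancing with the bias gives the rates
    ([plugin_achieves], [IF_achieves]).

    Lower bounds for given resolutions need only the bias.  All the laws used are
    images of a uniform covariate and two signs, whose joint density is
    [1 + u(X) s + v(X) t + th(X) s t] ([exists_perturbed_law]): [u] and [v] perturb the
    two regression functions and [th] the conditional covariance.  Taking [u] and [v]
    to be plus or minus a sum of wavelets at one level, and [th] so that the
    conditional mean of [A Y] does not move, produces four laws for which only the
    approximation error changes ([four_laws]); a constant [th] moves only the diagonal
    moment ([const_law]).  Hence the risk is at least of the order of the square of each of
    the two terms separately ([risk_ge_bias], [risk_ge_diag]).

    For an arbitrary estimator, a constant [th] of order [n ^ (-1/2)] gives the
    parametric rate ([minimax_parametric]).  The slower rate comes from comparing two
    mixtures: [u] is a sum of wavelets with disjoint supports and random signs, and [v]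
    is proportional to [u] or to [- u] ([minimax_mixture]).  Both mixtures are products
    over the wavelets of densities that see only the observations in one support, so
    their Kullback-Leibler divergence is the sum of the divergences of these factors
    ([mixture_overlap]), and each of these is at most a chi-square distance that can
    be computed exactly ([Ex_cell_dist]).

    Undersmoothing is then a comparison of exponents: a risk of the order of the rate
    forces the bias to be small, hence a resolution to be large
    ([resol_ge_of_bias]), and for the IF estimator it also forces the diagonal moment to
    be small, hence the other resolution to be small ([resol_le_of_diag]). *)

(** * Expectations of bounded measurable functions *)

Section bounded_measurable.
Context {d : measure_display} {T : measurableType d} {R : realType}.
Implicit Types f g : T -> R.

(** The integrands that occur are bounded once the observations are clamped to
    [C1, C2]; within this class every integrability condition disappears. *)
Definition bm f := measurable_fun setT f /\ exists C, forall x, `|f x| <= C.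

Lemma bm_meas f : bm f -> measurable_fun setT f. Proof. by case. Qed.

Lemma bm_ub f : bm f -> exists C, 0 < C /\ forall x, `|f x| <= C.
Proof.
case=> _ [C hC]; exists (`|C| + 1); split; first by rewrite ltr_wpDl.
by move=> x; rewrite (le_trans (hC x))// ler_wpDr// ler_norm.
Qed.

Lemma bm_cst (c : R) : bm (fun _ : T => c).
Proof. by split; [exact: measurable_cst|exists `|c|]. Qed.

Lemma bmD f g : bm f -> bm g -> bm (fun x => f x + g x).
Proof.
move=> [mf [A hA]] [mg [B hB]]; split; first exact: measurable_funD.
by exists (A + B) => x; rewrite (le_trans (ler_normD _ _))// lerD.
Qed.

Lemma bmN f : bm f -> bm (fun x => - f x).
Proof.
move=> [mf [A hA]]; split; first exact: measurable_funN.
by exists A => x; rewrite normrN.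
Qed.

Lemma bmB f g : bm f -> bm g -> bm (fun x => f x - g x).
Proof. by move=> bf bg; apply: bmD => //; exact: bmN. Qed.

Lemma bmM f g : bm f -> bm g -> bm (fun x => f x * g x).
Proof.
move=> [mf [A hA]] [mg [B hB]]; split; first exact: measurable_funM.
by exists (A * B) => x; rewrite normrM ler_pM.
Qed.

Lemma bmX f n : bm f -> bm (fun x => f x ^+ n).
Proof.
move=> bf; elim: n => [|n IH]; first exact: bm_cst.
by under eq_fun do rewrite exprS; exact: bmM.
Qed.

Lemma bm_norm f : bm f -> bm (fun x => `|f x|).
Proof.
move=> [mf [A hA]]; split; first exact: measurableT_comp.
by exists A => x; rewrite normr_id.
Qed.

Lemma bm_sum (I : Type) (r : seq I) (P : pred I) (F : I -> T -> R) :
  (forall i, bm (F i)) -> bm (fun x => \sum_(i <- r | P i) F i x).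
Proof.
move=> bF; elim: r => [|i r IH].
  by under eq_fun do rewrite big_nil; exact: bm_cst.
case Pi : (P i).
  by under eq_fun do rewrite big_cons Pi; exact: bmD.
by under eq_fun do rewrite big_cons Pi.
Qed.

Lemma bm_prod (I : Type) (r : seq I) (P : pred I) (F : I -> T -> R) :
  (forall i, bm (F i)) -> bm (fun x => \prod_(i <- r | P i) F i x).
Proof.
move=> bF; elim: r => [|i r IH].
  by under eq_fun do rewrite big_nil; exact: bm_cst.
case Pi : (P i).
  by under eq_fun do rewrite big_cons Pi; exact: bmM.
by under eq_fun do rewrite big_cons Pi.
Qed.

Lemma bm_indic (A : set T) : measurable A -> bm (\1_A : T -> R).
Proof.
move=> mA; split; first exact: measurable_indic.
by exists 1 => x; rewrite indicE; case: (x \in A); rewrite ?normr1 ?normr0.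
Qed.

End bounded_measurable.

Lemma bm_comp d1 d2 (T1 : measurableType d1) (T2 : measurableType d2)
    (R : realType) (f : T2 -> R) (g : T1 -> T2) :
  bm f -> measurable_fun setT g -> bm (fun x => f (g x)).
Proof. by move=> [mf [A hA]] mg; split; [exact: measurableT_comp|exists A]. Qed.

Section expectation.
Context {d : measure_display} {T : measurableType d} {R : realType}.
Variable P : probability T R.
Implicit Types f g : T -> R.

Definition Ex f : R := \int[P]_x f x.

Lemma bm_integrable f : bm f -> P.-integrable setT (EFin \o f).
Proof.
move=> [mf [C hC]]; apply: measurable_bounded_integrable => //.
  by have := probability_setT P => /= ->; rewrite ltry.
exists C; split; first by rewrite num_real.
by move=> x Cx y _; exact: (le_trans (hC y) (ltW Cx)).
Qed.

Lemma ExE f : bm f -> (\int[P]_x (f x)%:E)%E = (Ex f)%:E.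
Proof.
move=> bf; rewrite /Ex /Rintegral fineK//.
by apply: integrable_fin_num => //; exact: bm_integrable.
Qed.

Lemma eq_Ex f g : f =1 g -> Ex f = Ex g.
Proof. by move=> fg; congr Ex; apply/funext. Qed.

Lemma Ex_cst c : Ex (fun _ => c) = c.
Proof.
by rewrite /Ex Rintegral_cst//; have /= -> := probability_setT P; rewrite mulr1.
Qed.

Lemma ExD f g : bm f -> bm g -> Ex (fun x => f x + g x) = Ex f + Ex g.
Proof. by move=> bf bg; rewrite /Ex RintegralD//; exact: bm_integrable. Qed.

Lemma ExB f g : bm f -> bm g -> Ex (fun x => f x - g x) = Ex f - Ex g.
Proof. by move=> bf bg; rewrite /Ex RintegralB//; exact: bm_integrable. Qed.

Lemma ExZ c f : bm f -> Ex (fun x => c * f x) = c * Ex f.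
Proof. by move=> bf; rewrite /Ex RintegralZl//; exact: bm_integrable. Qed.

Lemma ExZr c f : bm f -> Ex (fun x => f x * c) = Ex f * c.
Proof. by move=> bf; rewrite /Ex RintegralZr//; exact: bm_integrable. Qed.

Lemma Ex_sum (I : Type) (r : seq I) (Q : pred I) (F : I -> T -> R) :
  (forall i, bm (F i)) ->
  Ex (fun x => \sum_(i <- r | Q i) F i x) = \sum_(i <- r | Q i) Ex (F i).
Proof.
move=> bF; elim: r => [|i r IH].
  by under eq_Ex do rewrite big_nil; rewrite Ex_cst big_nil.
rewrite big_cons; case Qi : (Q i).
  by under eq_Ex do rewrite big_cons Qi; rewrite ExD ?IH//; exact: bm_sum.
by under eq_Ex do rewrite big_cons Qi.
Qed.

Lemma Ex_ge0 f : (forall x, 0 <= f x) -> 0 <= Ex f.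
Proof. by move=> f0; exact: Rintegral_ge0. Qed.

Lemma Ex_le f g : bm f -> bm g -> (forall x, f x <= g x) -> Ex f <= Ex g.
Proof. by move=> bf bg fg; apply: le_Rintegral => //; exact: bm_integrable. Qed.

Lemma Ex_abs f : bm f -> `|Ex f| <= Ex (fun x => `|f x|).
Proof. by move=> bf; apply: le_normr_Rintegral => //; exact: bm_integrable. Qed.

Lemma Ex_lec f c : bm f -> (forall x, f x <= c) -> Ex f <= c.
Proof. by move=> bf fc; rewrite -(Ex_cst c); apply: Ex_le => //; exact: bm_cst. Qed.

(** Expanding E (E g^2 f - E (fg) g)^2 >= 0 avoids square roots. *)
Lemma Ex_CS f g : bm f -> bm g ->
  Ex (fun x => f x * g x) ^+ 2 <= Ex (fun x => f x ^+ 2) * Ex (fun x => g x ^+ 2).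
Proof.
move=> bf bg.
set a := Ex (fun x => f x ^+ 2); set b := Ex (fun x => g x ^+ 2).
set c := Ex (fun x => f x * g x).
have bff := bmX 2 bf; have bgg := bmX 2 bg; have bfg := bmM bf bg.
have key s t : 0 <= s ^+ 2 * a + 2 * s * t * c + t ^+ 2 * b.
  have -> : s ^+ 2 * a + 2 * s * t * c + t ^+ 2 * b =
      Ex (fun x => (s * f x + t * g x) ^+ 2).
    rewrite /a /b /c -ExZ// -ExZ// -ExZ// -ExD; [|by apply: bmM => //; exact: bm_cst..].
    rewrite -ExD; [|by [apply: bmD; apply: bmM => //; exact: bm_cst|
      apply: bmM => //; exact: bm_cst]..].
    by apply: eq_Ex => x; ring.
  by apply: Ex_ge0 => x; exact: sqr_ge0.
have a0 : 0 <= a by apply: Ex_ge0 => x; exact: sqr_ge0.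
have b0 : 0 <= b by apply: Ex_ge0 => x; exact: sqr_ge0.
have [b00|bn0] := eqVneq b 0.
  have [a00|an0] := eqVneq a 0.
    rewrite b00 mulr0.
    have := key 1 (- c); have := key 1 c; rewrite a00 b00 => k1 k2; nra.
  have := key (- c) a; have : 0 < a by rewrite lt0r an0.
  by move=> ap; nra.
have bp : 0 < b by rewrite lt0r bn0.
have := key b (- c) => k; nra.
Qed.

Lemma Ex_sqr f : bm f -> Ex f ^+ 2 <= Ex (fun x => f x ^+ 2).
Proof.
move=> bf; have := Ex_CS bf (bm_cst 1).
rewrite (_ : Ex (fun x => 1 ^+ 2) = 1) ?mulr1; last first.
  by rewrite -[RHS]Ex_cst; apply: eq_Ex => x; rewrite expr1n.
by rewrite (_ : Ex (fun x => f x * 1) = Ex f)//; apply: eq_Ex => x; rewrite mulr1.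
Qed.

(** Monotone convergence: a bound on the risk of unbounded losses may be checked on
    bounded ones. *)
Lemma integral_le_trunc (f : T -> R) (c : R) : measurable_fun setT f ->
  (forall x, 0 <= f x) ->
  (forall n : nat, Ex (fun x => Num.min (f x) n%:R) <= c) ->
  (\int[P]_x (f x)%:E <= c%:E)%E.
Proof.
move=> mf f0 hn.
pose g (n : nat) x := (Num.min (f x) n%:R)%:E.
have bg n : bm (fun x => Num.min (f x) n%:R).
  split; first by apply: measurable_minr => //; exact: measurable_cst.
  exists n%:R => x; rewrite ger0_norm ?ge_min ?lexx ?orbT//.
  by rewrite le_min f0 ler0n.
have mg n : measurable_fun setT (g n) by apply/measurable_EFinP; case: (bg n).
have -> : (\int[P]_x (f x)%:E)%E = (\int[P]_x limn (g^~ x))%E.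
  apply: eq_integral => x _; apply/esym/cvg_lim => //.
  apply/fine_cvgP; split; first exact: nearW.
  apply: cvg_near_cst; near=> n; rewrite /g /=.
  apply/eqP; rewrite eq_minl//; near: n; exact: nbhs_infty_ger.
rewrite monotone_convergence//; last 2 first.
- by move=> n x _; rewrite lee_fin le_min f0 ler0n.
- by move=> x _ m n mn; rewrite lee_fin le_min !ge_min lexx/= ler_nat mn orbT.
apply: lime_le.
  apply: ereal_nondecreasing_is_cvgn => m n mn; apply: ge0_le_integral => //.
  - by move=> x _; rewrite lee_fin le_min f0 ler0n.
  - by move=> x _; rewrite lee_fin le_min !ge_min lexx/= ler_nat mn orbT.
by apply: nearW => n; rewrite ExE// lee_fin.
Unshelve. all: end_near. Qed.

End expectation.

Section product_expectation.
Context {d1 d2 : measure_display} {T1 : measurableType d1}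
  {T2 : measurableType d2} {R : realType}.
Variables (P : probability T1 R) (Q : probability T2 R).
Implicit Type f : T1 * T2 -> R.

Lemma bm_pair1 f x : bm f -> bm (fun y => f (x, y)).
Proof. by move=> bf; apply: bm_comp bf _; exact: measurable_pair1. Qed.

Lemma bm_pair2 f y : bm f -> bm (fun x => f (x, y)).
Proof. by move=> bf; apply: bm_comp bf _; exact: measurable_pair2. Qed.

Lemma bm_Ex_snd f : bm f -> bm (fun x => Ex Q (fun y => f (x, y))).
Proof.
move=> bf; split; last first.
  have [C [_ hC]] := bm_ub bf; exists C => x.
  rewrite (le_trans (Ex_abs Q (bm_pair1 x bf)))//.
  by apply: Ex_lec => //; exact: bm_norm (bm_pair1 x bf).
apply/measurable_EFinP.
have := @measurable_fubini_F _ _ _ _ _ P Q (EFin \o f)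
  (bm_integrable (P \x Q)%E bf).
by under [X in _ -> measurable_fun _ X]eq_fun do
  rewrite /= -(ExE Q (bm_pair1 _ bf)).
Qed.

Lemma bm_Ex_fst f : bm f -> bm (fun y => Ex P (fun x => f (x, y))).
Proof.
move=> bf; split; last first.
  have [C [_ hC]] := bm_ub bf; exists C => y.
  rewrite (le_trans (Ex_abs P (bm_pair2 y bf)))//.
  by apply: Ex_lec => //; exact: bm_norm (bm_pair2 y bf).
apply/measurable_EFinP.
have := @measurable_fubini_G _ _ _ _ _ P Q (EFin \o f)
  (bm_integrable (P \x Q)%E bf).
by under [X in _ -> measurable_fun _ X]eq_fun do
  rewrite /= -(ExE P (bm_pair2 _ bf)).
Qed.

Lemma Ex_prod f : bm f ->
  Ex (P \x Q)%E f = Ex P (fun x => Ex Q (fun y => f (x, y))).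
Proof.
move=> bf; apply: EFin_inj; rewrite -ExE// -ExE; last exact: bm_Ex_snd.
rewrite -(integral12_prod_meas1 (bm_integrable (P \x Q)%E bf)).
apply: eq_integral => x _; rewrite -(ExE Q (bm_pair1 _ bf)).
by [].
Qed.

Lemma Ex_prod_swap f : bm f ->
  Ex (P \x Q)%E f = Ex Q (fun y => Ex P (fun x => f (x, y))).
Proof.
move=> bf; apply: EFin_inj; rewrite -ExE// -ExE; last exact: bm_Ex_fst.
rewrite -(integral21_prod_meas1 (bm_integrable (P \x Q)%E bf)).
apply: eq_integral => x _; rewrite -(ExE P (bm_pair2 _ bf)).
by [].
Qed.

Lemma Ex_swap (g : T1 -> T2 -> R) : bm (fun z => g z.1 z.2) ->
  Ex P (fun x => Ex Q (g x)) = Ex Q (fun y => Ex P (g^~ y)).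
Proof. by move=> bg; rewrite -(Ex_prod bg) Ex_prod_swap. Qed.

Lemma Ex_distribution (X : {mfun T1 >-> T2}) (f : T2 -> R) : bm f ->
  Ex (distribution P X) f = Ex P (fun x => f (X x)).
Proof.
move=> bf; apply: EFin_inj; rewrite -ExE// -ExE; last first.
  by apply: bm_comp bf _; exact: measurable_funPT.
rewrite integral_distribution//.
  by apply/measurable_EFinP; case: bf.
by apply: (bm_integrable P (f := f \o X)); apply: bm_comp bf _; exact: measurable_funPT.
Qed.

End product_expectation.

(** * Independent samples *)

Section iid_expectation.
Context {disp : measure_display} {T : measurableType disp} {R : realType}.
Variable P : probability T R.

Lemma bm_tnth n (f : T -> R) (i : 'I_n) : bm f ->
  bm (fun v : n.-tuple T => f (tnth v i)).
Proof. by move=> bf; apply: (bm_comp bf); exact: measurable_tnth. Qed.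

Lemma bm_tcons n (F : n.+1.-tuple T -> R) : bm F ->
  bm (fun z : T * n.-tuple T => F (tcons z)).
Proof. by move=> bF; apply: (bm_comp bF); exact: measurable_tcons. Qed.

Lemma Ex_iid0 (F : 0.-tuple T -> R) : bm F -> Ex (iid P 0) F = F [tuple].
Proof.
move=> bF; apply: EFin_inj; rewrite -ExE//= integral_dirac//.
  by rewrite diracE in_setT mul1e.
by apply/measurable_EFinP; case: bF.
Qed.

Lemma Ex_iidS n (F : n.+1.-tuple T -> R) : bm F ->
  Ex (iid P n.+1) F = Ex P (fun w => Ex (iid P n) (fun v => F (tcons (w, v)))).
Proof.
move=> bF; rewrite /= (Ex_distribution (P \x iid P n)%E)//.
by rewrite (Ex_prod P (iid P n))//; exact: bm_tcons.
Qed.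

Lemma tnth_tcons0 n w (v : n.-tuple T) : tnth (tcons (w, v)) ord0 = w.
Proof. by []. Qed.

Lemma tnth_tconsS n w (v : n.-tuple T) i :
  tnth (tcons (w, v)) (lift ord0 i) = tnth v i.
Proof. by rewrite /tcons tnthS. Qed.

Lemma Ex_iid_prod n (g : 'I_n -> T -> R) : (forall i, bm (g i)) ->
  Ex (iid P n) (fun v => \prod_i g i (tnth v i)) = \prod_i Ex P (g i).
Proof.
have bp m (h : 'I_m -> T -> R) : (forall i, bm (h i)) ->
    bm (fun v : m.-tuple T => \prod_i h i (tnth v i)).
  by move=> bh; apply: bm_prod => i; exact: (bm_tnth i (bh i)).
elim: n g => [|n IH] g bg; first by rewrite Ex_iid0 ?big_ord0//; exact: bp.
rewrite Ex_iidS; last exact: bp.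
under eq_Ex do under eq_Ex do rewrite big_ord_recl tnth_tcons0.
rewrite big_ord_recl -IH// -ExZr//; apply: eq_Ex => w.
rewrite -ExZ; last by apply: (bp _ (fun i => g (lift ord0 i))) => i.
by apply: eq_Ex => v; congr (_ * _); apply: eq_bigr => i _; rewrite tnth_tconsS.
Qed.

Lemma Ex_iid_tnth n (g : T -> R) (i : 'I_n) : bm g ->
  Ex (iid P n) (fun v => g (tnth v i)) = Ex P g.
Proof.
move=> bg; pose h j := if j == i then g else fun _ => 1.
rewrite (_ : Ex P g = \prod_j Ex P (h j)); last first.
  rewrite (bigD1 i)//= /h eqxx big1 ?mulr1// => j /negPf ->; exact: Ex_cst.
rewrite -Ex_iid_prod; last first.
  by move=> j; rewrite /h; case: ifP => // _; exact: bm_cst.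
apply: eq_Ex => v; rewrite (bigD1 i)//= /h eqxx big1 ?mulr1//.
by move=> j /negPf ->.
Qed.

Lemma Ex_iid_tnth2 n (g h : T -> R) (i j : 'I_n) : i != j -> bm g -> bm h ->
  Ex (iid P n) (fun v => g (tnth v i) * h (tnth v j)) = Ex P g * Ex P h.
Proof.
move=> ij bg bh; pose f k := if k == i then g else if k == j then h else fun _ => 1.
have ji : j != i by rewrite eq_sym.
rewrite (_ : Ex P g * _ = \prod_k Ex P (f k)); last first.
  rewrite (bigD1 i)//= (bigD1 j)//= /f eqxx (negPf ji) eqxx big1 ?mulr1//.
  by move=> k /andP[/negPf -> /negPf ->]; exact: Ex_cst.
rewrite -Ex_iid_prod; last first.
  by move=> k; rewrite /f; case: ifP => // _; case: ifP => // _; exact: bm_cst.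
apply: eq_Ex => v; rewrite (bigD1 i)//= (bigD1 j)//= /f eqxx (negPf ji) eqxx.
by rewrite big1 ?mulr1// => k /andP[/negPf -> /negPf ->].
Qed.

End iid_expectation.

Section law_change.
Context {d1 d2 : measure_display} {T1 : measurableType d1}
  {T2 : measurableType d2} {R : realType}.

Lemma measurable_map_tuple n (tau : T1 -> T2) : measurable_fun setT tau ->
  measurable_fun setT (fun w : n.-tuple T1 => map_tuple tau w).
Proof.
move=> mt; apply/measurable_fun_tnthP => i.
rewrite (_ : _ \o _ = tau \o (fun w => tnth w i)).
  by apply: measurableT_comp => //; exact: measurable_tnth.
by apply/funext => w /=; rewrite tnth_map.
Qed.

Lemma map_tcons n (tau : T1 -> T2) w (v : n.-tuple T1) :
  map_tuple tau (tcons (w, v)) = tcons (tau w, map_tuple tau v).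
Proof. exact: val_inj. Qed.

(** One statement serves for images of a law (g = 1), for densities (tau the
    identity), and for both at once. *)
Lemma Ex_iid_change (mu : probability T1 R) (Q : probability T2 R)
    (tau : T1 -> T2) (g : T1 -> R) :
  measurable_fun setT tau -> bm g ->
  (forall h, bm h -> Ex Q h = Ex mu (fun w => g w * h (tau w))) ->
  forall n (F : n.-tuple T2 -> R), bm F ->
  Ex (iid Q n) F =
  Ex (iid mu n) (fun w => (\prod_i g (tnth w i)) * F (map_tuple tau w)).
Proof.
move=> mt bg hQ.
have bR n (F : n.-tuple T2 -> R) : bm F ->
    bm (fun w => (\prod_i g (tnth w i)) * F (map_tuple tau w)).
  move=> bF; apply: bmM; first by apply: bm_prod => i; exact: (bm_tnth i bg).
  by apply: (bm_comp bF); exact: measurable_map_tuple.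
elim=> [|n IH] F bF.
  rewrite !Ex_iid0//; last exact: bR.
  by rewrite big_ord0 mul1r; congr F; exact: val_inj.
rewrite !Ex_iidS//; last exact: bR.
have bF1 w' : bm (fun v => F (tcons (w', v))).
  exact: (bm_pair1 w' (bm_tcons bF)).
under eq_Ex => w' do rewrite (IH _ (bF1 w')).
rewrite hQ; last first.
  pose G (z : T2 * n.-tuple T1) :=
    (\prod_i g (tnth z.2 i)) * F (tcons (z.1, map_tuple tau z.2)).
  apply: (bm_Ex_snd Q (iid mu n) (f := G)); apply: bmM.
    by apply: bm_prod => i; apply: (bm_comp (bm_tnth i bg)).
  apply: (bm_comp (bm_tcons bF) (g := fun z => (z.1, map_tuple tau z.2))).
  apply: measurable_fun_pair => //; apply: measurableT_comp => //.
  exact: measurable_map_tuple.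
apply: eq_Ex => w; rewrite -ExZ; last first.
  exact: bR (bF1 (tau w)).
apply: eq_Ex => v; rewrite big_ord_recl tnth_tcons0 mulrA.
congr (_ * _ * _); last by rewrite map_tcons.
by apply: eq_bigr => i _; rewrite tnth_tconsS.
Qed.

End law_change.

Section samples.
Context {disp : measure_display} {T : measurableType disp} {R : realType}.
Variable P : probability T R.

Definition smean n (D : n.-tuple T) (f : T -> R) : R :=
  n%:R^-1 * \sum_(i < n) f (tnth D i).

Lemma bm_smean n (f : T -> R) : bm f -> bm (fun D : n.-tuple T => smean D f).
Proof.
move=> bf; apply: bmM; first exact: bm_cst.
by apply: bm_sum => i; exact: (bm_tnth i bf).
Qed.

Lemma Ex_smean n (f : T -> R) : (0 < n)%N -> bm f ->
  Ex (iid P n) (fun D => smean D f) = Ex P f.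
Proof.
move=> n0 bf; rewrite /smean ExZ; last by apply: bm_sum => i; exact: (bm_tnth i bf).
rewrite Ex_sum; last by move=> i; exact: (bm_tnth i bf).
under eq_bigr do rewrite Ex_iid_tnth//.
by rewrite sumr_const card_ord -[Ex P f *+ n]mulr_natl mulrA mulVf ?mul1r// pnatr_eq0 -lt0n.
Qed.

(** Separating the diagonal of a double sum over the sample gives variances, and
    the bias of quadratic statistics. *)
Lemma Ex_double_sum n (H : T -> T -> R) (g : T -> R) (c : R) :
  bm (fun z => H z.1 z.2) -> (forall w, H w w = g w) -> bm g -> (forall i j : 'I_n, i != j ->
    Ex (iid P n) (fun D => H (tnth D i) (tnth D j)) = c) ->
  Ex (iid P n) (fun D => \sum_(i < n) \sum_(j < n) H (tnth D i) (tnth D j)) =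
  n%:R * Ex P g + (n%:R * (n%:R - 1)) * c.
Proof.
move=> bH Hg bg hc.
have bHij i j : bm (fun D : n.-tuple T => H (tnth D i) (tnth D j)).
  apply: (bm_comp bH (g := fun D => (tnth D i, tnth D j))).
  by apply: measurable_fun_pair; exact: measurable_tnth.
rewrite Ex_sum; last by move=> i; apply: bm_sum.
under eq_bigr => i _ do rewrite Ex_sum//.
transitivity (\sum_(i < n) (Ex P g + (n%:R - 1) * c)).
  apply: eq_bigr => i _; rewrite (bigD1 i)//=; congr (_ + _).
    by rewrite -(Ex_iid_tnth P i bg); apply: eq_Ex => D.
  under eq_bigr => j ji do rewrite hc 1?eq_sym//.
  rewrite sumr_const cardC1 card_ord -[c *+ _]mulr_natl; congr (_ * _).
  by rewrite -subn1 natrB//; case: (n) i => [[]|].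
by rewrite sumr_const card_ord -[(_ + _) *+ n]mulr_natl mulrDr mulrA.
Qed.

Lemma Ex_smean_sqr n (f : T -> R) (c : R) : (0 < n)%N -> bm f ->
  Ex (iid P n) (fun D => (smean D f - c) ^+ 2) =
  (Ex P f - c) ^+ 2 + n%:R^-1 * (Ex P (fun w => f w ^+ 2) - Ex P f ^+ 2).
Proof.
move=> n0 bf.
have n0' : n%:R != 0 :> R by rewrite pnatr_eq0 -lt0n.
pose g w := f w - c.
have bg : bm g by apply: bmB => //; exact: bm_cst.
have Eg : Ex P g = Ex P f - c by rewrite ExB ?Ex_cst//; exact: bm_cst.
have Eg2 : Ex P (fun w => g w ^+ 2) =
    Ex P (fun w => f w ^+ 2) - 2 * c * Ex P f + c ^+ 2.
  rewrite -ExZ// -ExB; [|by [exact: bmX|apply: bmM => //; exact: bm_cst]..].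
  rewrite -[c ^+ 2](Ex_cst P) -ExD; last exact: bm_cst.
    by apply: eq_Ex => w; rewrite /g; ring.
  by apply: bmB; [exact: bmX|apply: bmM => //; exact: bm_cst].
transitivity (n%:R^-1 ^+ 2 * Ex (iid P n) (fun D =>
    \sum_(i < n) \sum_(j < n) g (tnth D i) * g (tnth D j))).
  rewrite -ExZ; last first.
    by apply: bm_sum => i; apply: bm_sum => j; apply: bmM; exact: (bm_tnth _ bg).
  apply: eq_Ex => D; rewrite /smean.
  rewrite -big_distrlr/= -expr2 -exprMn; congr (_ ^+ 2).
  rewrite /g sumrB mulrBr sumr_const card_ord -[c *+ n]mulr_natl mulrA.
  by rewrite mulVf// mul1r.
rewrite (@Ex_double_sum n (fun w w' => g w * g w') (fun w => g w ^+ 2)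
  (Ex P g ^+ 2))//.
- by rewrite Eg2 Eg; field.
- by apply: bmM; [exact: (bm_comp bg)|exact: (bm_comp bg)].
- exact: bmX.
- by move=> i j ij; rewrite Ex_iid_tnth2.
Qed.

Lemma Ex_smean_mse n (f : T -> R) (c : R) : (0 < n)%N -> bm f ->
  Ex (iid P n) (fun D => (smean D f - c) ^+ 2) <=
  (Ex P f - c) ^+ 2 + n%:R^-1 * Ex P (fun w => f w ^+ 2).
Proof.
move=> n0 bf; rewrite Ex_smean_sqr// lerD2l ler_wpM2l ?invr_ge0//.
by rewrite gerBl sqr_ge0.
Qed.

Lemma measurable_cat_tuple m n : measurable_fun setT
  (fun z : m.-tuple T * n.-tuple T => cat_tuple z.1 z.2).
Proof.
apply/measurable_fun_tnthP => i; rewrite -(splitK i).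
case: (fintype.split i) => j /=.
  rewrite (_ : _ \o _ = (fun v => tnth v j) \o fst); last first.
    by apply/funext => z /=; rewrite tnth_lshift.
  by apply: measurableT_comp => //; exact: measurable_tnth.
rewrite (_ : _ \o _ = (fun v => tnth v j) \o snd); last first.
  by apply/funext => z /=; rewrite tnth_rshift.
by apply: measurableT_comp => //; exact: measurable_tnth.
Qed.

Lemma Ex_iid_cat m n (F : (m + n).-tuple T -> R) : bm F ->
  Ex (iid P (m + n)) F =
  Ex (iid P m) (fun u => Ex (iid P n) (fun v => F (cat_tuple u v))).
Proof.
elim: m F => [|m IH] F bF.
  rewrite Ex_iid0; last first.
    by apply: (bm_Ex_snd (iid P 0) (iid P n) (bm_comp bF (@measurable_cat_tuple 0 n))).
  by apply: eq_Ex => v; congr F; exact: val_inj.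
rewrite (@Ex_iidS _ _ _ P (m + n) F)// Ex_iidS; last first.
  by apply: (bm_Ex_snd (iid P m.+1) (iid P n) (bm_comp bF (@measurable_cat_tuple m.+1 n))).
apply: eq_Ex => w; rewrite IH; last exact: (bm_pair1 w (bm_tcons bF)).
apply: eq_Ex => u; apply: eq_Ex => v; congr F; exact: val_inj.
Qed.

End samples.

(** * Densities and the uniform law on the cube *)

Lemma Ex_indic d (T : measurableType d) (R : realType) (P : probability T R)
  (A : set T) : measurable A -> (Ex P \1_A)%:E = P A.
Proof.
move=> mA; rewrite -ExE; last exact: bm_indic.
by rewrite integral_indic// setIT.
Qed.

Section density.
Context {disp : measure_display} {T : measurableType disp} {R : realType}.
Variables (mu : probability T R) (f : T -> R).
Hypotheses (bf : bm f) (f0 : forall x, 0 <= f x) (f1 : Ex mu f = 1).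

Definition density_law (A : set T) : \bar R := (\int[mu]_(x in A) (f x)%:E)%E.

Let density_law0 : density_law set0 = 0%E.
Proof. by rewrite /density_law integral_set0. Qed.

Let density_law_ge0 A : (0 <= density_law A)%E.
Proof. by apply: integral_ge0 => x _; rewrite lee_fin. Qed.

Let density_law_additive : semi_sigma_additive density_law.
Proof.
apply: (@semi_sigma_additive_nng_induced _ _ _ mu (EFin \o f)).
  by apply/measurable_EFinP; case: bf.
by move=> x; rewrite lee_fin.
Qed.

HB.instance Definition _ := isMeasure.Build _ _ _ density_law
  density_law0 density_law_ge0 density_law_additive.

Let density_lawT : density_law setT = 1%:E.
Proof. by rewrite /density_law ExE// f1. Qed.

HB.instance Definition _ := @Measure_isProbability.Build _ _ R
  density_law density_lawT.

(** A density with respect to [mu] determines a law, whose Radon-Nikodym derivative it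
    is; this is how all laws of the lower bounds are built. *)
Lemma exists_density : exists Q : probability T R,
  forall h, bm h -> Ex Q h = Ex mu (fun x => f x * h x).
Proof.
pose Q : probability T R := density_law; exists Q => h bh.
have Qmu : Q `<< mu.
  apply/null_content_dominatesP => A mA muA.
  apply/eqP; rewrite eq_le measure_ge0 andbT.
  have [C [C0 hC]] := bm_ub bf.
  apply: (@le_trans _ _ (\int[mu]_(x in A) C%:E)%E); last first.
    by rewrite integral_cst//; move: muA => /= ->; rewrite mule0.
  apply: ge0_le_integral => //.
  - by move=> x _; rewrite lee_fin.
  - by apply/measurable_EFinP; apply: measurable_funTS; case: bf.
  - by move=> x _; rewrite lee_fin (le_trans (ler_norm _)).
apply: EFin_inj; rewrite -ExE// -ExE; last exact: bmM.
rewrite -(Radon_Nikodym_change_of_variables Qmu measurableT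
  (bm_integrable Q bh)).
have hRN : ae_eq mu setT (EFin \o f)
    (Radon_Nikodym (charge_of_finite_measure Q) mu).
  apply: integral_ae_eq => //.
  - exact: bm_integrable.
  - by move=> E _ mE; rewrite -Radon_Nikodym_integral.
apply: ae_eq_integral => //.
- apply: emeasurable_funM; first by apply/measurable_EFinP; case: bh.
  by apply: measurable_int; apply: Radon_Nikodym_integrable.
- by apply/measurable_EFinP; case: (bmM bf bh).
- move: hRN; apply: filterS => x /= hx _; rewrite -hx//.
  by rewrite EFinM muleC.
Qed.

End density.

Section uniform_law.
Context {R : realType}.

Lemma Ex_uniform01_itv (a b : R) : a <= b ->
  Ex uniform01 \1_(`[a, b]%classic) <= b - a.
Proof.
move=> ab; rewrite -lee_fin Ex_indic//.
rewrite /uniform01 /= /distribution /pushforward /=.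
rewrite /uniform_prob integral_uniform_pdf.
apply: (@le_trans _ _ (\int[lebesgue_measure]_(x in `[a, b]%classic `&` `[0%R, 1%R]) (cst 1%:E) x)%E).
  apply: ge0_le_integral => //.
  - by apply: measurableI => //; apply: measurable_itv.
  - by move=> x _; rewrite lee_fin uniform_pdf_ge0.
  - apply/measurable_EFinP; apply: measurable_funTS; exact: measurable_uniform_pdf.
  - by move=> x _; rewrite lee_fin /uniform_pdf subr0 invr1; case: ifP.
rewrite integral_cst; last by apply: measurableI => //; apply: measurable_itv.
rewrite mul1e; apply: (@le_trans _ _ (lebesgue_measure `[a, b]%classic)).
  by apply: le_measure; rewrite ?inE//; apply: measurableI => //; apply: measurable_itv.
by rewrite lebesgue_measure_itv/= lte_fin; case: ltP; rewrite ?lee_fin ?subr_ge0.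
Qed.

Lemma Ex_uniform01_unit : Ex uniform01 \1_(`[0 : R, 1]%classic) = 1.
Proof.
apply: EFin_inj; rewrite Ex_indic//.
rewrite /uniform01 /= /distribution /pushforward /=.
by rewrite /uniform_prob integral_uniform_pdf1// subr0 invr1.
Qed.

Variable d : nat.

Lemma cube_indicE (x : d.-tuple R) :
  \1_(cube d) x = \prod_i \1_(`[0 : R, 1]%classic) (tnth x i) :> R.
Proof.
rewrite indicE; case: (boolP (x \in cube d)) => [|]; last first.
  move=> /negP xc.
  have [i hi] : exists i, ~ (0 <= tnth x i <= 1).
    by apply/existsNP => h; apply: xc; rewrite inE.
  rewrite (bigD1 i)//= indicE memNset ?mul0r//=.
rewrite inE => xc; rewrite big1// => i _.
by rewrite indicE mem_set//= in_itv/=; exact: xc.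
Qed.

Lemma bm_cube : bm (\1_(cube d) : d.-tuple R -> R).
Proof.
rewrite (_ : \1_(cube d) = fun x : d.-tuple R =>
    \prod_i \1_(`[0 : R, 1]%classic) (tnth x i)).
  apply: bm_prod => i; apply: (bm_tnth i (f := \1_(`[0 : R, 1]%classic))).
  exact: bm_indic.
by apply/funext => x; rewrite cube_indicE.
Qed.

Lemma measurable_cube : measurable (cube d : set (d.-tuple R)).
Proof. by apply/(@measurable_indicP _ _ R); exact: bm_meas bm_cube. Qed.

Lemma Ex_unif_cube : Ex (unif d) (\1_(cube d) : d.-tuple R -> R) = 1.
Proof.
under eq_Ex do rewrite cube_indicE.
rewrite /unif (Ex_iid_prod _ (g := fun _ => \1_(`[0 : R, 1]%classic))); last first.
  by move=> i; exact: bm_indic.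
by rewrite big1// => i _; exact: Ex_uniform01_unit.
Qed.

Lemma unif_cube : unif d (cube d : set (d.-tuple R)) = 1%E.
Proof. by rewrite -Ex_indic ?Ex_unif_cube//; exact: measurable_cube. Qed.

(** The cube has full measure, so integrands may be cut off outside of it. *)
Lemma Ex_unif_cut (f : d.-tuple R -> R) : bm f ->
  Ex (unif d) (fun x => \1_(cube d) x * f x) = Ex (unif d) f.
Proof.
move=> bf; have [C [C0 hC]] := bm_ub bf.
have b1 := bm_cube; have bcf := bmM b1 bf.
apply/eqP; rewrite -subr_eq0 -ExB// -normr_le0.
apply: (le_trans (Ex_abs _ (bmB bcf bf))).
apply: (@le_trans _ _ (Ex (unif d) (fun x => C * (1 - \1_(cube d) x)))).
  apply: Ex_le.
  - exact: bm_norm (bmB bcf bf).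
  - by apply: bmM; [exact: bm_cst|apply: bmB => //; exact: bm_cst].
  - move=> x; rewrite -[X in _ - X]mul1r -mulrBl normrM distrC mulrC.
    rewrite indicE; case: (x \in _); rewrite ?subrr ?normr0 ?mulr0//.
    by rewrite subr0 normr1 !mulr1.
rewrite ExZ; last by apply: bmB => //; exact: bm_cst.
by rewrite ExB ?Ex_cst ?Ex_unif_cube ?subrr ?mulr0//; exact: bm_cst.
Qed.

Lemma ipE (f g : d.-tuple R -> R) : bm f -> bm g ->
  ip f g = Ex (unif d) (fun x => f x * g x).
Proof.
move=> bf bg; rewrite -Ex_unif_cut; last exact: bmM.
rewrite /ip Rintegral_mkcond; apply: eq_Ex => x.
rewrite patchE indicE; case: (x \in _); by rewrite ?mul1r ?mul0r.
Qed.

Lemma eq_ip (f f' g g' : d.-tuple R -> R) :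
  (forall x, cube d x -> f x = f' x) -> (forall x, cube d x -> g x = g' x) ->
  ip f g = ip f' g'.
Proof.
move=> ff gg; apply: eq_Rintegral => x; rewrite inE => cx.
by rewrite ff// gg.
Qed.

(** Per coordinate the uniform law gives an interval at most its length. *)
Lemma Ex_unif_box (c : d.-tuple R) (e : R) (f : d.-tuple R -> R) : 0 <= e ->
  bm f -> (forall x, f x <= [forall r, `|tnth x r - tnth c r| <= e]%:R) ->
  Ex (unif d) f <= (2 * e) ^+ d.
Proof.
move=> e0 bf hf.
pose g (i : 'I_d) : R -> R := \1_(`[tnth c i - e, tnth c i + e]%classic).
have bg i : bm (g i) by exact: bm_indic.
apply: (@le_trans _ _ (Ex (unif d) (fun x => \prod_i g i (tnth x i)))).
  apply: Ex_le => //; first by apply: bm_prod => i; exact: (bm_tnth i (bg i)).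
  move=> x; apply: (le_trans (hf x)); case: forallP => [h|_]; last first.
    by apply: prodr_ge0 => i _; rewrite /g indicE; case: (_ \in _).
  rewrite big1// => i _; rewrite /g indicE mem_set//=.
  by rewrite in_itv/= -ler_distl; exact: h.
rewrite /unif Ex_iid_prod//; apply: (@le_trans _ _ (\prod_(i < d) (2 * e))); last first.
  by rewrite prodr_const card_ord.
apply: ler_prod => i _; apply/andP; split.
  by apply: Ex_ge0 => x; rewrite /g indicE; case: (_ \in _).
apply: (le_trans (Ex_uniform01_itv _)); first by rewrite lerD2l ge0_cp.
by rewrite le_eqVlt; apply/orP; left; apply/eqP; ring.
Qed.

End uniform_law.

(** * Uniformly continuous functions on the cube *)

Section uniform_continuity.
Context {R : realType} {d : nat}.
Implicit Type f : d.-tuple R -> R.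

(** Functions are only controlled on the cube; multiplication by its indicator
    makes them bounded and measurable everywhere. *)
Definition cutoff f (x : d.-tuple R) : R := \1_(cube d) x * f x.

Lemma cutoff_in f x : cube d x -> cutoff f x = f x.
Proof. by move=> cx; rewrite /cutoff indicE mem_set// mul1r. Qed.

Lemma cutoff_out f x : ~ cube d x -> cutoff f x = 0.
Proof. by move=> cx; rewrite /cutoff indicE memNset// mul0r. Qed.

Section grid.
Variable N : nat.

Definition grid_pt (k : {ffun 'I_d -> 'I_N.+2}) : d.-tuple R :=
  [tuple (k r)%:R / N.+1%:R | r < d].

Definition grid_cell (k : 'I_N.+2) : set R := [set t | k%:R <= t * N.+1%:R < k.+1%:R].

(** A step function on the grid of mesh [1 / N.+1]; uniform limits of such functions
    show that uniform continuity on the cube gives measurability. *)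
Definition grid_fun f (x : d.-tuple R) : R :=
  \sum_(k : {ffun 'I_d -> 'I_N.+2})
    f (grid_pt k) * \prod_r \1_(grid_cell (k r)) (tnth x r).

Lemma measurable_grid_cell k : measurable (grid_cell k).
Proof.
rewrite (_ : grid_cell k = `[k%:R / N.+1%:R, k.+1%:R / N.+1%:R[%classic)//.
by apply/seteqP; split => t /=; rewrite in_itv/= ler_pdivrMr// ltr_pdivlMr.
Qed.

Lemma bm_grid_fun f : bm (grid_fun f).
Proof.
apply: bm_sum => k; apply: bmM; first exact: bm_cst.
apply: bm_prod => r; apply: (bm_tnth r (f := \1_(grid_cell (k r)))).
by apply: bm_indic; exact: measurable_grid_cell.
Qed.

Lemma grid_funP f x : cube d x -> exists k, [/\ grid_fun f x = f (grid_pt k),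
  cube d (grid_pt k) & forall r, `|tnth x r - tnth (grid_pt k) r| <= N.+1%:R^-1].
Proof.
move=> cx.
have tr r : 0 <= tnth x r * N.+1%:R by rewrite mulr_ge0//; case/andP: (cx r).
have tr1 r : (Num.truncn (tnth x r * N.+1%:R) < N.+2)%N.
  rewrite ltnS -(@ler_nat R); case/andP: (truncn_itv (tr r)) => h _.
  apply: (le_trans h); rewrite ler_piMl//; by case/andP: (cx r).
pose k := [ffun r => Ordinal (tr1 r)]; exists k.
have kin r : grid_cell (k r) (tnth x r) by rewrite /grid_cell/= ffunE/= truncn_itv.
split.
- rewrite /grid_fun (bigD1 k)//= [X in _ + X]big1 ?addr0; last first.
    move=> k' k'k; have [r hr] : exists r, k' r != k r.
      by apply/existsP; rewrite -negb_forall; apply: contra k'k => /forallP h;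
        apply/eqP/ffunP => r; exact/eqP.
    rewrite (bigD1 r)//= indicE memNset ?mul0r ?mulr0// /grid_cell/=.
    move=> h; case/negP: hr; apply/eqP/val_inj.
    by rewrite ffunE/=; apply/esym/truncn_def.
  rewrite big1 ?mulr1// => r _; rewrite indicE mem_set//; exact: kin.
- move=> r; rewrite tnth_mktuple divr_ge0//= ler_pdivrMr// mul1r ler_nat.
  by rewrite -ltnS.
- move=> r; rewrite tnth_mktuple; have /andP[h1 h2] := kin r.
  have N0 : 0 < N.+1%:R :> R by rewrite ltr0n.
  have -> : tnth x r - (k r)%:R / N.+1%:R = (tnth x r * N.+1%:R - (k r)%:R) / N.+1%:R.
    by field; rewrite gt_eqF.
  rewrite normrM normfV [X in _ / X]gtr0_norm// ger0_norm ?subr_ge0//.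
  by rewrite ler_pdivrMr// mulVf ?gt_eqF// lerBlDr -[1]/1%:R -natrD add1n ltW.
Qed.

End grid.

Lemma ucont_approx f : ucont_cube f -> forall e, 0 < e -> exists N0, forall N,
  (N0 <= N)%N -> forall x, cube d x -> `|f x - grid_fun N f x| < e.
Proof.
move=> uf e e0; have [t t0 ht] := uf e e0.
exists (Num.truncn t^-1) => N hN x cx.
have [k [-> ck hk]] := grid_funP N f cx.
apply: ht => // r; apply: (le_lt_trans (hk r)).
rewrite invf_plt ?posrE//; apply: (lt_le_trans (truncnS_gt _)).
by rewrite ler_nat ltnS.
Qed.

Lemma bm_ucont f : ucont_cube f -> bm (cutoff f).
Proof.
move=> uf; split.
  apply: (@measurable_fun_cvg _ _ R setT (fun N => cutoff (grid_fun N f))).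
    by move=> N; apply: bm_meas; apply: bmM (bm_grid_fun _ _); exact: bm_cube.
  move=> x _; have [cx|cx] := pselect (cube d x); last first.
    rewrite cutoff_out//; under eq_fun do rewrite cutoff_out//; exact: cvg_cst.
  rewrite cutoff_in//; under eq_fun do rewrite cutoff_in//.
  apply/cvgrPdist_lt => e e0; have [N0 hN0] := ucont_approx uf e0.
  by exists N0 => // N /= hN; exact: hN0.
have [N0 hN0] := ucont_approx uf ltr01.
have [C [C0 hC]] := bm_ub (bm_grid_fun N0 f).
exists (1 + C) => x; have [cx|cx] := pselect (cube d x); last first.
  by rewrite cutoff_out// normr0 addr_ge0// ltW.
rewrite cutoff_in// -(subrK (grid_fun N0 f x) (f x)).
by rewrite (le_trans (ler_normD _ _))// lerD//; exact/ltW/hN0.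
Qed.

End uniform_continuity.

(** * Projections on the multiresolution spaces *)

Section wavelet_projections.
Context {R : realType} {d J0 S : nat} (W : wavelets R d).
Hypothesis hW : cdv_basis W J0 S.

(** On bounded measurable functions this is [ip] ([ipE]), in a form to which the rules for
    expectations apply. *)
Definition dot (f g : d.-tuple R -> R) : R := Ex (unif d) (fun x => f x * g x).

Definition wproj (j : nat) (f : d.-tuple R -> R) (x : d.-tuple R) : R :=
  \sum_m dot f (phi W j m) * phi W j m x.

Lemma bm_phi j m : (J0 <= j)%N -> bm (phi W j m).
Proof.
move=> hj; rewrite (_ : phi W j m = cutoff (phi W j m)).
  by apply: bm_ucont; case: (cdv_continuous hW hj m).
apply/funext => x; have [cx|cx] := pselect (cube d x); first by rewrite cutoff_in.
by rewrite cutoff_out//; case: (cdv_off hW hj m cx).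
Qed.

Lemma bm_psi j i m : (J0 <= j)%N -> bm (psi W j i m).
Proof.
move=> hj; rewrite (_ : psi W j i m = cutoff (psi W j i m)).
  by apply: bm_ucont; case: (cdv_continuous hW hj m).
apply/funext => x; have [cx|cx] := pselect (cube d x); first by rewrite cutoff_in.
by rewrite cutoff_out//; case: (cdv_off hW hj m cx) => _ ->.
Qed.

Lemma dotC f g : dot f g = dot g f.
Proof. by apply: eq_Ex => x; rewrite mulrC. Qed.

Lemma dotDl f g h : bm f -> bm g -> bm h ->
  dot (fun x => f x + g x) h = dot f h + dot g h.
Proof.
move=> bf bg bh; rewrite /dot -ExD; [|exact: bmM..].
by apply: eq_Ex => x; rewrite mulrDl.
Qed.

Lemma dotBl f g h : bm f -> bm g -> bm h ->
  dot (fun x => f x - g x) h = dot f h - dot g h.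
Proof.
move=> bf bg bh; rewrite /dot -ExB; [|exact: bmM..].
by apply: eq_Ex => x; rewrite mulrBl.
Qed.

Lemma dotZl c f h : bm f -> bm h -> dot (fun x => c * f x) h = c * dot f h.
Proof.
move=> bf bh; rewrite /dot -ExZ; last exact: bmM.
by apply: eq_Ex => x; rewrite mulrA.
Qed.

Lemma dot_suml (I : finType) (F : I -> d.-tuple R -> R) h :
  (forall i, bm (F i)) -> bm h ->
  dot (fun x => \sum_i F i x) h = \sum_i dot (F i) h.
Proof.
move=> bF bh; rewrite /dot -Ex_sum; last by move=> i; exact: bmM (bF i) bh.
by apply: eq_Ex => x; rewrite mulr_suml.
Qed.

Lemma dot_comb (I : finType) (c : I -> R) (F : I -> d.-tuple R -> R) h :
  (forall i, bm (F i)) -> bm h ->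
  dot (fun x => \sum_i c i * F i x) h = \sum_i c i * dot (F i) h.
Proof.
move=> bF bh; rewrite (dot_suml (F := fun i x => c i * F i x))//.
  by apply: eq_bigr => i _; rewrite dotZl.
by move=> i; apply: bmM (bF i); exact: bm_cst.
Qed.

Lemma bm_comb (I : finType) (c : I -> R) (F : I -> d.-tuple R -> R) :
  (forall i, bm (F i)) -> bm (fun x => \sum_i c i * F i x).
Proof. by move=> bF; apply: bm_sum => i; apply: bmM (bF i); exact: bm_cst. Qed.

Lemma phi_on j m m' : (J0 <= j)%N -> dot (phi W j m) (phi W j m') = (m == m')%:R.
Proof.
by move=> hj; rewrite -(cdv_phi_orthonormal hW hj) ipE//; exact: bm_phi.
Qed.

Lemma psi_on l i m i' m' : (J0 <= l)%N ->
  dot (psi W l i m) (psi W l i' m') = ((i == i') && (m == m'))%:R.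
Proof.
by move=> hj; rewrite -(cdv_psi_orthonormal hW hj) ipE//; exact: bm_psi.
Qed.

Lemma psi_levels l l' i m i' m' : (J0 <= l)%N -> (J0 <= l')%N -> l != l' ->
  dot (psi W l i m) (psi W l' i' m') = 0.
Proof.
by move=> hl hl' ll'; rewrite -(cdv_psi_levels hW hl hl' ll' i m i' m') ipE//;
  exact: bm_psi.
Qed.

Lemma bm_in_V j f : (J0 <= j)%N -> in_V W j f -> bm f.
Proof.
move=> hj [c hc]; rewrite (_ : f = fun x => \sum_m c m * phi W j m x).
  by apply: bm_comb => m; exact: bm_phi.
exact/funext.
Qed.

Lemma bm_in_detail l f : (J0 <= l)%N -> in_detail W l f -> bm f.
Proof.
move=> hj [c hc]; rewrite (_ : f = fun x => \sum_i \sum_m c i m * psi W l i m x).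
  by apply: bm_sum => i; apply: bm_comb => m; exact: bm_psi.
exact/funext.
Qed.

Lemma in_V_phi j m : in_V W j (phi W j m).
Proof.
exists (fun m' => (m' == m)%:R) => x; rewrite (bigD1 m)//= eqxx mul1r.
by rewrite big1 ?addr0// => m' /negPf ->; rewrite mul0r.
Qed.

Lemma in_VS j f : (J0 <= j)%N -> in_V W j f -> in_V W j.+1 f.
Proof.
move=> hj vf; apply/(cdv_multiresolution hW hj); exists f, (fun _ => 0); split => //.
  exists (fun _ _ => 0) => x; rewrite big1// => i _; rewrite big1// => m _.
  by rewrite mul0r.
by move=> x; rewrite addr0.
Qed.

Lemma in_V_mono j L f : (J0 <= j)%N -> (j <= L)%N -> in_V W j f -> in_V W L f.
Proof.
move=> hj jL vf; elim: L jL => [|L IH]; first by rewrite leqn0 => /eqP <-.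
rewrite leq_eqVlt => /predU1P[<-//|]; rewrite ltnS => jL.
by apply: in_VS; [exact: leq_trans jL|exact: IH].
Qed.

Lemma in_V_dot0 j f h : (J0 <= j)%N -> bm h -> in_V W j f ->
  (forall m, dot (phi W j m) h = 0) -> dot f h = 0.
Proof.
move=> hj bh [c hc] h0; rewrite (_ : f = fun x => \sum_m c m * phi W j m x).
  rewrite dot_comb//; last by move=> m; exact: bm_phi.
  by rewrite big1// => m _; rewrite h0 mulr0.
exact/funext.
Qed.

Lemma in_detail_dot0 l f h : (J0 <= l)%N -> bm h -> in_detail W l f ->
  (forall i m, dot (psi W l i m) h = 0) -> dot f h = 0.
Proof.
move=> hj bh [c hc] h0; rewrite (_ : f = fun x => \sum_i \sum_m c i m * psi W l i m x).
  rewrite (dot_suml (F := fun i x => \sum_m c i m * psi W l i m x))//; last first.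
    by move=> i; apply: bm_comb => m; exact: bm_psi.
  rewrite big1// => i _; rewrite dot_comb//; last by move=> m; exact: bm_psi.
  by rewrite big1// => m _; rewrite h0 mulr0.
exact/funext.
Qed.

(** The wavelets are orthogonal to the scaling functions of all lower levels, since
    these lie in the span of the coarsest ones and of the details in between. *)
Lemma phi_psi j l m i m' : (J0 <= j)%N -> (j <= l)%N ->
  dot (phi W j m) (psi W l i m') = 0.
Proof.
move=> hj jl; have hl := leq_trans hj jl; have bps := bm_psi i m' hl.
have base k : J0 = k -> forall m, dot (phi W k m) (psi W l i m') = 0.
  by move=> <- m0; rewrite -(cdv_phi_psi hW hl m0 i m') ipE//; exact: bm_phi.
elim: j hj jl m => [|j IH] hj jl m.
  by apply: base; apply/eqP; rewrite -leqn0.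
move: hj; rewrite leq_eqVlt => /predU1P[J0j|]; last rewrite ltnS => hj.
  exact: base.
have [g [h [vg dh E]]] := (cdv_multiresolution hW hj (phi W j.+1 m)).1 (in_V_phi _).
rewrite (_ : phi W j.+1 m = fun x => g x + h x); last exact/funext.
rewrite dotDl//; [|exact: bm_in_V vg|exact: bm_in_detail dh].
rewrite (in_V_dot0 hj bps vg) ?add0r; last by move=> m''; exact: IH (ltnW jl) _.
by apply: (in_detail_dot0 hj bps dh) => i' m''; apply: psi_levels => //; rewrite ltn_eqF.
Qed.

Lemma in_V_psi j l f i m : (J0 <= j)%N -> (j <= l)%N -> in_V W j f ->
  dot f (psi W l i m) = 0.
Proof.
move=> hj jl vf; apply: (in_V_dot0 hj _ vf) => [|m']; last exact: phi_psi.
by apply: bm_psi; exact: leq_trans jl.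
Qed.

Lemma in_V_proj j f : in_V W j (wproj j f).
Proof. by exists (fun m => dot f (phi W j m)) => x. Qed.

Lemma bm_proj j f : (J0 <= j)%N -> bm (wproj j f).
Proof. by move=> hj; exact: bm_in_V (in_V_proj j f). Qed.

Lemma proj_id j f : (J0 <= j)%N -> in_V W j f -> wproj j f = f.
Proof.
move=> hj [c hc]; apply/funext => x; rewrite hc; apply: eq_bigr => m _; congr (_ * _).
rewrite (_ : f = fun x => \sum_m c m * phi W j m x); last exact/funext.
rewrite dot_comb; [|by move=> m'; exact: bm_phi|exact: bm_phi].
rewrite (bigD1 m)//= phi_on// eqxx mulr1 big1 ?addr0// => m' /negPf m'm.
by rewrite phi_on// m'm mulr0.
Qed.

Lemma dot_proj j f g : (J0 <= j)%N -> bm f ->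
  dot f (wproj j g) = \sum_m dot f (phi W j m) * dot g (phi W j m).
Proof.
move=> hj bf; rewrite dotC dot_comb//; last by move=> m; exact: bm_phi.
by apply: eq_bigr => m _; rewrite mulrC (dotC (phi W j m)).
Qed.

Lemma dot_proj_sym j f g : (J0 <= j)%N -> bm f -> bm g ->
  dot f (wproj j g) = dot (wproj j f) g.
Proof.
move=> hj bf bg; rewrite (dotC (wproj j f)) !dot_proj//.
by apply: eq_bigr => m _; rewrite mulrC.
Qed.

Lemma dot_proj_proj j f : (J0 <= j)%N -> bm f ->
  dot (wproj j f) (wproj j f) = dot f (wproj j f).
Proof.
move=> hj bf; rewrite -(dot_proj_sym hj bf (bm_proj f hj)) proj_id//.
exact: in_V_proj.
Qed.

Lemma dot_ge0 f : 0 <= dot f f.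
Proof. by apply: Ex_ge0 => x; rewrite -expr2 sqr_ge0. Qed.

(** Bessel's inequality *)
Lemma dot_proj_le j f : (J0 <= j)%N -> bm f -> dot f (wproj j f) <= dot f f.
Proof.
move=> hj bf; have bp := bm_proj f hj.
have := dot_ge0 (fun x => f x - wproj j f x).
rewrite dotBl//; last exact: bmB.
rewrite (dotC f (fun x => _)) (dotC (wproj j f) (fun x => _)) !dotBl//.
by rewrite dot_proj_proj// (dotC (wproj j f) f) subrr subr0 subr_ge0.
Qed.

Lemma dot_pythagoras u v : bm u -> bm v -> dot u v = 0 ->
  dot u u <= dot (fun x => u x + v x) (fun x => u x + v x).
Proof.
move=> bu bv uv; have buv := bmD bu bv.
rewrite dotDl// (dotC u (fun x => u x + v x)) (dotC v (fun x => u x + v x)) !dotDl//.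
by rewrite (dotC v u) uv addr0 add0r lerDl dot_ge0.
Qed.

Lemma proj_best j f g : (J0 <= j)%N -> bm f -> in_V W j g ->
  dot (fun x => f x - wproj j f x) (fun x => f x - wproj j f x) <=
  dot (fun x => f x - g x) (fun x => f x - g x).
Proof.
move=> hj bf vg; have bp := bm_proj f hj; have bg := bm_in_V hj vg.
have bfp := bmB bf bp; have bfg := bmB bf bg; have bpg := bmB bp bg.
have o : dot (fun x => f x - wproj j f x) (fun x => wproj j f x - g x) = 0.
  rewrite dotC; apply: (in_V_dot0 hj bfp).
    case: vg => c hc; exists (fun m => dot f (phi W j m) - c m) => x.
    by rewrite hc /wproj -sumrB; apply: eq_bigr => m _; rewrite mulrBl.
  move=> m; rewrite dotC dotBl//; last exact: bm_phi.
  rewrite -(dot_proj_sym hj bf (bm_phi m hj)) proj_id ?subrr//.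
  exact: in_V_phi.
rewrite [leRHS](_ : _ = dot (fun x => (f x - wproj j f x) + (wproj j f x - g x))
   (fun x => (f x - wproj j f x) + (wproj j f x - g x))); last first.
  by apply: eq_Ex => x; congr (_ * _); ring.
exact: dot_pythagoras.
Qed.

Lemma kernelC j x y : Defs.kernel W j x y = Defs.kernel W j y x.
Proof. by apply: eq_bigr => m _; rewrite mulrC. Qed.

Lemma bm_kernel j x : (J0 <= j)%N -> bm (Defs.kernel W j x).
Proof. by move=> hj; apply: bm_comb => m; exact: bm_phi. Qed.

Lemma in_V_kernel j x : in_V W j (Defs.kernel W j x).
Proof. by exists (fun m => phi W j m x) => y. Qed.

Lemma proj_kernel j f x : (J0 <= j)%N -> bm f ->
  wproj j f x = dot f (Defs.kernel W j x).
Proof.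
move=> hj bf; rewrite dotC dot_comb//; last by move=> m; exact: bm_phi.
by apply: eq_bigr => m _; rewrite mulrC (dotC (phi W j m)).
Qed.

(** Since the spaces are nested, the larger projection fixes the kernel of the
    smaller one. *)
Lemma dot_kernel j1 j2 x y : (J0 <= j1)%N -> (J0 <= j2)%N ->
  dot (Defs.kernel W j1 x) (Defs.kernel W j2 y) = Defs.kernel W (minn j1 j2) x y.
Proof.
wlog j12 : j1 j2 x y / (j1 <= j2)%N.
  move=> H h1 h2; case/orP: (leq_total j1 j2) => h; first exact: H.
  by rewrite dotC minnC kernelC; exact: H.
move=> h1 h2; rewrite (minn_idPl j12) -proj_kernel//; last exact: bm_kernel.
by rewrite proj_id//; apply: in_V_mono (in_V_kernel _ _).
Qed.

Lemma proj_step L g x : (J0 <= L)%N -> bm g ->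
  wproj L.+1 g x = wproj L g x + \sum_i \sum_m dot g (psi W L i m) * psi W L i m x.
Proof.
move=> hL bg.
pose D x := \sum_i \sum_m dot g (psi W L i m) * psi W L i m x.
pose F x := wproj L g x + D x.
have dD : in_detail W L D by exists (fun i m => dot g (psi W L i m)).
have bD := bm_in_detail hL dD; have bp := bm_proj g hL.
have bF : bm F := bmD bp bD.
have hL1 : (J0 <= L.+1)%N by exact: leqW.
have vF : in_V W L.+1 F.
  apply/(cdv_multiresolution hW hL); exists (wproj L g), D; split => //.
  exact: in_V_proj.
suff : wproj L.+1 g = F by move=> ->.
rewrite -(proj_id hL1 vF).
apply/funext => z; apply: eq_bigr => m _; congr (_ * _).
have bph := bm_phi m hL1.
apply/eqP; rewrite -subr_eq0 -dotBl//; apply/eqP.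
have bgF := bmB bg bF.
have [u [h [vu dh E]]] := (cdv_multiresolution hW hL (phi W L.+1 m)).1 (in_V_phi _).
have bu := bm_in_V hL vu; have bh := bm_in_detail hL dh.
rewrite (_ : phi W L.+1 m = fun x => u x + h x); last exact/funext.
rewrite dotC dotDl// (in_V_dot0 hL bgF vu) ?(in_detail_dot0 hL bgF dh) ?addr0//.
- move=> i m'; have bps := bm_psi i m' hL.
  rewrite dotC dotBl// dotDl// (in_V_psi _ _ hL (leqnn _) (in_V_proj _ _)) add0r.
  rewrite (dot_suml (F := fun i x => \sum_m dot g (psi W L i m) * psi W L i m x))//; last first.
    by move=> k; apply: bm_comb => m''; exact: bm_psi.
  rewrite (bigD1 i)//= [X in _ - (_ + X)]big1 ?addr0; last first.
    move=> k /negPf ki; rewrite dot_comb//; last by move=> m''; exact: bm_psi.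
    by rewrite big1// => m'' _; rewrite psi_on// ki mulr0.
  rewrite dot_comb//; last by move=> m''; exact: bm_psi.
  rewrite (bigD1 m')//= psi_on// !eqxx mulr1 big1 ?addr0 ?subrr//.
  by move=> m'' /negPf k; rewrite psi_on// k andbF mulr0.
- move=> m'; have bph' := bm_phi m' hL.
  rewrite dotC dotBl// dotDl//.
  have -> : dot D (phi W L m') = 0.
    apply: (in_detail_dot0 hL bph' dD) => i m''.
    by rewrite dotC phi_psi.
  by rewrite addr0 -(dot_proj_sym hL bg bph') proj_id ?subrr//; exact: in_V_phi.
Qed.

Lemma dot_proj_step L f g : (J0 <= L)%N -> bm f -> bm g ->
  dot f (wproj L.+1 g) = dot f (wproj L g) +
    \sum_i \sum_m dot f (psi W L i m) * dot g (psi W L i m).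
Proof.
move=> hL bf bg.
have -> : wproj L.+1 g = fun x =>
    wproj L g x + \sum_i \sum_m dot g (psi W L i m) * psi W L i m x.
  by apply/funext => x; exact: proj_step.
have bD i : bm (fun x => \sum_m dot g (psi W L i m) * psi W L i m x).
  by apply: bm_comb => m; exact: bm_psi.
rewrite dotC dotDl//; [|exact: bm_proj|exact: bm_sum].
rewrite dotC; congr (_ + _); rewrite dot_suml//; apply: eq_bigr => i _.
rewrite dot_comb//; last by move=> m; exact: bm_psi.
by apply: eq_bigr => m _; rewrite mulrC (dotC (psi W L i m)).
Qed.

(** Completeness provides some element of some [V_j] close to [f], and the projections
    on the larger spaces do at least as well. *)
Lemma proj_dense f e : bm f -> 0 < e -> exists2 j, (J0 <= j)%N & forall L, (j <= L)%N ->
  dot (fun x => f x - wproj L f x) (fun x => f x - wproj L f x) < e.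
Proof.
move=> bf e0.
have mf : measurable_fun (cube d) f by apply: measurable_funTS; case: bf.
have bcut g : bm g -> ((\int[unif d]_(x in cube d) (g x)%:E)%E = (Ex (unif d) g)%:E).
  move=> bg; rewrite -[in RHS]Ex_unif_cut// -ExE; last by apply: bmM bg; exact: bm_cube.
  rewrite integral_mkcond; apply: eq_integral => x _.
  rewrite patchE indicE; case: (_ \in _); by rewrite ?mul1r ?mul0r.
have fin : (\int[unif d]_(x in cube d) (f x ^+ 2)%:E < +oo)%E.
  by rewrite bcut ?ltry//; exact: bmX.
have [j hj [g vg hg]] := cdv_complete hW mf fin e0.
exists j => // L jL; have hL := leq_trans hj jL.
have vgL := in_V_mono hj jL vg; have bg := bm_in_V hj vg.
apply: (le_lt_trans (proj_best hL bf vgL)).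
move: hg; rewrite bcut; last by apply: bmX; exact: bmB.
by rewrite lte_fin; congr (_ < _); apply: eq_Ex => x; rewrite expr2.
Qed.

End wavelet_projections.

(** * Kernels, details and the approximation error *)

Lemma pow2D (R : realType) (r s : R) : 2 `^ r * 2 `^ s = 2 `^ (r + s) :> R.
Proof. by rewrite powRD// pnatr_eq0 implybT. Qed.

Lemma leq_card_cover (I T : finType) (P : pred I) (F : I -> {set T}) :
  (#|(\bigcup_(i | P i) F i)%SET| <= \sum_(i | P i) #|F i|)%N.
Proof.
elim/big_rec2: _ => [|i n A _ IH]; first by rewrite finset.cards0.
by apply: (leq_trans (finset.leq_card_setU _ _)); rewrite leq_add2l.
Qed.

Section wavelet_bounds.
Context {R : realType} {d J0 S : nat} (W : wavelets R d).
Hypothesis hW : cdv_basis W J0 S.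

Lemma resol_gt0 j : 0 < @resol R d j.
Proof. by rewrite /resol exprn_gt0. Qed.

Lemma resolE j : @resol R d j = (2 ^+ j) ^+ d.
Proof. by rewrite /resol exprM. Qed.

Lemma resol_powR j : @resol R d j = 2 `^ (j%:R * d%:R).
Proof. by rewrite /resol -natrM powR_mulrn. Qed.

Lemma sqrt_resolM j : Num.sqrt (@resol R d j) * Num.sqrt (@resol R d j) = @resol R d j.
Proof. by rewrite -expr2 sqr_sqrtr// ltW// resol_gt0. Qed.

Section local_family.
Variables (j : nat) (F : idx W j -> d.-tuple R -> R) (C e : R) (N : nat)
  (loc : idx W j -> d.-tuple R).
Hypotheses (C0 : 0 <= C) (e0 : 0 <= e) (bF : forall m, bm (F m))
  (FC : forall m x, `|F m x| <= C * Num.sqrt (@resol R d j)).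
Let near m x := [forall r, `|tnth x r - tnth (loc m) r| <= e].
Hypotheses (Fnear : forall m x, F m x != 0 -> near m x)
  (cardN : forall x, (#|[pred m | near m x]| <= N)%N).

(** At each point at most [N] of the functions do not vanish. *)
Lemma local_weighted_sum (w : idx W j -> R) (B : R) x : 0 <= B ->
  (forall m, 0 <= w m <= B) ->
  \sum_m `|F m x| * w m <= N%:R * (C * Num.sqrt (@resol R d j) * B).
Proof.
move=> B0 hw; rewrite (bigID (fun m => near m x))/= [X in _ + X]big1 ?addr0; last first.
  move=> m hm; have [->|/Fnear] := eqVneq (F m x) 0; first by rewrite normr0 mul0r.
  by rewrite (negPf hm).
apply: (@le_trans _ _ (\sum_(m | near m x) C * Num.sqrt (@resol R d j) * B)).
  by apply: ler_sum => m _; case/andP: (hw m) => ? ?; apply: ler_pM.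
rewrite sumr_const -[leLHS]mulr_natl ler_wpM2r//.
  by rewrite !mulr_ge0// sqrtr_ge0.
by rewrite ler_nat; exact: cardN.
Qed.

Lemma local_sum x : \sum_m `|F m x| <= N%:R * (C * Num.sqrt (@resol R d j)).
Proof.
have := @local_weighted_sum (fun _ => 1) 1 x ler01.
rewrite mulr1 => h; apply: le_trans (h _); last by move=> m; rewrite ler01 lexx.
by under [leRHS]eq_bigr do rewrite mulr1.
Qed.

Lemma local_support (m : idx W j) (f : d.-tuple R -> R) : bm f ->
  (forall x, f x <= (F m x != 0)%:R) -> Ex (unif d) f <= (2 * e) ^+ d.
Proof.
move=> bf hf; apply: (Ex_unif_box (c := loc m) e0 bf) => x.
apply: (le_trans (hf x)); rewrite ler_nat.
by case: (boolP (F m x != 0)) => // /Fnear; rewrite /near => ->.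
Qed.

Lemma local_Ex m : Ex (unif d) (fun x => `|F m x|) <=
  C * Num.sqrt (@resol R d j) * (2 * e) ^+ d.
Proof.
have bn : bm (\1_[set x | F m x != 0] : d.-tuple R -> R).
  apply: bm_indic.
  have -> : [set x | F m x != 0] = F m @^-1` (~` [set 0]).
    by apply/seteqP; split => x /=; [move=> /eqP|move=> /eqP].
  by rewrite -[X in measurable X]setTI; apply: (bm_meas (bF m)) => //; exact: measurableC.
apply: (@le_trans _ _ (Ex (unif d) (fun x =>
    C * Num.sqrt (@resol R d j) * \1_[set x | F m x != 0] x))).
  apply: Ex_le; [exact: bm_norm|by apply: bmM => //; exact: bm_cst|].
  move=> x; rewrite indicE; case: (boolP (F m x == 0)) => [/eqP ->|h].
    by rewrite normr0 mulr_ge0// ?mulr_ge0// sqrtr_ge0.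
  by rewrite mem_set ?mulr1.
rewrite ExZ// ler_wpM2l ?mulr_ge0 ?sqrtr_ge0//.
apply: (@local_support m) => // x; rewrite indicE.
by case: (boolP (F m x == 0)) => [h|h]; [rewrite memNset//=; exact/negP/negPn|rewrite mem_set].
Qed.

Hypothesis (C20 : forall m, near m (loc m)).

(** A maximal family of indices with disjoint boxes has positive density
    because each box meets boundedly many others: a box of radius e around
    loc m' that meets the one around loc m contains one of the 2^d corners of
    the latter. *)
Lemma disjoint_family : exists A : {set idx W j},
  (#|idx W j| <= #|A| * (2 ^ d * N))%N /\
  forall m m', m \in A -> m' \in A -> m != m' -> forall x, F m x * F m' x = 0.
Proof.
pose cf m m' := `[< exists x, near m x /\ near m' x >].
have cfC m m' : cf m m' -> cf m' m.
  by move=> /asboolP [x [h1 h2]]; apply/asboolP; exists x.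
have cfm m : cf m m by apply/asboolP; exists (loc m).
pose indep (A : {set idx W j}) :=
  [forall m in A, forall m' in A, (m != m') ==> ~~ cf m m'].
have indepP (A : {set idx W j}) : reflect (forall m m', m \in A -> m' \in A ->
    m != m' -> ~~ cf m m') (indep A).
  apply: (iffP idP) => [h m m' mA m'A mm'|h].
    by move: h => /forall_inP /(_ _ mA) /forall_inP /(_ _ m'A) /implyP; apply.
  apply/forall_inP => m mA; apply/forall_inP => m' m'A; apply/implyP => mm'.
  exact: h.
have [A /maxsetP [/indepP iA mA] _] : {A : {set idx W j} | maxset indep A & finset.set0 \subset A}.
  by apply: maxset_exists; apply/indepP => m m'; rewrite finset.inE.
exists A; split; last first.
  move=> m m' Am Am' mm' x; apply/eqP; rewrite mulf_eq0.
  have [//|/= h1] := eqVneq (F m x) 0; apply: contraT => h2.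
  have := iA _ _ Am Am' mm'; rewrite -(rwP negP) => h; exfalso; apply: h.
  by apply/asboolP; exists x; split; exact: Fnear.
have cov m : exists2 a, a \in A & cf a m.
  have [Am|nAm] := boolP (m \in A); first by exists m.
  apply: contrapT => h.
  have hcf a : a \in A -> ~~ cf a m by move=> aA; apply/negP => c; apply: h; exists a.
  have /mA : indep (m |: A).
    apply/indepP => a b; rewrite !finset.in_setU1 => /predU1P[->|aA] /predU1P[->|bA] ab.
    - by rewrite eqxx in ab.
    - by apply/negP => /cfC; exact/negP/hcf.
    - exact: hcf.
    - exact: iA.
  move=> /(_ (finset.subsetUr _ _)) E; move: nAm; rewrite -E finset.in_setU1 eqxx//.
(* a box meeting the one around loc a contains the corner on its side *)
pose corner m (b : {ffun 'I_d -> bool}) : d.-tuple R :=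
  [tuple tnth (loc m) r + (if b r then e else - e) | r < d].
have nbr a : (#|[set m | cf a m]%SET| <= 2 ^ d * N)%N.
  apply: (@leq_trans #|(\bigcup_(b : {ffun 'I_d -> bool}) [set m | near m (corner a b)])%SET|).
    apply/subset_leq_card/fintype.subsetP => m; rewrite finset.inE => /asboolP [x [h1 h2]].
    apply/finset.bigcupP.
    exists [ffun r => tnth (loc a) r <= tnth (loc m) r] => //; rewrite finset.inE.
    apply/forallP => r; rewrite tnth_mktuple ffunE.
    move: h1 h2 => /forallP /(_ r) h1 /forallP /(_ r) h2.
    rewrite !ler_distl in h1 h2 *; case: (lerP (tnth (loc a) r)) => h3; lra.
  apply: (leq_trans (leq_card_cover _ _)).
  apply: (@leq_trans (\sum_(b : {ffun 'I_d -> bool}) N)).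
    apply: leq_sum => b _; apply: leq_trans (cardN (corner a b)).
    by rewrite finset.cardsE.
  by rewrite sum_nat_const card_ffun card_bool card_ord.
have -> : #|idx W j| = #|(\bigcup_(a in A) [set m | cf a m])%SET|.
  apply/esym/eqP; rewrite -cardsT; apply/eqP; congr #|pred_of_set _|.
  apply/finset.setP => m; rewrite !finset.inE; apply/finset.bigcupP.
  by have [a aA c] := cov m; exists a => //; rewrite finset.inE.
apply: (leq_trans (leq_card_cover _ _)).
by rewrite -sum_nat_const; apply: leq_sum => a _; exact: nbr.
Qed.

End local_family.

Lemma box_volume (C : R) j : (2 * (C / 2 ^+ j)) ^+ d = (2 * C) ^+ d / @resol R d j.
Proof. by rewrite mulrA expr_div_n -resolE. Qed.

(** Localization gives the uniform bound and, since supports have volume of order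
    [1 / resol j], also the bounded mass, which does not depend on the level. *)
Lemma kernel_bounds : exists B : R, 0 < B /\ forall j, (J0 <= j)%N ->
  (forall x y, `|Defs.kernel W j x y| <= B * @resol R d j) /\
  (forall x, Ex (unif d) (fun y => `|Defs.kernel W j x y|) <= B).
Proof.
have [Cb Cb0 hb] := cdv_bound hW; have [C [N [C0 hloc]]] := cdv_local hW.
exists (N%:R * (Cb * Cb) + N%:R * (Cb * Cb * (2 * C) ^+ d) + 1); split.
  by rewrite ltr_wpDl// addr_ge0// mulr_ge0// ?mulr_ge0 ?exprn_ge0 ?mulr_ge0// ltW.
move=> j hj; have [loc [hnear hN]] := hloc j hj.
have r0 := resol_gt0 j; have e0 : 0 <= C / 2 ^+ j by rewrite divr_ge0 ?exprn_ge0 ?ltW.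
have bF m := bm_phi hW m hj.
have FC m x := (hb j hj m x).1.
have Fn m x := (hnear m x).1.
have k1 x y : `|Defs.kernel W j x y| <= \sum_m `|phi W j m x| * `|phi W j m y|.
  by rewrite (le_trans (ler_norm_sum _ _ _))//; apply: ler_sum => m _; rewrite normrM.
have p1 : 0 <= N%:R * (Cb * Cb) by rewrite !mulr_ge0// ltW.
have p2 : 0 <= N%:R * (Cb * Cb * (2 * C) ^+ d).
  by rewrite !mulr_ge0// ?exprn_ge0 ?mulr_ge0// ltW.
split=> [x y|x].
  apply: (le_trans (k1 x y)).
  apply: (le_trans (@local_weighted_sum _ _ Cb _ N loc (ltW Cb0) FC Fn hN
    (fun m => `|phi W j m y|) (Cb * Num.sqrt (@resol R d j)) x _ _)).
  - by rewrite mulr_ge0 ?sqrtr_ge0 ?ltW.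
  - by move=> m; rewrite normr_ge0 FC.
  rewrite mulrACA sqrt_resolM [leLHS]mulrA ler_pM2r//.
  by rewrite -addrA lerDl addr_ge0.
have bk : bm (fun y => \sum_m `|phi W j m x| * `|phi W j m y|).
  by apply: bm_comb => m; exact: bm_norm.
apply: (le_trans (Ex_le _ (bm_norm (bm_kernel hW x hj)) bk (k1 x))).
rewrite Ex_sum; last by move=> m; apply: bmM; [exact: bm_cst|exact: bm_norm].
rewrite (eq_bigr (fun m => `|phi W j m x| * Ex (unif d) (fun y => `|phi W j m y|))); last first.
  by move=> m _; rewrite ExZ//; exact: bm_norm.
have hE m := @local_Ex _ _ Cb _ loc (ltW Cb0) e0 bF FC Fn m.
apply: (le_trans (@local_weighted_sum _ _ Cb _ N loc (ltW Cb0) FC Fn hN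
    (fun m => Ex (unif d) (fun y => `|phi W j m y|))
    (Cb * Num.sqrt (@resol R d j) * (2 * (C / 2 ^+ j)) ^+ d) x _ _)).
- by rewrite !mulr_ge0 ?exprn_ge0 ?mulr_ge0 ?sqrtr_ge0// ltW.
- move=> m; rewrite Ex_ge0//=; exact: hE.
rewrite box_volume.
have -> : N%:R * (Cb * Num.sqrt (@resol R d j) * (Cb * Num.sqrt (@resol R d j) *
    ((2 * C) ^+ d / @resol R d j))) = N%:R * (Cb * Cb * (2 * C) ^+ d) *
    ((Num.sqrt (@resol R d j) * Num.sqrt (@resol R d j)) / @resol R d j) by ring.
rewrite sqrt_resolM divff ?gt_eqF// mulr1.
by rewrite addrAC lerDr addr_ge0.
Qed.

(** By orthonormality each scaling function contributes 1. *)
Lemma Ex_kernel_diag j : (J0 <= j)%N ->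
  Ex (unif d) (fun x => Defs.kernel W j x x) = #|idx W j|%:R.
Proof.
move=> hj; rewrite Ex_sum; last by move=> m; apply: bmM; exact: (bm_phi hW).
under eq_bigr => m _ do rewrite -/(dot _ _) (phi_on hW)// eqxx.
by rewrite sumr_const.
Qed.

Lemma detail_bounds : exists B c : R, [/\ 0 < B, 0 < c &
  forall l, (J0 <= l)%N -> forall i, [/\
    forall x, \sum_m `|psi W l i m x| <= B * Num.sqrt (@resol R d l),
    (forall m (f : d.-tuple R -> R), bm f ->
       (forall x, f x <= (psi W l i m x != 0)%:R) -> Ex (unif d) f <= B / @resol R d l)
  & exists A : {set idx W l}, c * @resol R d l <= #|A|%:R /\
      forall m m', m \in A -> m' \in A -> m != m' ->
        forall x, psi W l i m x * psi W l i m' x = 0]].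
Proof.
have [Cb Cb0 hb] := cdv_bound hW; have [C [N [C0 hloc]]] := cdv_local hW.
have [cc [CC [cc0 CC0 hcard]]] := cdv_card hW.
have p2 : 0 <= (2 * C) ^+ d by rewrite exprn_ge0// mulr_ge0// ltW.
have p1 : 0 <= N%:R * Cb by rewrite !mulr_ge0// ltW.
have K0 : 0 < (2 ^ d * N.+1)%:R :> R by rewrite ltr0n muln_gt0 expn_gt0.
exists (N%:R * Cb + (2 * C) ^+ d + 1), (cc / (2 ^ d * N.+1)%:R); split.
- by rewrite ltr_wpDl// addr_ge0.
- by rewrite divr_gt0.
move=> l hl i; have [loc [hnear hN]] := hloc l hl.
have r0 := resol_gt0 l; have e0 : 0 <= C / 2 ^+ l by rewrite divr_ge0 ?exprn_ge0 ?ltW.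
have bF m := bm_psi hW i m hl.
have FC m x := (hb l hl m x).2 i.
have Fn m x := (hnear m x).2 i.
split.
- move=> x; apply: (le_trans (local_sum (ltW Cb0) FC Fn hN x)).
  by rewrite mulrA ler_wpM2r ?sqrtr_ge0// -addrA lerDl addr_ge0.
- move=> m f bf hf; apply: (le_trans (local_support e0 Fn bf hf)).
  rewrite box_volume ler_pM2r ?invr_gt0//.
  by rewrite -addrA addrC -addrA lerDl addr_ge0.
- have [|A [hA hd]] := disjoint_family Fn hN.
    by move=> m; apply/forallP => r; rewrite subrr normr0.
  exists A; split; last exact: hd.
  have [c1 _] := andP (hcard l hl).
  rewrite mulrAC ler_pdivrMr// (le_trans c1)// -natrM ler_nat.
  by rewrite (leq_trans hA)// leq_mul// leq_mul.
Qed.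

(** Parseval's identity on the details of level at least j; the geometric
    series is summed by telescoping. *)
Lemma dot_tail (s1 s2 M : R) : 0 < s1 -> 0 < s2 -> 0 < M ->
  exists T : R, 0 < T /\ forall f g, bm f -> bm g ->
  (forall l, (J0 <= l)%N -> forall i m,
     2 `^ (l%:R * (s1 + d%:R / 2)) * `|dot f (psi W l i m)| <= M) ->
  (forall l, (J0 <= l)%N -> forall i m,
     2 `^ (l%:R * (s2 + d%:R / 2)) * `|dot g (psi W l i m)| <= M) ->
  forall j, (J0 <= j)%N ->
  `|dot f g - dot f (wproj W j g)| <= T * 2 `^ (- (j%:R * (s1 + s2))).
Proof.
move=> s10 s20 M0; have [cc [CC [cc0 CC0 hcard]]] := cdv_card hW.
set s := s1 + s2; have s0 : 0 < s by exact: addr_gt0.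
pose q : R := 2 `^ (- s).
have q1 : 0 < 1 - q.
  rewrite subr_gt0 /q powRN invf_lt1 ?powR_gt0//.
  have := @gt0_ltr_powR R s s0 1 2; rewrite !nnegrE powR1; apply => //.
  by rewrite ltr1n.
pose K := #|{: orientation d}|%:R * (CC * M ^+ 2).
have K0 : 0 <= K by rewrite !mulr_ge0// ?sqr_ge0// ltW.
exists (K / (1 - q) + 1); split.
  by rewrite ltr_wpDl// divr_ge0// ltW.
move=> f g bf bg hf hg j hj.
pose p (l : nat) : R := 2 `^ (- (l%:R * s)).
have pS l : p l.+1 = p l * q.
  by rewrite /p /q pow2D; congr (_ `^ _); rewrite -natr1; ring.
have step l : (J0 <= l)%N ->
    `|\sum_i \sum_m dot f (psi W l i m) * dot g (psi W l i m)| <= K * p l.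
  move=> hl.
  have hm i m : `|dot f (psi W l i m) * dot g (psi W l i m)| <=
      M ^+ 2 * 2 `^ (- (l%:R * (s + d%:R))).
    have -> : 2 `^ (- (l%:R * (s + d%:R))) =
        2 `^ (- (l%:R * (s1 + d%:R / 2))) * 2 `^ (- (l%:R * (s2 + d%:R / 2))) :> R.
      by rewrite pow2D; congr (_ `^ _); rewrite /s; field.
    rewrite expr2 mulrACA normrM; apply: ler_pM => //.
      by rewrite powRN ler_pdivlMr ?powR_gt0// mulrC hf.
    by rewrite powRN ler_pdivlMr ?powR_gt0// mulrC hg.
  apply: (le_trans (ler_norm_sum _ _ _)).
  apply: (@le_trans _ _ (\sum_(i : orientation d) CC * M ^+ 2 * p l)); last first.
    by rewrite sumr_const -[leLHS]mulr_natl /K !mulrA.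
  apply: ler_sum => i _; apply: (le_trans (ler_norm_sum _ _ _)).
  apply: (le_trans (ler_sum _ (fun m _ => hm i m))).
  rewrite sumr_const -[leLHS]mulr_natl.
  have [_ c2] := andP (hcard l hl).
  apply: (@le_trans _ _ (CC * @resol R d l * (M ^+ 2 * 2 `^ (- (l%:R * (s + d%:R)))))).
    by rewrite ler_wpM2r// mulr_ge0 ?sqr_ge0 ?powR_ge0.
  have -> : p l = @resol R d l * 2 `^ (- (l%:R * (s + d%:R))).
    by rewrite resol_powR pow2D; congr (_ `^ _); ring.
  by rewrite le_eqVlt; apply/orP; left; apply/eqP; ring.
have partial L : (j <= L)%N ->
    `|dot f (wproj W L g) - dot f (wproj W j g)| <= K / (1 - q) * (p j - p L).
  elim: L => [|L IH]; first by rewrite leqn0 => /eqP ->; rewrite !subrr normr0 mulr0.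
  rewrite leq_eqVlt => /predU1P[->|]; first by rewrite !subrr normr0 mulr0.
  rewrite ltnS => jL; have hL := leq_trans hj jL.
  rewrite (dot_proj_step hW)// addrAC (le_trans (ler_normD _ _))//.
  apply: (le_trans (lerD (IH jL) (step L hL))).
  rewrite le_eqVlt; apply/orP; left; apply/eqP; rewrite pS; field.
  by rewrite gt_eqF.
have pj0 : 0 < p j by exact: powR_gt0.
rewrite -/(p j); apply/ler_addgt0Pr => e e0.
have [t t0 ht] : exists2 t : R, 0 < t & dot f f * t <= e ^+ 2.
  exists (e ^+ 2 / (dot f f + 1)).
    by rewrite divr_gt0 ?exprn_gt0// ltr_wpDl// dot_ge0.
  rewrite mulrCA ler_piMr ?sqr_ge0// ler_pdivrMr ?mul1r ?lerDl//.
  by rewrite ltr_wpDl// dot_ge0.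
have [j' hj' hd] := proj_dense hW bg t0.
pose L := maxn j j'; have jL : (j <= L)%N by exact: leq_maxl.
have hL := leq_trans hj jL; have bp := bm_proj hW g hL.
have -> : dot f g - dot f (wproj W j g) =
   (dot f g - dot f (wproj W L g)) + (dot f (wproj W L g) - dot f (wproj W j g)) by ring.
apply: (le_trans (ler_normD _ _)); rewrite addrC; apply: lerD.
  apply: (le_trans (partial L jL)); apply: (@le_trans _ _ (K / (1 - q) * p j)).
    by rewrite ler_wpM2l ?gerBl ?powR_ge0// divr_ge0// ltW.
  by rewrite mulrDl lerDl mul1r ltW.
have -> : dot f g - dot f (wproj W L g) = dot f (fun x => g x - wproj W L g x).
  by rewrite (dotC f (fun x => g x - wproj W L g x)) dotBl// (dotC g) (dotC (wproj W L g)).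
rewrite -ler_sqr ?nnegrE ?(ltW e0)// real_normK ?num_real//.
apply: (le_trans (Ex_CS _ bf (bmB bg bp))).
apply: (le_trans _ ht); rewrite -[X in _ <= X * _](eq_Ex _ (f := fun x => f x ^+ 2)); last first.
  by move=> x; rewrite expr2.
apply: ler_wpM2l; first by apply: Ex_ge0 => x; exact: sqr_ge0.
rewrite -[leLHS](eq_Ex _ (f := fun x => (g x - wproj W L g x) * (g x - wproj W L g x))); last first.
  by move=> x; rewrite expr2.
by apply/ltW/hd; exact: leq_maxr.
Qed.

End wavelet_bounds.

(** * Conditional expectations given the covariate *)

Lemma Ex_ext_sets d (T : measurableType d) (R : realType) (P Q : probability T R) :
  (forall A, measurable A -> P A = Q A) -> forall h, bm h -> Ex P h = Ex Q h.
Proof.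
move=> PQ h bh; apply: EFin_inj; rewrite -!ExE//.
by apply: eq_measure_integral => A mA _; exact: PQ.
Qed.

Lemma ae_eq_Ex d (T : measurableType d) (R : realType) (P : probability T R)
  (f g : T -> R) : bm f -> bm g -> {ae P, forall x, f x = g x} -> Ex P f = Ex P g.
Proof.
move=> bf bg fg; apply: EFin_inj; rewrite -!ExE//; apply: ae_eq_integral => //.
- by apply/measurable_EFinP; case: bf.
- by apply/measurable_EFinP; case: bg.
- by move: fg; apply: filterS => x /= ->.
Qed.

Section conditioning.
Context {d d' : measure_display} {T : measurableType d} {T' : measurableType d'}
  {R : realType}.
Variables (P : probability T R) (mu : probability T' R) (X : {mfun T >-> T'}).
Hypothesis PX : forall B, measurable B -> P (X @^-1` B) = mu B.

Lemma Ex_marginal (h : T' -> R) : bm h -> Ex P (fun w => h (X w)) = Ex mu h.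
Proof. by move=> bh; rewrite -Ex_distribution//; apply: Ex_ext_sets. Qed.

Lemma ae_marginal (Q : T' -> Prop) :
  {ae mu, forall x, Q x} -> {ae P, forall w, Q (X w)}.
Proof.
move=> [N [mN N0 QN]]; exists (X @^-1` N); split.
- by rewrite -[_ @^-1` _]setTI; exact: measurable_funPT.
- by rewrite PX.
- by move=> w /= nQ; exact: QN.
Qed.

Lemma marginal_integrable (g : T' -> R) : mu.-integrable setT (EFin \o g) ->
  P.-integrable setT (fun w => (g (X w))%:E).
Proof.
move=> /integrableP [mg ig]; have mXg := measurableT_comp mg (measurable_funPT X).
apply/integrableP; split => //.
have mag : measurable_fun setT (fun x => `|(EFin \o g) x|%E) by exact: measurableT_comp.
have := @ge0_integral_distribution _ _ _ _ _ P X _ mag (fun x => abse_ge0 _).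
move=> /= <-; move: ig; congr (_ < _)%E.
apply: eq_measure_integral => A mA _; exact: (esym (PX mA)).
Qed.

Lemma marginal_integral (g : T' -> R) B : mu.-integrable setT (EFin \o g) ->
  measurable B ->
  (\int[P]_(w in X @^-1` B) (g (X w))%:E = \int[mu]_(x in B) (g x)%:E)%E.
Proof.
move=> ig mB; have iXg := marginal_integrable ig.
have mX : measurable (X @^-1` B) by rewrite -[X in measurable X]setTI; exact: measurable_funPT.
have mg := measurable_int _ ig.
have i2 : P.-integrable (X @^-1` B) ((EFin \o g) \o X).
  exact: (integrableS measurableT).
rewrite -(@integral_pushforward _ _ _ _ R X (measurable_funPT X) P B (EFin \o g))//.
apply: eq_measure_integral => A mA _; exact: (PX mA).
Qed.

(** Conditional expectations exist: after shifting and scaling, Z is the density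
    of a probability whose image under X has a density with respect to mu. *)
Lemma conditional_version (Z : T -> R) : bm Z -> exists g : T' -> R,
  [/\ measurable_fun setT g, mu.-integrable setT (EFin \o g) &
  forall B, measurable B ->
    (\int[P]_(w in X @^-1` B) (Z w)%:E = \int[mu]_(x in B) (g x)%:E)%E].
Proof.
move=> bZ; have [C [C0 hC]] := bm_ub bZ.
pose c := Ex P (fun w => Z w + (C + 1)).
have bZC : bm (fun w => Z w + (C + 1)) by apply: bmD => //; exact: bm_cst.
have c0 : 0 < c.
  apply: (@lt_le_trans _ _ 1) => //; rewrite -[leLHS](Ex_cst P 1).
  apply: Ex_le => //; first exact: bm_cst.
  by move=> w; rewrite addrA lerDr -lerBlDr sub0r; have := hC w; rewrite ler_norml => /andP[].
pose f w := c^-1 * (Z w + (C + 1)).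
have bf : bm f by apply: bmM => //; exact: bm_cst.
have f0 w : 0 <= f w.
  rewrite mulr_ge0 ?invr_ge0 ?(ltW c0)// addrA addr_ge0// -lerBlDr sub0r.
  by have := hC w; rewrite ler_norml => /andP[].
have f1 : Ex P f = 1 by rewrite ExZ// mulVf// gt_eqF.
have [Q hQ] := exists_density bf f0 f1.
pose nu : probability T' R := distribution Q X.
have nuE A : measurable A -> nu A = (Ex P (fun w => f w * \1_A (X w)))%:E.
  move=> mA; rewrite -Ex_indic// Ex_distribution; last exact: bm_indic.
  rewrite hQ//; apply: (bm_comp (bm_indic mA)); exact: measurable_funPT.
have bA A : measurable A -> bm (fun w => \1_A (X w) : R).
  by move=> mA; apply: (bm_comp (bm_indic mA)); exact: measurable_funPT.
have numu : nu `<< mu.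
  apply/null_content_dominatesP => A mA muA.
  have [D [D0 hD]] := bm_ub bf.
  apply/eqP; rewrite eq_le measure_ge0 andbT nuE// lee_fin.
  apply: (@le_trans _ _ (Ex P (fun w => D * \1_A (X w)))).
    apply: Ex_le.
    - by apply: bmM => //; exact: (bA _ mA).
    - by apply: bmM; [exact: bm_cst|exact: (bA _ mA)].
    move=> w; rewrite ler_wpM2r ?indicE ?ler0n//.
    exact: le_trans (ler_norm _) (hD w).
  rewrite ExZ; last exact: (bA _ mA).
  rewrite Ex_marginal; last exact: bm_indic.
  suff -> : Ex mu (\1_A : T' -> R) = 0 by rewrite mulr0.
  by apply: EFin_inj; rewrite Ex_indic.
pose g0 := Radon_Nikodym (charge_of_finite_measure nu) mu.
have g0fin x : g0 x \is a fin_num by exact: Radon_Nikodym_fin_num.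
have ig0 : mu.-integrable setT g0 by exact: Radon_Nikodym_integrable.
have Eg0 : EFin \o (fine \o g0) = g0 by apply/funext => x /=; rewrite fineK.
pose g x := c * fine (g0 x) - (C + 1).
have igc : mu.-integrable setT (fun x => (c * fine (g0 x))%:E).
  rewrite (_ : (fun x => (c * fine (g0 x))%:E) = (fun x => (c%:E * g0 x)%E)).
    exact: integrableZl.
  by apply/funext => x; rewrite EFinM (fineK (g0fin x)).
have icst : mu.-integrable setT (EFin \o (fun=> C + 1)).
  by apply: bm_integrable; exact: bm_cst.
have ig : mu.-integrable setT (EFin \o g).
  rewrite (_ : EFin \o g = (fun x => ((c * fine (g0 x))%:E - (C + 1)%:E)%E)).
    exact: integrableB.
  by apply/funext => x; rewrite /g /= EFinB.
exists g; split => //.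
  by apply/measurable_EFinP; exact: measurable_int ig.
move=> B mB.
have mXB : measurable (X @^-1` B) by rewrite -[X in measurable X]setTI; exact: measurable_funPT.
have -> : (\int[P]_(w in X @^-1` B) (Z w)%:E)%E =
    (Ex P (fun w => \1_B (X w) * Z w))%:E.
  rewrite -ExE; last by apply: bmM => //; exact: (bA _ mB).
  rewrite integral_mkcond; apply: eq_integral => w _.
  rewrite patchE indicE /=.
  have [h|h] := boolP (w \in X @^-1` B).
    by move: h; rewrite inE/= => h; rewrite mem_set// mul1r.
  by move: h; rewrite notin_setE/= => h; rewrite memNset// mul0r.
have -> : (\int[mu]_(x in B) (g x)%:E)%E =
    ((\int[mu]_(x in B) (c * fine (g0 x))%:E) - (\int[mu]_(x in B) (C + 1)%:E))%E.
  rewrite -integralB//.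
  - by apply: (integrableS measurableT).
  - by apply: (integrableS measurableT).
rewrite (_ : \int[mu]_(x in B) (c * fine (g0 x))%:E = c%:E * nu B)%E; last first.
  under eq_integral => x _ do rewrite EFinM (fineK (g0fin x)).
  rewrite integralZl//; last exact: (integrableS measurableT).
  by congr (_ * _)%E; rewrite -Radon_Nikodym_integral.
rewrite nuE// integral_cst//; have /= <- := Ex_indic mu mB.
rewrite -EFinM -EFinM -EFinB; congr EFin.
rewrite -(Ex_marginal (bm_indic mB)) -ExZ; last by apply: bmM => //; exact: (bA _ mB).
rewrite -ExZ; last exact: (bA _ mB).
rewrite -ExB; [|by apply: bmM; [exact: bm_cst|apply: bmM => //; exact: (bA _ mB)]
  |by apply: bmM; [exact: bm_cst|exact: (bA _ mB)]].
apply: eq_Ex => w; rewrite /f; field; exact: lt0r_neq0.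
Qed.

(** Two finite measures with the same values on sets integrate bounded functions in
    the same way; shifting [Z] and [p] reduces signed densities to this case. *)
Lemma conditional_extend (Z : T -> R) (p : T' -> R) : bm Z -> bm p ->
  (forall B, measurable B ->
    Ex P (fun w => \1_B (X w) * Z w) = Ex mu (fun x => \1_B x * p x)) ->
  forall h, bm h -> Ex P (fun w => Z w * h (X w)) = Ex mu (fun x => p x * h x).
Proof.
move=> bZ bp hB h bh.
have [C [C0 hC]] := bm_ub bZ; have [D [D0 hD]] := bm_ub bp.
pose s := C + D + 1; have s0 : 0 < s by rewrite ltr_wpDl// addr_ge0 ?ltW.
have bZs : bm (fun w => Z w + s) by apply: bmD => //; exact: bm_cst.
have bps : bm (fun w => p w + s) by apply: bmD => //; exact: bm_cst.
pose c := Ex P (fun w => Z w + s).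
have hc : c = Ex mu (fun x => p x + s).
  rewrite /c !ExD ?Ex_cst//; try exact: bm_cst.
  congr (_ + _); transitivity (Ex P (fun w => \1_setT (X w) * Z w)).
    by apply: eq_Ex => w; rewrite indicT mul1r.
  by rewrite hB//; apply: eq_Ex => w; rewrite indicT mul1r.
have Z1 w : 1 <= Z w + s.
  by rewrite /s; have := hC w; rewrite ler_norml => /andP[? _]; lra.
have p1 x : 1 <= p x + s.
  by rewrite /s; have := hD x; rewrite ler_norml => /andP[? _]; lra.
have c0 : 0 < c.
  apply: (@lt_le_trans _ _ 1) => //; rewrite -[leLHS](Ex_cst P 1).
  by apply: Ex_le => //; exact: bm_cst.
have ci0 : 0 <= c^-1 by rewrite invr_ge0 ltW.
have bfZ : bm (fun w => c^-1 * (Z w + s)) by apply: bmM => //; exact: bm_cst.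
have bfp : bm (fun w => c^-1 * (p w + s)) by apply: bmM => //; exact: bm_cst.
have [Q1 h1] : exists Q : probability T R, forall h, bm h -> Ex Q h =
    Ex P (fun x => c^-1 * (Z x + s) * h x).
  apply: exists_density => //; first by move=> w; rewrite mulr_ge0// (le_trans _ (Z1 w)).
  by rewrite ExZ// mulVf// gt_eqF.
have [Q2 h2] : exists Q : probability T' R, forall h, bm h -> Ex Q h =
    Ex mu (fun x => c^-1 * (p x + s) * h x).
  apply: exists_density => //; first by move=> w; rewrite mulr_ge0// (le_trans _ (p1 w)).
  by rewrite ExZ// -hc mulVf// gt_eqF.
have bhX k : bm k -> bm (fun w => k (X w) : R).
  by move=> bk; apply: (bm_comp bk); exact: measurable_funPT.
have E12 k : bm k -> Ex P (fun x => c^-1 * (Z x + s) * k (X x)) =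
    Ex mu (fun x => c^-1 * (p x + s) * k x).
  move=> bk; rewrite -h1; last exact: bhX.
  rewrite -h2// -Ex_distribution//; apply: Ex_ext_sets => // A mA.
  rewrite -Ex_indic// -[RHS]Ex_indic//; congr EFin; have b1 := bm_indic (R := R) mA.
  rewrite Ex_distribution// h1; last exact: bhX.
  rewrite h2//.
  have b2 : bm (fun x => \1_A (X x) * Z x) by apply: bmM => //; exact: bhX.
  have b3 := bhX _ b1.
  have b4 : bm (fun x => \1_A x * p x) by exact: bmM.
  transitivity (c^-1 * (Ex P (fun x => \1_A (X x) * Z x) + s * Ex P (fun x => \1_A (X x)))).
    rewrite -ExZ// -ExD//; last by apply: bmM => //; exact: bm_cst.
    rewrite -ExZ; last by apply: bmD => //; apply: bmM => //; exact: bm_cst.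
    by apply: eq_Ex => w; ring.
  rewrite hB// Ex_marginal// -ExZ// -ExD//; last by apply: bmM => //; exact: bm_cst.
  rewrite -ExZ; last by apply: bmD => //; apply: bmM => //; exact: bm_cst.
  by apply: eq_Ex => w; ring.
have := E12 h bh.
have bhh := bhX _ bh.
have -> : Ex P (fun x => c^-1 * (Z x + s) * h (X x)) =
    c^-1 * (Ex P (fun x => Z x * h (X x)) + s * Ex P (fun x => h (X x))).
  rewrite -ExZ// -ExD//; [|exact: bmM|by apply: bmM => //; exact: bm_cst].
  rewrite -ExZ; last by apply: bmD; apply: bmM => //; exact: bm_cst.
  by apply: eq_Ex => w; ring.
have -> : Ex mu (fun x => c^-1 * (p x + s) * h x) =
    c^-1 * (Ex mu (fun x => p x * h x) + s * Ex mu h).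
  rewrite -ExZ// -ExD//; [|exact: bmM|by apply: bmM => //; exact: bm_cst].
  rewrite -ExZ; last by apply: bmD; apply: bmM => //; exact: bm_cst.
  by apply: eq_Ex => w; ring.
rewrite Ex_marginal// => /mulfI E; apply: (addIr (s * Ex mu h)); apply: E.
by rewrite invr_eq0 gt_eqF.
Qed.

End conditioning.

(** * Laws of the model *)

Section holder.
Context {R : realType} {d J0 S : nat} (W : wavelets R d).
Hypothesis hW : cdv_basis W J0 S.

Lemma ip_cutoff (h f : d.-tuple R -> R) : ucont_cube h -> bm f -> ip h f = dot (cutoff h) f.
Proof.
move=> uh bf; rewrite /dot -ipE//; last exact: bm_ucont.
by apply: eq_ip => x cx //; rewrite cutoff_in.
Qed.

(** Splitting the bound [M] between the coarse coefficients, which receive [B], and the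
    details turns the supremum in the extended reals into two pointwise bounds. *)
Lemma holder_ballP (a M : R) (h : d.-tuple R -> R) : holder_ball W J0 a M h <->
  ucont_cube h /\ exists B, [/\ 0 <= B,
    forall m, 2 `^ (J0%:R * (a + d%:R / 2)) * `|dot (cutoff h) (phi W J0 m)| <= B &
    forall l, (J0 <= l)%N -> forall i m,
      2 `^ (l%:R * (a + d%:R / 2)) * `|dot (cutoff h) (psi W l i m)| <= M - B].
Proof.
set t := 2 `^ (J0%:R * (a + d%:R / 2)); have t0 : 0 < t by exact: powR_gt0.
split=> [[uh hM]|[uh [B [B0 hB hM]]]]; split => //.
  set mx := \big[Num.max/0]_(m : idx W J0) `|ip h (phi W J0 m)| in hM.
  have mx0 : 0 <= mx by exact: bigmax_ge_id.
  exists (t * mx); split => [|m|l hl i m]; first by rewrite mulr_ge0// ltW.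
    rewrite -ip_cutoff//; last exact: (bm_phi hW).
    by rewrite ler_pM2l//; exact: (le_bigmax _ (fun m => `|ip h (phi W J0 m)|)).
  rewrite -lee_fin EFinB leeBrDl//; apply: le_trans hM; rewrite leeD2l//.
  apply: ereal_sup_ubound => /=; exists l, i, m; split => //.
  by rewrite ip_cutoff//; exact: (bm_psi hW).
apply: (@le_trans _ _ (B%:E + (M - B)%:E)%E); last by rewrite -EFinD addrC subrK.
apply: leeD.
  rewrite lee_fin mulrC -ler_pdivlMr//; apply: bigmax_le; first by rewrite divr_ge0// ltW.
  move=> m _; rewrite ler_pdivlMr// mulrC ip_cutoff//; exact: (bm_phi hW).
apply: ge_ereal_sup => _ [l [i [m [hl ->]]]]; rewrite lee_fin ip_cutoff//.
  exact: hM.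
exact: (bm_psi hW).
Qed.

End holder.

Section observation.
Context {R : realType} {d : nat}.

Lemma measurable_obsX : measurable_fun setT (@obsX R d).
Proof. exact: measurableT_comp. Qed.

HB.instance Definition _ := isMeasurableFun.Build _ _ _ _ (@obsX R d) measurable_obsX.

Lemma measurable_obsA : measurable_fun setT (@obsA R d).
Proof. exact: measurableT_comp. Qed.

Lemma measurable_obsY : measurable_fun setT (@obsY R d).
Proof. exact: measurable_snd. Qed.

Variables C1 C2 : R.

(** The observations lie in [C1, C2] only almost surely; clamping makes them bounded
    everywhere without changing any expectation. *)
Definition clamp (a : R) := Num.max C1 (Num.min a C2).

Definition clA (w : obs R d) := clamp (obsA w).
Definition clY (w : obs R d) := clamp (obsY w).
Definition kap (w : obs R d) : obs R d := (obsX w, clA w, clY w).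

Definition clbound : R := `|C1| + `|C2|.

Lemma clamp_id a : C1 <= a <= C2 -> clamp a = a.
Proof.
by case/andP => h1 h2; rewrite /clamp (min_idPl h2) (max_idPr h1).
Qed.

Lemma clamp_le a : `|clamp a| <= clbound.
Proof.
rewrite /clamp /clbound; have := ler_norm C1; have := ler_norm C2.
have := ler_norm (- C1); have := ler_norm (- C2); rewrite !normrN.
have := normr_ge0 C1; have := normr_ge0 C2.
by rewrite ler_norml => *; apply/andP; case: (leP a C2) => h; case: (leP C1 _) => h'; split; lra.
Qed.

Lemma measurable_clamp : measurable_fun setT clamp.
Proof.
apply: measurable_maxr; first exact: measurable_cst.
apply: measurable_minr; [exact: measurable_id|exact: measurable_cst].
Qed.

Lemma bm_clA : bm clA.
Proof.
split; first exact: measurableT_comp measurable_clamp measurable_obsA.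
by exists clbound => w; exact: clamp_le.
Qed.

Lemma bm_clY : bm clY.
Proof.
split; first exact: measurableT_comp measurable_clamp measurable_obsY.
by exists clbound => w; exact: clamp_le.
Qed.

Lemma measurable_kap : measurable_fun setT kap.
Proof.
apply: measurable_fun_pair; last exact: bm_meas bm_clY.
by apply: measurable_fun_pair; [exact: measurable_obsX|exact: bm_meas bm_clA].
Qed.

Lemma bm_obsX (h : d.-tuple R -> R) : bm h -> bm (fun w : obs R d => h (obsX w)).
Proof. by move=> bh; apply: (bm_comp bh); exact: measurable_obsX. Qed.

(** What the analysis of the estimators uses about a law of the model. *)
Record law_spec (P : probability (obs R d) R) (p b : d.-tuple R -> R) : Prop := LawSpec {
  ls_p : bm p;
  ls_b : bm b;
  ls_clamp : forall h, bm h -> Ex P h = Ex P (fun w => h (kap w));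
  ls_X : forall h, bm h -> Ex P (fun w => h (obsX w)) = Ex (unif d) h;
  ls_A : forall h, bm h -> Ex P (fun w => clA w * h (obsX w)) = dot p h;
  ls_Y : forall h, bm h -> Ex P (fun w => clY w * h (obsX w)) = dot b h;
  ls_psi : psi_fun P = Ex P (fun w => clA w * clY w) - dot p b }.

Section law.
Variable P : probability (obs R d) R.
Hypothesis PX : forall B, measurable B -> P (obsX @^-1` B) = unif d B.
Hypothesis PC : {ae P, forall w, C1 <= obsA w <= C2 /\ C1 <= obsY w <= C2}.

Lemma is_cond_expE (Z Z' : obs R d -> R) (g : d.-tuple R -> R) :
  measurable_fun setT Z -> measurable_fun setT Z' ->
  {ae P, forall w, Z w = Z' w} -> is_cond_exp P Z g -> is_cond_exp P Z' g.
Proof.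
move=> mZ mZ' ZZ [mg ig hg]; split => // B mB; rewrite -hg//.
have mXB : measurable (obsX @^-1` B).
  by rewrite -[X in measurable X]setTI; exact: measurable_obsX.
apply: ae_eq_integral => //.
- by apply/measurable_EFinP; exact: measurable_funTS.
- by apply/measurable_EFinP; exact: measurable_funTS.
- by move: ZZ; apply: filterS => x /= ->.
Qed.

Lemma cond_expP (Z Z' : obs R d -> R) : measurable_fun setT Z -> bm Z' ->
  {ae P, forall w, Z w = Z' w} -> is_cond_exp P Z (cond_exp P Z).
Proof.
move=> mZ bZ' ZZ; apply: xgetPex.
have [g [mg ig hg]] := conditional_version (X := @obsX R d) PX bZ'.
exists g; apply: (@is_cond_expE Z' Z) => //; first by case: bZ'.
  by move: ZZ; apply: filterS => x /= ->.
split => //; first exact: (marginal_integrable (X := @obsX R d) PX).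
move=> B mB; rewrite hg//; apply/esym.
exact: (marginal_integral (X := @obsX R d) PX).
Qed.

Lemma ae_clA : {ae P, forall w, obsA w = clA w}.
Proof. by move: PC; apply: filterS => w [h _]; rewrite /clA clamp_id. Qed.

Lemma ae_clY : {ae P, forall w, obsY w = clY w}.
Proof. by move: PC; apply: filterS => w [_ h]; rewrite /clY clamp_id. Qed.

Lemma ae_kap : {ae P, forall w, kap w = w}.
Proof.
move: PC; apply: filterS => w [h1 h2]; rewrite /kap /clA /clY !clamp_id//.
by case: w h1 h2 => [[x a] y].
Qed.

(** Testing on indicators of sets suffices, by [conditional_extend]. *)
Lemma cond_exp_test (Z Z' : obs R d -> R) (g : d.-tuple R -> R) :
  measurable_fun setT Z -> bm Z' -> {ae P, forall w, Z w = Z' w} -> bm g ->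
  {ae unif d, forall x, cond_exp P Z x = g x} ->
  forall h, bm h -> Ex P (fun w => Z' w * h (obsX w)) = dot g h.
Proof.
move=> mZ bZ' ZZ bg Zg; apply: (conditional_extend (X := @obsX R d) PX) => // B mB.
have [mc ic hc] := cond_expP mZ bZ' ZZ.
have b1 := bm_indic (R := R) mB; have b1X := bm_obsX b1.
have mXB : measurable (obsX @^-1` B : set (obs R d)).
  by rewrite -[X in measurable X]setTI; exact: measurable_obsX.
have gP : {ae P, forall w, cond_exp P Z (obsX w) = g (obsX w)}.
  exact: (ae_marginal (X := @obsX R d) PX Zg).
rewrite -(Ex_marginal (X := @obsX R d) PX); last exact: bmM.
have bgX := bm_obsX bg.
apply: EFin_inj; rewrite -!ExE; [|exact: bmM..].
have res (f : obs R d -> R) : (\int[P]_w (\1_B (obsX w) * f w)%:E =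
    \int[P]_(w in obsX @^-1` B) (f w)%:E)%E.
  rewrite [RHS]integral_mkcond; apply: eq_integral => w _.
  rewrite patchE indicE /=.
  have [h|h] := boolP (w \in obsX @^-1` B).
    by move: h; rewrite inE/= => h; rewrite mem_set// mul1r.
  by move: h; rewrite notin_setE/= => h; rewrite memNset// mul0r.
rewrite !res; transitivity (\int[P]_(w in obsX @^-1` B) (Z w)%:E)%E.
  apply: ae_eq_integral => //.
  - by apply/measurable_EFinP; apply: measurable_funTS; case: bZ'.
  - by apply/measurable_EFinP; apply: measurable_funTS.
  - by move: ZZ; apply: filterS => x /= ->.
rewrite hc//; apply: ae_eq_integral => //.
- by apply: measurable_funTS; exact: measurable_int ic.
- by apply/measurable_EFinP; apply: measurable_funTS; case: bgX.
- by move: gP; apply: filterS => x /= ->.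
Qed.

(** The covariance functional is E(AY) - <p, b>, by the tower property. *)
Lemma law_specP (p b : d.-tuple R -> R) : bm p -> bm b ->
  {ae unif d, forall x, cond_exp P obsA x = p x} ->
  {ae unif d, forall x, cond_exp P obsY x = b x} -> law_spec P p b.
Proof.
move=> bp bb hp hb.
have bA := bm_clA; have bY := bm_clY.
have hA := cond_exp_test measurable_obsA bA ae_clA bp hp.
have hY := cond_exp_test measurable_obsY bY ae_clY bb hb.
have hX h : bm h -> Ex P (fun w => h (obsX w)) = Ex (unif d) h.
  exact: (Ex_marginal (X := @obsX R d) PX).
split => //.
  move=> h bh; apply: ae_eq_Ex => //; first exact: (bm_comp bh measurable_kap).
  by move: ae_kap; apply: filterS => w ->.
have bpX := bm_obsX bp; have bbX := bm_obsX bb.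
pose Z' w := (clA w - p (obsX w)) * (clY w - b (obsX w)).
have bZ' : bm Z' by apply: bmM; exact: bmB.
have [mcA _ _] := cond_expP measurable_obsA bA ae_clA.
have [mcY _ _] := cond_expP measurable_obsY bY ae_clY.
have mZ : measurable_fun setT (fun w => (obsA w - cond_exp P obsA (obsX w)) *
                       (obsY w - cond_exp P obsY (obsX w))).
  apply: measurable_funM; apply: measurable_funB.
  - exact: measurable_obsA.
  - exact: measurableT_comp mcA measurable_obsX.
  - exact: measurable_obsY.
  - exact: measurableT_comp mcY measurable_obsX.
have aZ : {ae P, forall w, (obsA w - cond_exp P obsA (obsX w)) *
                       (obsY w - cond_exp P obsY (obsX w)) = Z' w}.
  have hpX := ae_marginal (X := @obsX R d) PX hp.
  have hbX := ae_marginal (X := @obsX R d) PX hb.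
  have hAY : {ae P, forall w, obsA w = clA w /\ obsY w = clY w}.
    by move: ae_clA ae_clY; apply: filterS2 => w h1 h2; split.
  move: hAY hpX hbX; apply: filterS3.
  by move=> w [hA1 hY1] hp1 hb1; rewrite /Z' -hA1 -hY1 -hp1 -hb1.
have [mc ic hc] := cond_expP mZ bZ' aZ.
have -> : psi_fun P = Ex P Z'.
  rewrite /psi_fun /Ex /Rintegral; congr fine.
  have := hc setT measurableT; rewrite preimage_setT => <-.
  apply: ae_eq_integral => //.
  - by apply/measurable_EFinP.
  - by apply/measurable_EFinP; case: bZ'.
  - by move: aZ; apply: filterS => x /= ->.
have E1 : Ex P (fun w => clA w * b (obsX w)) = dot p b by exact: hA.
have E2 : Ex P (fun w => clY w * p (obsX w)) = dot p b by rewrite hY// dotC.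
have E3 : Ex P (fun w => p (obsX w) * b (obsX w)) = dot p b.
  by rewrite (hX (fun x => p x * b x))//; exact: bmM.
rewrite (_ : _ - _ = Ex P (fun w => clA w * clY w) - dot p b - dot p b + dot p b); last by ring.
rewrite -[in LHS]/Z' -{1}E1 -{1}E2 -{1}E3.
rewrite -ExB; [|exact: bmM..].
rewrite -ExB; [|by apply: bmB; exact: bmM|exact: bmM].
rewrite -ExD; [|by apply: bmB; [apply: bmB|]; exact: bmM|exact: bmM].
by apply: eq_Ex => w; rewrite /Z'; ring.
Qed.

(** Conversely, integrals determine the conditional expectation almost everywhere. *)
Lemma cond_exp_unique (Z Z' : obs R d -> R) (g : d.-tuple R -> R) :
  measurable_fun setT Z -> bm Z' -> {ae P, forall w, Z w = Z' w} -> bm g ->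
  (forall h, bm h -> Ex P (fun w => Z' w * h (obsX w)) = dot g h) ->
  {ae unif d, forall x, cond_exp P Z x = g x}.
Proof.
move=> mZ bZ' ZZ bg hg.
have [mc ic hc] := cond_expP mZ bZ' ZZ.
have mgX := bm_meas (bm_obsX bg).
have icu : (unif d).-integrable setT (EFin \o cond_exp P Z).
  apply/integrableP; split; first exact/measurable_EFinP.
  have mag : measurable_fun setT (fun x => `|(EFin \o cond_exp P Z) x|%E).
    by apply: measurableT_comp => //; exact/measurable_EFinP.
  move/integrableP: ic => [_].
  have := @ge0_integral_distribution _ _ _ _ _ P (@obsX R d) _ mag (fun x => abse_ge0 _).
  move=> /= <-; congr (_ < _)%E.
  apply: eq_measure_integral => A mA _; exact: (PX mA).
have : ae_eq (unif d) setT (EFin \o cond_exp P Z) (EFin \o g).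
  apply: integral_ae_eq => //; first by apply/measurable_EFinP; case: bg.
  move=> E _ mE; rewrite -(marginal_integral (X := @obsX R d) PX icu mE) -hc//.
  have b1 := bm_indic (R := R) mE.
  have mXB : measurable (obsX @^-1` E : set (obs R d)).
    by rewrite -[X in measurable X]setTI; exact: measurable_obsX.
  transitivity ((Ex P (fun w => Z' w * \1_E (obsX w)))%:E).
    rewrite -ExE; last by apply: bmM => //; exact: bm_obsX.
    rewrite integral_mkcond; apply: ae_eq_integral => //.
    - have /(_ (obsX @^-1` E)) := @measurable_restrictT _ _ _ _ _ (EFin \o Z).
      by move=> h; apply/h => //; apply: measurable_funTS; exact/measurable_EFinP.
    - by apply/measurable_EFinP; case: (bmM bZ' (bm_obsX b1)).
    - move: ZZ; apply: filterS => w hw _; rewrite patchE indicE /=.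
      have [h|h] := boolP (w \in obsX @^-1` E).
        by move: h; rewrite inE/= => h; rewrite mem_set// mulr1 hw.
      by move: h; rewrite notin_setE/= => h; rewrite memNset// mulr0.
  rewrite hg// -ExE; last exact: bmM.
  rewrite [RHS]integral_mkcond; apply: eq_integral => x _; rewrite patchE indicE.
  by case: (_ \in _); rewrite ?mulr1 ?mulr0.
by apply: filterS => x /(_ I)[].
Qed.

End law.

Section model_spec.
Variables (J0 S : nat) (W : wavelets R d) (alpha beta M : R).
Hypothesis hW : cdv_basis W J0 S.

Definition coef_bound (s : R) (f : d.-tuple R -> R) :=
  forall l, (J0 <= l)%N -> forall i m,
     2 `^ (l%:R * (s + d%:R / 2)) * `|dot f (psi W l i m)| <= M.

Lemma ae_cutoff (f : d.-tuple R -> R) : {ae unif d, forall x, f x = cutoff f x}.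
Proof.
exists (~` cube d); split.
- by apply: measurableC; exact: measurable_cube.
- by rewrite probability_setC ?unif_cube ?subee//; exact: measurable_cube.
- move=> x /= h cx; apply: h; by rewrite cutoff_in.
Qed.

Lemma model_spec P : model W J0 C1 C2 alpha beta M P -> exists p b,
  [/\ law_spec P p b, coef_bound alpha p & coef_bound beta b].
Proof.
move=> [PX PC [p hp Ap] [b hb Ab]].
have [up [Bp [Bp0 _ hpc]]] := (holder_ballP hW _ _ _).1 hp.
have [ub [Bb [Bb0 _ hbc]]] := (holder_ballP hW _ _ _).1 hb.
exists (cutoff p), (cutoff b); split.
- apply: law_specP => //; [exact: bm_ucont|exact: bm_ucont| |].
  + by move: Ap (ae_cutoff p); apply: filterS2 => x -> ->.
  + by move: Ab (ae_cutoff b); apply: filterS2 => x -> ->.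
- by move=> l hl i m; apply: (le_trans (hpc l hl i m)); rewrite gerBl.
- by move=> l hl i m; apply: (le_trans (hbc l hl i m)); rewrite gerBl.
Qed.

(** To place a law in the class it suffices to know its moments against functions
    of the covariate. *)
Lemma spec_model (P : probability (obs R d) R) p b :
  (forall B, measurable B -> P (obsX @^-1` B) = unif d B) ->
  {ae P, forall w, C1 <= obsA w <= C2 /\ C1 <= obsY w <= C2} ->
  holder_ball W J0 alpha M p -> holder_ball W J0 beta M b ->
  (forall h, bm h -> Ex P (fun w => clA w * h (obsX w)) = dot (cutoff p) h) ->
  (forall h, bm h -> Ex P (fun w => clY w * h (obsX w)) = dot (cutoff b) h) ->
  model W J0 C1 C2 alpha beta M P /\ law_spec P (cutoff p) (cutoff b).
Proof.
move=> PX PC hp hb hA hY.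
have bp := bm_ucont hp.1; have bb := bm_ucont hb.1.
have Ap := cond_exp_unique PX measurable_obsA bm_clA (ae_clA PC) bp hA.
have Ab := cond_exp_unique PX measurable_obsY bm_clY (ae_clY PC) bb hY.
split; last exact: law_specP.
split => //.
- by exists p => //; move: Ap (ae_cutoff p); apply: filterS2 => x -> ->.
- by exists b => //; move: Ab (ae_cutoff b); apply: filterS2 => x -> ->.
Qed.

End model_spec.

End observation.

(** * Samples from a law of the model *)

Section data.
Context {R : realType} {d : nat}.
Implicit Type P : probability (obs R d) R.

Lemma Ex_data P n (F : data R d n -> R) : bm F ->
  Ex (data_law P n) F = Ex (iid P n) (fun D1 => Ex (iid P n) (fun D2 =>
    Ex (iid P n) (fun D3 => F (D1, D2, D3)))).
Proof.
move=> bF; rewrite /data_law Ex_prod// Ex_prod//.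
exact: (bm_Ex_snd (iid P n \x iid P n)%E (iid P n) bF).
Qed.

Definition kap3 C1 C2 n (D : data R d n) : data R d n :=
  (map_tuple (kap C1 C2) D.1.1, map_tuple (kap C1 C2) D.1.2,
   map_tuple (kap C1 C2) D.2).

Lemma measurable_kap3 C1 C2 n : measurable_fun setT (@kap3 C1 C2 n).
Proof.
have mk : measurable_fun setT (fun D : n.-tuple (obs R d) => map_tuple (kap C1 C2) D).
  by apply: measurable_map_tuple; exact: measurable_kap.
have mD1 : measurable_fun setT (fun D : data R d n => D.1.1) by exact: measurableT_comp.
have mD2 : measurable_fun setT (fun D : data R d n => D.1.2) by exact: measurableT_comp.
have mD3 : measurable_fun setT (fun D : data R d n => D.2) by exact: measurable_snd.
apply: measurable_fun_pair; last exact: (measurableT_comp mk mD3).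
by apply: measurable_fun_pair; [exact: (measurableT_comp mk mD1)|exact: (measurableT_comp mk mD2)].
Qed.

Section clamped.
Variables (C1 C2 : R) (P : probability (obs R d) R) (p b : d.-tuple R -> R).
Hypothesis hP : law_spec C1 C2 P p b.

Lemma Ex_iid_clamp n (F : n.-tuple (obs R d) -> R) : bm F ->
  Ex (iid P n) F = Ex (iid P n) (fun D => F (map_tuple (kap C1 C2) D)).
Proof.
move=> bF; rewrite (@Ex_iid_change _ _ _ _ _ P P (kap C1 C2) (fun=> 1))//.
- by apply: eq_Ex => D; rewrite big1_eq mul1r.
- exact: measurable_kap.
- exact: bm_cst.
- by move=> h bh; rewrite (ls_clamp hP)//; apply: eq_Ex => w; rewrite mul1r.
Qed.

Lemma Ex_data_clamp n (F : data R d n -> R) : bm F ->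
  Ex (data_law P n) F = Ex (data_law P n) (fun D => F (kap3 C1 C2 D)).
Proof.
move=> bF; have bFk := bm_comp bF (@measurable_kap3 C1 C2 n).
have mk : measurable_fun setT (fun D : n.-tuple (obs R d) => map_tuple (kap C1 C2) D).
  by apply: measurable_map_tuple; exact: measurable_kap.
have bF1 D1 D2 : bm (fun D3 => F (D1, D2, D3)) by exact: (bm_pair1 (D1, D2) bF).
have bF2 D1 : bm (fun D2 => Ex (iid P n) (fun D3 => F (D1, D2, D3))).
  exact: (bm_pair1 D1 (bm_Ex_snd (iid P n \x iid P n)%E (iid P n) bF)).
have bF3 : bm (fun D1 => Ex (iid P n) (fun D2 => Ex (iid P n) (fun D3 => F (D1, D2, D3)))).
  exact: (bm_Ex_snd (iid P n) (iid P n) (bm_Ex_snd (iid P n \x iid P n)%E (iid P n) bF)).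
rewrite (Ex_data P bF) (Ex_data P bFk) (Ex_iid_clamp bF3); apply: eq_Ex => D1.
rewrite (Ex_iid_clamp (bF2 _)); apply: eq_Ex => D2.
exact: (Ex_iid_clamp (bF1 _ _)).
Qed.

(** The loss is unbounded only on a null set. *)
Lemma mse_clamp n (T : data R d n -> R) (c : R) : measurable_fun setT T ->
  bm (fun D => T (kap3 C1 C2 D)) ->
  (\int[data_law P n]_D ((T D - c) ^+ 2)%:E)%E =
  (Ex (data_law P n) (fun D => (T (kap3 C1 C2 D) - c) ^+ 2))%:E.
Proof.
move=> mT bTk; set L := fun D => (T D - c) ^+ 2.
have mL : measurable_fun setT L.
  apply: measurable_funX; apply: measurable_funB => //; exact: measurable_cst.
have bLk : bm (fun D => L (kap3 C1 C2 D)) by apply: bmX; apply: bmB => //; exact: bm_cst.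
have L0 D : 0 <= L D by exact: sqr_ge0.
have bmin (K : R) : 0 <= K -> bm (fun D => Num.min (L D) K).
  move=> K0; split; first by apply: measurable_minr => //; exact: measurable_cst.
  by exists K => D; rewrite ger0_norm ?ge_min ?lexx ?orbT// le_min L0.
apply/eqP; rewrite eq_le; apply/andP; split.
  apply: integral_le_trunc => // K; rewrite Ex_data_clamp; last exact: bmin.
  apply: Ex_le => //; first exact: (bm_comp (bmin _ (ler0n _ K)) (@measurable_kap3 C1 C2 n)).
  by move=> D; rewrite ge_min lexx.
have [K [K0 hK]] := bm_ub bLk.
have -> : Ex (data_law P n) (fun D => L (kap3 C1 C2 D)) =
    Ex (data_law P n) (fun D => Num.min (L D) K).
  rewrite [RHS]Ex_data_clamp; last exact: bmin (ltW K0).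
  apply: eq_Ex => D; rewrite (min_idPl _)//; exact: le_trans (ler_norm _) (hK D).
rewrite -ExE; last exact: bmin (ltW K0).
apply: ge0_le_integral => //.
- by move=> D _; rewrite lee_fin le_min L0 ltW.
- by apply/measurable_EFinP; case: (bmin K (ltW K0)).
- exact/measurable_EFinP.
- by move=> D _; rewrite lee_fin ge_min lexx.
Qed.

End clamped.

Section regroup.
Variable n : nat.

Definition lhalf T m k (D : (m + k).-tuple T) : m.-tuple T :=
  [tuple tnth D (lshift k i) | i < m].
Definition rhalf T m k (D : (m + k).-tuple T) : k.-tuple T :=
  [tuple tnth D (rshift m i) | i < k].

(** The three subsamples as the thirds of one sample, on which changes of law apply at
    once. *)
Definition dsplit (D : (n + n + n).-tuple (obs R d)) : data R d n :=
  (lhalf (lhalf D), rhalf (lhalf D), rhalf D).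

Lemma measurable_lhalf (m k : nat) :
  measurable_fun setT (@lhalf (obs R d) m k).
Proof.
apply/measurable_fun_tnthP => i; rewrite (_ : _ \o _ = fun D => tnth D (lshift k i)).
  exact: measurable_tnth.
by apply/funext => D /=; rewrite tnth_mktuple.
Qed.

Lemma measurable_rhalf (m k : nat) :
  measurable_fun setT (@rhalf (obs R d) m k).
Proof.
apply/measurable_fun_tnthP => i; rewrite (_ : _ \o _ = fun D => tnth D (rshift m i)).
  exact: measurable_tnth.
by apply/funext => D /=; rewrite tnth_mktuple.
Qed.

Lemma measurable_dsplit : measurable_fun setT dsplit.
Proof.
apply: measurable_fun_pair; last exact: measurable_rhalf.
apply: measurable_fun_pair.
  exact: (measurableT_comp (@measurable_lhalf n n) (@measurable_lhalf (n + n) n)).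
exact: (measurableT_comp (@measurable_rhalf n n) (@measurable_lhalf (n + n) n)).
Qed.

Lemma lhalf_cat T m k (u : m.-tuple T) (v : k.-tuple T) : lhalf (cat_tuple u v) = u.
Proof. by apply: eq_from_tnth => i; rewrite tnth_mktuple tnth_lshift. Qed.

Lemma rhalf_cat T m k (u : m.-tuple T) (v : k.-tuple T) : rhalf (cat_tuple u v) = v.
Proof. by apply: eq_from_tnth => i; rewrite tnth_mktuple tnth_rshift. Qed.

Lemma Ex_data_iid P (F : data R d n -> R) : bm F ->
  Ex (data_law P n) F = Ex (iid P (n + n + n)) (fun D => F (dsplit D)).
Proof.
move=> bF; have bFd := bm_comp bF measurable_dsplit.
have cm := @measurable_cat_tuple _ (obs R d) (n + n) n.
rewrite (@Ex_iid_cat _ _ _ P (n + n) n)// (@Ex_iid_cat _ _ _ P n n); last first.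
  apply: (bm_Ex_snd (iid P (n + n)) (iid P n) (f := fun z => F (dsplit (cat_tuple z.1 z.2)))).
  exact: (bm_comp bFd cm).
rewrite (Ex_data P bF); apply: eq_Ex => D1; apply: eq_Ex => D2; apply: eq_Ex => D3.
by rewrite /dsplit !lhalf_cat !rhalf_cat.
Qed.

End regroup.

End data.

(** * Laws with prescribed regression functions and conditional covariance *)

Section sign_model.
Context {R : realType} {d : nat}.

Definition sg (s : bool) : R := if s then 1 else -1.

Definition coin : probability bool R := bernoulli_prob (2^-1 : R).

Lemma bm_bool (g : bool -> R) : bm g.
Proof. by split => //; exists (`|g true| + `|g false|) => -[]; rewrite ?lerDl ?lerDr. Qed.

Lemma Ex_coin (g : bool -> R) : Ex coin g = (g true + g false) / 2.
Proof.
have h01 : 0 <= (2^-1 : R) <= 1 by apply/andP; split; lra.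
have E1 : Ex coin (fun s => s%:R) = 2^-1.
  apply: EFin_inj; rewrite -ExE; last exact: bm_bool.
  rewrite integral_bernoulli_prob//.
  by rewrite -!EFinM -EFinD/= mulr1 mulr0 addr0.
rewrite (@eq_Ex _ _ _ coin _ (fun s : bool => g false + (g true - g false) * s%:R)); last first.
  by case; rewrite /=; lra.
rewrite ExD ?ExZ ?Ex_cst ?E1; [|exact: bm_bool..]; lra.
Qed.

(** The sample space on which all the least favourable laws live: a covariate
    and two independent fair signs. *)
Definition base_law : probability (d.-tuple R * bool * bool)%type R :=
  (unif d \x coin \x coin)%E.

Lemma Ex_base (F : d.-tuple R * bool * bool -> R) : bm F -> Ex base_law F =
  Ex (unif d) (fun x => (F (x, true, true) + F (x, true, false) +
    F (x, false, true) + F (x, false, false)) / 4).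
Proof.
move=> bF; rewrite /base_law Ex_prod// Ex_prod//; last first.
  exact: (bm_Ex_snd (unif d \x coin)%E coin bF).
by apply: eq_Ex => x; rewrite !Ex_coin; field.
Qed.

Lemma bm_signX (h : d.-tuple R -> R) : bm h ->
  bm (fun z : d.-tuple R * bool * bool => h z.1.1).
Proof. by move=> bh; apply: (bm_comp bh); exact: measurableT_comp. Qed.

Lemma bm_sign1 : bm (fun z : d.-tuple R * bool * bool => sg z.1.2).
Proof. by apply: (bm_comp (bm_bool sg)); exact: measurableT_comp. Qed.

Lemma bm_sign2 : bm (fun z : d.-tuple R * bool * bool => sg z.2).
Proof. exact: (bm_comp (bm_bool sg)). Qed.

Definition sdens (u v th : d.-tuple R -> R) (z : d.-tuple R * bool * bool) : R :=
  1 + u z.1.1 * sg z.1.2 + v z.1.1 * sg z.2 + th z.1.1 * (sg z.1.2 * sg z.2).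

Lemma bm_sdens u v th : bm u -> bm v -> bm th -> bm (sdens u v th).
Proof.
move=> bu bv bt; have := bm_sign1; have := bm_sign2 => b2 b1.
apply: bmD; last by apply: bmM; [exact: bm_signX|exact: bmM].
apply: bmD; last by apply: bmM => //; exact: bm_signX.
by apply: bmD; [exact: bm_cst|apply: bmM => //; exact: bm_signX].
Qed.

Section law.
Variables (C1 C2 dl : R) (P0 B0 : d.-tuple R -> R).
Hypotheses (dl0 : 0 < dl) (bP0 : bm P0) (bB0 : bm B0)
  (hP0 : forall x, C1 + dl <= P0 x <= C2 - dl)
  (hB0 : forall x, C1 + dl <= B0 x <= C2 - dl).

(** The signs move A and Y by [dl] around [P0] and [B0], which therefore have to stay at
    distance [dl] from the bounds C1 and C2. *)
Definition sobs (z : d.-tuple R * bool * bool) : obs R d :=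
  (z.1.1, P0 z.1.1 + dl * sg z.1.2, B0 z.1.1 + dl * sg z.2).

Lemma measurable_sobs : measurable_fun setT sobs.
Proof.
have := bm_sign1; have := bm_sign2 => b2 b1.
apply: measurable_fun_pair.
  apply: measurable_fun_pair; first exact: measurableT_comp.
  apply: bm_meas; apply: bmD; first exact: bm_signX.
  by apply: bmM => //; exact: bm_cst.
apply: bm_meas; apply: bmD; first exact: bm_signX.
by apply: bmM => //; exact: bm_cst.
Qed.

HB.instance Definition _ := isMeasurableFun.Build _ _ _ _ sobs measurable_sobs.

Lemma clA_sobs z : clA C1 C2 (sobs z) = P0 z.1.1 + dl * sg z.1.2.
Proof.
rewrite /clA clamp_id// /obsA/=; have /andP[h1 h2] := hP0 z.1.1.
by have := dl0; case: z.1.2 => ? /=; apply/andP; rewrite /sg; split; lra.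
Qed.

Lemma clY_sobs z : clY C1 C2 (sobs z) = B0 z.1.1 + dl * sg z.2.
Proof.
rewrite /clY clamp_id// /obsY/=; have /andP[h1 h2] := hB0 z.1.1.
by have := dl0; case: z.2 => ? /=; apply/andP; rewrite /sg; split; lra.
Qed.

Variables (u v th : d.-tuple R -> R).
Hypotheses (bu : bm u) (bv : bm v) (bt : bm th)
  (huvt : forall x, `|u x| + `|v x| + `|th x| <= 1).

Lemma sdens_ge0 z : 0 <= sdens u v th z.
Proof.
rewrite /sdens; have := huvt z.1.1.
have := ler_norm (u z.1.1); have := ler_norm (- u z.1.1).
have := ler_norm (v z.1.1); have := ler_norm (- v z.1.1).
have := ler_norm (th z.1.1); have := ler_norm (- th z.1.1).
rewrite !normrN /sg; case: z.1.2; case: z.2; lra.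
Qed.

Let bf := bm_sdens bu bv bt.

Lemma Ex_sdens : Ex base_law (sdens u v th) = 1.
Proof.
rewrite Ex_base// -[RHS](Ex_cst (unif d) 1); apply: eq_Ex => x.
by rewrite /sdens/=; field.
Qed.

Lemma exists_perturbed_law : exists Q : probability (obs R d) R, [/\
  (forall h, bm h -> Ex Q h = Ex base_law (fun z => sdens u v th z * h (sobs z))),
  (forall B, measurable B -> Q (obsX @^-1` B) = unif d B) &
  {ae Q, forall w, C1 <= obsA w <= C2 /\ C1 <= obsY w <= C2}].
Proof.
have [Q hQ] := exists_density bf sdens_ge0 Ex_sdens.
have hQ' h : bm h -> Ex (distribution Q sobs) h =
    Ex base_law (fun z => sdens u v th z * h (sobs z)).
  move=> bh; rewrite Ex_distribution// hQ//.
  exact: (bm_comp bh measurable_sobs).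
exists (distribution Q sobs); split => //.
  move=> B mB.
  have mXB : measurable (obsX @^-1` B : set (obs R d)).
    by rewrite -[X in measurable X]setTI; exact: measurable_obsX.
  rewrite -Ex_indic// -[RHS]Ex_indic//; congr EFin.
  have b1 := bm_indic (R := R) mXB; have b2 := bm_indic (R := R) mB.
  rewrite hQ'// Ex_base; last by apply: bmM => //; exact: (bm_comp b1 measurable_sobs).
  apply: eq_Ex => x; rewrite /sdens/= !indicE.
  have -> s t : (sobs (x, s, t) \in obsX @^-1` B) = (x \in B).
    by apply/idP/idP; rewrite !inE.
  by field.
pose I : set R := `[C1, C2]%classic.
pose G : set (obs R d) := obsA @^-1` I `&` obsY @^-1` I.
have mG : measurable G.
  apply: measurableI; rewrite -[X in measurable X]setTI.
    by apply: measurable_obsA => //; exact: measurable_itv.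
  by apply: measurable_obsY => //; exact: measurable_itv.
exists (~` G); split; first exact: measurableC.
  rewrite /= /distribution /pushforward /= (_ : _ @^-1` _ = set0) ?measure0//.
  apply/seteqP; split => // z; apply; rewrite /G /I /=; split; rewrite /= in_itv/=.
    have /andP[h1 h2] := hP0 z.1.1.
    by have := dl0; rewrite /obsA/=; case: z.1.2 => ? /=; apply/andP; rewrite /sg; split; lra.
  have /andP[h1 h2] := hB0 z.1.1.
  by have := dl0; rewrite /obsY/=; case: z.2 => ? /=; apply/andP; rewrite /sg; split; lra.
move=> w /= h [h1 h2]; apply: h; move: h1 h2.
by rewrite /I /= !in_itv/=.
Qed.

(** The regression functions of the perturbed law are P0 + dl u and B0 + dl v,
    and th only enters through the conditional covariance. *)
Lemma perturbed_moments (Q : probability (obs R d) R) :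
  (forall h, bm h -> Ex Q h = Ex base_law (fun z => sdens u v th z * h (sobs z))) ->
  forall h, bm h -> [/\
    Ex Q (fun w => clA C1 C2 w * h (obsX w)) = dot (fun x => P0 x + dl * u x) h,
    Ex Q (fun w => clY C1 C2 w * h (obsX w)) = dot (fun x => B0 x + dl * v x) h &
    Ex Q (fun w => clA C1 C2 w * clY C1 C2 w * h (obsX w)) =
    dot (fun x => P0 x * B0 x + dl * (P0 x * v x + B0 x * u x) + dl ^+ 2 * th x) h].
Proof.
move=> hQ h bh; have bA := bm_clA (d := d) C1 C2; have bY := bm_clY (d := d) C1 C2.
have bX := bm_obsX bh; have bs := measurable_sobs.
have gen k : bm k -> bm (fun z => sdens u v th z * k (sobs z)).
  by move=> bk; apply: bmM => //; exact: (bm_comp bk bs).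
have bAh := bmM bA bX; have bYh := bmM bY bX; have bAYh := bmM (bmM bA bY) bX.
split.
- rewrite (hQ _ bAh) (Ex_base (gen _ bAh)); apply: eq_Ex => x.
  by rewrite !clA_sobs/= /sdens/= /obsX/=; field.
- rewrite (hQ _ bYh) (Ex_base (gen _ bYh)); apply: eq_Ex => x.
  by rewrite !clY_sobs/= /sdens/= /obsX/=; field.
- rewrite (hQ _ bAYh) (Ex_base (gen _ bAYh)); apply: eq_Ex => x.
  by rewrite !clA_sobs !clY_sobs/= /sdens/= /obsX/=; field.
Qed.

End law.
End sign_model.

(** * Moments of sums and averages *)

Ltac bmt := repeat first [done | exact: bm_cst | apply: bm_sum => ? |
  apply: bmX | apply: bmB | apply: bmD | apply: bmN | apply: bmM |
  apply: bm_norm | apply: bm_tnth].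

Lemma sum_CS (R : realType) (I : finType) (x y : I -> R) :
  (\sum_i x i * y i) ^+ 2 <= (\sum_i x i ^+ 2) * (\sum_i y i ^+ 2).
Proof.
set c := \sum_i x i * y i; set a := \sum_i x i ^+ 2; set b := \sum_i y i ^+ 2.
have key s t : 0 <= s ^+ 2 * a + 2 * s * t * c + t ^+ 2 * b.
  rewrite (_ : _ + _ = \sum_i (s * x i + t * y i) ^+ 2).
    by apply: sumr_ge0 => i _; exact: sqr_ge0.
  by rewrite /a /b /c !mulr_sumr -!big_split/=; apply: eq_bigr => i _; ring.
have a0 : 0 <= a by apply: sumr_ge0 => i _; exact: sqr_ge0.
have b0 : 0 <= b by apply: sumr_ge0 => i _; exact: sqr_ge0.
have [b00|bn0] := eqVneq b 0.
  have [a00|an0] := eqVneq a 0.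
    rewrite b00 mulr0.
    have := key 1 (- c); have := key 1 c; rewrite a00 b00 => k1 k2; nra.
  have := key (- c) a; have : 0 < a by rewrite lt0r an0.
  by move=> ap; nra.
have bp : 0 < b by rewrite lt0r bn0.
have := key b (- c) => k; nra.
Qed.

Section moments.
Context {disp : measure_display} {T : measurableType disp} {R : realType}.
Variable P : probability T R.

(** Adding one vector xi to the sum s changes the squared norm by
    q + 2 c with q = |xi|^2 and c = <xi, s>, and c, q c and |s|^2 c are centred; the
    fourth moment then follows by induction from c^2 <= q |s|^2. *)
Lemma sum_sq_moments (I : finType) (xi : I -> T -> R) (B : R) :
  (forall i, bm (xi i)) -> (forall i, Ex P (xi i) = 0) ->
  (forall w, \sum_i xi i w ^+ 2 <= B) -> forall n,
  let N (D : n.-tuple T) := \sum_i (\sum_k xi i (tnth D k)) ^+ 2 in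
  Ex (iid P n) N <= n%:R * B /\
  Ex (iid P n) (fun D => N D ^+ 2) <= 3 * n%:R ^+ 2 * B ^+ 2.
Proof.
move=> bxi xi0 xiB; elim=> [|n [IH1 IH2]] N.
  have bN : bm N by bmt.
  have N0 D : N D = 0.
    by rewrite /N big1// => i _; rewrite big_ord0 expr0n.
  rewrite (_ : N = fun=> 0); last exact/funext.
  rewrite !Ex_cst mul0r expr0n mulr0 mul0r; split => //.
pose S i (v : n.-tuple T) := \sum_k xi i (tnth v k).
pose s v := \sum_i S i v ^+ 2.
have bS i : bm (S i) by bmt.
have bs : bm s by bmt.
have bN : bm N by bmt.
have B0 : 0 <= B.
  have [w _] : exists w : T, True by exists point.
  by apply: le_trans (xiB w); apply: sumr_ge0 => i _; exact: sqr_ge0.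
have s0 v : 0 <= s v by apply: sumr_ge0 => i _; exact: sqr_ge0.
pose q w := \sum_i xi i w ^+ 2.
pose c w v := \sum_i xi i w * S i v.
have bq : bm q by bmt.
have q0 w : 0 <= q w by apply: sumr_ge0 => i _; exact: sqr_ge0.
have bc w : bm (c w) by bmt.
have NE w v : N (tcons (w, v)) = q w + 2 * c w v + s v.
  rewrite /N /q /c /s mulr_sumr -!big_split/=; apply: eq_bigr => i _.
  rewrite big_ord_recl tnth_tcons0.
  rewrite (_ : \sum_(k < n) _ = S i v); first by ring.
  by apply: eq_bigr => k _; rewrite tnth_tconsS.
have ES i : Ex (iid P n) (S i) = 0.
  rewrite Ex_sum; last by move=> k; exact: bm_tnth.
  by rewrite big1// => k _; rewrite Ex_iid_tnth.
have Ec w : Ex (iid P n) (c w) = 0.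
  rewrite Ex_sum; last by move=> i; bmt.
  by rewrite big1// => i _; rewrite ExZ// ES mulr0.
have Esc w : Ex (iid P n) (fun v => s v * c w v) =
    \sum_i xi i w * Ex (iid P n) (fun v => s v * S i v).
  rewrite (eq_Ex _ (g := fun v => \sum_i xi i w * (s v * S i v))); last first.
    by move=> v; rewrite mulr_sumr; apply: eq_bigr => i _; ring.
  rewrite Ex_sum; last by move=> i; bmt.
  by apply: eq_bigr => i _; rewrite ExZ//; bmt.
have cs w v : c w v ^+ 2 <= q w * s v by exact: sum_CS.
have bN1 w : bm (fun v => N (tcons (w, v))) by exact: (bm_pair1 w (bm_tcons bN)).
split.
  rewrite Ex_iidS//.
  apply: (@le_trans _ _ (Ex P (fun w => B + n%:R * B))); last first.
    by rewrite Ex_cst -natr1 mulrDl mul1r addrC.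
  apply: Ex_le; [exact: (bm_Ex_snd P (iid P n) (bm_tcons bN))|bmt|].
  move=> w; under eq_Ex do rewrite NE.
  rewrite ExD//; last by bmt.
  rewrite ExD; [|by bmt..]; rewrite Ex_cst ExZ// Ec mulr0 addr0.
  by rewrite lerD//; exact: xiB.
have bN2 : bm (fun D => N D ^+ 2) by bmt.
have bG w : bm (fun v => B ^+ 2 + 6 * B * s v + s v ^+ 2 + 4 * (q w * c w v) +
   4 * (s v * c w v)) by bmt.
rewrite Ex_iidS//.
pose K := B ^+ 2 + 6 * B * Ex (iid P n) s + Ex (iid P n) (fun v => s v ^+ 2).
apply: (@le_trans _ _ (Ex P (fun w => K + 4 * \sum_i xi i w *
    Ex (iid P n) (fun v => s v * S i v)))).
  apply: Ex_le; [exact: (bm_Ex_snd P (iid P n) (bm_tcons bN2))|bmt|].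
  move=> w; rewrite -Esc.
  apply: (@le_trans _ _ (Ex (iid P n) (fun v => B ^+ 2 + 6 * B * s v + s v ^+ 2 +
      4 * (q w * c w v) + 4 * (s v * c w v)))).
    apply: Ex_le => //; first exact: bmX.
    move=> v; rewrite NE; have := cs w v; have := q0 w; have := s0 v; have := xiB w.
    rewrite -/(q w) => qB sv qw csv; nra.
  rewrite ExD; [|by bmt..]; rewrite ExD; [|by bmt..]; rewrite ExD; [|by bmt..].
  rewrite ExD; [|by bmt..]; rewrite !ExZ; [|by bmt..].
  by rewrite Ex_cst Ec !mulr0 addr0.
rewrite ExD; [|by bmt..]; rewrite Ex_cst ExZ; last by bmt.
rewrite Ex_sum; last by move=> i; bmt.
rewrite big1 ?mulr0 ?addr0; last by move=> i _; rewrite ExZr// xi0 mul0r.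
rewrite /K -natr1; have n0 : 0 <= n%:R :> R by [].
have IH1' : Ex (iid P n) s <= n%:R * B := IH1.
have IH2' : Ex (iid P n) (fun v => s v ^+ 2) <= 3 * n%:R ^+ 2 * B ^+ 2 := IH2.
nra.
Qed.

Lemma Ex_iid_prod_cst n (g : T -> R) : bm g ->
  Ex (iid P n) (fun v => \prod_i g (tnth v i)) = Ex P g ^+ n.
Proof.
by move=> bg; rewrite (Ex_iid_prod P (g := fun _ => g))// prodr_const card_ord.
Qed.

(** The moment generating function controls all moments of an average of
    nonnegative variables at once, however skewed the variables are. *)
Lemma smean_fourth_moment n (h : T -> R) (c : R) : (0 < n)%N -> 0 < c -> bm h ->
  (forall w, 0 <= h w <= n%:R * c / 2) -> Ex P h <= c ->
  Ex (iid P n) (fun D => smean D h ^+ 4) <= 4 ^+ 4 * c ^+ 4 * expR 2.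
Proof.
move=> n0 c0 bh hb Eh.
have n0' : 0 < n%:R :> R by rewrite ltr0n.
have nc0 : 0 < n%:R * c by rewrite mulr_gt0.
pose t w := h w / (n%:R * c).
have t01 w : 0 <= t w <= 2^-1.
  have /andP[h1 h2] := hb w; rewrite /t divr_ge0//= ?(ltW nc0)//.
  by rewrite ler_pdivrMr// mulrC.
have bt : bm t by bmt.
have be : bm (fun w => expR (t w)).
  split; first by apply: measurableT_comp; [exact: measurable_expR|case: bt].
  exists (expR 2^-1) => w; rewrite gtr0_norm ?expR_gt0// ler_expR.
  by case/andP: (t01 w).
have pw (D : n.-tuple T) : smean D h ^+ 4 <= 4 ^+ 4 * c ^+ 4 * \prod_i expR (t (tnth D i)).
  rewrite -expR_sum; set y := \sum_i t (tnth D i).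
  have y0 : 0 <= y by apply: sumr_ge0 => i _; case/andP: (t01 (tnth D i)).
  have -> : smean D h = c * y.
    rewrite /smean /y /t -mulr_suml mulrC mulrCA invfM; congr (_ * _).
    by rewrite mulrCA mulfV ?gt_eqF// mulr1.
  rewrite exprMn (_ : 4 ^+ 4 * c ^+ 4 * expR y = c ^+ 4 * (4 ^+ 4 * expR y)); last by ring.
  rewrite ler_wpM2l ?exprn_ge0 ?(ltW c0)//.
  have -> : expR y = expR (y / 4) ^+ 4 by rewrite -expRM_natl; congr expR; field.
  have h1 : y / 4 <= expR (y / 4).
    by apply: le_trans (expR_ge1Dx _); rewrite lerDr.
  have -> : y ^+ 4 = (y / 4) ^+ 4 * 4 ^+ 4 by field.
  rewrite [leRHS]mulrC ler_wpM2r ?exprn_ge0//.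
  by apply: lerXn2r h1; rewrite nnegrE ?expR_ge0// divr_ge0.
apply: (@le_trans _ _ (Ex (iid P n) (fun D => 4 ^+ 4 * c ^+ 4 * \prod_i expR (t (tnth D i))))).
  apply: Ex_le => //; first by apply: bmX; exact: bm_smean.
  by apply: bmM; [bmt|apply: bm_prod => i; exact: (bm_tnth i be)].
rewrite ExZ; last by apply: bm_prod => i; exact: (bm_tnth i be).
apply: ler_wpM2l; first by apply: mulr_ge0; apply: exprn_ge0; rewrite ?ltW.
rewrite (Ex_iid_prod_cst n (g := fun w => expR (t w)))//.
have et w : expR (t w) <= 1 + 2 * t w.
  have /andP[t0 t1] := t01 w.
  have h1 : 1 - t w <= expR (- t w) by have := expR_ge1Dx (- t w).
  rewrite expRN in h1; have e0 := expR_gt0 (t w).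
  have h2 : (1 - t w) * expR (t w) <= 1 by rewrite -ler_pdivlMr// div1r.
  nra.
have Et : Ex P t <= n%:R^-1.
  rewrite /t ExZr// invfM mulrCA ler_piMr ?invr_ge0 ?(ltW n0')//.
  by rewrite ler_pdivrMr// mul1r.
apply: (@le_trans _ _ ((1 + 2 / n%:R) ^+ n)).
  apply: lerXn2r; rewrite ?nnegrE.
  - by apply: Ex_ge0 => w; exact: expR_ge0.
  - by rewrite addr_ge0// divr_ge0// ltW.
  - apply: (@le_trans _ _ (Ex P (fun w => 1 + 2 * t w))); first by apply: Ex_le => //; bmt.
    rewrite ExD; [|by bmt..]; rewrite Ex_cst ExZ// lerD2l ler_wpM2l//.
apply: (@le_trans _ _ (expR (2 / n%:R) ^+ n)).
  apply: lerXn2r; [|by rewrite nnegrE expR_ge0|exact: expR_ge1Dx].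
  by rewrite nnegrE addr_ge0// divr_ge0// ltW.
by rewrite -expRM_natl mulrCA mulfV ?mulr1// gt_eqF.
Qed.

End moments.

(** * Projection estimates *)

Lemma smean_bound d (T : measurableType d) (R : realType) n (D : n.-tuple T)
  (f : T -> R) C : 0 <= C -> (forall w, `|f w| <= C) -> `|smean D f| <= C.
Proof.
move=> C0 hC; rewrite /smean normrM normfV normr_nat.
have [n0|n0] := boolP (n == 0%N).
  by rewrite (_ : n%:R^-1 = 0) ?mul0r// (eqP n0) invr0.
have n0' : 0 < n%:R :> R by rewrite ltr0n lt0n.
rewrite mulrC ler_pdivrMr//; apply: (le_trans (ler_norm_sum _ _ _)).
apply: (@le_trans _ _ (\sum_(i < n) C)); first by apply: ler_sum => i _.
by rewrite sumr_const card_ord mulr_natr.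
Qed.

Section projection_estimators.
Context {R : realType} {d J0 S : nat} (W : wavelets R d).
Hypothesis hW : cdv_basis W J0 S.
Local Notation K := (Defs.kernel W).

Definition est (f : obs R d -> R) j n (D : n.-tuple (obs R d)) (x : d.-tuple R) : R :=
  smean D (fun w => f w * K j (obsX w) x).

(** The integral of the product of two projection estimates, by [dot_est2]. *)
Definition cross (f g : obs R d -> R) j n (D : n.-tuple (obs R d)) : R :=
  n%:R^-1 ^+ 2 * \sum_(i < n) \sum_(k < n)
    f (tnth D i) * g (tnth D k) * K j (obsX (tnth D i)) (obsX (tnth D k)).

Definition coef (f : obs R d -> R) j m n (D : n.-tuple (obs R d)) : R :=
  smean D (fun w => f w * phi W j m (obsX w)).
Arguments coef f j m {n} D.

Lemma est_coef f j n (D : n.-tuple (obs R d)) x :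
  est f j D x = \sum_m coef f j m D * phi W j m x.
Proof.
rewrite /est /coef /smean /Defs.kernel.
under eq_bigr do rewrite mulr_sumr.
rewrite exchange_big mulr_sumr; apply: eq_bigr => m _.
by rewrite -mulrA mulr_suml; congr (_ * _); apply: eq_bigr => i _; rewrite mulrA.
Qed.

Lemma in_V_est f j n (D : n.-tuple (obs R d)) : in_V W j (est f j D).
Proof. by exists (fun m => coef f j m D) => x; exact: est_coef. Qed.

Lemma bm_est f j n (D : n.-tuple (obs R d)) : (J0 <= j)%N -> bm (est f j D).
Proof. by move=> hj; exact: (bm_in_V hW hj (in_V_est f j D)). Qed.

Lemma dot_est f j n (D : n.-tuple (obs R d)) h : (J0 <= j)%N -> bm h ->
  dot h (est f j D) = smean D (fun w => f w * wproj W j h (obsX w)).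
Proof.
move=> hj bh; have bk x := bm_kernel hW x hj.
rewrite dotC /est /smean dotZl//; last by bmt.
rewrite dot_comb//; congr (_ * _); apply: eq_bigr => i _.
by rewrite (proj_kernel hW)// dotC.
Qed.

(** Integrating the kernels exactly leaves only the smaller resolution. *)
Lemma dot_est2 f g j1 j2 n (D : n.-tuple (obs R d)) : (J0 <= j1)%N -> (J0 <= j2)%N ->
  dot (est f j1 D) (est g j2 D) = cross f g (minn j1 j2) D.
Proof.
move=> h1 h2; have bk x := bm_kernel hW x h1; have be := bm_est g D h2.
rewrite {1}/est /smean dotZl//; last by bmt.
rewrite dot_comb// /cross expr2 -mulrA; congr (_ * _).
rewrite mulr_sumr; apply: eq_bigr => i _.
rewrite (dot_est _ _ h2 (bk _)) /smean mulrCA; congr (_ * _).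
rewrite mulr_sumr; apply: eq_bigr => k _.
rewrite -(dot_kernel hW _ _ h1 h2) -mulrA; congr (_ * (_ * _)).
by rewrite (proj_kernel hW)//.
Qed.

Lemma cross_coef f g j n (D : n.-tuple (obs R d)) :
  cross f g j D = \sum_m coef f j m D * coef g j m D.
Proof.
rewrite /cross /coef /smean /Defs.kernel.
transitivity (n%:R^-1 ^+ 2 * \sum_m \sum_(i < n) \sum_(k < n)
  f (tnth D i) * phi W j m (obsX (tnth D i)) *
  (g (tnth D k) * phi W j m (obsX (tnth D k)))).
  congr (_ * _); rewrite [RHS]exchange_big; apply: eq_bigr => i _.
  rewrite [RHS]exchange_big; apply: eq_bigr => k _.
  by rewrite mulr_sumr; apply: eq_bigr => m _; ring.
rewrite mulr_sumr; apply: eq_bigr => m _.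
by rewrite -big_distrlr/=; ring.
Qed.

Lemma bm_phiX j m : (J0 <= j)%N -> bm (fun w : obs R d => phi W j m (obsX w)).
Proof. by move=> hj; apply: bm_obsX; exact: (bm_phi hW). Qed.

Lemma bm_coef f j m n : (J0 <= j)%N -> bm f ->
  bm (fun D : n.-tuple (obs R d) => coef f j m D).
Proof. by move=> hj bf; apply: bm_smean; apply: bmM => //; exact: bm_phiX. Qed.

Lemma bm_cross f g j n : (J0 <= j)%N -> bm f -> bm g ->
  bm (fun D : n.-tuple (obs R d) => cross f g j D).
Proof.
move=> hj bf bg; under eq_fun do rewrite cross_coef.
by apply: bm_sum => m; apply: bmM; exact: bm_coef.
Qed.

Lemma bm_estX f j n x : (J0 <= j)%N -> bm f ->
  bm (fun D : n.-tuple (obs R d) => est f j D x).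
Proof.
move=> hj bf; under eq_fun do rewrite est_coef.
by apply: bm_sum => m; apply: bmM; [exact: bm_coef|exact: bm_cst].
Qed.

Lemma bm_est_pair f j n d' (T : measurableType d') (D : T -> n.-tuple (obs R d))
  (X : T -> d.-tuple R) : (J0 <= j)%N -> bm f ->
  measurable_fun setT D -> measurable_fun setT X ->
  bm (fun t => est f j (D t) (X t)).
Proof.
move=> hj bf mD mX; under eq_fun do rewrite est_coef.
apply: bm_sum => m; apply: bmM; first exact: (bm_comp (bm_coef m n hj bf) mD).
exact: (bm_comp (bm_phi hW m hj) mX).
Qed.

Section regression.
Variables (P : probability (obs R d) R) (f g : obs R d -> R) (pf pg : d.-tuple R -> R).
Hypotheses (bf : bm f) (bg : bm g) (bpf : bm pf) (bpg : bm pg)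
  (hX : forall h, bm h -> Ex P (fun w => h (obsX w)) = Ex (unif d) h)
  (hf : forall h, bm h -> Ex P (fun w => f w * h (obsX w)) = dot pf h)
  (hg : forall h, bm h -> Ex P (fun w => g w * h (obsX w)) = dot pg h).

Lemma bm_diag j : (J0 <= j)%N -> bm (fun x => K j x x).
Proof. by move=> hj; apply: bm_sum => m; apply: bmM; exact: (bm_phi hW). Qed.

(** The diagonal terms use the same observation twice; they are the source of the bias
    of order [resol j / n]. *)
Lemma Ex_cross j n : (0 < n)%N -> (J0 <= j)%N ->
  Ex (iid P n) (cross f g j (n := n)) =
  n%:R^-1 * Ex P (fun w => f w * g w * K j (obsX w) (obsX w)) +
  (1 - n%:R^-1) * dot pf (wproj W j pg).
Proof.
move=> n0 hj; have n0' : n%:R != 0 :> R by rewrite pnatr_eq0 -lt0n.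
pose H w w' := f w * g w' * K j (obsX w) (obsX w').
pose G w := f w * g w * K j (obsX w) (obsX w).
have bG : bm G by apply: bmM; [exact: bmM|exact: (bm_obsX (bm_diag hj))].
have bH : bm (fun z => H z.1 z.2).
  apply: bmM.
    by apply: bmM; [exact: (bm_comp bf)|exact: (bm_comp bg)].
  apply: bm_sum => m; apply: bmM.
    exact: (bm_comp (bm_phiX m hj) measurable_fst).
  exact: (bm_comp (bm_phiX m hj) measurable_snd).
have off (i k : 'I_n) : i != k ->
    Ex (iid P n) (fun D => H (tnth D i) (tnth D k)) = dot pf (wproj W j pg).
  move=> ik; rewrite (dot_proj hW)//.
  rewrite (eq_Ex _ (g := fun D => \sum_m
     (f (tnth D i) * phi W j m (obsX (tnth D i))) *
     (g (tnth D k) * phi W j m (obsX (tnth D k))))); last first.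
    by move=> D; rewrite /H /Defs.kernel mulr_sumr; apply: eq_bigr => m _; ring.
  have bfp m : bm (fun w => f w * phi W j m (obsX w)) by apply: bmM => //; exact: bm_phiX.
  have bgp m : bm (fun w => g w * phi W j m (obsX w)) by apply: bmM => //; exact: bm_phiX.
  rewrite Ex_sum; last by move=> m; exact: (bmM (bm_tnth i (bfp m)) (bm_tnth k (bgp m))).
  apply: eq_bigr => m _.
  rewrite (Ex_iid_tnth2 P ik (bfp m) (bgp m)).
  by rewrite hf ?hg//; exact: (bm_phi hW).
rewrite ExZ; last first.
  apply: bm_sum => i; apply: bm_sum => k.
  apply: (bm_comp bH (g := fun D => (tnth D i, tnth D k))).
  by apply: measurable_fun_pair; exact: measurable_tnth.
rewrite (Ex_double_sum (g := G) bH _ bG off)//.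
by field.
Qed.

Lemma Ex_kernel_diagX j C : (J0 <= j)%N -> (forall w, `|f w * g w| <= C) ->
  `|Ex P (fun w => f w * g w * K j (obsX w) (obsX w))| <= C * #|idx W j|%:R.
Proof.
move=> hj hC; have bd := bm_diag hj.
have bfg := bmM bf bg; have bdX := bm_obsX bd.
apply: (le_trans (Ex_abs _ (bmM bfg bdX))).
apply: (@le_trans _ _ (Ex P (fun w => C * K j (obsX w) (obsX w)))).
  apply: Ex_le; [exact: bm_norm (bmM bfg bdX)|by bmt|].
  move=> w; rewrite normrM; have k0 : 0 <= K j (obsX w) (obsX w).
    by apply: sumr_ge0 => m _; rewrite -expr2 sqr_ge0.
  by rewrite (ger0_norm k0) ler_wpM2r.
rewrite ExZ// (hX bd) (Ex_kernel_diag hW)//.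
Qed.

Lemma Ex_pf_sqr C : (forall w, `|f w| <= C) -> dot pf pf <= C ^+ 2.
Proof.
move=> hC; have bfp := bm_obsX bpf.
have h : 2 * dot pf pf <= Ex P (fun w => f w ^+ 2) + dot pf pf.
  rewrite -{1}(hf bpf) -[X in _ <= _ + X](hX (bmM bpf bpf)) -ExZ; last exact: bmM.
  rewrite -ExD; [|by bmt..]; apply: Ex_le; [by bmt..|] => w.
  by have := sqr_ge0 (f w - pf (obsX w)) => ?; nra.
have h2 : Ex P (fun w => f w ^+ 2) <= C ^+ 2.
  apply: Ex_lec => [|w]; first exact: bmX.
  by rewrite -ler_sqrt ?sqr_ge0// !sqrtr_sqr (le_trans (hC w))// ler_norm.
by lra.
Qed.

(** The statistics that are linear in the estimation error have parametric variance,
    whatever the resolution. *)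
Lemma smean_linear_mse n h C : (0 < n)%N -> bm h -> (forall w, `|f w| <= C) ->
  Ex (iid P n) (fun D => (smean D (fun w => f w * h (obsX w)) - dot pf h) ^+ 2) <=
  n%:R^-1 * (C ^+ 2 * dot h h).
Proof.
move=> n0 bh hC; have bhX := bm_obsX bh.
apply: (le_trans (Ex_smean_mse P _ n0 (bmM bf bhX))).
rewrite (hf bh) subrr expr0n add0r ler_wpM2l ?invr_ge0//.
rewrite -[dot h h](hX (bmM bh bh)) -ExZ; last exact: bmM.
apply: Ex_le; [by bmt..|] => w.
rewrite exprMn -expr2 ler_wpM2r ?sqr_ge0//.
by rewrite -ler_sqrt ?sqr_ge0// !sqrtr_sqr (le_trans (hC w))// ler_norm.
Qed.

(** The vector of empirical coefficients is an average of independent vectors with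
    squared norm of order [K(x, x)]. *)
Lemma centred_coef_norm j n C B : (0 < n)%N -> (J0 <= j)%N -> (forall w, `|f w| <= C) ->
  (forall x y, `|K j x y| <= B) ->
  let V := 2 * (C ^+ 2 * (B + 1)) / n%:R in
  let N (D : n.-tuple (obs R d)) := \sum_m (coef f j m D - dot pf (phi W j m)) ^+ 2 in
  Ex (iid P n) N <= V /\ Ex (iid P n) (fun D => N D ^+ 2) <= 3 * V ^+ 2.
Proof.
move=> n0 hj hC hB V N; have n0' : 0 < n%:R :> R by rewrite ltr0n.
have n1 : n%:R != 0 :> R by rewrite gt_eqF.
pose xi m w := f w * phi W j m (obsX w) - dot pf (phi W j m).
have bxi m : bm (xi m) by have := bm_phiX m hj => b; bmt.
have xi0 m : Ex P (xi m) = 0.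
  rewrite ExB ?Ex_cst; [|by apply: bmM => //; exact: bm_phiX|bmt].
  by rewrite hf ?subrr//; exact: (bm_phi hW).
have a2 : \sum_m dot pf (phi W j m) ^+ 2 <= C ^+ 2.
  apply: (le_trans _ (Ex_pf_sqr hC)); apply: (le_trans _ (dot_proj_le hW hj bpf)).
  by rewrite (dot_proj hW).
have xiB w : \sum_m xi m w ^+ 2 <= 2 * (C ^+ 2 * (B + 1)).
  apply: (@le_trans _ _ (2 * (f w ^+ 2 * K j (obsX w) (obsX w) +
      \sum_m dot pf (phi W j m) ^+ 2))).
    rewrite /Defs.kernel mulrDr !mulr_sumr -big_split/=; apply: ler_sum => m _.
    have := sqr_ge0 (f w * phi W j m (obsX w) + dot pf (phi W j m)).
    by rewrite /xi => ?; nra.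
  have f2 : f w ^+ 2 <= C ^+ 2.
    by rewrite -ler_sqrt ?sqr_ge0// !sqrtr_sqr (le_trans (hC w))// ler_norm.
  have kB : K j (obsX w) (obsX w) <= B by apply: le_trans (hB _ _); exact: ler_norm.
  have k0 : 0 <= K j (obsX w) (obsX w).
    by apply: sumr_ge0 => m _; rewrite -expr2 sqr_ge0.
  have := sqr_ge0 (f w); nra.
have [m1 m2] := sum_sq_moments bxi xi0 xiB n.
have NE D : N D = n%:R^-1 ^+ 2 * \sum_m (\sum_k xi m (tnth D k)) ^+ 2.
  rewrite mulr_sumr; apply: eq_bigr => m _; rewrite -exprMn; congr (_ ^+ 2).
  rewrite /coef /smean /xi sumrB mulrBr sumr_const card_ord; congr (_ - _).
  by rewrite -[dot _ _ *+ _]mulr_natl mulrA mulVf// mul1r.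
have bS : bm (fun D : n.-tuple (obs R d) => \sum_m (\sum_k xi m (tnth D k)) ^+ 2).
  by apply: bm_sum => m; apply: bmX; apply: bm_sum => k; exact: (bm_tnth k (bxi m)).
split.
  rewrite (eq_Ex _ NE) ExZ//.
  apply: (le_trans (ler_wpM2l _ m1)); first by rewrite sqr_ge0.
  by rewrite le_eqVlt; apply/orP; left; apply/eqP; rewrite /V; field.
rewrite (eq_Ex _ (g := fun D => n%:R^-1 ^+ 4 *
    (\sum_m (\sum_k xi m (tnth D k)) ^+ 2) ^+ 2)); last first.
  by move=> D; rewrite NE exprMn -exprM.
rewrite ExZ; last exact: bmX.
apply: (le_trans (ler_wpM2l _ m2)); first by rewrite exprn_ge0// invr_ge0 ltW.
by rewrite le_eqVlt; apply/orP; left; apply/eqP; rewrite /V; field.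
Qed.

End regression.

End projection_estimators.

(** * The three estimators on clamped data *)

Section estimator_identities.
Context {R : realType} {d J0 S : nat} (W : wavelets R d).
Hypothesis hW : cdv_basis W J0 S.
Local Notation K := (Defs.kernel W).

Lemma measurable_coef f j (m : idx W j) n : (J0 <= j)%N -> measurable_fun setT f ->
  measurable_fun setT (fun D : n.-tuple (obs R d) => coef f m D).
Proof.
move=> hj mf; apply: measurable_funM; first exact: measurable_cst.
apply: measurable_sum => i; apply: measurable_funM.
  exact: (measurableT_comp mf (measurable_tnth i)).
exact: (bm_meas (bm_tnth i (bm_phiX hW m hj))).
Qed.

Lemma measurable_cross f g j n : (J0 <= j)%N -> measurable_fun setT f ->
  measurable_fun setT g ->
  measurable_fun setT (fun D : n.-tuple (obs R d) => cross W f g j D).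
Proof.
move=> hj mf mg; under eq_fun do rewrite cross_coef.
by apply: measurable_sum => m; apply: measurable_funM; exact: measurable_coef.
Qed.

Lemma measurable_est_pair f j n d' (T : measurableType d') (D : T -> n.-tuple (obs R d))
  (X : T -> d.-tuple R) : (J0 <= j)%N -> measurable_fun setT f ->
  measurable_fun setT D -> measurable_fun setT X ->
  measurable_fun setT (fun t => est W f j (D t) (X t)).
Proof.
move=> hj mf mD mX; under eq_fun do rewrite est_coef.
apply: measurable_sum => m; apply: measurable_funM.
  exact: (measurableT_comp (@measurable_coef f j m n hj mf) mD).
exact: (measurableT_comp (bm_meas (bm_phi hW m hj)) mX).
Qed.

Section raw.
Variables (j1 j2 n : nat).
Hypotheses (h1 : (J0 <= j1)%N) (h2 : (J0 <= j2)%N).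
Let D1 (D : data R d n) := D.1.1.
Let D2 (D : data R d n) := D.1.2.
Let D3 (D : data R d n) := D.2.

Lemma measurable_D1 : measurable_fun setT D1.
Proof. exact: measurableT_comp. Qed.
Lemma measurable_D2 : measurable_fun setT D2.
Proof. exact: measurableT_comp. Qed.
Lemma measurable_D3 : measurable_fun setT D3.
Proof. exact: measurable_snd. Qed.

Let h12 : (J0 <= minn j1 j2)%N. Proof. by rewrite leq_min h1. Qed.

Lemma psi_INT_raw (D : data R d n) : psi_INT W j1 j2 D =
  smean (D2 D) (fun w => obsA w * obsY w) - cross W (@obsA R d) (@obsY R d) (minn j1 j2) (D1 D).
Proof.
case: D => [[E1 E2] E3]; rewrite /psi_INT /D1 /D2 /=; congr (_ - _).
by rewrite ipE; [exact: (dot_est2 hW)|exact: (bm_est hW)|exact: (bm_est hW)].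
Qed.

Lemma psi_MC_raw (D : data R d n) : psi_MC W j1 j2 D =
  smean (D2 D) (fun w => obsA w * obsY w) -
  smean (D3 D) (fun w => est W (@obsA R d) j1 (D1 D) (obsX w) *
                         est W (@obsY R d) j2 (D1 D) (obsX w)).
Proof. by case: D => [[E1 E2] E3]. Qed.

Lemma psi_IF_raw (D : data R d n) : psi_IF W j1 j2 D =
  smean (D2 D) (fun w => (obsA w - est W (@obsA R d) j1 (D1 D) (obsX w)) *
                         (obsY w - est W (@obsY R d) j2 (D1 D) (obsX w))).
Proof. by case: D => [[E1 E2] E3]. Qed.

Lemma measurable_smean_dep (F : data R d n -> n.-tuple (obs R d))
  (G : data R d n -> obs R d -> R) : measurable_fun setT F ->
  (forall i, measurable_fun setT (fun D => G D (tnth (F D) i))) ->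
  measurable_fun setT (fun D => smean (F D) (G D)).
Proof.
move=> mF mG; apply: measurable_funM; first exact: measurable_cst.
exact: measurable_sum.
Qed.

Let mA (F : data R d n -> n.-tuple (obs R d)) i : measurable_fun setT F ->
  measurable_fun setT (fun D => obsA (tnth (F D) i)).
Proof.
move=> mF; apply: (measurableT_comp measurable_obsA).
exact: (measurableT_comp (measurable_tnth i) mF).
Qed.

Let mY (F : data R d n -> n.-tuple (obs R d)) i : measurable_fun setT F ->
  measurable_fun setT (fun D => obsY (tnth (F D) i)).
Proof.
move=> mF; apply: (measurableT_comp measurable_obsY).
exact: (measurableT_comp (measurable_tnth i) mF).
Qed.

Let mX (F : data R d n -> n.-tuple (obs R d)) i : measurable_fun setT F ->
  measurable_fun setT (fun D => obsX (tnth (F D) i)).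
Proof.
move=> mF; apply: (measurableT_comp measurable_obsX).
exact: (measurableT_comp (measurable_tnth i) mF).
Qed.

Lemma measurable_psi_INT : measurable_fun setT (@psi_INT R d W j1 j2 n).
Proof.
rewrite (_ : @psi_INT R d W j1 j2 n = fun D => smean (D2 D) (fun w => obsA w * obsY w) -
   cross W (@obsA R d) (@obsY R d) (minn j1 j2) (D1 D)); last first.
  by apply/funext => D; exact: psi_INT_raw.
apply: measurable_funB; last first.
  apply: (measurableT_comp _ measurable_D1).
  exact: measurable_cross measurable_obsA measurable_obsY.
apply: measurable_smean_dep => [|i]; first exact: measurable_D2.
by apply: measurable_funM; [exact: mA measurable_D2|exact: mY measurable_D2].
Qed.

Lemma measurable_psi_MC : measurable_fun setT (@psi_MC R d W j1 j2 n).
Proof.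
rewrite (_ : @psi_MC R d W j1 j2 n = fun D => smean (D2 D) (fun w => obsA w * obsY w) -
  smean (D3 D) (fun w => est W (@obsA R d) j1 (D1 D) (obsX w) *
                         est W (@obsY R d) j2 (D1 D) (obsX w))); last first.
  by apply/funext => D; exact: psi_MC_raw.
apply: measurable_funB.
  apply: measurable_smean_dep => [|i]; first exact: measurable_D2.
  by apply: measurable_funM; [exact: mA measurable_D2|exact: mY measurable_D2].
apply: measurable_smean_dep => [|i]; first exact: measurable_D3.
apply: measurable_funM.
  exact: (measurable_est_pair h1 measurable_obsA measurable_D1 (mX i measurable_D3)).
exact: (measurable_est_pair h2 measurable_obsY measurable_D1 (mX i measurable_D3)).
Qed.

Lemma measurable_psi_IF : measurable_fun setT (@psi_IF R d W j1 j2 n).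
Proof.
rewrite (_ : @psi_IF R d W j1 j2 n = fun D =>
  smean (D2 D) (fun w => (obsA w - est W (@obsA R d) j1 (D1 D) (obsX w)) *
                         (obsY w - est W (@obsY R d) j2 (D1 D) (obsX w)))); last first.
  by apply/funext => D; exact: psi_IF_raw.
apply: measurable_smean_dep => [|i]; first exact: measurable_D2.
apply: measurable_funM; apply: measurable_funB.
- exact: mA measurable_D2.
- exact: (measurable_est_pair h1 measurable_obsA measurable_D1 (mX i measurable_D2)).
- exact: mY measurable_D2.
- exact: (measurable_est_pair h2 measurable_obsY measurable_D1 (mX i measurable_D2)).
Qed.

Variables C1 C2 : R.
Local Notation A := (@clA R d C1 C2).
Local Notation Y := (@clY R d C1 C2).

Lemma smean_kap m (D : m.-tuple (obs R d)) (f : obs R d -> R) :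
  smean (map_tuple (kap C1 C2) D) f = smean D (fun w => f (kap C1 C2 w)).
Proof. by rewrite /smean; congr (_ * _); apply: eq_bigr => i _; rewrite tnth_map. Qed.

Lemma est_kapA j m (D : m.-tuple (obs R d)) :
  est W (@obsA R d) j (map_tuple (kap C1 C2) D) = est W A j D.
Proof. by apply/funext => x; rewrite /est smean_kap. Qed.

Lemma est_kapY j m (D : m.-tuple (obs R d)) :
  est W (@obsY R d) j (map_tuple (kap C1 C2) D) = est W Y j D.
Proof. by apply/funext => x; rewrite /est smean_kap. Qed.

Lemma cross_kap j m (D : m.-tuple (obs R d)) :
  cross W (@obsA R d) (@obsY R d) j (map_tuple (kap C1 C2) D) = cross W A Y j D.
Proof.
rewrite /cross; congr (_ * _); apply: eq_bigr => i _; apply: eq_bigr => k _.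
by rewrite !tnth_map.
Qed.

Lemma psi_INT_kap (D : data R d n) : psi_INT W j1 j2 (kap3 C1 C2 D) =
  smean D.1.2 (fun w => A w * Y w) - cross W A Y (minn j1 j2) D.1.1.
Proof. by rewrite psi_INT_raw /D1 /D2 /= cross_kap smean_kap. Qed.

Lemma psi_MC_kap (D : data R d n) : psi_MC W j1 j2 (kap3 C1 C2 D) =
  smean D.1.2 (fun w => A w * Y w) -
  smean D.2 (fun w => est W A j1 D.1.1 (obsX w) * est W Y j2 D.1.1 (obsX w)).
Proof. by rewrite psi_MC_raw /D1 /D2 /D3 /= !smean_kap est_kapA est_kapY. Qed.

Lemma psi_IF_kap (D : data R d n) : psi_IF W j1 j2 (kap3 C1 C2 D) =
  smean D.1.2 (fun w => (A w - est W A j1 D.1.1 (obsX w)) *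
                         (Y w - est W Y j2 D.1.1 (obsX w))).
Proof. by rewrite psi_IF_raw /D1 /D2 /= smean_kap est_kapA est_kapY. Qed.

Lemma est_bound (f : obs R d -> R) j (C B : R) : 0 <= C -> 0 <= B ->
  (forall w, `|f w| <= C) -> (forall x y, `|K j x y| <= B) ->
  forall m (D : m.-tuple (obs R d)) x, `|est W f j D x| <= C * B.
Proof.
move=> C0 B0 hC hB m D x; apply: smean_bound; first exact: mulr_ge0.
by move=> w; rewrite normrM ler_pM.
Qed.

Lemma Cm_ge0 : 0 <= clbound C1 C2.
Proof. by rewrite addr_ge0. Qed.

Lemma kernel_ub j : (J0 <= j)%N -> exists B : R, 0 <= B /\ forall x y, `|K j x y| <= B.
Proof.
move=> hj; have [B [B0 hB]] := kernel_bounds hW; exists (B * @resol R d j).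
by split; [rewrite mulr_ge0 ?(ltW B0)// ltW// resol_gt0|case: (hB j hj)].
Qed.

Lemma cross_bound (f g : obs R d -> R) j : (J0 <= j)%N -> bm f -> bm g ->
  exists C : R, forall m (D : m.-tuple (obs R d)), `|cross W f g j D| <= C.
Proof.
move=> hj bf bg; have [Cf [Cf0 hf]] := bm_ub bf; have [Cg [Cg0 hg]] := bm_ub bg.
have [B' [B'0 hB']] := kernel_ub hj.
exists (Cf * B' * (Cg * B')) => m D.
rewrite -[j in cross _ _ _ j _](minnn j) -(dot_est2 hW)//.
have be f' : bm (est W f' j D) := bm_est hW f' D hj.
apply: (le_trans (Ex_abs _ (bmM (be f) (be g)))).
apply: Ex_lec; first exact: bm_norm (bmM (be f) (be g)).
move=> x; rewrite normrM; apply: ler_pM => //.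
  exact: (est_bound (ltW Cf0) B'0 hf hB').
exact: (est_bound (ltW Cg0) B'0 hg hB').
Qed.

Lemma bm_psi_INT : bm (fun D => @psi_INT R d W j1 j2 n (kap3 C1 C2 D)).
Proof.
split; first exact: measurableT_comp measurable_psi_INT (@measurable_kap3 R d C1 C2 n).
have [C hC] := cross_bound h12 (bm_clA C1 C2) (bm_clY C1 C2).
exists (clbound C1 C2 ^+ 2 + C) => D; rewrite psi_INT_kap.
apply: (le_trans (ler_normB _ _)); apply: lerD; last exact: hC.
apply: smean_bound => [|w]; first exact: sqr_ge0.
by rewrite normrM expr2 ler_pM// clamp_le.
Qed.

Lemma bm_psi_MC : bm (fun D => @psi_MC R d W j1 j2 n (kap3 C1 C2 D)).
Proof.
split; first exact: measurableT_comp measurable_psi_MC (@measurable_kap3 R d C1 C2 n).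
have c0 := Cm_ge0; have cA w : `|A w| <= clbound C1 C2 by exact: clamp_le.
have cY w : `|Y w| <= clbound C1 C2 by exact: clamp_le.
have [B1 [B10 hB1]] := kernel_ub h1; have [B2 [B20 hB2]] := kernel_ub h2.
exists (clbound C1 C2 ^+ 2 + clbound C1 C2 * B1 * (clbound C1 C2 * B2)) => D.
rewrite psi_MC_kap; apply: (le_trans (ler_normB _ _)); apply: lerD.
  apply: smean_bound => [|w]; first exact: sqr_ge0.
  by rewrite normrM expr2 ler_pM.
apply: smean_bound => [|w]; first by rewrite !mulr_ge0.
rewrite normrM; apply: ler_pM => //; first exact: (est_bound c0 B10 cA hB1).
exact: (est_bound c0 B20 cY hB2).
Qed.

Lemma bm_psi_IF : bm (fun D => @psi_IF R d W j1 j2 n (kap3 C1 C2 D)).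
Proof.
split; first exact: measurableT_comp measurable_psi_IF (@measurable_kap3 R d C1 C2 n).
have c0 := Cm_ge0; have cA w : `|A w| <= clbound C1 C2 by exact: clamp_le.
have cY w : `|Y w| <= clbound C1 C2 by exact: clamp_le.
have [B1 [B10 hB1]] := kernel_ub h1; have [B2 [B20 hB2]] := kernel_ub h2.
exists ((clbound C1 C2 + clbound C1 C2 * B1) * (clbound C1 C2 + clbound C1 C2 * B2)) => D.
rewrite psi_IF_kap; apply: smean_bound => [|w].
  by rewrite mulr_ge0// addr_ge0// mulr_ge0.
rewrite normrM; apply: ler_pM => //; apply: (le_trans (ler_normB _ _)); apply: lerD => //.
  exact: (est_bound c0 B10 cA hB1).
exact: (est_bound c0 B20 cY hB2).
Qed.

End raw.
End estimator_identities.

(** * Bias of the estimators *)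

Section data_slices.
Context {R : realType} {d : nat}.
Variables (P : probability (obs R d) R) (n : nat).
Local Notation smp := (n.-tuple (obs R d)).

Lemma bm_data2 (F : data R d n -> R) D1 : bm F ->
  bm (fun D2 => Ex (iid P n) (fun D3 => F (D1, D2, D3))).
Proof.
move=> bF; exact: (bm_pair1 D1 (bm_Ex_snd (iid P n \x iid P n)%E (iid P n) bF)).
Qed.

Lemma bm_data1 (F : data R d n -> R) : bm F ->
  bm (fun D1 => Ex (iid P n) (fun D2 => Ex (iid P n) (fun D3 => F (D1, D2, D3)))).
Proof.
move=> bF.
exact: (bm_Ex_snd (iid P n) (iid P n) (bm_Ex_snd (iid P n \x iid P n)%E (iid P n) bF)).
Qed.

Lemma Ex_data_le1 (F : data R d n -> R) (G : smp -> R) : bm F -> bm G ->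
  (forall D1, Ex (iid P n) (fun D2 => Ex (iid P n) (fun D3 => F (D1, D2, D3))) <= G D1) ->
  Ex (data_law P n) F <= Ex (iid P n) G.
Proof.
by move=> bF bG FG; rewrite (Ex_data P bF); apply: Ex_le => //; exact: bm_data1.
Qed.

Lemma bm_D1 (g : smp -> R) : bm g -> bm (fun D : data R d n => g D.1.1).
Proof. by move=> bg; apply: (bm_comp bg); exact: measurable_D1. Qed.

Lemma bm_D2 (g : smp -> R) : bm g -> bm (fun D : data R d n => g D.1.2).
Proof. by move=> bg; apply: (bm_comp bg); exact: measurable_D2. Qed.

Lemma Ex_D1 (g : smp -> R) : bm g ->
  Ex (data_law P n) (fun D => g D.1.1) = Ex (iid P n) g.
Proof.
move=> bg; rewrite (Ex_data P (bm_D1 bg)); apply: eq_Ex => D1 /=.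
by rewrite !Ex_cst.
Qed.

Lemma Ex_D2 (g : smp -> R) : bm g ->
  Ex (data_law P n) (fun D => g D.1.2) = Ex (iid P n) g.
Proof.
move=> bg; rewrite (Ex_data P (bm_D2 bg)) /= Ex_cst.
by apply: eq_Ex => D2; rewrite Ex_cst.
Qed.

End data_slices.

Section estimator_risk.
Context {R : realType} {d J0 S : nat} (W : wavelets R d).
Hypothesis hW : cdv_basis W J0 S.
Local Notation K := (Defs.kernel W).
Variables (C1 C2 : R).
Local Notation A := (@clA R d C1 C2).
Local Notation Y := (@clY R d C1 C2).
Local Notation Cm := (clbound C1 C2).

Let bA : bm A := bm_clA C1 C2.
Let bY : bm Y := bm_clY C1 C2.
Let cA w : `|A w| <= Cm. Proof. exact: clamp_le. Qed.
Let cY w : `|Y w| <= Cm. Proof. exact: clamp_le. Qed.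
Let c0 : 0 <= Cm. Proof. exact: Cm_ge0. Qed.
Let cAY w : `|A w * Y w| <= Cm ^+ 2.
Proof. by rewrite normrM expr2 ler_pM. Qed.

Section one_law.
Variables (P : probability (obs R d) R) (p b : d.-tuple R -> R).
Hypothesis hP : law_spec C1 C2 P p b.

Let bp := ls_p hP.
Let bb := ls_b hP.
Let hX := ls_X hP.
Let hA := ls_A hP.
Let hY := ls_Y hP.

Definition diag_moment j := Ex P (fun w => A w * Y w * K j (obsX w) (obsX w)).
Definition EAY := Ex P (fun w => A w * Y w).

Let bAY : bm (fun w => A w * Y w) := bmM bA bY.

Lemma Ex_est_prod j1 j2 n (D : n.-tuple (obs R d)) : (J0 <= j1)%N -> (J0 <= j2)%N ->
  Ex P (fun w => est W A j1 D (obsX w) * est W Y j2 D (obsX w)) =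
  cross W A Y (minn j1 j2) D.
Proof.
move=> h1 h2; have b1 := bm_est hW A D h1; have b2 := bm_est hW Y D h2.
by rewrite -(dot_est2 hW A Y D h1 h2); exact: (hX (bmM b1 b2)).
Qed.

Lemma Ex_IF_inner j1 j2 n (D : n.-tuple (obs R d)) : (J0 <= j1)%N -> (J0 <= j2)%N ->
  Ex P (fun w => (A w - est W A j1 D (obsX w)) * (Y w - est W Y j2 D (obsX w))) =
  EAY - smean D (fun w => Y w * wproj W j2 p (obsX w)) -
  smean D (fun w => A w * wproj W j1 b (obsX w)) + cross W A Y (minn j1 j2) D.
Proof.
move=> h1 h2; have b1 := bm_est hW A D h1; have b2 := bm_est hW Y D h2.
have b1X := bm_obsX b1; have b2X := bm_obsX b2.
rewrite -(dot_est hW Y D h2 bp) -(dot_est hW A D h1 bb) -Ex_est_prod//.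
rewrite -(hA b2) -(hY b1) /EAY -ExB; [|by bmt..].
rewrite -ExB; [|by bmt..]; rewrite -ExD; [|by bmt..].
by apply: eq_Ex => w; ring.
Qed.

Section expectations.
Variables (j1 j2 n : nat).
Hypotheses (n0 : (0 < n)%N) (h1 : (J0 <= j1)%N) (h2 : (J0 <= j2)%N).
Let h12 : (J0 <= minn j1 j2)%N. Proof. by rewrite leq_min h1. Qed.

Lemma Ex_psi_INT : Ex (data_law P n) (fun D => psi_INT W j1 j2 (kap3 C1 C2 D)) =
  EAY - (n%:R^-1 * diag_moment (minn j1 j2) +
         (1 - n%:R^-1) * dot p (wproj W (minn j1 j2) b)).
Proof.
have bI := bm_psi_INT hW n h1 h2 C1 C2; have bc := bm_cross hW n h12 bA bY.
rewrite (Ex_data P bI) -(Ex_cross hW bA bY bp hA hY n0 h12) -[EAY](Ex_cst (iid P n)).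
rewrite -ExB; [|exact: bm_cst|exact: bc]; apply: eq_Ex => D1.
rewrite -[EAY](Ex_smean P n0 bAY) -[X in _ - X](Ex_cst (iid P n)).
rewrite -ExB; [|exact: bm_smean|exact: bm_cst]; apply: eq_Ex => D2.
by under eq_Ex do rewrite (psi_INT_kap hW h1 h2)/=; rewrite Ex_cst.
Qed.

(** Given the first subsample, the Monte Carlo average is unbiased for the integral. *)
Lemma Ex_psi_MC : Ex (data_law P n) (fun D => psi_MC W j1 j2 (kap3 C1 C2 D)) =
  Ex (data_law P n) (fun D => psi_INT W j1 j2 (kap3 C1 C2 D)).
Proof.
have bI := bm_psi_INT hW n h1 h2 C1 C2; have bC := bm_psi_MC hW n h1 h2 C1 C2.
rewrite (Ex_data P bI) (Ex_data P bC); apply: eq_Ex => D1; apply: eq_Ex => D2.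
under [RHS]eq_Ex do rewrite (psi_INT_kap hW h1 h2)/=.
under eq_Ex do rewrite psi_MC_kap/=.
have b1 := bm_obsX (bm_est hW A D1 h1); have b2 := bm_obsX (bm_est hW Y D1 h2).
rewrite ExB; [|exact: bm_cst|by apply: bm_smean; exact: bmM].
by rewrite Ex_smean// ?Ex_est_prod// ?Ex_cst//; exact: bmM.
Qed.

Lemma bias_INT : Ex (data_law P n) (fun D => psi_INT W j1 j2 (kap3 C1 C2 D)) - psi_fun P =
  dot p b - (1 - n%:R^-1) * dot p (wproj W (minn j1 j2) b) -
  n%:R^-1 * diag_moment (minn j1 j2).
Proof. rewrite Ex_psi_INT (ls_psi hP) -/EAY; ring. Qed.

(** Both sides contain the two projections once: the larger and the smaller resolution
    together are the first and the second. *)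
Lemma dot_proj_maxmin : dot p (wproj W j2 b) + dot b (wproj W j1 p) =
  dot p (wproj W (maxn j1 j2) b) + dot p (wproj W (minn j1 j2) b).
Proof.
rewrite (dot_proj_sym hW h1 bb bp) (dotC (wproj W j1 b)).
case/orP: (leq_total j1 j2) => h.
  by rewrite (maxn_idPr h) (minn_idPl h).
by rewrite (maxn_idPl h) (minn_idPr h) addrC.
Qed.

(** The two linear corrections remove the projection error of the smaller resolution and
    leave that of the larger one. *)
Lemma bias_IF : Ex (data_law P n) (fun D => psi_IF W j1 j2 (kap3 C1 C2 D)) - psi_fun P =
  dot p b - dot p (wproj W (maxn j1 j2) b) -
  n%:R^-1 * dot p (wproj W (minn j1 j2) b) + n%:R^-1 * diag_moment (minn j1 j2).
Proof.
have bI := bm_psi_IF hW n h1 h2 C1 C2; have bc := bm_cross hW n h12 bA bY.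
have bp2 := bm_obsX (bm_proj hW p h2); have bb1 := bm_obsX (bm_proj hW b h1).
have -> : Ex (data_law P n) (fun D => psi_IF W j1 j2 (kap3 C1 C2 D)) =
    EAY - dot b (wproj W j2 p) - dot p (wproj W j1 b) + Ex (iid P n) (cross W A Y (minn j1 j2) (n := n)).
  rewrite -(hY (bm_proj hW p h2)) -(hA (bm_proj hW b h1)).
  rewrite -(Ex_smean P n0 (bmM bY bp2)) -(Ex_smean P n0 (bmM bA bb1)).
  have s1 := bm_smean n (bmM bY bp2); have s2 := bm_smean n (bmM bA bb1).
  rewrite -[EAY](Ex_cst (iid P n)) -ExB; [|by bmt..].
  rewrite -ExB; [|by bmt..]; rewrite -ExD; [|by bmt..].
  rewrite (Ex_data P bI); apply: eq_Ex => D1; rewrite -Ex_IF_inner//.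
  have b1 := bm_obsX (bm_est hW A D1 h1); have b2 := bm_obsX (bm_est hW Y D1 h2).
  rewrite -(Ex_smean P n0 (bmM (bmB bA b1) (bmB bY b2))); apply: eq_Ex => D2.
  by under eq_Ex do rewrite psi_IF_kap/=; rewrite Ex_cst.
rewrite (Ex_cross hW bA bY bp hA hY n0 h12) (ls_psi hP) -/EAY -/(diag_moment _).
rewrite (dot_proj_sym hW h2 bb bp) (dotC (wproj W j2 b)).
rewrite (dot_proj_sym hW h1 bp bb) (dotC (wproj W j1 p)).
have := dot_proj_maxmin => e; move: e; set x1 := dot p _; set x2 := dot b _.
by move=> e; rewrite (_ : x2 = dot p (wproj W (maxn j1 j2) b) + dot p (wproj W (minn j1 j2) b) - x1);
  [ring|rewrite -e; ring].
Qed.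

End expectations.
End one_law.
End estimator_risk.

(** * Mean squared error of the estimators *)

Lemma sqr_le_norm (R : realType) (x C : R) : `|x| <= C -> x ^+ 2 <= C ^+ 2.
Proof.
by move=> h; rewrite -ler_sqrt ?sqr_ge0// !sqrtr_sqr (le_trans h)// ler_norm.
Qed.

Section linear_bound.
Context {disp : measure_display} {T : measurableType disp} {R : realType}.
Variable P : probability T R.

Lemma Ex_le_comb4 (F f1 f2 f3 f4 : T -> R) (a1 a2 a3 a4 t e1 e2 e3 e4 : R) :
  bm F -> bm f1 -> bm f2 -> bm f3 -> bm f4 ->
  0 <= a1 -> 0 <= a2 -> 0 <= a3 -> 0 <= a4 ->
  (forall x, F x <= a1 * f1 x + a2 * f2 x + a3 * f3 x + a4 * f4 x + t) ->
  Ex P f1 <= e1 -> Ex P f2 <= e2 -> Ex P f3 <= e3 -> Ex P f4 <= e4 ->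
  Ex P F <= a1 * e1 + a2 * e2 + a3 * e3 + a4 * e4 + t.
Proof.
move=> bF b1 b2 b3 b4 h1 h2 h3 h4 hF g1 g2 g3 g4.
have c1 := bmM (bm_cst a1) b1; have c2 := bmM (bm_cst a2) b2.
have c3 := bmM (bm_cst a3) b3; have c4 := bmM (bm_cst a4) b4.
have c12 := bmD c1 c2; have c123 := bmD c12 c3; have c1234 := bmD c123 c4.
apply: (le_trans (Ex_le P bF (bmD c1234 (bm_cst t)) hF)).
rewrite (ExD P c1234 (bm_cst t)) (ExD P c123 c4) (ExD P c12 c3) (ExD P c1 c2).
by rewrite Ex_cst !ExZ// !lerD// ler_wpM2l.
Qed.

Lemma Ex_le_comb2 (F f1 f2 : T -> R) (a1 a2 t e1 e2 : R) :
  bm F -> bm f1 -> bm f2 -> 0 <= a1 -> 0 <= a2 ->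
  (forall x, F x <= a1 * f1 x + a2 * f2 x + t) ->
  Ex P f1 <= e1 -> Ex P f2 <= e2 -> Ex P F <= a1 * e1 + a2 * e2 + t.
Proof.
move=> bF b1 b2 h1 h2 hF g1 g2.
have := @Ex_le_comb4 F f1 f2 f1 f1 a1 a2 0 0 t e1 e2 e1 e1 bF b1 b2 b1 b1 h1 h2
  (lexx _) (lexx _).
rewrite !mul0r !addr0; apply => // x.
by rewrite !mul0r !addr0.
Qed.

End linear_bound.

Section upper_bounds.
Context {R : realType} {d J0 S : nat} (W : wavelets R d).

Lemma smean_wproj f h j n (D : n.-tuple (obs R d)) :
  smean D (fun w => f w * wproj W j h (obsX w)) =
  \sum_m coef f m D * dot h (phi W j m) :> R.
Proof.
rewrite /smean /coef /wproj.
under eq_bigr do rewrite mulr_sumr.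
rewrite exchange_big mulr_sumr; apply: eq_bigr => m _.
rewrite -mulrA mulr_suml; congr (_ * _); apply: eq_bigr => i _; ring.
Qed.

Hypothesis hW : cdv_basis W J0 S.
Local Notation K := (Defs.kernel W).
Variables (C1 C2 : R).
Local Notation A := (@clA R d C1 C2).
Local Notation Y := (@clY R d C1 C2).
Local Notation Cm := (clbound C1 C2).

Let bA : bm A := bm_clA C1 C2.
Let bY : bm Y := bm_clY C1 C2.
Let cA w : `|A w| <= Cm. Proof. exact: clamp_le. Qed.
Let cY w : `|Y w| <= Cm. Proof. exact: clamp_le. Qed.
Let C4 : Cm ^+ 4 = Cm ^+ 2 * Cm ^+ 2. Proof. by rewrite -exprD. Qed.
Let c0 : 0 <= Cm. Proof. exact: Cm_ge0. Qed.
Let cAY w : `|A w * Y w| <= Cm ^+ 2.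
Proof. by rewrite normrM expr2 ler_pM. Qed.

Variables (P : probability (obs R d) R) (p b : d.-tuple R -> R).
Hypothesis hP : law_spec C1 C2 P p b.

Let bp := ls_p hP.
Let bb := ls_b hP.
Let hX := ls_X hP.
Let hA := ls_A hP.
Let hY := ls_Y hP.
Let bAY : bm (fun w => A w * Y w) := bmM bA bY.

Variables (n : nat).
Hypothesis n0 : (0 < n)%N.
Let n0' : 0 < n%:R :> R. Proof. by rewrite ltr0n. Qed.

Lemma smean_AY_mse :
  Ex (iid P n) (fun D => (smean D (fun w => A w * Y w) - EAY C1 C2 P) ^+ 2) <=
  n%:R^-1 * Cm ^+ 4.
Proof.
apply: (le_trans (Ex_smean_mse P _ n0 bAY)).
rewrite subrr expr0n add0r ler_wpM2l ?invr_ge0//.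
apply: Ex_lec => [|w]; first by bmt.
by rewrite (_ : Cm ^+ 4 = (Cm ^+ 2) ^+ 2) ?(sqr_le_norm (cAY w))// -exprM.
Qed.

Section plugin.
Variables (j : nat) (B T : R).
Hypotheses (hj : (J0 <= j)%N) (B0 : 0 < B)
  (hB : forall x y, `|K j x y| <= B)
  (hT : `|dot p b - dot p (wproj W j b)| <= T).

Let V : R := 2 * (Cm ^+ 2 * (B + 1)) / n%:R.

(** The error of [cross] splits into two linear statistics [x1] and [x2], the product
    [x3] of the two estimation errors and the approximation error; [x3] is bounded by
    the fourth moments of the norms. *)
Lemma cross_mse :
  Ex (iid P n) (fun D => (cross W A Y j D - dot p b) ^+ 2) <=
  8 * (n%:R^-1 * Cm ^+ 4) + 12 * V ^+ 2 + 4 * T ^+ 2.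
Proof.
pose a m := dot p (phi W j m); pose c m := dot b (phi W j m).
pose Na (D : n.-tuple (obs R d)) := \sum_m (coef A m D - a m) ^+ 2.
pose Nc (D : n.-tuple (obs R d)) := \sum_m (coef Y m D - c m) ^+ 2.
pose x1 (D : n.-tuple (obs R d)) :=
  smean D (fun w => A w * wproj W j b (obsX w)) - dot p (wproj W j b).
pose x2 (D : n.-tuple (obs R d)) :=
  smean D (fun w => Y w * wproj W j p (obsX w)) - dot b (wproj W j p).
pose x3 (D : n.-tuple (obs R d)) := \sum_m (coef A m D - a m) * (coef Y m D - c m).
have bwp := bm_proj hW p hj; have bwb := bm_proj hW b hj.
have bwpX := bm_obsX bwp; have bwbX := bm_obsX bwb.
have bcA m := bm_coef hW m n hj bA; have bcY m := bm_coef hW m n hj bY.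
have bx1 : bm x1 by apply: bmB; [apply: bm_smean; exact: bmM|exact: bm_cst].
have bx2 : bm x2 by apply: bmB; [apply: bm_smean; exact: bmM|exact: bm_cst].
have bx3 : bm x3.
  by apply: bm_sum => m; apply: bmM; apply: bmB => //; exact: bm_cst.
have bNa : bm Na by apply: bm_sum => m; apply: bmX; apply: bmB => //; exact: bm_cst.
have bNc : bm Nc by apply: bm_sum => m; apply: bmX; apply: bmB => //; exact: bm_cst.
have E D : cross W A Y j D - dot p b = x1 D + x2 D + x3 D - (dot p b - dot p (wproj W j b)).
  rewrite cross_coef /x1 /x2 /x3 !smean_wproj !(dot_proj hW)//.
  rewrite (_ : \sum_m coef A m D * coef Y m D =
     \sum_m coef A m D * c m + \sum_m coef Y m D * a m
     - \sum_m c m * a m + \sum_m (coef A m D - a m) * (coef Y m D - c m)).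
    rewrite (_ : \sum_m dot p (phi W j m) * dot b (phi W j m) = \sum_m c m * a m).
      by rewrite /a /c; ring.
    by apply: eq_bigr => m _; rewrite mulrC.
  by rewrite -!big_split/= -sumrB -!big_split/=; apply: eq_bigr => m _; ring.
have x3N D : x3 D ^+ 2 <= 2^-1 * (Na D ^+ 2 + Nc D ^+ 2).
  apply: (le_trans (sum_CS _ _)); rewrite -/(Na D) -/(Nc D).
  by have := sqr_ge0 (Na D - Nc D) => ?; lra.
have pw D : (cross W A Y j D - dot p b) ^+ 2 <=
    4 * x1 D ^+ 2 + 4 * x2 D ^+ 2 + 2 * (Na D ^+ 2 + Nc D ^+ 2) + 4 * T ^+ 2.
  rewrite E; have := x3N D; have := sqr_le_norm hT.
  move: (x1 D) (x2 D) (x3 D) (dot p b - _) => y1 y2 y3 y4 h3 h4.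
  have := sqr_ge0 (y1 - y2); have := sqr_ge0 (y1 - y3); have := sqr_ge0 (y1 + y4).
  have := sqr_ge0 (y2 - y3); have := sqr_ge0 (y2 + y4); have := sqr_ge0 (y3 + y4).
  by move=> *; nra.
have bcr := bm_cross hW n hj bA bY.
have h1 : Ex (iid P n) (fun D => x1 D ^+ 2) <= n%:R^-1 * Cm ^+ 4.
  apply: (le_trans (smean_linear_mse bA hX hA n0 bwb cA)).
  rewrite C4 ler_wpM2l ?invr_ge0// ler_wpM2l ?sqr_ge0//.
  rewrite (dot_proj_proj hW)//.
  exact: (le_trans (dot_proj_le hW hj bb) (Ex_pf_sqr bY bb hX hY cY)).
have h2 : Ex (iid P n) (fun D => x2 D ^+ 2) <= n%:R^-1 * Cm ^+ 4.
  apply: (le_trans (smean_linear_mse bY hX hY n0 bwp cY)).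
  rewrite C4 ler_wpM2l ?invr_ge0// ler_wpM2l ?sqr_ge0//.
  rewrite (dot_proj_proj hW)//.
  exact: (le_trans (dot_proj_le hW hj bp) (Ex_pf_sqr bA bp hX hA cA)).
have [_ h3] := centred_coef_norm hW bA bp hX hA n0 hj cA hB.
have [_ h4] := centred_coef_norm hW bY bb hX hY n0 hj cY hB.
have h3' : Ex (iid P n) (fun D => Na D ^+ 2) <= 3 * V ^+ 2 := h3.
have h4' : Ex (iid P n) (fun D => Nc D ^+ 2) <= 3 * V ^+ 2 := h4.
have bF : bm (fun D : n.-tuple (obs R d) => (cross W A Y j D - dot p b) ^+ 2).
  by apply: bmX; apply: bmB => //; exact: bm_cst.
have := @Ex_le_comb4 _ _ _ (iid P n) _ _ _ _ _ 4 4 2 2 (4 * T ^+ 2) _ _ _ _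
  bF (bmX 2 bx1) (bmX 2 bx2) (bmX 2 bNa) (bmX 2 bNc) (ler0n _ _) (ler0n _ _)
  (ler0n _ _) (ler0n _ _) _ h1 h2 h3' h4'.
have pw' D : (cross W A Y j D - dot p b) ^+ 2 <=
    4 * x1 D ^+ 2 + 4 * x2 D ^+ 2 + 2 * Na D ^+ 2 + 2 * Nc D ^+ 2 + 4 * T ^+ 2.
  by apply: (le_trans (pw D)); rewrite [2 * (_ + _)]mulrDr !addrA.
move=> /(_ pw') H; apply: (le_trans H); rewrite le_eqVlt; apply/orP; left; apply/eqP.
move: (n%:R^-1 * Cm ^+ 4) (V ^+ 2) (T ^+ 2) => y1 y2 y3; ring.
Qed.

Lemma psi_INT_mse :
  Ex (data_law P n) (fun D => (psi_INT W j j (kap3 C1 C2 D) - psi_fun P) ^+ 2) <=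
  18 * (n%:R^-1 * Cm ^+ 4) + 24 * V ^+ 2 + 8 * T ^+ 2.
Proof.
pose g1 (D : n.-tuple (obs R d)) := (smean D (fun w => A w * Y w) - EAY C1 C2 P) ^+ 2.
pose g2 (D : n.-tuple (obs R d)) := (cross W A Y j D - dot p b) ^+ 2.
have bg1 : bm g1 by apply: bmX; apply: bmB; [exact: bm_smean|exact: bm_cst].
have bg2 : bm g2 by apply: bmX; apply: bmB; [exact: (bm_cross hW)|exact: bm_cst].
have bI := bm_psi_INT hW n hj hj C1 C2.
have b1 := bm_D2 bg1; have b2 := bm_D1 bg2.
have bF : bm (fun D : data R d n => (psi_INT W j j (kap3 C1 C2 D) - psi_fun P) ^+ 2).
  by apply: bmX; apply: bmB => //; exact: bm_cst.
have h1 : Ex (data_law P n) (fun D => g1 D.1.2) <= n%:R^-1 * Cm ^+ 4.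
  by rewrite (Ex_D2 P bg1); exact: smean_AY_mse.
have h2 : Ex (data_law P n) (fun D => g2 D.1.1) <=
    8 * (n%:R^-1 * Cm ^+ 4) + 12 * V ^+ 2 + 4 * T ^+ 2.
  by rewrite (Ex_D1 P bg2); exact: cross_mse.
apply: (le_trans (Ex_le_comb2 (a1 := 2) (a2 := 2) (t := 0) bF b1 b2 _ _ _ h1 h2)) => //.
  move=> D; rewrite (psi_INT_kap hW hj hj) minnn (ls_psi hP) -/(EAY C1 C2 P) /g1 /g2.
  move: (smean _ _) (EAY _ _ _) (cross _ _ _ _ _) (dot p b) => y1 y2 y3 y4.
  by have := sqr_ge0 ((y1 - y2) + (y3 - y4)) => ?; nra.
by lra.
Qed.

Variable B1 : R.
Hypotheses (B10 : 0 < B1) (hBB : B <= n%:R * B1)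
  (hB1 : forall x, Ex (unif d) (fun y => `|K j x y|) <= B1).

(** The kernel has bounded mass, so the estimate at a point is dominated by an average
    of nonnegative variables with bounded mean, to which [smean_fourth_moment] applies. *)
Lemma est_fourth (f : obs R d -> R) x : bm f -> (forall w, `|f w| <= Cm) ->
  Ex (iid P n) (fun D => est W f j D x ^+ 4) <=
  4 ^+ 4 * (2 * (Cm * B1 + 1)) ^+ 4 * expR 2.
Proof.
move=> bf cf; pose h w := `|f w * K j (obsX w) x|.
have bk : bm (fun y => K j y x) by apply: bm_sum => m; apply: bmM; [exact: (bm_phi hW)|exact: bm_cst].
have bfk := bmM bf (bm_obsX bk).
have bh : bm h by exact: bm_norm.
set c : R := 2 * (Cm * B1 + 1).
have CB : 0 <= Cm * B1 by rewrite mulr_ge0// ltW.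
have c0' : 0 < c by rewrite /c; lra.
have be : bm (fun D : n.-tuple (obs R d) => est W f j D x) by exact: bm_smean.
apply: (@le_trans _ _ (Ex (iid P n) (fun D => smean D h ^+ 4))).
  apply: Ex_le; [exact: bmX|by apply: bmX; exact: bm_smean|] => D.
  rewrite (_ : est W f j D x ^+ 4 = `|est W f j D x| ^+ 4); last first.
    by rewrite -[in RHS]normrX ger0_norm// (_ : 4 = 2 * 2)%N// exprM sqr_ge0.
  have hle : `|est W f j D x| <= smean D h.
    have ni : 0 <= n%:R^-1 :> R by rewrite invr_ge0.
    rewrite /est /smean normrM (ger0_norm ni); apply: ler_wpM2l => //.
    exact: ler_norm_sum.
  have s0 : 0 <= smean D h := le_trans (normr_ge0 _) hle.
  by apply: lerXn2r hle; rewrite nnegrE.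
apply: smean_fourth_moment => //.
  move=> w; rewrite normr_ge0/=.
  apply: (@le_trans _ _ (Cm * B)); first by rewrite /h normrM ler_pM.
  have : Cm * B <= Cm * (n%:R * B1) by rewrite ler_wpM2l.
  have := n0'; rewrite /c; nra.
apply: (@le_trans _ _ (Ex P (fun w => Cm * `|K j (obsX w) x|))).
  have bkX := bm_norm (bm_obsX bk).
  apply: Ex_le => //; first by bmt.
  by move=> w; rewrite /h normrM ler_wpM2r.
rewrite ExZ; last exact: bm_norm (bm_obsX bk).
rewrite (hX (bm_norm bk)).
apply: (@le_trans _ _ (Cm * B1)); last by rewrite /c; lra.
rewrite ler_wpM2l// (le_trans _ (hB1 x))// le_eqVlt; apply/orP; left; apply/eqP.
by apply: eq_Ex => y; rewrite kernelC.
Qed.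

(** Given the first subsample the MC estimator differs from the INT estimator by a
    centred average, with variance [1 / n] times the second moment of the product of
    the estimates. *)
Lemma psi_MC_mse :
  Ex (data_law P n) (fun D => (psi_MC W j j (kap3 C1 C2 D) - psi_fun P) ^+ 2) <=
  2 * (18 * (n%:R^-1 * Cm ^+ 4) + 24 * V ^+ 2 + 8 * T ^+ 2) +
  2 * (n%:R^-1 * (4 ^+ 4 * (2 * (Cm * B1 + 1)) ^+ 4 * expR 2)).
Proof.
have bI := bm_psi_INT hW n hj hj C1 C2; have bC := bm_psi_MC hW n hj hj C1 C2.
set E4 := 4 ^+ 4 * _ * _.
pose F1 (D : data R d n) := (psi_INT W j j (kap3 C1 C2 D) - psi_fun P) ^+ 2.
pose F2 (D : data R d n) :=
  (psi_INT W j j (kap3 C1 C2 D) - psi_MC W j j (kap3 C1 C2 D)) ^+ 2.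
have bF1 : bm F1 by apply: bmX; apply: bmB => //; exact: bm_cst.
have bF2 : bm F2 by apply: bmX; exact: bmB.
have bF : bm (fun D : data R d n => (psi_MC W j j (kap3 C1 C2 D) - psi_fun P) ^+ 2).
  by apply: bmX; apply: bmB => //; exact: bm_cst.
suff h2 : Ex (data_law P n) F2 <= n%:R^-1 * E4.
  apply: (le_trans (Ex_le_comb2 (a1 := 2) (a2 := 2) (t := 0) bF bF1 bF2 _ _ _ psi_INT_mse h2)) => //.
    move=> D; rewrite /F1 /F2 addr0.
    move: (psi_MC _ _ _ _) (psi_INT _ _ _ _) (psi_fun _) => y1 y2 y3.
    by have := sqr_ge0 ((y2 - y3) + (y2 - y1)) => ?; nra.
  by rewrite addr0.
pose q (D1 : n.-tuple (obs R d)) x := est W A j D1 x * est W Y j D1 x.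
have bq D1 : bm (q D1) by apply: bmM; exact: (bm_est hW).
have bq2 : bm (fun z : n.-tuple (obs R d) * d.-tuple R => q z.1 z.2 ^+ 2).
  by apply: bmX; apply: bmM; exact: (bm_est_pair hW).
apply: (@le_trans _ _ (Ex (iid P n) (fun D1 => n%:R^-1 * Ex (unif d) (fun x => q D1 x ^+ 2)))).
  apply: Ex_data_le1 => //.
    by apply: bmM; [exact: bm_cst|exact: (bm_Ex_snd (iid P n) (unif d) bq2)].
  move=> D1; apply: Ex_lec; first exact: bm_data2.
  move=> D2; apply: (@le_trans _ _ (Ex (iid P n) (fun D3 =>
     (smean D3 (fun w => q D1 (obsX w)) - cross W A Y j D1) ^+ 2))).
    rewrite le_eqVlt; apply/orP; left; apply/eqP; apply: eq_Ex => D3.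
    rewrite /F2 (psi_INT_kap hW hj hj) psi_MC_kap/= minnn.
    by congr (_ ^+ 2); rewrite /q; ring.
  have bqX := bm_obsX (bq D1).
  apply: (le_trans (Ex_smean_mse P _ n0 bqX)).
  rewrite (_ : Ex P _ = cross W A Y j D1); last first.
    by rewrite (Ex_est_prod hW hP D1 hj hj) minnn.
  rewrite subrr expr0n add0r ler_wpM2l ?invr_ge0//.
  by rewrite (hX (bmX 2 (bq D1))).
rewrite ExZ; last exact: (bm_Ex_snd (iid P n) (unif d) bq2).
rewrite ler_wpM2l ?invr_ge0// (Ex_swap (iid P n) (unif d) bq2).
apply: Ex_lec; first exact: (bm_Ex_fst (iid P n) (unif d) bq2).
move=> x; have bAx := bm_estX hW n x hj bA; have bYx := bm_estX hW n x hj bY.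
apply: (le_trans (Ex_le_comb2 (a1 := 2^-1) (a2 := 2^-1) (t := 0) (bm_pair2 x bq2)
   (bmX 4 bAx) (bmX 4 bYx) _ _ _ (est_fourth x bA cA) (est_fourth x bY cY))) => //.
  move=> D; rewrite /q /= exprMn addr0.
  have := sqr_ge0 (est W A j D x ^+ 2 - est W Y j D x ^+ 2).
  rewrite sqrrB -!exprM => h; move: h; rewrite mulr2n; lra.
rewrite -/E4; lra.
Qed.

End plugin.

Section first_order.
Variables (j0 j : nat) (B0 T Ck : R).
Hypotheses (hj0 : (J0 <= j0)%N) (hj : (j0 <= j)%N) (B00 : 0 < B0)
  (hB0 : forall x y, `|K j0 x y| <= B0)
  (hCk : #|idx W j|%:R <= Ck)
  (hT : `|dot p b - dot p (wproj W j b)| <= T).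
Let hj' : (J0 <= j)%N := leq_trans hj0 hj.

(** Because the coarse estimate of [p] stays bounded, the product of the two estimation
    errors is of order [n ^ (-1/2)]; only the variance of the fine estimate of [b] sees
    the larger resolution, divided by [n ^ 2]. *)
Lemma psi_IF_mse :
  Ex (data_law P n) (fun D => (psi_IF W j0 j (kap3 C1 C2 D) - psi_fun P) ^+ 2) <=
  3 * T ^+ 2 + 3 * (n%:R^-1 * Cm ^+ 4) +
  3 * ((Cm * B0) ^+ 2 * (2 * (Cm ^+ 2 * (B0 + 1)) / n%:R)) +
  n%:R^-1 * ((Cm + Cm * B0) ^+ 2 *
    (2 * (Cm ^+ 2 + (n%:R^-1 * (Cm ^+ 2 * Ck) + Cm ^+ 2)))).
Proof.
pose Nc (D : n.-tuple (obs R d)) := \sum_m (coef Y m D - dot b (phi W j0 m)) ^+ 2.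
pose x2 (D : n.-tuple (obs R d)) :=
  smean D (fun w => Y w * wproj W j p (obsX w)) - dot b (wproj W j p).
have bwp := bm_proj hW p hj'; have bwpX := bm_obsX bwp.
have bcY m := bm_coef hW m n hj0 bY.
have bx2 : bm x2 by apply: bmB; [apply: bm_smean; exact: bmM|exact: bm_cst].
have bNc : bm Nc by apply: bm_sum => m; apply: bmX; apply: bmB => //; exact: bm_cst.
have bYY := bm_cross hW n hj' bY bY.
have CB0 : 0 <= Cm * B0 by rewrite mulr_ge0// ltW.
have mn : minn j0 j = j0 by exact/minn_idPl.
have mnj : minn j j = j by exact: minnn.
pose G (D : n.-tuple (obs R d)) := 3 * T ^+ 2 + 3 * x2 D ^+ 2 + 3 * ((Cm * B0) ^+ 2 * Nc D) +
  n%:R^-1 * ((Cm + Cm * B0) ^+ 2 * (2 * (Cm ^+ 2 + cross W Y Y j D))).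
have bG : bm G by bmt.
have bI := bm_psi_IF hW n hj0 hj' C1 C2.
apply: (@le_trans _ _ (Ex (iid P n) G)).
  apply: Ex_data_le1 => //; first by apply: bmX; apply: bmB => //; exact: bm_cst.
  move=> D.
  pose g w := (A w - est W A j0 D (obsX w)) * (Y w - est W Y j D (obsX w)).
  have be1 := bm_est hW A D hj0; have be2 := bm_est hW Y D hj'.
  have be1X := bm_obsX be1; have be2X := bm_obsX be2.
  have bg : bm g by bmt.
  have e1B x : `|est W A j0 D x| <= Cm * B0.
    exact: (est_bound c0 (ltW B00) cA hB0).
  apply: (@le_trans _ _ (Ex (iid P n) (fun D2 => (smean D2 g - psi_fun P) ^+ 2))).
    rewrite le_eqVlt; apply/orP; left; apply/eqP; apply: eq_Ex => D2.
    by under eq_Ex do rewrite psi_IF_kap/=; rewrite Ex_cst.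
  apply: (le_trans (Ex_smean_mse P _ n0 bg)); apply: lerD.
    rewrite (Ex_IF_inner hW hP D hj0 hj') mn (ls_psi hP) -/(EAY C1 C2 P).
    pose x3 := \sum_m coef A m D * (coef Y m D - dot b (phi W j0 m)).
    have -> : EAY C1 C2 P - smean D (fun w => Y w * wproj W j p (obsX w)) -
      smean D (fun w => A w * wproj W j0 b (obsX w)) + cross W A Y j0 D -
      (EAY C1 C2 P - dot p b) = (dot p b - dot p (wproj W j b)) - x2 D + x3.
      have -> : x3 = \sum_(m : idx W j0) coef A m D * coef Y m D -
          \sum_(m : idx W j0) coef A m D * dot b (phi W j0 m).
        by rewrite -sumrB; apply: eq_bigr => m _; rewrite mulrBr.
      rewrite /x2 (dot_proj_sym hW hj' bb bp) (dotC (wproj W j b)).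
      rewrite (smean_wproj A) cross_coef.
      by ring.
    have h3 : x3 ^+ 2 <= (Cm * B0) ^+ 2 * Nc D.
      apply: (le_trans (sum_CS _ _)); rewrite -/(Nc D) ler_wpM2r//.
        by apply: sumr_ge0 => m _; exact: sqr_ge0.
      rewrite (_ : \sum_m coef A m D ^+ 2 = cross W A A j0 D); last first.
        by rewrite cross_coef; apply: eq_bigr => m _; rewrite expr2.
      rewrite -[in X in cross _ _ _ X _](minnn j0) -(dot_est2 hW A A D hj0 hj0).
      apply: Ex_lec; first exact: bmM.
      by move=> x; rewrite -expr2; exact: sqr_le_norm.
    have hT2 := sqr_le_norm hT; move: h3 hT2.
    move: (_ - dot p (wproj W j b)) (x2 D) x3 => y1 y2 y3 h3 h4.
    have := sqr_ge0 (y1 + y2); have := sqr_ge0 (y1 - y3); have := sqr_ge0 (y2 + y3).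
    by move=> *; nra.
  rewrite ler_wpM2l ?invr_ge0//.
  have b2sq : bm (fun w => est W Y j D (obsX w) ^+ 2) by exact: bmX.
  apply: (@le_trans _ _ (Ex P (fun w => (Cm + Cm * B0) ^+ 2 *
     (2 * (Cm ^+ 2 + est W Y j D (obsX w) ^+ 2))))).
    apply: Ex_le; [by bmt|by bmt|] => w; rewrite exprMn; apply: ler_pM; rewrite ?sqr_ge0//.
      by apply: sqr_le_norm; apply: (le_trans (ler_normB _ _)); exact: lerD.
    have := sqr_le_norm (cY w); have := sqr_ge0 (Y w + est W Y j D (obsX w)).
    by move=> *; nra.
  rewrite ExZ; last by bmt.
  rewrite ExZ; last by bmt.
  rewrite ExD; [|by bmt..]; rewrite Ex_cst.
  rewrite le_eqVlt; apply/orP; left; apply/eqP; congr (_ * (_ * (_ + _))).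
  rewrite -[in RHS]mnj -(dot_est2 hW Y Y D hj' hj').
  rewrite (hX (bmX 2 be2)); apply: eq_Ex => x; exact: expr2.
have h2 : Ex (iid P n) (fun D => x2 D ^+ 2) <= n%:R^-1 * Cm ^+ 4.
  apply: (le_trans (smean_linear_mse bY hX hY n0 bwp cY)).
  rewrite C4 ler_wpM2l ?invr_ge0// ler_wpM2l ?sqr_ge0//.
  rewrite (dot_proj_proj hW)//.
  exact: (le_trans (dot_proj_le hW hj' bp) (Ex_pf_sqr bA bp hX hA cA)).
have [h3 _] := centred_coef_norm hW bY bb hX hY n0 hj0 cY hB0.
have h4 : Ex (iid P n) (fun D => cross W Y Y j D) <= n%:R^-1 * (Cm ^+ 2 * Ck) + Cm ^+ 2.
  rewrite (Ex_cross hW bY bY bb hY hY n0 hj'); apply: lerD.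
    rewrite ler_wpM2l ?invr_ge0//; apply: (le_trans (ler_norm _)).
    apply: (@le_trans _ _ (Cm ^+ 2 * #|idx W j|%:R)); last by rewrite ler_wpM2l ?sqr_ge0.
    apply: (Ex_kernel_diagX hW bY bY hX hj') => w.
    by rewrite normrM expr2 ler_pM.
  have h5 := le_trans (dot_proj_le hW hj' bb) (Ex_pf_sqr bY bb hX hY cY).
  have h6 : 0 <= dot b (wproj W j b).
    by rewrite -(dot_proj_proj hW)//; exact: dot_ge0.
  have h7 : 0 <= n%:R^-1 :> R by rewrite invr_ge0.
  have h8 : n%:R^-1 <= 1 :> R by rewrite invf_le1// ler1n.
  nra.
have n10 : 0 <= n%:R^-1 :> R by rewrite invr_ge0.
have q0 : 0 <= n%:R^-1 * ((Cm + Cm * B0) ^+ 2 * 2).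
  by rewrite mulr_ge0// mulr_ge0// sqr_ge0.
have q1 : 0 <= 3 * (Cm * B0) ^+ 2 by rewrite mulr_ge0// sqr_ge0.
pose t := 3 * T ^+ 2 + n%:R^-1 * ((Cm + Cm * B0) ^+ 2 * 2) * Cm ^+ 2.
apply: (le_trans (Ex_le_comb4 (a1 := 3) (a2 := 3 * (Cm * B0) ^+ 2)
  (a3 := n%:R^-1 * ((Cm + Cm * B0) ^+ 2 * 2)) (a4 := 0) (t := t)
  bG (bmX 2 bx2) bNc bYY bYY _ q1 q0 _ _ h2 h3 h4 h4)) => //.
  by move=> D; rewrite /G /t le_eqVlt; apply/orP; left; apply/eqP; ring.
by rewrite /t le_eqVlt; apply/orP; left; apply/eqP; ring.
Qed.

End first_order.

End upper_bounds.

(** * The interior of the class *)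

Section law_spec_ext.
Context {R : realType} {d : nat}.

Lemma law_spec_ext C1 C2 (P : probability (obs R d) R) p b p' b' :
  law_spec C1 C2 P p b -> bm p' -> bm b' ->
  (forall h, bm h -> dot p h = dot p' h) -> (forall h, bm h -> dot b h = dot b' h) ->
  law_spec C1 C2 P p' b'.
Proof.
move=> [bp bb hc hX hA hY hpsi] bp' bb' hp hb; split => //.
- by move=> h bh; rewrite hA// hp.
- by move=> h bh; rewrite hY// hb.
- by rewrite hpsi hp// dotC hb// dotC.
Qed.

End law_spec_ext.

Section base_point.
Context {R : realType} {d J0 S : nat} (W : wavelets R d).
Hypothesis hW : cdv_basis W J0 S.
Hypothesis hS : (1 <= S)%N.
Variables (C1 C2 alpha beta M : R).
Hypothesis C12 : C1 < C2.

(** Coefficient bounds leaving room g for perturbing the details. *)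
Definition interior_coefs (s g : R) (h : d.-tuple R -> R) := exists B, [/\ 0 <= B,
    forall m, 2 `^ (J0%:R * (s + d%:R / 2)) * `|dot (cutoff h) (phi W J0 m)| <= B &
    forall l, (J0 <= l)%N -> forall i m,
      2 `^ (l%:R * (s + d%:R / 2)) * `|dot (cutoff h) (psi W l i m)| <= M - B - g].

(** Constants lie in the coarsest space. *)
Lemma cst_psi0 l i m : (J0 <= l)%N ->
  dot (cutoff (fun _ : d.-tuple R => 1)) (psi W l i m) = 0.
Proof.
move=> hl; have [|f vf f1] := cdv_polynomials hW (leqnn J0) (a := [ffun => 0%N]).
  by rewrite big1// => r _; rewrite ffunE.
rewrite -(in_V_psi hW i m (leqnn J0) hl vf).
have bf := bm_in_V hW (leqnn J0) vf; have bps := bm_psi hW i m hl.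
have b1 : bm (cutoff (fun _ : d.-tuple R => 1)) by apply: bmM; [exact: bm_cube|exact: bm_cst].
rewrite /dot -!ipE//; apply: eq_ip => x cx //.
by rewrite cutoff_in// f1// big1// => r _; rewrite ffunE expr0.
Qed.

Definition nneg_part (x : R) := Num.max x 0.

Lemma bm_nneg_part d' (T : measurableType d') (f : T -> R) : bm f ->
  bm (fun x => nneg_part (f x)).
Proof.
move=> [mf [C hC]]; split; first by apply: measurable_maxr => //; exact: measurable_cst.
exists C => x; rewrite /nneg_part; have := hC x; case: (leP (f x) 0) => h // h2.
by rewrite normr0; apply: le_trans h2.
Qed.

(** The regression function of a variable in [C1, C2] lies in [C1, C2] almost everywhere:
    test it on the set where it does not. *)
Lemma law_range (P : probability (obs R d) R) p (f : obs R d -> R) : bm p -> bm f ->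
  (forall w, C1 <= f w <= C2) ->
  (forall h, bm h -> Ex P (fun w => h (obsX w)) = Ex (unif d) h) ->
  (forall h, bm h -> Ex P (fun w => f w * h (obsX w)) = dot p h) ->
  Ex (unif d) (fun x => nneg_part (p x - C2)) = 0 /\
  Ex (unif d) (fun x => nneg_part (C1 - p x)) = 0.
Proof.
move=> bp bf fC hX hf.
have key (s c : R) (sf : forall w, s * f w <= c) :
    Ex (unif d) (fun x => nneg_part (s * p x - c)) = 0.
  pose h x : R := (0 <= s * p x - c)%R%:R.
  have bh : bm h.
    split; last by exists 1 => x; rewrite /h; case: (0 <= s * p x - c); rewrite ?normr1 ?normr0.
    have mA : measurable [set x | 0 <= s * p x - c].
      have bg : bm (fun x => s * p x - c).
        by apply: bmB; [apply: bmM => //; exact: bm_cst|exact: bm_cst].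
      rewrite (_ : [set x | _] = setT `&` (fun x => s * p x - c) @^-1` `[0, +oo[%classic).
        by apply: (bm_meas bg) => //; exact: measurable_itv.
      by apply/seteqP; split => x /=; rewrite in_itv/= andbT; [|case].
    rewrite (_ : h = \1_[set x | 0 <= s * p x - c]); first exact: measurable_indic.
    by apply/funext => x; rewrite indicE /h; congr (_%:R); congr nat_of_bool;
      apply/idP/idP; rewrite inE.
  have E x : nneg_part (s * p x - c) = s * (p x * h x) - c * h x.
    by rewrite /nneg_part /h; case: (leP 0 (s * p x - c)) => /= _; ring.
  apply/eqP; rewrite eq_le; apply/andP; split; last first.
    by apply: Ex_ge0 => x; rewrite /nneg_part le_max lexx orbT.
  have bhX := bm_obsX bh; have bph := bmM bp bh.
  rewrite (eq_Ex _ E) ExB; [|exact: (bmM (bm_cst s) bph)|exact: (bmM (bm_cst c) bh)].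
  have bfh := bmM bf bhX.
  rewrite !ExZ// -[Ex _ (fun x => p x * h x)](hf _ bh) -(hX _ bh) -!ExZ//.
  rewrite -ExB; [|exact: (bmM (bm_cst s) bfh)|exact: (bmM (bm_cst c) bhX)].
  rewrite -(Ex_cst P 0); apply: Ex_le; [|exact: bm_cst|].
    by apply: bmB; [exact: (bmM (bm_cst s) bfh)|exact: (bmM (bm_cst c) bhX)].
  move=> w; rewrite mulrA -mulrBl mulr_le0_ge0//; first by rewrite subr_le0.
split.
  rewrite -(key 1 C2); last by move=> w; rewrite mul1r; case/andP: (fC w).
  by apply: eq_Ex => x; rewrite mul1r.
rewrite -(key (-1) (- C1)); last by move=> w; rewrite mulN1r lerN2; case/andP: (fC w).
by apply: eq_Ex => x; congr nneg_part; ring.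
Qed.

Lemma clamp_range a : C1 <= clamp C1 C2 a <= C2.
Proof.
by rewrite /clamp le_max lexx/= ge_max (ltW C12)/= ge_min lexx orbT.
Qed.

(** Shrinking a regression function slightly towards the constant (C1 + C2) / 2
    moves it to the interior of both constraints: constants have no details, and the
    slack [M - M'] pays for the coarse coefficients. *)
Lemma interior_point (s M' : R) h (P : probability (obs R d) R) (f : obs R d -> R) :
  M' < M -> holder_ball W J0 s M' h -> bm f -> (forall w, C1 <= f w <= C2) ->
  (forall h, bm h -> Ex P (fun w => h (obsX w)) = Ex (unif d) h) ->
  (forall k, bm k -> Ex P (fun w => f w * k (obsX w)) = dot (cutoff h) k) ->
  exists dl0 g0, [/\ 0 < dl0, 0 < g0 & forall dl, 0 < dl -> dl <= dl0 ->
  exists h0 H0, [/\ ucont_cube h0, interior_coefs s g0 h0, bm H0,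
    forall x, C1 + dl <= H0 x <= C2 - dl &
    forall k, bm k -> dot H0 k = dot (cutoff h0) k]].
Proof.
move=> MM hh bf fC hX hf.
have [uh [B [B0 hB hM]]] := (holder_ballP hW _ _ _).1 hh.
have bh := bm_ucont uh.
have [r1 r2] := law_range bh bf fC hX hf.
pose c := (C1 + C2) / 2.
pose one := cutoff (fun _ : d.-tuple R => 1 : R).
have b1 : bm one by apply: bmM; [exact: bm_cube|exact: bm_cst].
set tt := 2 `^ (J0%:R * (s + d%:R / 2)) in hB *.
have tt0 : 0 < tt by exact: powR_gt0.
pose N := tt * \sum_m `|dot one (phi W J0 m)|.
have N0 : 0 <= N by rewrite mulr_ge0 ?(ltW tt0)// sumr_ge0.
have hN m : tt * `|dot one (phi W J0 m)| <= N.
  by rewrite ler_pM2l// (bigD1 m)//= lerDl sumr_ge0.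
pose D := 4 * (`|c| * N + `|M'| + 1).
have D0 : 0 < D by rewrite mulr_gt0// ltr_wpDl// addr_ge0// mulr_ge0.
pose t0 := Num.min (2^-1) ((M - M') / D).
have MM0 : 0 < M - M' by rewrite subr_gt0.
have t00 : 0 < t0 by rewrite lt_min invr_gt0 ltr0n/= divr_gt0.
have hw0 : 0 < (C2 - C1) / 2 by rewrite divr_gt0// subr_gt0.
exists (t0 * ((C2 - C1) / 2)), ((M - M') / 2); split; [by rewrite mulr_gt0|by rewrite divr_gt0|].
move=> dl dl0 hdl.
(* the weight of the constant that makes the distance to the bounds exactly dl *)
pose t := dl / ((C2 - C1) / 2).
have tE : t * ((C2 - C1) / 2) = dl by rewrite /t mulfVK// gt_eqF.
have t_gt0 : 0 < t by rewrite divr_gt0.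
have tt0' : t <= t0 by rewrite /t ler_pdivrMr.
have t2 : t <= 2^-1 by apply: (le_trans tt0'); rewrite ge_min lexx.
have tD : t * D <= M - M' by rewrite -ler_pdivlMr// (le_trans tt0')// ge_min lexx orbT.
pose h0 x := (1 - t) * h x + t * c.
pose q x := (1 - t) * cutoff h x + t * c.
pose H0 x := Num.max (C1 + dl) (Num.min (q x) (C2 - dl)).
have cut0 x : cutoff h0 x = (1 - t) * cutoff h x + (t * c) * one x.
  by rewrite /cutoff /h0 /one /cutoff; ring.
have cutE : cutoff h0 = fun x => (1 - t) * cutoff h x + (t * c) * one x by apply/funext.
have bq : bm q by apply: bmD; [apply: bmM => //; exact: bm_cst|exact: bm_cst].
have dl1 : C1 + dl <= C2 - dl.
  have : t * ((C2 - C1) / 2) <= 2^-1 * ((C2 - C1) / 2) by rewrite ler_pM2r.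
  by rewrite tE; have := C12; lra.
have H0r x : C1 + dl <= H0 x <= C2 - dl.
  by rewrite /H0 le_max lexx/= ge_max dl1/= ge_min lexx orbT.
have bH0 : bm H0.
  split.
    apply: measurable_maxr; first exact: measurable_cst.
    by apply: measurable_minr; [case: bq|exact: measurable_cst].
  exists (`|C1 + dl| + `|C2 - dl|) => x; have /andP[h1 h2] := H0r x.
  have := ler_norm (C2 - dl); have := ler_norm (- (C1 + dl)); rewrite normrN.
  have := normr_ge0 (C2 - dl); have := normr_ge0 (C1 + dl).
  by move=> *; rewrite ler_norml; apply/andP; split; lra.
exists h0, H0; split => //.
- move=> e e0; have [ep ep0 hep] := uh e e0; exists ep => // x y cx cy hxy.
  rewrite /h0 (_ : _ - _ = (1 - t) * (h x - h y)); last by ring.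
  rewrite normrM ger0_norm; last by lra.
  have := hep x y cx cy hxy; have := normr_ge0 (h x - h y); nra.
- exists ((1 - t) * B + t * (`|c| * N)); split.
  + apply: addr_ge0; apply: mulr_ge0 => //; [lra|exact: ltW|exact: mulr_ge0].
  + move=> m; have bph := bm_phi hW m (leqnn J0).
    rewrite cutE dotDl//; [|by apply: bmM => //; exact: bm_cst..].
    rewrite !dotZl//.
    apply: (@le_trans _ _ (tt * ((1 - t) * `|dot (cutoff h) (phi W J0 m)| +
        t * (`|c| * `|dot one (phi W J0 m)|)))).
      rewrite ler_pM2l// (le_trans (ler_normD _ _))//; apply: lerD.
        by rewrite normrM ger0_norm//; lra.
      by rewrite 2!normrM (gtr0_norm t_gt0) mulrA.
    rewrite mulrDr; apply: lerD.
      by rewrite mulrCA ler_wpM2l//; lra.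
    by rewrite mulrCA ler_pM2l// mulrCA ler_wpM2l.
  + move=> l hl i m; have bps := bm_psi hW i m hl.
    rewrite cutE dotDl//; [|by apply: bmM => //; exact: bm_cst..].
    rewrite !dotZl// (cst_psi0 i m hl) mulr0 addr0 normrM ger0_norm; last by lra.
    rewrite mulrCA; apply: (@le_trans _ _ ((1 - t) * (M' - B))).
      by rewrite ler_wpM2l ?hM//; lra.
    have h1 : t * (4 * (`|c| * N)) + t * (4 * `|M'|) + t * 4 <= M - M'.
      by move: tD; rewrite /D; lra.
    have h2 : 0 <= t * (`|c| * N) by rewrite mulr_ge0 ?(ltW t_gt0)// mulr_ge0.
    have h3 : - (t * M') <= t * `|M'|.
      by rewrite -mulrN ler_pM2l// -normrN ler_norm.
    lra.
- move=> k bk.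
  have -> : dot (cutoff h0) k = dot q k.
    rewrite /dot -Ex_unif_cut; last by apply: bmM => //; rewrite cutE; apply: bmD;
      apply: bmM => //; exact: bm_cst.
    rewrite -[RHS]Ex_unif_cut; last exact: bmM.
    apply: eq_Ex => x; rewrite cut0 /q /one; have [cx|cx] := pselect (cube d x).
      by rewrite !(cutoff_in _ cx) mulr1.
    by rewrite indicE memNset// !mul0r.
  have bqk := bmB bH0 bq.
  have [Ck [Ck0 hCk]] := bm_ub bk.
  apply/eqP; rewrite -subr_eq0 -dotBl// -normr_le0.
  have bn1 : bm (fun x => nneg_part (cutoff h x - C2)).
    by apply: bm_nneg_part; apply: bmB => //; exact: bm_cst.
  have bn2 : bm (fun x => nneg_part (C1 - cutoff h x)).
    by apply: bm_nneg_part; apply: bmB => //; exact: bm_cst.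
  apply: (le_trans (Ex_abs _ (bmM bqk bk))).
  apply: (@le_trans _ _ (Ex (unif d) (fun x => Ck * nneg_part (cutoff h x - C2) +
     Ck * nneg_part (C1 - cutoff h x)))).
    apply: Ex_le; first exact: bm_norm (bmM bqk bk).
      by apply: bmD; apply: bmM => //; exact: bm_cst.
    move=> x; rewrite -mulrDr normrM mulrC; apply: ler_pM => //.
    rewrite /H0 /q /nneg_part; move: (cutoff h x) => y.
    have E1 : (1 - t) * C2 + t * c = C2 - dl by rewrite -tE /c; field.
    have E2 : (1 - t) * C1 + t * c = C1 + dl by rewrite -tE /c; field.
    have t1 : 0 <= 1 - t by lra.
    have t1' : 1 - t <= 1 by lra.
    case: (leP (y - C2) 0) => h1; case: (leP (C1 - y) 0) => h2.
    + rewrite (min_idPl _); last by rewrite -E1; nra.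
      rewrite (max_idPr _); last by rewrite -E2; nra.
      by rewrite subrr normr0 addr0.
    + rewrite (min_idPl _); last by rewrite -E1; nra.
      rewrite (max_idPl _); last by rewrite -E2; nra.
      rewrite -E2 ger0_norm; nra.
    + rewrite (min_idPr _); last by rewrite -E1; nra.
      rewrite (max_idPr _)//.
      rewrite -E1 ler0_norm; nra.
    + by have := C12; lra.
  rewrite ExD; [|by apply: bmM => //; exact: bm_cst..].
  by rewrite !ExZ// r1 r2 !mulr0 addr0.
Qed.

End base_point.

(** * Least favourable laws *)

Section max_risk_bounds.
Context {R : realType} {d : nat}.
Variable Pm : set (probability (obs R d) R).

Lemma max_risk_ge n (T : data R d n -> R) Q : Pm Q ->
  (\int[data_law Q n]_D ((T D - psi_fun Q) ^+ 2)%:E <= max_risk Pm T)%E.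
Proof. by move=> hQ; apply: ereal_sup_ubound; exists Q. Qed.

(** The mean squared error is at least the squared bias. *)
Lemma max_risk_bias C1 C2 n (T : data R d n -> R) Q p b : Pm Q ->
  law_spec C1 C2 Q p b -> measurable_fun setT T ->
  bm (fun D => T (kap3 C1 C2 D)) ->
  (((Ex (data_law Q n) (fun D => T (kap3 C1 C2 D)) - psi_fun Q) ^+ 2)%:E <=
   max_risk Pm T)%E.
Proof.
move=> hQ sQ mT bT; apply: le_trans (max_risk_ge T hQ).
rewrite (mse_clamp sQ _ mT bT) lee_fin.
have bTc : bm (fun D => T (kap3 C1 C2 D) - psi_fun Q) by apply: bmB => //; exact: bm_cst.
apply: le_trans (Ex_sqr _ bTc).
by rewrite ExB ?Ex_cst//; exact: bm_cst.
Qed.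

End max_risk_bounds.

(** The second difference over the four sign patterns isolates the interaction [w]. *)
Lemma four_point (R : realType) (r : \bar R) (x y z w : R) :
  (forall s t : bool, ((x + sg t * y + sg s * z + sg s * sg t * w) ^+ 2)%:E <= r)%E ->
  ((w ^+ 2)%:E <= r)%E.
Proof.
case: r => [r| |] h; last 2 first.
- by rewrite leey.
- by have := h true true.
have := h true true; have := h true false; have := h false true; have := h false false.
rewrite !lee_fin /sg => h1 h2 h3 h4.
have := sqr_ge0 x; have := sqr_ge0 y; have := sqr_ge0 z => q1 q2 q3.
move: h1 h2 h3 h4; rewrite !expr2; move: q1 q2 q3; rewrite !expr2; nra.
Qed.

(** One of the two values is at distance at least half of [w] from 0. *)
Lemma two_point (R : realType) (r : \bar R) (x w : R) :
  (forall s : bool, ((x + s%:R * w) ^+ 2)%:E <= r)%E -> (((w / 2) ^+ 2)%:E <= r)%E.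
Proof.
case: r => [r| |] h; last 2 first.
- by rewrite leey.
- by have := h true.
have := h true; have := h false; rewrite !lee_fin => h1 h2.
have := sqr_ge0 (x + (x + w)); move: h1 h2; rewrite !expr2/= => *; nra.
Qed.

Section uniform_continuity_comb.
Context {R : realType} {d : nat}.
Implicit Types f g : d.-tuple R -> R.

Lemma ucontD f g : ucont_cube f -> ucont_cube g -> ucont_cube (fun x => f x + g x).
Proof.
move=> uf ug e e0; have e2 : 0 < e / 2 by rewrite divr_gt0.
have [t1 t10 h1] := uf _ e2; have [t2 t20 h2] := ug _ e2.
exists (Num.min t1 t2); first by rewrite lt_min t10.
move=> x y cx cy hxy; rewrite (_ : _ - _ = (f x - f y) + (g x - g y)); last by ring.
apply: (le_lt_trans (ler_normD _ _)).
have a1 : `|f x - f y| < e / 2.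
  by apply: h1 => // i; apply: (lt_le_trans (hxy i)); rewrite ge_min lexx.
have a2 : `|g x - g y| < e / 2.
  by apply: h2 => // i; apply: (lt_le_trans (hxy i)); rewrite ge_min lexx orbT.
lra.
Qed.

Lemma ucontZ c f : ucont_cube f -> ucont_cube (fun x => c * f x).
Proof.
move=> uf e e0; have c1 : 0 < `|c| + 1 by rewrite ltr_wpDl.
have [t t0 h] := uf (e / (`|c| + 1)) (divr_gt0 e0 c1).
exists t => // x y cx cy hxy; rewrite -mulrBr normrM.
have := h x y cx cy hxy; rewrite ltr_pdivlMr// => h1.
apply: le_lt_trans h1; rewrite mulrC ler_wpM2l// lerDl//.
Qed.

Lemma ucont_comb (I : finType) (c : I -> R) (F : I -> d.-tuple R -> R) :
  (forall i, ucont_cube (F i)) -> ucont_cube (fun x => \sum_i c i * F i x).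
Proof.
move=> uF; rewrite unlock; elim: (index_enum I) => [|i r IH] /=.
  by move=> e e0; exists 1 => // x y _ _ _; rewrite subrr normr0.
by apply: ucontD => //; exact: ucontZ.
Qed.

End uniform_continuity_comb.

Section least_favourable.
Context {R : realType} {d J0 S : nat} (W : wavelets R d).
Hypothesis hW : cdv_basis W J0 S.
Variables (C1 C2 alpha beta M : R).

(** A detail orientation exists because [d] is positive. *)
Definition full_orientation (hd : (1 <= d)%N) : orientation d.
Proof.
exists [ffun => true]; apply/existsP; exists (Ordinal hd); by rewrite ffunE.
Defined.

Variable i0 : orientation d.

Definition detail l (c : idx W l -> R) (x : d.-tuple R) : R :=
  \sum_m c m * psi W l i0 m x.

Lemma bm_detail l (c : idx W l -> R) : (J0 <= l)%N -> bm (detail c).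
Proof. by move=> hl; apply: bm_comb => m; exact: (bm_psi hW). Qed.

Lemma dot_detail_V l (c : idx W l -> R) j f : (J0 <= j)%N -> (j <= l)%N -> in_V W j f ->
  dot (detail c) f = 0.
Proof.
move=> hj jl vf; have hl := leq_trans hj jl.
rewrite dot_comb; [|by move=> m; exact: (bm_psi hW)|exact: (bm_in_V hW hj vf)].
by rewrite big1// => m _; rewrite dotC (in_V_psi hW _ _ hj jl vf) mulr0.
Qed.

Lemma dot_detail_psi l (c : idx W l -> R) l' i m : (J0 <= l)%N -> (J0 <= l')%N ->
  (l' != l \/ i != i0) -> dot (detail c) (psi W l' i m) = 0.
Proof.
move=> hl hl' H; rewrite dot_comb; [|by move=> k; exact: (bm_psi hW)|exact: (bm_psi hW)].
rewrite big1// => k _; have [E|ll] := eqVneq l l'; last first.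
  by rewrite (@psi_levels _ _ _ _ _ hW l l' i0 k i m hl hl' ll) mulr0.
subst l'; case: H => [|ii]; first by rewrite eqxx.
by rewrite (psi_on hW)// eq_sym (negPf ii) mulr0.
Qed.

Lemma dot_detail_psi_eq l (c : idx W l -> R) m : (J0 <= l)%N ->
  dot (detail c) (psi W l i0 m) = c m.
Proof.
move=> hl; rewrite dot_comb; [|by move=> k; exact: (bm_psi hW)|exact: (bm_psi hW)].
rewrite (bigD1 m)//= (psi_on hW)// !eqxx mulr1 big1 ?addr0// => k km.
by rewrite (psi_on hW)// eqxx (negPf km) mulr0.
Qed.

Lemma dot_detail2 l (c c' : idx W l -> R) : (J0 <= l)%N ->
  dot (detail c) (detail c') = \sum_m c m * c' m.
Proof.
move=> hl; rewrite dotC dot_comb; [|by move=> k; exact: (bm_psi hW)|exact: bm_detail].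
by apply: eq_bigr => m _; rewrite dotC dot_detail_psi_eq// mulrC.
Qed.

Lemma detail_out l (c : idx W l -> R) x : (J0 <= l)%N -> ~ cube d x -> detail c x = 0.
Proof.
move=> hl cx; rewrite /detail big1// => m _.
by case: (cdv_off hW hl m cx) => _ ->; rewrite mulr0.
Qed.

Lemma ucont_detail l (c : idx W l -> R) : (J0 <= l)%N -> ucont_cube (detail c).
Proof. by move=> hl; apply: ucont_comb => m; case: (cdv_continuous hW hl m). Qed.

Lemma cutoff_perturb l (c : idx W l -> R) h (e : R) : (J0 <= l)%N ->
  cutoff (fun x => h x + e * detail c x) = fun x => cutoff h x + e * detail c x.
Proof.
move=> hl; apply/funext => x; have [cx|cx] := pselect (cube d x).
  by rewrite !cutoff_in.
by rewrite !cutoff_out// detail_out// mulr0 addr0.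
Qed.

(** A combination of details of one level and orientation changes only the coefficients
    at that level, by at most the room [g]. *)
Lemma holder_perturb (s g e : R) h l (c : idx W l -> R) : (J0 <= l)%N -> 0 <= e -> 0 <= g ->
  ucont_cube h -> interior_coefs W M s g h (J0 := J0) ->
  (forall m, 2 `^ (l%:R * (s + d%:R / 2)) * (e * `|c m|) <= g) ->
  holder_ball W J0 s M (fun x => h x + e * detail c x).
Proof.
move=> hl e0 g0 uh [B [B0 hB hM]] hc; apply/(holder_ballP hW); split.
  by apply: ucontD => //; apply: ucontZ; exact: ucont_detail.
have bh := bm_ucont uh; have bd := bm_detail c hl; have bed := bmM (bm_cst e) bd.
exists B; split => // [m|l' hl' i m]; rewrite cutoff_perturb//.
  have bph := bm_phi hW m (leqnn J0).
  rewrite dotDl// dotZl// (dot_detail_V _ (leqnn _) hl); last exact: in_V_phi.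
  by rewrite mulr0 addr0.
have bps := bm_psi hW i m hl'; rewrite dotDl// dotZl//.
have [E|ne] := eqVneq l' l; last first.
  rewrite dot_detail_psi//; last by left.
  rewrite mulr0 addr0; apply: (le_trans (hM l' hl' i m)); lra.
have [Ei|nei] := eqVneq i i0; last first.
  rewrite dot_detail_psi//; last by right.
  rewrite mulr0 addr0; apply: (le_trans (hM l' hl' i m)); lra.
subst l' i; rewrite dot_detail_psi_eq//.
apply: (@le_trans _ _ (2 `^ (l%:R * (s + d%:R / 2)) * `|dot (cutoff h) (psi W l i0 m)| +
   2 `^ (l%:R * (s + d%:R / 2)) * (e * `|c m|))).
  rewrite -mulrDr ler_wpM2l ?powR_ge0// (le_trans (ler_normD _ _))//.
  by rewrite [X in _ + X]normrM (ger0_norm e0).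
have := hM l hl i0 m; have := hc m; lra.
Qed.

(** A law inside the class, at distance [dl] from the range constraint and with
    room [g] in the Hoelder constraints.  [P0] and [B0] are versions of the regression
    functions [p0] and [b0] on the cube: the range constraint can be arranged to
    hold everywhere only after a modification on a null set, which may
    destroy the continuity that the Hoelder balls require. *)
Record base_point (dl g : R) (P0 B0 p0 b0 : d.-tuple R -> R) : Prop := BasePoint {
  bp_dl : 0 < dl; bp_g : 0 < g; bp_bmP : bm P0; bp_bmB : bm B0;
  bp_rangeP : forall x, C1 + dl <= P0 x <= C2 - dl;
  bp_rangeB : forall x, C1 + dl <= B0 x <= C2 - dl;
  bp_ucp : ucont_cube p0; bp_ucb : ucont_cube b0;
  bp_coefp : interior_coefs W M alpha g p0 (J0 := J0);
  bp_coefb : interior_coefs W M beta g b0 (J0 := J0);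
  bp_eqP : forall k, bm k -> dot P0 k = dot (cutoff p0) k;
  bp_eqB : forall k, bm k -> dot B0 k = dot (cutoff b0) k }.

Variables (dl g : R) (P0 B0 p0 b0 : d.-tuple R -> R).
Hypothesis hbase : base_point dl g P0 B0 p0 b0.
Let dl0 := bp_dl hbase.
Let g0 := bp_g hbase.
Let bP0 := bp_bmP hbase.
Let bB0 := bp_bmB hbase.
Let hP0 := bp_rangeP hbase.
Let hB0 := bp_rangeB hbase.
Let up0 := bp_ucp hbase.
Let ub0 := bp_ucb hbase.
Let ip0 := bp_coefp hbase.
Let ib0 := bp_coefb hbase.
Let eP0 := bp_eqP hbase.
Let eB0 := bp_eqB hbase.

Local Notation Pm := (model W J0 C1 C2 alpha beta M).
Local Notation A := (@clA R d C1 C2).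
Local Notation Y := (@clY R d C1 C2).

(** All the laws with nonconstant perturbations come from here; [th] is free, because it
    does not enter the regression functions. *)
Lemma family_law l (cu cv : idx W l -> R) (th : d.-tuple R -> R) : (J0 <= l)%N -> bm th ->
  (forall m, 2 `^ (l%:R * (alpha + d%:R / 2)) * (dl * `|cu m|) <= g) ->
  (forall m, 2 `^ (l%:R * (beta + d%:R / 2)) * (dl * `|cv m|) <= g) ->
  (forall x, `|detail cu x| + `|detail cv x| + `|th x| <= 1) ->
  let u := detail cu in let v := detail cv in exists Q, [/\ Pm Q,
    law_spec C1 C2 Q (fun x => P0 x + dl * u x) (fun x => B0 x + dl * v x),
    (forall h, bm h -> Ex Q h = Ex base_law (fun z => sdens u v th z * h (sobs dl P0 B0 z))) &
    forall h, bm h -> Ex Q (fun w => A w * Y w * h (obsX w)) =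
      dot (fun x => P0 x * B0 x + dl * (P0 x * v x + B0 x * u x) + dl ^+ 2 * th x) h].
Proof.
move=> hl bth hcu hcv hs u v.
have bu := bm_detail cu hl; have bv := bm_detail cv hl.
have bdu := bmM (bm_cst dl) bu; have bdv := bmM (bm_cst dl) bv.
have [Q [hQ QX QC]] := exists_perturbed_law dl0 bP0 bB0 hP0 hB0 bu bv bth hs.
have mom := perturbed_moments dl0 bP0 bB0 hP0 hB0 bu bv bth hQ.
have hp := holder_perturb hl (ltW dl0) (ltW g0) up0 ip0 hcu.
have hb := holder_perturb hl (ltW dl0) (ltW g0) ub0 ib0 hcv.
have bcp := bm_ucont up0; have bcb := bm_ucont ub0.
have E1 h : bm h -> dot (cutoff (fun x => p0 x + dl * u x)) h = dot (fun x => P0 x + dl * u x) h.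
  by move=> bh; rewrite cutoff_perturb// !dotDl// eP0.
have E2 h : bm h -> dot (cutoff (fun x => b0 x + dl * v x)) h = dot (fun x => B0 x + dl * v x) h.
  by move=> bh; rewrite cutoff_perturb// !dotDl// eB0.
have [] := spec_model QX QC hp hb.
- by move=> h bh; rewrite E1//; case: (mom h bh).
- by move=> h bh; rewrite E2//; case: (mom h bh).
move=> mQ sQ; exists Q; split => //.
  by apply: (law_spec_ext sQ) => //; exact: bmD.
by move=> h bh; case: (mom h bh).
Qed.

Lemma P0_le x : `|P0 x| <= clbound C1 C2.
Proof.
have /andP[h1 h2] := hP0 x; rewrite -(@clamp_id R C1 C2 (P0 x)) ?clamp_le//.
by apply/andP; have := dl0; split; lra.
Qed.

Lemma B0_le x : `|B0 x| <= clbound C1 C2.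
Proof.
have /andP[h1 h2] := hB0 x; rewrite -(@clamp_id R C1 C2 (B0 x)) ?clamp_le//.
by apply/andP; have := dl0; split; lra.
Qed.

Hypotheses (alpha0 : 0 < alpha) (beta0 : 0 < beta).

(** The largest size of the coefficients at level [l] in a Hoelder ball of exponent [s],
    up to a constant. *)
Definition amp (s : R) (l : nat) : R := 2 `^ (- (l%:R * (s + d%:R / 2))).

Lemma sqrt_resol l : Num.sqrt (@resol R d l) = 2 `^ (l%:R * (d%:R / 2)).
Proof.
by rewrite -powR12_sqrt ?ltW ?resol_gt0// resol_powR -powRrM mulrA.
Qed.

Lemma amp_sqrt s l : 0 <= s -> amp s l * Num.sqrt (@resol R d l) <= 1.
Proof.
move=> s0; rewrite sqrt_resol /amp pow2D -[leRHS](powRr0 (2 : R)).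
apply: ler_powR; first by rewrite ler1n.
have : 0 <= l%:R * s by rewrite mulr_ge0.
by rewrite mulrDr opprD; lra.
Qed.

Lemma amp_amp l : amp alpha l * amp beta l * @resol R d l = 2 `^ (- (l%:R * (alpha + beta))).
Proof. by rewrite resol_powR /amp !pow2D; congr (_ `^ _); field. Qed.

Lemma amp_scale (s c : R) l : 2 `^ (l%:R * (s + d%:R / 2)) * (c * amp s l) = c.
Proof.
rewrite mulrCA /amp pow2D.
by rewrite (_ : _ + _ = 0) ?powRr0 ?mulr1// addrC addNr.
Qed.

(** The perturbations of the regression functions are details of level [l], invisible to
    the projections on [V_j] for [j <= l], and [th] keeps the conditional mean of [A Y]
    fixed: the four laws differ in <p, b> only. *)
Lemma four_laws : exists c : R, 0 < c /\ forall l, (J0 <= l)%N ->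
  exists (Q : bool -> bool -> probability (obs R d) R) (p b : bool -> d.-tuple R -> R) y z w,
  [/\ c * 2 `^ (- (l%:R * (alpha + beta))) <= w,
    forall s t, Pm (Q s t) /\ law_spec C1 C2 (Q s t) (p s) (b t),
    forall j, (J0 <= j)%N -> (j <= l)%N -> forall s t,
      dot (p s) (wproj W j (b t)) = dot P0 (wproj W j B0),
    (forall s t h, bm h -> Ex (Q s t) (fun w => A w * Y w * h (obsX w)) =
       dot (fun x => P0 x * B0 x) h) &
    forall s t, dot (p s) (b t) = dot P0 B0 + sg t * y + sg s * z + sg s * sg t * w].
Proof.
have [B [cB [B_gt0 _ hB]]] := detail_bounds hW.
have [cc [CC [cc0 CC0 hcard]]] := cdv_card hW.
have Cm0 : 0 <= clbound C1 C2 := Cm_ge0 C1 C2.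
(* the two terms of D are the constraints that the density be nonnegative and that
   the coefficients fit into the room g *)
pose D := B * (2 + 2 * clbound C1 C2 / dl) + dl / g.
have D0 : 0 < D.
  apply: ltr_wpDr; first by rewrite divr_ge0// ltW.
  by rewrite mulr_gt0// ltr_wpDr// divr_ge0 ?mulr_ge0// ltW.
pose c1 := D^-1; have c10 : 0 < c1 by rewrite invr_gt0.
have hc1 : c1 * (B * (2 + 2 * clbound C1 C2 / dl)) <= 1.
  rewrite /c1 mulrC ler_pdivrMr// mul1r /D lerDl.
  by rewrite divr_ge0 ?(ltW dl0) ?(ltW g0).
have hc2 : dl * c1 <= g.
  rewrite /c1 ler_pdivrMr// /D mulrDr [X in _ + X](_ : _ = dl); last by field; exact: lt0r_neq0.
  rewrite lerDr mulr_ge0 ?(ltW g0)// mulr_ge0 ?(ltW B_gt0)// addr_ge0//.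
  by rewrite divr_ge0 ?(ltW dl0)// mulr_ge0.
exists (dl ^+ 2 * (c1 ^+ 2 * cc)); split; first by rewrite mulr_gt0 ?exprn_gt0// mulr_gt0 ?exprn_gt0.
move=> l hl.
pose cu (s : bool) (m : idx W l) := sg s * (c1 * amp alpha l).
pose cv (t : bool) (m : idx W l) := sg t * (c1 * amp beta l).
have sg1 (s : bool) : `|sg s : R| = 1 by case: s; rewrite /sg ?normrN normr1.
have a0 s : 0 < amp s l by exact: powR_gt0.
have sup (e : R) (c : idx W l -> R) : (forall m, `|c m| <= c1 * amp e l) -> 0 <= e ->
    forall x, `|detail c x| <= c1 * B.
  move=> hc e0 x; apply: (le_trans (ler_norm_sum _ _ _)).
  apply: (@le_trans _ _ (\sum_m c1 * amp e l * `|psi W l i0 m x|)).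
    by apply: ler_sum => m _; rewrite normrM ler_wpM2r.
  rewrite -mulr_sumr; have [h _ _] := hB l hl i0.
  apply: (@le_trans _ _ (c1 * amp e l * (B * Num.sqrt (@resol R d l)))).
    by rewrite ler_wpM2l ?h// mulr_ge0// ltW.
  have := amp_sqrt l e0; set q := Num.sqrt _ => hq.
  rewrite (_ : _ * _ = c1 * B * (amp e l * q)); last by ring.
  by rewrite ler_piMr// mulr_ge0// ltW.
have cuE s m : `|cu s m| = c1 * amp alpha l.
  by rewrite normrM sg1 mul1r ger0_norm// mulr_ge0// ltW.
have cvE t m : `|cv t m| = c1 * amp beta l.
  by rewrite normrM sg1 mul1r ger0_norm// mulr_ge0// ltW.
have su s x : `|detail (cu s) x| <= c1 * B.
  by apply: (sup alpha _ _ (ltW alpha0)) => m; rewrite cuE.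
have sv t x : `|detail (cv t) x| <= c1 * B.
  by apply: (sup beta _ _ (ltW beta0)) => m; rewrite cvE.
(* cancels the first-order change of the conditional mean of A Y *)
pose th s t x := - (P0 x * detail (cv t) x + B0 x * detail (cu s) x) / dl.
have bu s := bm_detail (cu s) hl; have bv t := bm_detail (cv t) hl.
have bth s t : bm (th s t).
  by apply: bmM; [apply: bmN; apply: bmD; exact: bmM|exact: bm_cst].
have hth s t x : `|detail (cu s) x| + `|detail (cv t) x| + `|th s t x| <= 1.
  have h1 : `|th s t x| <= (clbound C1 C2 * (c1 * B) + clbound C1 C2 * (c1 * B)) / dl.
    rewrite /th normrM normfV (gtr0_norm dl0) ler_pM2r ?invr_gt0// normrN.
    apply: (le_trans (ler_normD _ _)); rewrite !normrM; apply: lerD; apply: ler_pM => //.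
      exact: P0_le.
    exact: B0_le.
  have h2 : c1 * B + c1 * B + (clbound C1 C2 * (c1 * B) + clbound C1 C2 * (c1 * B)) / dl =
    c1 * (B * (2 + 2 * clbound C1 C2 / dl)) by field; rewrite gt_eqF.
  have := su s x; have := sv t x; move: h1 h2 hc1; lra.
have hcu s m : 2 `^ (l%:R * (alpha + d%:R / 2)) * (dl * `|cu s m|) <= g.
  by rewrite cuE (mulrA dl) amp_scale.
have hcv t m : 2 `^ (l%:R * (beta + d%:R / 2)) * (dl * `|cv t m|) <= g.
  by rewrite cvE (mulrA dl) amp_scale.
have fam' s t := cid (family_law hl (bth s t) (hcu s) (hcv t) (hth s t)).
pose p s x := P0 x + dl * detail (cu s) x.
pose b t x := B0 x + dl * detail (cv t) x.
pose u0 := detail (fun _ : idx W l => c1 * amp alpha l).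
pose v0 := detail (fun _ : idx W l => c1 * amp beta l).
have bu0 : bm u0 by exact: bm_detail.
have bv0 : bm v0 by exact: bm_detail.
have uE s x : detail (cu s) x = sg s * u0 x.
  by rewrite /u0 /detail mulr_sumr; apply: eq_bigr => m _; rewrite mulrA.
have vE t x : detail (cv t) x = sg t * v0 x.
  by rewrite /v0 /detail mulr_sumr; apply: eq_bigr => m _; rewrite mulrA.
have bpx s : bm (p s) by apply: bmD => //; apply: bmM => //; exact: bm_cst.
have bbx t : bm (b t) by apply: bmD => //; apply: bmM => //; exact: bm_cst.
exists (fun s t => sval (fam' s t)), p, b, (dl * dot P0 v0), (dl * dot u0 B0),
  (dl ^+ 2 * dot u0 v0); split.
- rewrite /u0 /v0 dot_detail2// sumr_const -[X in _ <= _ * X]mulr_natl -(mulrA (dl ^+ 2)) ler_wpM2l ?sqr_ge0//.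
  have [h1 _] := andP (hcard l hl).
  rewrite -amp_amp; set q := amp alpha l * amp beta l.
  have q0 : 0 <= q by rewrite mulr_ge0// ltW.
  rewrite (_ : #|idx W l|%:R * _ = c1 ^+ 2 * q * #|idx W l|%:R); last by rewrite /q; ring.
  rewrite (_ : c1 ^+ 2 * cc * _ = c1 ^+ 2 * q * (cc * @resol R d l)); last by ring.
  by rewrite ler_wpM2l// mulr_ge0 ?sqr_ge0.
- by move=> s t; case: (svalP (fam' s t)).
- move=> j hj jl s t; rewrite !(dot_proj hW)//; apply: eq_bigr => m _.
  have bph := bm_phi hW m hj.
  rewrite /p /b !dotDl//; [|by apply: bmM => //; exact: bm_cst..].
  rewrite !dotZl// !(dot_detail_V _ hj jl); [|exact: in_V_phi..].
  by rewrite !mulr0 !addr0.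
- move=> s t h bh; case: (svalP (fam' s t)) => _ _ _ ->//.
  apply: eq_Ex => x; congr (_ * _); rewrite /th; field; exact: lt0r_neq0.
- move=> s t; have bcP0 := bm_cst (T := d.-tuple R) (dl * sg s).
  rewrite (_ : p s = fun x => P0 x + (dl * sg s) * u0 x); last first.
    by apply/funext => x; rewrite /p uE mulrA.
  rewrite (_ : b t = fun x => B0 x + (dl * sg t) * v0 x); last first.
    by apply/funext => x; rewrite /b vE mulrA.
  have b1 : bm (fun x => dl * sg s * u0 x) by apply: bmM => //; exact: bm_cst.
  have b2 : bm (fun x => dl * sg t * v0 x) by apply: bmM => //; exact: bm_cst.
  have b3 := bmD bB0 b2.
  have e1 h : bm h -> dot (fun x => B0 x + dl * sg t * v0 x) h =
      dot B0 h + dl * sg t * dot v0 h.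
    by move=> bh; rewrite (dotDl bB0 b2 bh) dotZl.
  have e2 : dot (fun x => dl * sg s * u0 x) (fun x => B0 x + dl * sg t * v0 x) =
      dl * sg s * dot u0 (fun x => B0 x + dl * sg t * v0 x) by rewrite dotZl.
  rewrite (dotDl bP0 b1 b3) e2 (dotC P0) e1// (dotC u0 (fun x => B0 x + dl * sg t * v0 x)) e1//.
  by rewrite (dotC B0 P0) (dotC v0 P0) (dotC B0 u0) (dotC v0 u0); ring.
Qed.

End least_favourable.

(** * Lower bounds for given resolutions *)

Section base_point_existence.
Context {R : realType} {d J0 S : nat} (W : wavelets R d).
Hypotheses (hW : cdv_basis W J0 S) (hS : (1 <= S)%N).
Variables (C1 C2 alpha beta M : R).

(** Both regression functions of a law of the smaller class are moved to the interior
    with a common distance [dl]. *)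
Lemma exists_base_point : nondegenerate_class W J0 C1 C2 alpha beta M ->
  exists dl g P0 B0 p0 b0, @base_point R d J0 W C1 C2 alpha beta M dl g P0 B0 p0 b0.
Proof.
move=> [C12 [M' MM [P [PX PC [p hp Ap] [b hb Ab]]]]].
have up := hp.1; have ub := hb.1.
have bp := bm_ucont up; have bb := bm_ucont ub.
have hPl : law_spec C1 C2 P (cutoff p) (cutoff b).
  apply: law_specP => //.
  - by move: Ap (ae_cutoff p); apply: filterS2 => x -> ->.
  - by move: Ab (ae_cutoff b); apply: filterS2 => x -> ->.
have [d1 [g1 [d10 g10 H1]]] := interior_point hW hS C12 MM hp (bm_clA C1 C2)
  (fun w => clamp_range C12 (obsA w)) (ls_X hPl) (ls_A hPl).
have [d2 [g2 [d20 g20 H2]]] := interior_point hW hS C12 MM hb (bm_clY C1 C2)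
  (fun w => clamp_range C12 (obsY w)) (ls_X hPl) (ls_Y hPl).
have dl0 : 0 < Num.min d1 d2 by rewrite lt_min d10.
have geminl : Num.min d1 d2 <= d1 by rewrite ge_min lexx.
have geminr : Num.min d1 d2 <= d2 by rewrite ge_min lexx orbT.
have [p0 [P0 [up0 ip0 bP0 rP0 eP0]]] := H1 _ dl0 geminl.
have [b0 [B0 [ub0 ib0 bB0 rB0 eB0]]] := H2 _ dl0 geminr.
have mono s g g' h : g <= g' -> interior_coefs W M s g' h (J0 := J0) ->
    interior_coefs W M s g h (J0 := J0).
  move=> gg [B [B_ge0 hB hM]]; exists B; split => // l hl i m.
  by apply: (le_trans (hM l hl i m)); lra.
exists (Num.min d1 d2), (Num.min g1 g2), P0, B0, p0, b0; split => //.
- by rewrite lt_min g10.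
- by apply: mono ip0; rewrite ge_min lexx.
- by apply: mono ib0; rewrite ge_min lexx orbT.
Qed.

End base_point_existence.

Section bias_lower_bounds.
Context {R : realType} {d J0 S : nat} (W : wavelets R d).
Hypothesis hW : cdv_basis W J0 S.
Hypothesis hd : (1 <= d)%N.
Variables (C1 C2 alpha beta M : R).
Hypotheses (alpha0 : 0 < alpha) (beta0 : 0 < beta).
Variables (dl g : R) (P0 B0 p0 b0 : d.-tuple R -> R).
Hypothesis hbase : @base_point R d J0 W C1 C2 alpha beta M dl g P0 B0 p0 b0.

Local Notation Pm := (model W J0 C1 C2 alpha beta M).
Local Notation A := (@clA R d C1 C2).
Local Notation Y := (@clY R d C1 C2).
Local Notation i0 := (full_orientation hd).

(** Correlating the two signs changes the conditional covariance and nothing else. *)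
Lemma const_law t : 0 <= t <= 1 -> exists Q, [/\ Pm Q, law_spec C1 C2 Q P0 B0,
  (forall h, bm h -> Ex Q h = Ex base_law (fun z =>
     (1 + t * (sg z.1.2 * sg z.2)) * h (sobs dl P0 B0 z))) &
  forall h, bm h -> Ex Q (fun w => A w * Y w * h (obsX w)) =
    dot (fun x => P0 x * B0 x + dl ^+ 2 * t) h].
Proof.
move=> /andP[t0 t1]; pose c0 := fun _ : idx W J0 => 0 : R.
have dE x : detail i0 c0 x = 0 by rewrite /detail big1// => m _; rewrite mul0r.
have hc s m : 2 `^ (J0%:R * (s + d%:R / 2)) * (dl * `|c0 m|) <= g.
  by rewrite normr0 !mulr0 ltW// (bp_g hbase).
have hs x : `|detail i0 c0 x| + `|detail i0 c0 x| + `|(fun=> t) x| <= 1.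
  by rewrite dE normr0 !add0r ger0_norm.
have [Q [mQ sQ dQ aQ]] := family_law hW hbase (leqnn J0) (bm_cst t) (hc alpha) (hc beta) hs.
exists Q; split => //.
- apply: (law_spec_ext sQ (bp_bmP hbase) (bp_bmB hbase)) => h bh; congr dot; apply/funext => x.
    by rewrite dE mulr0 addr0.
  by rewrite dE mulr0 addr0.
- move=> h bh; rewrite dQ//; apply: eq_Ex => z; congr (_ * _).
  by rewrite /sdens !dE !mul0r !addr0.
- move=> h bh; rewrite aQ//; congr dot; apply/funext => x.
  by rewrite dE !mulr0 addr0 mulr0 addr0.
Qed.

Lemma const_law_psi t Q : law_spec C1 C2 Q P0 B0 ->
  (forall h, bm h -> Ex Q (fun w => A w * Y w * h (obsX w)) =
    dot (fun x => P0 x * B0 x + dl ^+ 2 * t) h) -> psi_fun Q = dl ^+ 2 * t.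
Proof.
move=> sQ aQ; rewrite (ls_psi sQ).
have bPB := bmM (bp_bmP hbase) (bp_bmB hbase).
have -> : Ex Q (fun w => A w * Y w) = dot (fun x => P0 x * B0 x + dl ^+ 2 * t) (fun=> 1).
  by rewrite -(aQ _ (bm_cst 1)); apply: eq_Ex => w; rewrite mulr1.
rewrite /dot (@eq_Ex _ _ _ _ _ (fun x => P0 x * B0 x + dl ^+ 2 * t)); last by move=> x; rewrite mulr1.
by rewrite ExD ?Ex_cst//; [ring|exact: bm_cst].
Qed.

(** The diagonal of the kernel has integral [#|idx W j|], so the bias of the
    estimators, as a function of the conditional covariance [dl ^+ 2 * t], has
    slope of order [resol j / n]. *)
Lemma const_diag_moment t Q j : (J0 <= j)%N -> law_spec C1 C2 Q P0 B0 ->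
  (forall h, bm h -> Ex Q (fun w => A w * Y w * h (obsX w)) =
    dot (fun x => P0 x * B0 x + dl ^+ 2 * t) h) ->
  diag_moment W C1 C2 Q j = dot (fun x => P0 x * B0 x) (fun x => Defs.kernel W j x x) +
    t * (dl ^+ 2 * #|idx W j|%:R).
Proof.
move=> hj sQ aQ; have bK := bm_diag hW hj.
have bPB := bmM (bp_bmP hbase) (bp_bmB hbase).
rewrite /diag_moment (aQ _ bK) dotDl//; last exact: bm_cst.
congr (_ + _); rewrite -(Ex_kernel_diag hW hj) mulrA (mulrC t) -ExZ//.
Qed.

(** The first-order and diagonal terms are the same for the four laws of [four_laws], so
    the second difference of the bias is that of <p, b>. *)
Lemma risk_ge_bias : exists2 c : R, 0 < c & forall n j1 j2,
  (0 < n)%N -> (J0 <= j1)%N -> (J0 <= j2)%N ->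
  let lo e := (((c * 2 `^ (- (e%:R * (alpha + beta)))) ^+ 2)%:E : \bar R) in
  [/\ (lo (minn j1 j2) <= max_risk Pm (psi_INT W j1 j2 (n := n)))%E,
      (lo (minn j1 j2) <= max_risk Pm (psi_MC W j1 j2 (n := n)))%E &
      (lo (maxn j1 j2) <= max_risk Pm (psi_IF W j1 j2 (n := n)))%E].
Proof.
have [c [c0 hc]] := four_laws hW i0 hbase alpha0 beta0; exists c => // n j1 j2 n0 h1 h2 lo.
have h12 : (J0 <= minn j1 j2)%N by rewrite leq_min h1.
have hM : (J0 <= maxn j1 j2)%N by rewrite leq_max h1.
have low l (w : R) r : c * 2 `^ (- (l%:R * (alpha + beta))) <= w ->
    ((w ^+ 2)%:E <= r -> lo l <= r)%E.
  move=> cw; apply: le_trans; rewrite lee_fin.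
  have cc0 : 0 <= c * 2 `^ (- (l%:R * (alpha + beta))) by rewrite mulr_ge0 ?powR_ge0// ltW.
  by rewrite ler_pXn2r ?nnegrE//; exact: le_trans cw.
have mI := measurable_psi_INT hW h1 h2 (n := n); have mC := measurable_psi_MC hW h1 h2 (n := n).
have mF := measurable_psi_IF hW h1 h2 (n := n).
have bI := bm_psi_INT hW n h1 h2 C1 C2; have bC := bm_psi_MC hW n h1 h2 C1 C2.
have bF := bm_psi_IF hW n h1 h2 C1 C2.
pose D l := dot (fun x => P0 x * B0 x) (fun x => Defs.kernel W l x x).
have dgm l Q : (J0 <= l)%N -> (forall h, bm h -> Ex Q (fun w => A w * Y w * h (obsX w)) =
    dot (fun x => P0 x * B0 x) h) -> diag_moment W C1 C2 Q l = D l.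
  by move=> hl aQ; rewrite /diag_moment (aQ _ (bm_diag hW hl)).
split.
- have [Q [p [b [y [z [w [cw sQ pQ aQ dQ]]]]]]] := hc _ h12.
  apply: (low _ _ _ cw); apply: (four_point (y := y) (z := z)
    (x := dot P0 B0 - (1 - n%:R^-1) * dot P0 (wproj W (minn j1 j2) B0) - n%:R^-1 * D (minn j1 j2))).
  move=> s t; have [mQ lQ] := sQ s t.
  apply: le_trans (max_risk_bias mQ lQ mI bI); rewrite lee_fin le_eqVlt; apply/orP; left; apply/eqP.
  by congr (_ ^+ 2); rewrite (bias_INT hW lQ n0 h1 h2) (dgm _ _ h12 (aQ s t)) dQ pQ//; ring.
- have [Q [p [b [y [z [w [cw sQ pQ aQ dQ]]]]]]] := hc _ h12.
  apply: (low _ _ _ cw); apply: (four_point (y := y) (z := z)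
    (x := dot P0 B0 - (1 - n%:R^-1) * dot P0 (wproj W (minn j1 j2) B0) - n%:R^-1 * D (minn j1 j2))).
  move=> s t; have [mQ lQ] := sQ s t.
  apply: le_trans (max_risk_bias mQ lQ mC bC); rewrite lee_fin le_eqVlt; apply/orP; left; apply/eqP.
  congr (_ ^+ 2); rewrite (Ex_psi_MC hW lQ n0 h1 h2) (bias_INT hW lQ n0 h1 h2).
  by rewrite (dgm _ _ h12 (aQ s t)) dQ pQ//; ring.
- have [Q [p [b [y [z [w [cw sQ pQ aQ dQ]]]]]]] := hc _ hM.
  apply: (low _ _ _ cw); apply: (four_point (y := y) (z := z)
    (x := dot P0 B0 - dot P0 (wproj W (maxn j1 j2) B0) -
      n%:R^-1 * dot P0 (wproj W (minn j1 j2) B0) + n%:R^-1 * D (minn j1 j2))).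
  move=> s t; have [mQ lQ] := sQ s t.
  apply: le_trans (max_risk_bias mQ lQ mF bF); rewrite lee_fin le_eqVlt; apply/orP; left; apply/eqP.
  have hmM : (minn j1 j2 <= maxn j1 j2)%N by rewrite (leq_trans (geq_minl _ _))// leq_maxl.
  by congr (_ ^+ 2); rewrite (bias_IF hW lQ n0 h1 h2) (dgm _ _ h12 (aQ s t)) dQ !pQ//; ring.
Qed.

(** The bias for the two constant covariances 0 and [dl ^+ 2] differs by the change of
    the diagonal moment. *)
Lemma risk_ge_diag : exists2 c : R, 0 < c & forall n j1 j2,
  (0 < n)%N -> (J0 <= j1)%N -> (J0 <= j2)%N ->
  let lo := (((c * (@resol R d (minn j1 j2) / n%:R)) ^+ 2)%:E : \bar R) in
  [/\ (lo <= max_risk Pm (psi_INT W j1 j2 (n := n)))%E,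
      (lo <= max_risk Pm (psi_MC W j1 j2 (n := n)))%E &
      (lo <= max_risk Pm (psi_IF W j1 j2 (n := n)))%E].
Proof.
have [cc [CC [cc0 CC0 hcard]]] := cdv_card hW; have dl0 := bp_dl hbase.
exists (dl ^+ 2 * cc / 2); first by rewrite divr_gt0// mulr_gt0// exprn_gt0.
move=> n j1 j2 n0 h1 h2 lo; set l := minn j1 j2 in lo *.
have h12 : (J0 <= l)%N by rewrite leq_min h1.
have n0' : 0 < n%:R :> R by rewrite ltr0n.
have [h _] := andP (hcard l h12).
pose w := n%:R^-1 * (dl ^+ 2 * #|idx W l|%:R).
have low (e : R) r : e = - w \/ e = w -> ((((e / 2) ^+ 2)%:E <= r) -> (lo <= r))%E.
  move=> ew; apply: le_trans; rewrite lee_fin.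
  have -> : (e / 2) ^+ 2 = (w / 2) ^+ 2 by case: ew => ->; rewrite ?mulNr ?sqrrN.
  have r0 := @resol_gt0 R d l.
  rewrite ler_pXn2r ?nnegrE//.
  - rewrite (_ : _ * (_ / _) = dl ^+ 2 / 2 / n%:R * (cc * @resol R d l)); last first.
      by field; rewrite gt_eqF.
    rewrite (_ : w / 2 = dl ^+ 2 / 2 / n%:R * #|idx W l|%:R); last first.
      by rewrite /w; field; rewrite gt_eqF.
    by rewrite ler_wpM2l// !divr_ge0// sqr_ge0.
  - by rewrite mulr_ge0 ?divr_ge0// ?mulr_ge0 ?sqr_ge0// ltW.
  - by rewrite divr_ge0// mulr_ge0 ?invr_ge0// mulr_ge0// sqr_ge0.
have mI := measurable_psi_INT hW h1 h2 (n := n); have mC := measurable_psi_MC hW h1 h2 (n := n).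
have mF := measurable_psi_IF hW h1 h2 (n := n).
have bI := bm_psi_INT hW n h1 h2 C1 C2; have bC := bm_psi_MC hW n h1 h2 C1 C2.
have bF := bm_psi_IF hW n h1 h2 C1 C2.
pose D := dot (fun x => P0 x * B0 x) (fun x => Defs.kernel W l x x).
have st (s : bool) : 0 <= (s%:R : R) <= 1 by case: s; rewrite lexx ler01.
split.
- apply: (low (- w)); first by left.
  apply: (two_point (x := dot P0 B0 - (1 - n%:R^-1) * dot P0 (wproj W l B0) - n%:R^-1 * D)).
  move=> s; have [Q [mQ lQ _ aQ]] := const_law (st s).
  apply: le_trans (max_risk_bias mQ lQ mI bI); rewrite lee_fin le_eqVlt; apply/orP; left; apply/eqP.
  by congr (_ ^+ 2); rewrite (bias_INT hW lQ n0 h1 h2) (const_diag_moment h12 lQ aQ) /w -/D; ring.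
- apply: (low (- w)); first by left.
  apply: (two_point (x := dot P0 B0 - (1 - n%:R^-1) * dot P0 (wproj W l B0) - n%:R^-1 * D)).
  move=> s; have [Q [mQ lQ _ aQ]] := const_law (st s).
  apply: le_trans (max_risk_bias mQ lQ mC bC); rewrite lee_fin le_eqVlt; apply/orP; left; apply/eqP.
  congr (_ ^+ 2); rewrite (Ex_psi_MC hW lQ n0 h1 h2) (bias_INT hW lQ n0 h1 h2).
  by rewrite (const_diag_moment h12 lQ aQ) /w -/D; ring.
- apply: (low w); first by right.
  apply: (two_point (x := dot P0 B0 - dot P0 (wproj W (maxn j1 j2) B0) -
      n%:R^-1 * dot P0 (wproj W l B0) + n%:R^-1 * D)).
  move=> s; have [Q [mQ lQ _ aQ]] := const_law (st s).
  apply: le_trans (max_risk_bias mQ lQ mF bF); rewrite lee_fin le_eqVlt; apply/orP; left; apply/eqP.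
  by congr (_ ^+ 2); rewrite (bias_IF hW lQ n0 h1 h2) (const_diag_moment h12 lQ aQ) /w -/D; ring.
Qed.

End bias_lower_bounds.

(** * The two-point method and the parametric rate *)

Lemma bm_minr {disp} {T : measurableType disp} {R : realType} (f g : T -> R) :
  bm f -> bm g -> bm (fun x => Num.min (f x) (g x)).
Proof.
move=> [mf [a ha]] [mg [b hb]]; split; first exact: measurable_minr.
exists (a + b) => D; have := ha D; have := hb D.
have := normr_ge0 (f D); have := normr_ge0 (g D).
by rewrite /Num.min; case: ifP => _ *; lra.
Qed.

Section le_cam.
Context {R : realType} {d : nat} {disp : measure_display} {Z : measurableType disp}.
Variables (mu : probability Z R) (tau : Z -> obs R d) (n : nat) (T : data R d n -> R).
Hypotheses (mtau : measurable_fun setT tau) (mT : measurable_fun setT T).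
Local Notation N := (n + n + n)%N.
Local Notation smp := (N.-tuple Z).

(** The two-point method.  [F1] and [F2] are densities with respect to a common law, of
    two laws or mixtures of laws with functionals [t1] and [t2]; no estimator is close to
    both where the densities overlap. *)
Lemma le_cam (F1 F2 : smp -> R) (t1 t2 a : R) (r : \bar R) : bm F1 -> bm F2 ->
  (forall D, 0 <= F1 D) -> (forall D, 0 <= F2 D) ->
  (forall L, bm L -> (forall D, 0 <= L D <= (T D - t1) ^+ 2) ->
     ((Ex (iid mu N) (fun D => F1 D * L (dsplit (map_tuple tau D))))%:E <= r)%E) ->
  (forall L, bm L -> (forall D, 0 <= L D <= (T D - t2) ^+ 2) ->
     ((Ex (iid mu N) (fun D => F2 D * L (dsplit (map_tuple tau D))))%:E <= r)%E) ->
  a <= Ex (iid mu N) (fun D => Num.min (F1 D) (F2 D)) ->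
  ((a * (t1 - t2) ^+ 2 / 4)%:E <= r)%E.
Proof.
move=> bF1 bF2 F10 F20 h1 h2 ha; set K := (t1 - t2) ^+ 2.
have K0 : 0 <= K by exact: sqr_ge0.
(* truncating the losses at the squared separation keeps them bounded *)
pose L t D := Num.min ((T D - t) ^+ 2) K.
have bL t : bm (L t).
  split.
    apply: measurable_minr; last exact: measurable_cst.
    by apply: measurable_funX; apply: measurable_funB => //; exact: measurable_cst.
  by exists K => D; rewrite ger0_norm ?ge_min ?lexx ?orbT// le_min sqr_ge0.
have L0 t D : 0 <= L t D <= (T D - t) ^+ 2.
  by rewrite le_min sqr_ge0 K0/= ge_min lexx.
have {h1} := h1 _ (bL t1) (L0 t1); have {h2} := h2 _ (bL t2) (L0 t2).
case: r => [r| |]; [|by move=> _ _; rewrite leey|by []]; rewrite !lee_fin => h2 h1.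
have mN : measurable_fun setT (fun D : smp => dsplit (map_tuple tau D)).
  by apply: (measurableT_comp (@measurable_dsplit R d n)); exact: measurable_map_tuple.
have b1 := bmM bF1 (bm_comp (bL t1) mN); have b2 := bmM bF2 (bm_comp (bL t2) mN).
have bm12 := bm_minr bF1 bF2; have bmK := bmM bm12 (bm_cst (K / 2)).
suff : Ex (iid mu N) (fun D => Num.min (F1 D) (F2 D) * (K / 2)) <= r + r.
  by rewrite ExZr// => hh; have := ler_wpM2r (_ : 0 <= K / 2) ha; rewrite divr_ge0// => /(_ isT); lra.
apply: le_trans (lerD h1 h2); rewrite -ExD//; apply: Ex_le => //; first exact: bmD.
move=> D; set m := Num.min _ _; set D' := dsplit _.
have m1 : m <= F1 D by rewrite ge_min lexx.
have m2 : m <= F2 D by rewrite ge_min lexx orbT.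
have m0 : 0 <= m by rewrite le_min F10 F20.
have /andP[l1 _] := L0 t1 D'; have /andP[l2 _] := L0 t2 D'.
apply: (@le_trans _ _ (m * L t1 D' + m * L t2 D')); last by apply: lerD; rewrite ler_wpM2r.
rewrite -mulrDr ler_wpM2l// /L /Num.min.
have q : K / 2 <= (T D' - t1) ^+ 2 + (T D' - t2) ^+ 2.
  by rewrite /K; have := sqr_ge0 ((T D' - t1) + (T D' - t2)); nra.
have := sqr_ge0 (T D' - t1); have := sqr_ge0 (T D' - t2).
by case: ifP => _; case: ifP => _ *; lra.
Qed.

End le_cam.

Section transfer.
Context {R : realType} {d : nat}.
Variables (Pm : set (probability (obs R d) R)).

(** A law given by a density with respect to [mu] turns its risk into an
    integral against the product density. *)
Lemma risk_density disp (Z : measurableType disp) (mu : probability Z R) (tau : Z -> obs R d)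
    (g : Z -> R) (Q : probability (obs R d) R) n (T : data R d n -> R) L :
  measurable_fun setT tau -> bm g ->
  (forall h, bm h -> Ex Q h = Ex mu (fun z => g z * h (tau z))) ->
  Pm Q -> measurable_fun setT T ->
  bm L -> (forall D, 0 <= L D <= (T D - psi_fun Q) ^+ 2) ->
  ((Ex (iid mu (n + n + n)) (fun D => (\prod_i g (tnth D i)) *
      L (dsplit (map_tuple tau D))))%:E <= max_risk Pm T)%E.
Proof.
move=> mtau bg hQ mQ mT bL hL; apply: le_trans (max_risk_ge T mQ).
have bLd := bm_comp bL (@measurable_dsplit R d n).
rewrite -(Ex_iid_change mtau bg hQ bLd) -(Ex_data_iid Q bL) -ExE//.
apply: ge0_le_integral => //.
- by move=> D _; rewrite lee_fin; case/andP: (hL D).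
- by apply/measurable_EFinP; case: bL.
- apply/measurable_EFinP; apply: measurable_funX; apply: measurable_funB => //; exact: measurable_cst.
- by move=> D _; rewrite lee_fin; case/andP: (hL D).
Qed.

End transfer.

Section parametric_rate.
Context {R : realType} {d J0 S : nat} (W : wavelets R d).
Hypotheses (hW : cdv_basis W J0 S) (hd : (1 <= d)%N).
Variables (C1 C2 alpha beta M dl g : R) (P0 B0 p0 b0 : d.-tuple R -> R).
Hypothesis hbase : @base_point R d J0 W C1 C2 alpha beta M dl g P0 B0 p0 b0.
Local Notation Pm := (model W J0 C1 C2 alpha beta M).

Lemma exp_half_le2 : expR (2^-1) <= 2 :> R.
Proof.
have := expR_ge1Dx (- 2^-1 : R); rewrite expRN => h.
have e0 := expR_gt0 (2^-1 : R).
have := ler_wpM2r (ltW e0) h; rewrite mulVf ?gt_eqF//; lra.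
Qed.

(** Changing the conditional covariance by a constant of order [n ^ (-1/2)]
    keeps the chi-square distance between the samples bounded. *)
Lemma minimax_parametric : exists2 c : R, 0 < c & forall n (T : data R d n -> R),
  (0 < n)%N -> measurable_fun setT T -> ((c / n%:R)%:E <= max_risk Pm T)%E.
Proof.
have dl0 := bp_dl hbase.
exists (dl ^+ 4 / 48); first by rewrite divr_gt0// exprn_gt0.
move=> n T n0 mT; have n0' : 0 < n%:R :> R by rewrite ltr0n.
have x0 : 0 <= (6 * n%:R : R)^-1 by rewrite invr_ge0 mulr_ge0// ltW.
pose t := Num.sqrt (6 * n%:R : R)^-1.
have t2 : t ^+ 2 = (6 * n%:R)^-1 by rewrite sqr_sqrtr.
have t0 : 0 <= t by exact: sqrtr_ge0.
have n1 : 1 <= n%:R :> R by rewrite ler1n.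
have t1 : t <= 1.
  rewrite -(ler_pXn2r (n := 2)) ?nnegrE// expr1n t2 invf_le1 ?mulr_gt0//.
  by rewrite -[leLHS]mul1r ler_pM// ler1n.
have h01 : 0 <= t <= 1 by rewrite t0.
have h00 : 0 <= (0 : R) <= 1 by rewrite lexx ler01.
have [Q1 [m1 s1 d1 a1]] := const_law hW hd hbase h01.
have [Q0 [m0 s0 d0 a0]] := const_law hW hd hbase h00.
have p1 := const_law_psi hbase s1 a1; have p0' := const_law_psi hbase s0 a0.
pose gt (t : R) (z : d.-tuple R * bool * bool) := 1 + t * (sg z.1.2 * sg z.2).
have bg s : bm (gt s).
  apply: bmD; first exact: bm_cst; apply: bmM; first exact: bm_cst.
  by apply: bmM; [exact: bm_sign1|exact: bm_sign2].
have gE s : Ex base_law (gt s) = 1.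
  rewrite Ex_base// -[RHS](Ex_cst (unif d)); apply: eq_Ex => x.
  by rewrite /gt /sg/=; field.
have g2E : Ex base_law (fun z => gt t z * gt t z) = 1 + t ^+ 2.
  rewrite Ex_base; last exact: bmM.
  rewrite -[RHS](Ex_cst (unif d)); apply: eq_Ex => x.
  by rewrite /gt /sg/=; field.
have ms := measurable_sobs dl (bp_bmP hbase) (bp_bmB hbase).
pose F s (D : (n + n + n).-tuple (d.-tuple R * bool * bool)) := \prod_i gt s (tnth D i).
have bF s : bm (F s) by apply: bm_prod => i; exact: (bm_tnth i (bg s)).
have ge0 s z : 0 <= s <= 1 -> 0 <= gt s z.
  by move=> /andP[u0 u1]; rewrite /gt /sg; case: z.1.2; case: z.2; lra.
have F0 s D : 0 <= s <= 1 -> 0 <= F s D by move=> hs; apply: prodr_ge0 => i _; exact: ge0.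
have FE s : Ex (iid base_law (n + n + n)) (F s) = 1.
  by rewrite (Ex_iid_prod_cst _ _ (bg s)) gE expr1n.
have F2E : Ex (iid base_law (n + n + n)) (fun D => F t D * F t D) <= 2.
  have -> : (fun D => F t D * F t D) = fun D => \prod_i ((fun z => gt t z * gt t z) (tnth D i)).
    by apply/funext => D; rewrite /F -big_split.
  rewrite (Ex_iid_prod_cst _ _ (bmM (bg t) (bg t))) g2E.
  apply: le_trans exp_half_le2; apply: (@le_trans _ _ (expR (t ^+ 2) ^+ (n + n + n))).
    by apply: lerXn2r; rewrite ?nnegrE ?expR_ge0 ?addr_ge0 ?sqr_ge0// expR_ge1Dx.
  rewrite -expRM_natl; rewrite t2 !natrD ler_expR le_eqVlt; apply/orP; left; apply/eqP; field.
  by rewrite gt_eqF.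
have F01 D : F 0 D = 1 by rewrite /F big1// => i _; rewrite /gt mul0r addr0.
have := @le_cam R d _ _ base_law (sobs dl P0 B0) n T ms mT (F t) (F 0) (dl ^+ 2 * t)
  (dl ^+ 2 * 0) 2^-1 (max_risk Pm T) (bF t) (bF 0) (fun D => F0 t D h01) (fun D => F0 0 D h00).
rewrite mulr0 subr0 exprMn t2 -exprM.
have -> : 2^-1 * (dl ^+ (2 * 2) * (6 * n%:R)^-1) / 4 = dl ^+ 4 / 48 / n%:R.
  by rewrite mulnn; field; rewrite gt_eqF.
apply.
- by move=> L bL hL; apply: (risk_density ms (bg t) d1 m1 mT bL) => D; rewrite p1.
- by move=> L bL hL; apply: (risk_density ms (bg 0) d0 m0 mT bL) => D; rewrite p0' mulr0.
- have bmm := bm_minr (bF t) (bF 0).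
  have b3 : bm (fun D => F t D - 4^-1 * (F t D * F t D)).
    by apply: bmB => //; apply: bmM; [exact: bm_cst|exact: bmM].
  apply: (@le_trans _ _ (Ex (iid base_law (n + n + n)) (fun D => F t D - 4^-1 * (F t D * F t D)))).
    rewrite ExB// ?FE; last by apply: bmM; [exact: bm_cst|exact: bmM].
    rewrite ExZ; last exact: bmM.
    lra.
  apply: Ex_le => // D; rewrite F01; have := F0 t D h01.
  rewrite /Num.min; set y := F t D => y0; case: ifP => [_|/negbT]; first by have := sqr_ge0 y; nra.
  by rewrite -leNgt => y1; have := sqr_ge0 (y - 2); nra.
Qed.

End parametric_rate.

(** * Inequalities for sign mixtures *)

Section parity.
Context {R : realType}.

(** Coefficients of [(B + t) ^+ N = E + t * O] in terms of [w = t ^+ 2]: [E] and [O] are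
    polynomials in [w] with nonnegative coefficients. *)
Fixpoint parity (B w : R) N : R * R :=
  if N is N'.+1 then
    let: (e, o) := parity B w N' in (B * e + w * o, e + B * o)
  else (1, 0).

Lemma parityE B t N : (B + t) ^+ N = (parity B (t ^+ 2) N).1 + t * (parity B (t ^+ 2) N).2.
Proof.
elim: N => [|N IH] /=; first by rewrite expr0 mulr0 addr0.
by rewrite exprS IH; case: (parity _ _ N) => E O /=; ring.
Qed.

(** By induction on [N], for the combination [E + x O], which is multiplied by [B + x] at
    each step up to the increment of [w]. *)
Lemma parity_diff B x Y N : 1 <= B -> 0 <= x -> 0 <= Y -> Y <= x ^+ 2 ->
  (parity B (x ^+ 2) N).1 - (parity B Y N).1 <= N%:R ^+ 2 * (x ^+ 2 - Y) * (B + x) ^+ N.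
Proof.
move=> B1 x0 Y0 YX; set X := x ^+ 2.
have X0 : 0 <= X by exact: sqr_ge0.
pose p n := (B + x) ^+ n; have p0 n : 0 <= p n by rewrite exprn_ge0//; lra.
suff [h1 h2 h3 h4 h5] : [/\ 0 <= (parity B Y N).1 <= (parity B X N).1,
    0 <= (parity B Y N).2 <= (parity B X N).2,
    (parity B X N).1 + x * (parity B X N).2 = p N,
    (parity B X N).2 <= N%:R * p N &
    ((parity B X N).1 - (parity B Y N).1) + x * ((parity B X N).2 - (parity B Y N).2) <=
      N%:R ^+ 2 * (X - Y) * p N].
  apply: le_trans h5; rewrite lerDl mulr_ge0//; case/andP: h2; lra.
elim: N => [|N] /=.
  have p1 : p 0 = 1 by rewrite /p expr0.
  by rewrite p1 !subrr !mulr0 addr0 !lexx ler01 expr0n/= !mul0r; split.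
rewrite /p (exprS (B + x)) -/(p N) -natr1; have := p0 N; set q := p N.
case: (parity B X N) => E O; case: (parity B Y N) => E' O' /= q0.
move=> [/andP[E0 EE] /andP[z0 zz] eq hO hD].
have m0 : 0 <= N%:R :> R by [].
set m : R := N%:R in hO hD m0 *.
have Bx1 : 1 <= B + x by lra.
have B0 : 0 <= B by lra.
have qm : q <= (B + x) * q by rewrite ler_peMl.
have hXO : x * O = q - E by rewrite -eq; ring.
split.
- apply/andP; split; first by rewrite addr_ge0// mulr_ge0.
  by apply: lerD; [rewrite ler_wpM2l|rewrite ler_pM].
- apply/andP; split; first by rewrite addr_ge0// mulr_ge0.
  by apply: lerD => //; rewrite ler_wpM2l.
- by rewrite -eq /X; ring.
- have h0 : E <= q by rewrite -eq lerDl mulr_ge0// (le_trans z0).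
  have h1 : B * O <= (B + x) * (m * q).
    by apply: ler_pM => //; [exact: le_trans z0 zz|rewrite lerDl].
  rewrite (_ : (m + 1) * _ = (B + x) * (m * q) + (B + x) * q); last by ring.
  lra.
- have XY0 : 0 <= X - Y by rewrite subr_ge0.
  have h1 : O' <= m * q by exact: le_trans zz hO.
  have -> : B * E + X * O - (B * E' + Y * O') + x * (E + B * O - (E' + B * O')) =
      (B + x) * (E - E' + x * (O - O')) + (X - Y) * O'.
    by rewrite /X; ring.
  apply: (@le_trans _ _ ((B + x) * (m ^+ 2 * (X - Y) * q) + (X - Y) * (m * q))).
    by apply: lerD; apply: ler_wpM2l => //; lra.
  rewrite -subr_ge0 (_ : _ - _ =
    (X - Y) * ((m + m + 1) * ((B + x) * q) - m * q)); last by ring.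
  rewrite mulr_ge0// subr_ge0; apply: ler_pM => //; lra.
Qed.

(** The left-hand side is even in [x] and in [y], hence of second order, and only
    [x ^+ 2 - y ^+ 2] matters. *)
Lemma even_part_diff (B x y : R) N : 1 <= B -> 0 <= x -> y ^+ 2 <= x ^+ 2 ->
  (B + x) ^+ N - (B + y) ^+ N + ((B - x) ^+ N - (B - y) ^+ N) <=
  2 * N%:R ^+ 2 * (x ^+ 2 - y ^+ 2) * (B + x) ^+ N.
Proof.
move=> B1 x0 yx; have := parity_diff N B1 x0 (sqr_ge0 y) yx.
rewrite [X in X - _ + _](parityE B x) (parityE B y) (parityE B (- x)) (parityE B (- y)) !sqrrN; lra.
Qed.

End parity.

Section sign_mixture_algebra.
Context {R : realType} {J : finType}.

(** At most one term does not vanish. *)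
Lemma disjoint_prod (x : J -> R) : (forall j k, j != k -> x j * x k = 0) ->
  \prod_j (1 + x j) = 1 + \sum_j x j.
Proof.
move=> hx; case: (pickP (fun j => x j != 0)) => [j xj|x0].
  rewrite (bigD1 j)//= [X in _ = 1 + X](bigD1 j)//= !big1 ?mulr1 ?addr0// => k kj.
    by have /eqP := hx k j kj; rewrite mulf_eq0 (negPf xj) orbF => /eqP.
  by have /eqP := hx k j kj; rewrite mulf_eq0 (negPf xj) orbF => /eqP ->; rewrite addr0.
have x00 j : x j = 0 by have := x0 j => /negbFE/eqP.
by rewrite !big1 ?addr0// => j _; rewrite x00 ?addr0.
Qed.

Lemma sum_signs_prod (G : J -> bool -> R) :
  \sum_(s : {ffun J -> bool}) \prod_j G j (s j) = \prod_j (G j true + G j false).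
Proof.
rewrite -bigA_distr_bigA/=; apply: eq_bigr => j _; by rewrite big_bool.
Qed.

End sign_mixture_algebra.

(** With [q / p = exp x] this is min(1, exp x) >= 1/2 - 3 (exp x - 1 - x): the overlap of
    two densities is bounded below by their Kullback-Leibler divergence, whose density is
    [exp x - 1 - x] up to a term of integral 0. *)
Lemma min_ge_kl (R : realType) (p q S : R) : 0 < p -> 0 < q -> p <= q * expR S ->
  p / 2 - 3 * (q - p + p * S) <= Num.min p q.
Proof.
move=> p0 q0 h; set e := expR (- S).
have e0 : 0 < e by exact: expR_gt0.
have hq : p * e <= q.
  have := ler_wpM2r (ltW e0) h; rewrite -mulrA /e -expRD subrr expR0 mulr1//.
have e1 : 1 - S <= e by have := expR_ge1Dx (- S).
have key : p * (7 / 2 - 3 * S) <= 4 * q.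
  apply: (@le_trans _ _ (p * (4 * e))); last by rewrite mulrCA ler_pM2l.
  rewrite ler_pM2l//.
  (* for large S the bound 1 - S on exp (- S) is too weak; it is applied after
     splitting off exp (- 1/2) >= 1/2 *)
  have [S2|S2] := lerP S (2^-1); first lra.
  have h2 : (2^-1 : R) <= expR (- 2^-1) by have := expR_ge1Dx (- 2^-1 : R); lra.
  have h3 : 1 + (2^-1 - S) <= expR (2^-1 - S) := expR_ge1Dx _.
  have h4 : e = expR (- 2^-1) * expR (2^-1 - S) by rewrite -expRD /e; congr expR; ring.
  have h5 := expR_gt0 (2^-1 - S).
  have : 2^-1 * expR (2^-1 - S) <= e by rewrite h4 ler_wpM2r// ltW.
  lra.
have key2 : p * (1 - S) <= q by apply: le_trans hq; rewrite ler_pM2l.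
by rewrite /Num.min; case: ifP => [pq|/negbT]; [|rewrite -leNgt => qp]; move: key key2; nra.
Qed.

(** * Mixtures over the signs of disjoint functions *)

Lemma bm_div {disp} {T : measurableType disp} {R : realType} (f g : T -> R) (c : R) :
  bm f -> bm g -> 0 < c -> (forall x, c <= g x) -> bm (fun x => f x / g x).
Proof.
move=> bf [mg _] c0 hc; apply: bmM => //; split.
  rewrite (_ : (fun x => _) = (fun x => g x `^ (-1))); last first.
    by apply/funext => x; rewrite powR_inv1// (le_trans (ltW c0)).
  exact: measurableT_comp (measurable_powR _) mg.
by exists c^-1 => x; rewrite normfV ger0_norm ?lef_pV2 ?posrE ?(lt_le_trans c0)// (le_trans (ltW c0)).
Qed.

Lemma exists_image_density d1 d2 (T1 : measurableType d1) (T2 : measurableType d2)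
    (R : realType) (mu : probability T1 R) (g : T1 -> R) (tau : T1 -> T2) :
  bm g -> (forall z, 0 <= g z) -> Ex mu g = 1 -> measurable_fun setT tau ->
  exists Q : probability T2 R, forall h, bm h -> Ex Q h = Ex mu (fun z => g z * h (tau z)).
Proof.
move=> bg g0 g1 mt; have [Q hQ] := exists_density bg g0 g1.
pose t : {mfun T1 >-> T2} := mfun_Sub (mem_set mt).
exists (distribution Q t) => h bh; rewrite Ex_distribution// hQ//.
exact: (bm_comp bh mt).
Qed.

Section sign_mixture.
Context {R : realType} {d : nat} {J : finType}.
Variables (f : J -> d.-tuple R -> R) (e1 e2 : R).
Hypotheses (bf : forall j, bm (f j)) (e10 : 0 <= e1) (e20 : 0 <= e2)
  (disj : forall j k, j != k -> forall x, f j x * f k x = 0)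
  (small : forall j x, (e1 + e2) * `|f j x| <= 2^-1).

Local Notation Z := (d.-tuple R * bool * bool)%type.
Local Notation mu := (@base_law R d).

(** The first-order change of the density of one observation when [f j] perturbs both
    regression functions, with relative sign [s]. *)
Definition tilt (s : bool) j (z : Z) : R := f j z.1.1 * (e1 * sg z.1.2 + sg s * e2 * sg z.2).

Lemma bm_tilt s j : bm (tilt s j).
Proof.
apply: bmM; first exact: bm_signX.
apply: bmD; (apply: bmM; first exact: bm_cst); [exact: bm_sign1|exact: bm_sign2].
Qed.

Lemma tilt_le s j z : `|tilt s j z| <= 2^-1.
Proof.
apply: le_trans (small j z.1.1); rewrite normrM mulrC ler_wpM2r//.
have sg1 (b : bool) : `|sg b : R| = 1 by case: b; rewrite /sg ?normrN normr1.
apply: (le_trans (ler_normD _ _)).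
by rewrite !normrM !sg1 !mulr1 mul1r !ger0_norm.
Qed.

(** The density of one observation when the perturbations of the regression functions
    are [e1] and [sg s * e2] times the same combination of the [f j] with signs [lam]. *)
Definition sdensity (s : bool) (lam : J -> bool) (z : Z) : R :=
  1 + (\sum_j sg (lam j) * f j z.1.1) * (e1 * sg z.1.2 + sg s * e2 * sg z.2).

Lemma sdensityE s lam z : sdensity s lam z = \prod_j (1 + sg (lam j) * tilt s j z).
Proof.
rewrite disjoint_prod; last first.
  move=> j k jk; rewrite /tilt (_ : _ * _ = sg (lam j) * sg (lam k) * (f j z.1.1 * f k z.1.1) *
    (e1 * sg z.1.2 + sg s * e2 * sg z.2) ^+ 2); last by ring.
  by rewrite disj// mulr0 mul0r.
by rewrite /sdensity mulr_suml; congr (1 + _); apply: eq_bigr => j _; rewrite mulrA.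
Qed.

Lemma factor_ge (b s : bool) j z : 2^-1 <= 1 + sg b * tilt s j z.
Proof.
by have := tilt_le s j z; rewrite ler_norml => /andP[]; rewrite /sg; case: b; lra.
Qed.

Lemma sdensity_ge0 s lam z : 0 <= sdensity s lam z.
Proof.
rewrite sdensityE; apply: prodr_ge0 => j _; have := factor_ge (lam j) s j z; lra.
Qed.

Lemma bm_sdensity s lam : bm (sdensity s lam).
Proof.
apply: bmD; first exact: bm_cst; apply: bmM.
  by apply: bm_sum => j; apply: bmM; [exact: bm_cst|exact: bm_signX].
apply: bmD; (apply: bmM; first exact: bm_cst); [exact: bm_sign1|exact: bm_sign2].
Qed.

(** [Ex_mixture_cell] compares laws after this map, under which the observations outside
    the support of [f j] carry no information. *)
Definition erase j (z : Z) : Z := if f j z.1.1 == 0 then (z.1.1, true, true) else z.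

Lemma measurable_erase j : measurable_fun setT (erase j).
Proof.
apply: measurable_fun_ifT => //.
  apply: measurable_fun_eqr; last exact: measurable_cst.
  by apply: bm_meas; exact: bm_signX.
apply: measurable_fun_pair; last exact: measurable_cst.
by apply: measurable_fun_pair; [exact: measurableT_comp|exact: measurable_cst].
Qed.

Lemma tilt_erase s j z : tilt s j (erase j z) = tilt s j z.
Proof. by rewrite /erase /tilt; case: ifP => // /eqP -> /=; rewrite !mul0r. Qed.

(** Off the support of [f j] the signs are averaged out, and on it the other [f k]
    vanish. *)
Lemma Ex_sdensity_erase s lam j (h : Z -> R) : bm h ->
  Ex mu (fun z => sdensity s lam z * h (erase j z)) =
  Ex mu (fun z => (1 + sg (lam j) * tilt s j z) * h (erase j z)).
Proof.
move=> bh; have bhe := bm_comp bh (measurable_erase j).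
have bt : bm (fun z => 1 + sg (lam j) * tilt s j z).
  by apply: bmD; [exact: bm_cst|apply: bmM; [exact: bm_cst|exact: bm_tilt]].
rewrite (Ex_base (bmM (bm_sdensity s lam) bhe)) (Ex_base (bmM bt bhe)).
apply: eq_Ex => x; rewrite /erase /sdensity /tilt /=; case: eqP => [->|/eqP fj].
  by rewrite /sg; field.
rewrite (bigD1 j)//= big1 ?addr0; last first.
  move=> k kj; have /eqP := disj kj x.
  by rewrite mulf_eq0 (negPf fj) orbF => /eqP ->; rewrite mulr0.
by rewrite !mulrA.
Qed.

Lemma Ex_sdensity s lam : Ex mu (sdensity s lam) = 1.
Proof.
rewrite (Ex_base (bm_sdensity s lam)) -[RHS](Ex_cst (unif d)); apply: eq_Ex => x.
by rewrite /sdensity /sg/=; field.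
Qed.

Lemma Ex_factor b s j : Ex mu (fun z => 1 + sg b * tilt s j z) = 1.
Proof.
have bt : bm (fun z => 1 + sg b * tilt s j z).
  by apply: bmD; [exact: bm_cst|apply: bmM; [exact: bm_cst|exact: bm_tilt]].
rewrite (Ex_base bt) -[RHS](Ex_cst (unif d)); apply: eq_Ex => x.
by rewrite /tilt /sg/=; field.
Qed.

Variable N : nat.
Local Notation smp := (N.-tuple Z).

Definition signed_cell s j b (D : smp) : R := \prod_i (1 + sg b * tilt s j (tnth D i)).
Definition cell s j (D : smp) : R := (signed_cell s j true D + signed_cell s j false D) / 2.
(** The density of the sample when the signs are averaged out ([mixtureE]); it
    factorizes because the [f j] have disjoint supports. *)
Definition mixture s (D : smp) : R := \prod_j cell s j D.

Let bfac b s j : bm (fun z => 1 + sg b * tilt s j z).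
Proof. by apply: bmD; [exact: bm_cst|apply: bmM; [exact: bm_cst|exact: bm_tilt]]. Qed.

Lemma bm_signed_cell s j b : bm (signed_cell s j b).
Proof. by apply: bm_prod => i; exact: (bm_tnth i (bfac b s j)). Qed.

Lemma bm_cell s j : bm (cell s j).
Proof. by apply: bmM; [apply: bmD; exact: bm_signed_cell|exact: bm_cst]. Qed.

Lemma bm_mixture s : bm (mixture s).
Proof. by apply: bm_prod => j; exact: bm_cell. Qed.

Lemma signed_cell_ge s j b D : 2^-1 ^+ N <= signed_cell s j b D.
Proof.
rewrite -[N in _ ^+ N]card_ord -prodr_const; apply: ler_prod => i _.
by rewrite factor_ge invr_ge0 ler0n.
Qed.

Lemma cell_ge s j D : 2^-1 ^+ N <= cell s j D.
Proof. have := signed_cell_ge s j true D; have := signed_cell_ge s j false D; rewrite /cell; lra. Qed.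

Lemma half_exp_gt0 : 0 < 2^-1 ^+ N :> R.
Proof. by rewrite exprn_gt0// invr_gt0. Qed.

Lemma cell_gt0 s j D : 0 < cell s j D.
Proof. exact: lt_le_trans half_exp_gt0 (cell_ge s j D). Qed.

Lemma mixtureE s D : mixture s D = (2^-1) ^+ #|J| *
  \sum_(lam : {ffun J -> bool}) \prod_i sdensity s lam (tnth D i).
Proof.

under eq_bigr => lam _.
  under eq_bigr => i _ do rewrite sdensityE.
  rewrite exchange_big/=; over.
rewrite (sum_signs_prod (fun j b => signed_cell s j b D)) /mixture /cell.
by rewrite big_split/= prodr_const mulrC.
Qed.

Lemma Ex_signed_cell s j b : Ex (iid mu N) (signed_cell s j b) = 1.
Proof. by rewrite (Ex_iid_prod_cst _ _ (bfac b s j)) Ex_factor expr1n. Qed.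

Lemma Ex_cell s j : Ex (iid mu N) (cell s j) = 1.
Proof.
rewrite /cell ExZr ?ExD ?Ex_signed_cell; [by field|exact: bm_signed_cell..|].
by apply: bmD; exact: bm_signed_cell.
Qed.

Lemma bm_prod_sdensity s lam : bm (fun D : smp => \prod_i sdensity s lam (tnth D i)).
Proof. by apply: bm_prod => i; exact: (bm_tnth i (bm_sdensity s lam)). Qed.

(** A function of the signs in one cell does not see how the other cells are tilted, so
    the law of the sample may be replaced by the one tilted in that cell only. *)
Lemma Ex_mixture_cell s j (G : smp -> R) : bm G ->
  (forall D, G (map_tuple (erase j) D) = G D) ->
  Ex (iid mu N) (fun D => mixture s D * G D) = Ex (iid mu N) (fun D => cell s j D * G D).
Proof.
move=> bG hG; have me := measurable_erase j.
pose H b := Ex (iid mu N) (fun D => signed_cell s j b D * G D).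
have E1 lam : Ex (iid mu N) (fun D => (\prod_i sdensity s lam (tnth D i)) * G D) = H (lam j).
  have [Q hQ] := exists_image_density (bm_sdensity s lam) (sdensity_ge0 s lam)
    (Ex_sdensity s lam) me.
  have := Ex_iid_change me (bm_sdensity s lam) hQ bG.
  have hQ' h : bm h -> Ex Q h =
      Ex mu (fun z => (1 + sg (lam j) * tilt s j z) * h (erase j z)).
    by move=> bh; rewrite hQ// Ex_sdensity_erase.
  rewrite (Ex_iid_change me (bfac (lam j) s j) hQ' bG) => E.
  transitivity (Ex (iid mu N) (fun D => (\prod_i sdensity s lam (tnth D i)) * G (map_tuple (erase j) D))).
    by apply: eq_Ex => D; rewrite hG.
  by rewrite -E; apply: eq_Ex => D; rewrite hG.
have -> : (fun D => mixture s D * G D) = fun D => (2^-1) ^+ #|J| *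
    \sum_(lam : {ffun J -> bool}) (\prod_i sdensity s lam (tnth D i)) * G D.
  by apply/funext => D; rewrite mixtureE -mulrA mulr_suml.
have b1 (lam : {ffun J -> bool}) := bmM (bm_prod_sdensity s lam) bG.
rewrite ExZ; last exact: bm_sum.
rewrite Ex_sum//; under eq_bigr => lam _ do rewrite E1.
transitivity ((H true + H false) / 2); last first.
  have b2 b := bmM (bm_signed_cell s j b) bG.
  rewrite /H -ExD// -ExZr; last exact: bmD.
  by apply: eq_Ex => D; rewrite /cell; field.
pose K k b := if k == j then H b else 1.
have -> : \sum_(lam : {ffun J -> bool}) H (lam j) =
    \sum_(lam : {ffun J -> bool}) \prod_k K k (lam k).
  apply: eq_bigr => lam _; rewrite (bigD1 j)//= big1 ?mulr1 /K ?eqxx// => k kj.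
  by rewrite (negPf kj).
rewrite sum_signs_prod (_ : _ ^+ _ = \prod_(k : J) (2^-1 : R)); last by rewrite prodr_const.
rewrite -big_split/= (bigD1 j)//= big1.
  by rewrite mulr1 /K eqxx mulrC.
by move=> k kj; rewrite /K (negPf kj); field.
Qed.

Lemma Ex_mixture s : Ex (iid mu N) (mixture s) = 1.
Proof.
have -> : mixture s = fun D => (2^-1) ^+ #|J| *
    \sum_(lam : {ffun J -> bool}) \prod_i sdensity s lam (tnth D i).
  by apply/funext => D; rewrite mixtureE.
have b1 (lam : {ffun J -> bool}) := bm_prod_sdensity s lam.
rewrite ExZ; last exact: bm_sum.
rewrite Ex_sum//; under eq_bigr => lam _ do rewrite (Ex_iid_prod_cst _ _ (bm_sdensity s lam)) Ex_sdensity expr1n.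
by rewrite sumr_const card_ffun card_bool natrX -exprMn mulVf// expr1n.
Qed.

End sign_mixture.

(** * The distance between two sign mixtures *)

Section mixture_distance.
Context {R : realType} {d : nat} {J : finType}.
Variables (f : J -> d.-tuple R -> R) (e1 e2 : R).
Hypotheses (bf : forall j, bm (f j)) (e10 : 0 <= e1) (e20 : 0 <= e2)
  (disj : forall j k, j != k -> forall x, f j x * f k x = 0)
  (small : forall j x, (e1 + e2) * `|f j x| <= 2^-1).

Local Notation Z := (d.-tuple R * bool * bool)%type.
Local Notation mu := (@base_law R d).
Local Notation tiltf := (tilt f e1 e2).

(** It bounds the inverse of a density factor, and its product over the sample the
    inverse of [cell] ([cell_weight_ge1]). *)
Definition weight j (z : Z) : R := 1 + (f j z.1.1 != 0)%:R.

Lemma bm_neq0 j : bm (fun x => (f j x != 0)%:R : R).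
Proof.
split; last by exists 1 => x; case: (f j x != 0); rewrite ?normr1 ?normr0.
rewrite (_ : (fun x => _) = fun x => if f j x == 0 then 0 else 1); last first.
  by apply/funext => x; case: (f j x == 0).
apply: measurable_fun_ifT; [|exact: measurable_cst|exact: measurable_cst].
by apply: measurable_fun_eqr; [exact: bm_meas|exact: measurable_cst].
Qed.

Lemma bm_weight j : bm (weight j).
Proof. by apply: bmD; [exact: bm_cst|exact: bm_signX (bm_neq0 j)]. Qed.

Lemma weight_factor_ge1 (b s : bool) j z : 1 <= (1 + sg b * tiltf s j z) * weight j z.
Proof.
have h := factor_ge e10 e20 small b s j z; rewrite /weight.
have [f0|f0] := eqVneq (f j z.1.1) 0; last by rewrite /=; lra.
by rewrite /tilt f0 mul0r mulr0 !addr0 mul1r.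
Qed.

(** The signs are fair, so only the terms with each sign an even number of times
    remain; the weight 2 on the support of [f j] doubles the second moment of [f j]. *)
Lemma Ex_weight_factors j (b s b' s' : bool) :
  Ex mu (fun z => weight j z * ((1 + sg b * tiltf s j z) * (1 + sg b' * tiltf s' j z))) =
  1 + Ex (unif d) (fun x => (f j x != 0)%:R) +
  sg b * sg b' * (2 * Ex (unif d) (fun x => f j x ^+ 2) * (e1 ^+ 2 + sg s * sg s' * e2 ^+ 2)).
Proof.
have bt b1 s1 : bm (fun z => 1 + sg b1 * tiltf s1 j z).
  by apply: bmD; [exact: bm_cst|apply: bmM; [exact: bm_cst|exact: bm_tilt]].
rewrite Ex_base; last by apply: bmM; [exact: bm_weight|exact: bmM].
pose c : R := sg b * sg b' * (2 * (e1 ^+ 2 + sg s * sg s' * e2 ^+ 2)).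
transitivity (Ex (unif d) (fun x => 1 + (f j x != 0)%:R + c * f j x ^+ 2)).
  apply: eq_Ex => x; rewrite /weight /tilt /c /=; have [->|_] := eqVneq (f j x) 0 => /=.
    by rewrite /sg /=; case: b s b' s' @c => -[] [] [] /=; field.
  by rewrite /sg /=; case: b s b' s' @c => -[] [] [] /=; field.
have b1 := bm_neq0 j; have b2 := bmX 2 (bf j).
rewrite ExD ?ExD ?Ex_cst ?ExZ//; [rewrite /c; ring|exact: bm_cst| |].
  by apply: bmD => //; exact: bm_cst.
by apply: bmM => //; exact: bm_cst.
Qed.

Variable N : nat.
Local Notation smp := (N.-tuple Z).
Local Notation cellf := (cell f e1 e2 (N := N)).
Local Notation signedf := (signed_cell f e1 e2 (N := N)).
Local Notation mixf := (mixture f e1 e2 (N := N)).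

Definition cell_weight j (D : smp) : R := \prod_i weight j (tnth D i).

Definition cell_dist j (D : smp) : R :=
  cell_weight j D * (cellf true j D - cellf false j D) ^+ 2.

Lemma bm_cell_weight j : bm (cell_weight j).
Proof. by apply: bm_prod => i; exact: (bm_tnth i (bm_weight j)). Qed.

Lemma bm_cell_dist j : bm (cell_dist j).
Proof. by apply: bmM; [exact: bm_cell_weight|apply: bmX; apply: bmB; exact: bm_cell]. Qed.

Lemma cell_weight_ge1 s j D : 1 <= cellf s j D * cell_weight j D.
Proof.
have h b : 1 <= signedf s j b D * cell_weight j D.
  rewrite /signedf /cell_weight -big_split/=.
  apply: (@le_trans _ _ (\prod_(i < N) 1)); first by rewrite big1_eq.
  by apply: ler_prod => i _; rewrite ler01/=; exact: weight_factor_ge1.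
by have := h true; have := h false; rewrite /cell; lra.
Qed.

(** Expanding the square gives powers of [1 + q] plus or minus [x] and [y], where [x] and
    [y] come from equal and opposite relative signs; what remains is the difference of
    their even parts. *)
Lemma Ex_cell_dist j (q rho : R) :
  q = Ex (unif d) (fun x => (f j x != 0)%:R) ->
  rho = Ex (unif d) (fun x => f j x ^+ 2) ->
  Ex (iid mu N) (cell_dist j) <=
  2 * N%:R ^+ 2 * (16 * (rho * e1 * e2) ^+ 2) * (1 + q + 2 * rho * (e1 ^+ 2 + e2 ^+ 2)) ^+ N.
Proof.
move=> qE rhoE.
have rho0 : 0 <= rho by rewrite rhoE; apply: Ex_ge0 => x; exact: sqr_ge0.
have q0 : 0 <= q by rewrite qE; apply: Ex_ge0 => x; exact: ler0n.
pose P (s b s' b' : bool) D := cell_weight j D * (signedf s j b D * signedf s' j b' D).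
have bP s b s' b' : bm (P s b s' b').
  by apply: bmM; [exact: bm_cell_weight|apply: bmM; exact: bm_signed_cell].
pose c (s b s' b' : bool) : R := sg b * sg b' * (2 * rho * (e1 ^+ 2 + sg s * sg s' * e2 ^+ 2)).
have EP s b s' b' : Ex (iid mu N) (P s b s' b') = (1 + q + c s b s' b') ^+ N.
  rewrite /c qE rhoE -(Ex_weight_factors j b s b' s') -Ex_iid_prod_cst; last first.
    apply: bmM; first exact: bm_weight.
    by apply: bmM; (apply: bmD; [exact: bm_cst|apply: bmM; [exact: bm_cst|exact: bm_tilt]]).
  by apply: eq_Ex => D; rewrite /P /signed_cell /cell_weight -!big_split.
have -> : cell_dist j = fun D => \sum_s \sum_b \sum_s' \sum_b'
    sg s * sg s' / 4 * P s b s' b' D.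
  by apply/funext => D; rewrite !big_bool /cell_dist /P /cell /sg/=; field.
have b1 s b s' b' : bm (fun D => sg s * sg s' / 4 * P s b s' b' D).
  by apply: bmM => //; exact: bm_cst.
rewrite Ex_sum; last by move=> s; apply: bm_sum => b; apply: bm_sum => s'; exact: bm_sum.
under eq_bigr => s _.
  rewrite Ex_sum; last by move=> b; apply: bm_sum => s'; exact: bm_sum.
  under eq_bigr => b _.
    rewrite Ex_sum; last by move=> s'; exact: bm_sum.
    under eq_bigr => s' _.
      rewrite Ex_sum//; under eq_bigr => b' _ do rewrite ExZ// EP; over.
    over.
  over.
rewrite /= !big_bool /= /c /sg.
set x := 2 * rho * (e1 ^+ 2 + e2 ^+ 2); pose y := 2 * rho * (e1 ^+ 2 - e2 ^+ 2).
have xy : x ^+ 2 - y ^+ 2 = 16 * (rho * e1 * e2) ^+ 2 by rewrite /x /y; ring.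
have x0 : 0 <= x by rewrite mulr_ge0 ?addr_ge0 ?sqr_ge0// mulr_ge0.
have yx : y ^+ 2 <= x ^+ 2 by rewrite -subr_ge0 xy mulr_ge0 ?sqr_ge0.
have B1 : 1 <= 1 + q by rewrite lerDl.
rewrite -xy; apply: le_trans (even_part_diff N B1 x0 yx).
rewrite le_eqVlt; apply/orP; left; apply/eqP.
rewrite !(mul1r, mulN1r, mulrN, mulr1, opprK, mulNr) -/x -/y.
by field.
Qed.

(** The Kullback-Leibler divergence is additive over the cells, although the
    observations in different cells are dependent, and each cell contributes
    at most its chi-square distance. *)
Lemma mixture_overlap :
  2^-1 - 3 * \sum_j Ex (iid mu N) (cell_dist j) <=
  Ex (iid mu N) (fun D => Num.min (mixf true D) (mixf false D)).
Proof.
(* G j bounds the logarithm of the ratio of the two factors *)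
pose G j D := cellf true j D / cellf false j D - 1.
have bc s j : bm (cellf s j) := bm_cell e1 e2 bf N s j.
have bG j : bm (G j).
  apply: bmB; last exact: bm_cst.
  exact: (bm_div (bc true j) (bc false j) (half_exp_gt0 N) (cell_ge e10 e20 small false j)).
have c0 s j D : 0 < cellf s j D := cell_gt0 e10 e20 small s j D.
have m0 s D : 0 < mixf s D by apply: prodr_gt0 => j _.
have bmix s : bm (mixf s) := bm_mixture e1 e2 bf N s.
have bS : bm (fun D => \sum_j mixf true D * G j D) by apply: bm_sum => j; exact: bmM.
pose lo D := mixf true D / 2 - 3 * (mixf false D - mixf true D +
   \sum_j mixf true D * G j D).
have b2 : bm (fun D => mixf true D / 2) by apply: bmM => //; exact: bm_cst.
have b3 : bm (fun D => mixf false D - mixf true D + \sum_j mixf true D * G j D).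
  by apply: bmD => //; exact: bmB.
have b4 : bm (fun D => 3 * (mixf false D - mixf true D + \sum_j mixf true D * G j D)).
  by apply: bmM => //; exact: bm_cst.
have Emix s : Ex (iid mu N) (mixf s) = 1 by exact: Ex_mixture.
have h1 : Ex (iid mu N) lo <= Ex (iid mu N) (fun D => Num.min (mixf true D) (mixf false D)).
  apply: Ex_le => [||D]; [exact: bmB| |].
    by apply: bm_minr.
  rewrite /lo -mulr_sumr; apply: min_ge_kl => //.
  rewrite expR_sum -big_split/=; apply: ler_prod => j _; rewrite (ltW (c0 _ _ _))/=.
  have := expR_ge1Dx (G j D); rewrite {1}/G addrC subrK ler_pdivrMr// => h.
  by rewrite mulrC.
apply: le_trans h1; rewrite /lo ExB// ExZr// ExZ// ExD//; last exact: bmB.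
rewrite ExB// !Emix subrr add0r Ex_sum; last by move=> j; exact: bmM.
have : \sum_j Ex (iid mu N) (fun D => mixf true D * G j D) <=
    \sum_j Ex (iid mu N) (cell_dist j).
  apply: ler_sum => j _; rewrite (Ex_mixture_cell bf e10 e20 disj small true (j := j) (bG j)); last first.
    move=> D; rewrite /G /cell /signed_cell.
    have E s b : \prod_i (1 + sg b * tiltf s j (tnth (map_tuple (erase f j) D) i)) =
        \prod_i (1 + sg b * tiltf s j (tnth D i)).
      by apply: eq_bigr => i _; rewrite tnth_map tilt_erase.
    by rewrite !E.
  apply: (@le_trans _ _ (Ex (iid mu N) (fun D => cell_dist j D + (cellf true j D - cellf false j D)))).
    have bd := bm_cell_dist j; have bd2 := bmB (bc true j) (bc false j).
    apply: Ex_le => [||D]; [exact: bmM|exact: bmD|].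
    have cf := c0 false j D; have w1 := cell_weight_ge1 false j D.
    have -> : cellf true j D * G j D = (cellf true j D - cellf false j D) ^+ 2 / cellf false j D +
        (cellf true j D - cellf false j D) by rewrite /G; field; rewrite gt_eqF.
    rewrite lerD2r /cell_dist [leRHS]mulrC ler_wpM2l ?sqr_ge0//.
    by rewrite -[leLHS]mul1r ler_pdivrMr// mulrC.
  have bd2 := bmB (bc true j) (bc false j).
  rewrite ExD//; [|exact: bm_cell_dist].
  by rewrite ExB// !(Ex_cell e1 e2 bf) subrr addr0.
lra.
Qed.

End mixture_distance.

(** * The nonparametric lower bound *)

Section mixture_risk.
Context {R : realType} {d : nat} {J : finType}.
Variables (f : J -> d.-tuple R -> R) (e1 e2 : R).
Hypotheses (bf : forall j, bm (f j))
  (disj : forall j k, j != k -> forall x, f j x * f k x = 0).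

(** A bound on every risk is a bound on their average. *)
Lemma Ex_mixture_le N s (L : N.-tuple (d.-tuple R * bool * bool) -> R) (r : \bar R) : bm L ->
  (forall lam : {ffun J -> bool},
    ((Ex (iid base_law N) (fun D => (\prod_i sdensity f e1 e2 s lam (tnth D i)) * L D))%:E <= r)%E) ->
  ((Ex (iid base_law N) (fun D => mixture f e1 e2 s D * L D))%:E <= r)%E.
Proof.
move=> bL; case: r => [r| |] hr; [|by rewrite leey|by have := hr [ffun => true]].
rewrite lee_fin.
have -> : (fun D => mixture f e1 e2 s D * L D) = fun D => (2^-1) ^+ #|J| *
    \sum_(lam : {ffun J -> bool}) (\prod_i sdensity f e1 e2 s lam (tnth D i)) * L D.
  by apply/funext => D; rewrite (mixtureE _ _ disj) -mulrA mulr_suml.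
have b1 (lam : {ffun J -> bool}) := bmM (bm_prod_sdensity e1 e2 bf N s lam) bL.
rewrite ExZ; last exact: bm_sum.
rewrite Ex_sum//.
apply: (@le_trans _ _ (2^-1 ^+ #|J| * \sum_(lam : {ffun J -> bool}) r)).
  rewrite ler_wpM2l ?exprn_ge0 ?invr_ge0//; apply: ler_sum => lam _.
  by have := hr lam; rewrite lee_fin.
rewrite sumr_const card_ffun card_bool -[X in _ * X]mulr_natl natrX mulrA -exprMn.
by rewrite mulVf// expr1n mul1r.
Qed.

End mixture_risk.

Section nonparametric_rate.
Context {R : realType} {d J0 S : nat} (W : wavelets R d).
Hypotheses (hW : cdv_basis W J0 S) (hd : (1 <= d)%N).
Variables (C1 C2 alpha beta M dl g : R) (P0 B0 p0 b0 : d.-tuple R -> R).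
Hypotheses (alpha0 : 0 < alpha) (beta0 : 0 < beta).
Hypothesis hbase : @base_point R d J0 W C1 C2 alpha beta M dl g P0 B0 p0 b0.
Local Notation Pm := (model W J0 C1 C2 alpha beta M).
Local Notation i0 := (full_orientation hd).

Lemma sqr_amp_le s l : 0 <= s -> @amp R d s l ^+ 2 <= (@resol R d l)^-1.
Proof.
move=> s0; have r0 := @resol_gt0 R d l; have := @amp_sqrt R d _ l s0.
set q := Num.sqrt _ => hq.
have q2 : q ^+ 2 = @resol R d l by rewrite sqr_sqrtr// ltW.
have a0 : 0 <= @amp R d s l by exact: powR_ge0.
have aq0 : 0 <= @amp R d s l * q by rewrite mulr_ge0 ?sqrtr_ge0.
have : (@amp R d s l * q) ^+ 2 <= 1 by rewrite -(expr1n _ 2) ler_pXn2r// ?nnegrE.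
by rewrite exprMn q2 -ler_pdivlMr// div1r.
Qed.

(** At level [l] there are of order [resol l] wavelets with disjoint supports and each
    cell contains boundedly many observations on average, because [n <= resol l].  The divergence is
    of order [n ^ 2] times the square of the separation divided by [resol l], which the
    last hypothesis bounds. *)
Lemma minimax_mixture : exists2 c : R, 0 < c & forall n l (T : data R d n -> R),
  (0 < n)%N -> (J0 <= l)%N -> measurable_fun setT T ->
  n%:R <= @resol R d l ->
  n%:R ^+ 2 * (2 `^ (- (l%:R * (alpha + beta)))) ^+ 2 <= @resol R d l ->
  (((c * 2 `^ (- (l%:R * (alpha + beta)))) ^+ 2)%:E <= max_risk Pm T)%E.
Proof.
have [B [cA [B_gt0 cA0 hB]]] := detail_bounds hW.
have [cc [CC [cc0 CC0 hcard]]] := cdv_card hW.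
have dl0 := bp_dl hbase; have g0 := bp_g hbase.
set E := expR (3 * (B + 4)); have E0 : 0 < E by exact: expR_gt0.
have [k0 [k00 k0E]] : exists k : R, 0 < k /\ k = 288 * 12.
  by exists (288 * 12); split; [lra|].
(* 1 / D is a common size for the coefficients: the Hoelder room, density factors
   within 1/2 of 1, and a total divergence of at most 1/12 *)
pose D := 1 + dl / g + 4 * B + k0 * CC * E.
have t1 : 0 < dl / g by rewrite divr_gt0.
have t2 : 0 < k0 * CC * E := mulr_gt0 (mulr_gt0 k00 CC0) E0.
have D1 : 1 <= D by rewrite /D; lra.
pose c := D^-1; have c0 : 0 < c by rewrite invr_gt0; lra.
have cD : c * D = 1 by rewrite mulVf// gt_eqF//; lra.
have c1 : c <= 1 by rewrite invf_le1//; lra.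
have cg : dl * c <= g.
  have : c * (dl / g) <= 1 by rewrite -[leRHS]cD ler_wpM2l ?(ltW c0)// /D; lra.
  by rewrite mulrA ler_pdivrMr// mul1r mulrC.
have cB : 4 * (c * B) <= 1.
  have : c * (4 * B) <= 1 by rewrite -[leRHS]cD ler_wpM2l ?(ltW c0)// /D; lra.
  lra.
have cE : k0 * CC * E * c ^+ 4 <= 1.
  have h : c * (k0 * CC * E) <= 1 by rewrite -[leRHS]cD ler_wpM2l ?(ltW c0)// /D; lra.
  apply: le_trans h; rewrite [leRHS]mulrC ler_wpM2l ?(ltW t2)//.
  by rewrite exprS ler_piMr ?(ltW c0)// exprn_ile1// ltW.
exists (dl ^+ 2 * c ^+ 2 * cA / 2).
  by rewrite divr_gt0// !mulr_gt0// exprn_gt0.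
move=> n l T n0 hl mT nl hn2.
have r0 := @resol_gt0 R d l.
have [hBl hq [A [cardA disA]]] := hB l hl i0.
have [_ cardl] := andP (hcard l hl).
pose e1 := c * @amp R d alpha l; pose e2 := c * @amp R d beta l.
have a0 s : 0 < @amp R d s l by exact: powR_gt0.
have e10 : 0 <= e1 by rewrite mulr_ge0// ltW.
have e20 : 0 <= e2 by rewrite mulr_ge0// ltW.
pose f m x := (m \in A)%:R * psi W l i0 m x.
have bf m : bm (f m) by apply: bmM; [exact: bm_cst|exact: (bm_psi hW)].
have disj j k : j != k -> forall x, f j x * f k x = 0.
  move=> jk x; rewrite /f; case: (boolP (j \in A)) => jA; last by rewrite !mul0r.
  case: (boolP (k \in A)) => kA; last by rewrite !mul0r mulr0.
  by rewrite !mul1r disA.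
have sumB e x : 0 <= e -> c * @amp R d e l * \sum_m `|psi W l i0 m x| <= c * B.
  move=> e_ge0; apply: (@le_trans _ _ (c * @amp R d e l * (B * Num.sqrt (@resol R d l)))).
    by rewrite ler_wpM2l// mulr_ge0// ltW.
  have := @amp_sqrt R d _ l e_ge0; set q := Num.sqrt _ => hh.
  rewrite (_ : _ * _ = c * B * (@amp R d e l * q)); last by ring.
  by rewrite ler_piMr// mulr_ge0// ltW.
have f_le m x : `|f m x| <= \sum_m `|psi W l i0 m x|.
  rewrite (bigD1 m)//= /f; case: (m \in A); last by rewrite mul0r normr0 addr_ge0// sumr_ge0.
  by rewrite mul1r lerDl sumr_ge0.
have small j x : (e1 + e2) * `|f j x| <= 2^-1.
  have h1 := sumB alpha x (ltW alpha0); have h2 := sumB beta x (ltW beta0).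
  have h3 := ler_wpM2l e10 (f_le j x); have h4 := ler_wpM2l e20 (f_le j x).
  rewrite mulrDl; move: h1 h2; rewrite -/e1 -/e2; clear -h3 h4 cB; lra.
pose cu (lam : {ffun idx W l -> bool}) m : R := sg (lam m) * (m \in A)%:R * e1.
pose cv (s : bool) (lam : {ffun idx W l -> bool}) m : R := sg s * (sg (lam m) * (m \in A)%:R * e2).
have sg1 (s : bool) : `|sg s : R| = 1 by case: s; rewrite /sg ?normrN normr1.
have nA m : `|(m \in A)%:R : R| <= 1 by case: (m \in A); rewrite ?normr1 ?normr0.
have cu_le lam m : `|cu lam m| <= e1.
  by rewrite /cu normrM (normrM (sg _)) sg1 mul1r (ger0_norm e10) ler_piMl.
have cv_le s lam m : `|cv s lam m| <= e2.
  by rewrite /cv normrM sg1 mul1r normrM (normrM (sg _)) sg1 mul1r (ger0_norm e20) ler_piMl.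
have hol e (k : R) : `|k| <= c * @amp R d e l -> 2 `^ (l%:R * (e + d%:R / 2)) * (dl * `|k|) <= g.
  move=> hk; apply: le_trans cg.
  apply: (@le_trans _ _ (2 `^ (l%:R * (e + d%:R / 2)) * (dl * (c * @amp R d e l)))).
    by rewrite ler_wpM2l ?powR_ge0// ler_wpM2l ?(ltW dl0).
  by rewrite (mulrA dl) amp_scale.
have det_le e (k : idx W l -> R) x : 0 <= e -> (forall m, `|k m| <= c * @amp R d e l) ->
    `|detail i0 k x| <= c * B.
  move=> e_ge0 hk; apply: le_trans (sumB e x e_ge0); apply: (le_trans (ler_norm_sum _ _ _)).
  by rewrite mulr_sumr; apply: ler_sum => m _; rewrite normrM ler_wpM2r.
have hs s lam x : `|detail i0 (cu lam) x| + `|detail i0 (cv s lam) x| + `|(fun=> 0 : R) x| <= 1.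
  have h1 := det_le alpha (cu lam) x (ltW alpha0) (cu_le lam).
  have h2 := det_le beta (cv s lam) x (ltW beta0) (cv_le s lam).
  rewrite normr0; clear -h1 h2 cB; lra.
have fam s lam := family_law hW hbase hl (bm_cst 0) (fun m => hol alpha _ (cu_le lam m))
  (fun m => hol beta _ (cv_le s lam m)) (hs s lam).
have uE lam x : detail i0 (cu lam) x = e1 * \sum_m sg (lam m) * f m x.
  by rewrite /detail mulr_sumr; apply: eq_bigr => m _; rewrite /cu /f; ring.
have vE s lam x : detail i0 (cv s lam) x = sg s * e2 * \sum_m sg (lam m) * f m x.
  by rewrite /detail mulr_sumr; apply: eq_bigr => m _; rewrite /cv /f; ring.
have densE s lam z : sdens (detail i0 (cu lam)) (detail i0 (cv s lam)) (fun=> 0) z =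
    sdensity f e1 e2 s lam z.
  by rewrite /sdens /sdensity uE vE; ring.
pose th := dl ^+ 2 * (e1 * e2 * #|A|%:R).
have psiE s lam Q :
    law_spec C1 C2 Q (fun x => P0 x + dl * detail i0 (cu lam) x) (fun x => B0 x + dl * detail i0 (cv s lam) x) ->
    (forall h, bm h -> Ex Q (fun w => clA C1 C2 w * clY C1 C2 w * h (obsX w)) =
      dot (fun x => P0 x * B0 x + dl * (P0 x * detail i0 (cv s lam) x + B0 x * detail i0 (cu lam) x) +
         dl ^+ 2 * (fun=> 0) x) h) ->
    psi_fun Q = - (sg s * th).
  move=> sQ aQ; rewrite (ls_psi sQ).
  have bu := bm_detail hW i0 (cu lam) hl; have bv := bm_detail hW i0 (cv s lam) hl.
  have bP := bp_bmP hbase; have bB := bp_bmB hbase.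
  have bG : bm (fun x => P0 x * B0 x +
      dl * (P0 x * detail i0 (cv s lam) x + B0 x * detail i0 (cu lam) x)).
    apply: bmD; first exact: bmM.
    by apply: bmM; [exact: bm_cst|apply: bmD; exact: bmM].
  have -> : Ex Q (fun w => clA C1 C2 w * clY C1 C2 w) = Ex (unif d) (fun x => P0 x * B0 x +
      dl * (P0 x * detail i0 (cv s lam) x + B0 x * detail i0 (cu lam) x)).
    rewrite [RHS](_ : _ = dot (fun x => P0 x * B0 x + dl * (P0 x * detail i0 (cv s lam) x +
       B0 x * detail i0 (cu lam) x) + dl ^+ 2 * (fun=> 0) x) (fun=> 1)).
      by rewrite -(aQ _ (bm_cst 1)); apply: eq_Ex => w; rewrite mulr1.
    by apply: eq_Ex => x; rewrite mulr0 addr0 mulr1.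
  have bpb : bm (fun x => (P0 x + dl * detail i0 (cu lam) x) * (B0 x + dl * detail i0 (cv s lam) x)).
    by apply: bmM; (apply: bmD => //; apply: bmM => //; exact: bm_cst).
  rewrite /dot -ExB//.
  transitivity (- (dl ^+ 2 * dot (detail i0 (cu lam)) (detail i0 (cv s lam)))).
    rewrite /dot -ExZ; last exact: bmM.
    rewrite -mulN1r -ExZ; last by apply: bmM; [exact: bm_cst|exact: bmM].
    by apply: eq_Ex => x; ring.
  rewrite (dot_detail2 hW)// /th; congr (- _); rewrite mulrCA; congr (_ * _).
  rewrite -sum1_card natr_sum mulr_sumr mulr_sumr [RHS]big_mkcond/=; apply: eq_bigr => m _.
  rewrite /cu /cv; have : sg (lam m) * sg (lam m) = 1 :> R.
    by case: (lam m); rewrite /sg ?mulr1 ?mulrNN ?mulr1.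
  case: (m \in A) => sm /=; last by rewrite mulr0 !mul0r.
  transitivity (sg (lam m) * sg (lam m) * (sg s * (e1 * e2))); first by ring.
  by rewrite sm; ring.
have ms := measurable_sobs dl (bp_bmP hbase) (bp_bmB hbase).
have risk s L : bm L -> (forall D, 0 <= L D <= (T D - - (sg s * th)) ^+ 2) ->
    ((Ex (iid base_law (n + n + n)) (fun D => mixture f e1 e2 s D *
       L (dsplit (map_tuple (sobs dl P0 B0) D))))%:E <= max_risk Pm T)%E.
  move=> bL hL; apply: Ex_mixture_le => //.
    apply: (bm_comp bL); apply: (measurableT_comp (@measurable_dsplit R d n)).
    exact: measurable_map_tuple.
  move=> lam; have [Q [mQ sQ dQ aQ]] := fam s lam.
  apply: (risk_density ms (bm_sdensity e1 e2 bf s lam) _ mQ mT bL).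
    by move=> h bh; rewrite dQ//; apply: eq_Ex => z; rewrite densE.
  by move=> D'; rewrite (psiE s lam Q sQ aQ).
have KL : \sum_j Ex (iid base_law (n + n + n)) (cell_dist f e1 e2 j (N := n + n + n)) <= 12^-1.
  set N := (n + n + n)%N; set p2 := 2 `^ _ in hn2.
  have p20 : 0 <= p2 by exact: powR_ge0.
  have NE : N%:R = 3 * n%:R :> R by rewrite !natrD; ring.
  have r1 : 0 <= (@resol R d l)^-1 by rewrite invr_ge0 ltW.
  have esq e : 0 <= e -> (c * @amp R d e l) ^+ 2 <= (@resol R d l)^-1.
    move=> e_ge0; rewrite exprMn -[leRHS]mul1r; apply: ler_pM; rewrite ?sqr_ge0//.
      by rewrite exprn_ile1// ltW.
    exact: sqr_amp_le.
  have e12 : e1 * e2 = c ^+ 2 * (p2 * (@resol R d l)^-1).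
    rewrite /p2 -(@amp_amp R d alpha beta l) mulfK ?gt_eqF// /e1 /e2; ring.
  pose K := 2 * N%:R ^+ 2 * (16 * (c ^+ 2 * (p2 * (@resol R d l)^-1)) ^+ 2) * E.
  apply: (@le_trans _ _ (\sum_(j : idx W l) K)); last first.
    rewrite sumr_const -[X in X <= _]mulr_natl.
    have K0 : 0 <= K by rewrite /K !mulr_ge0 ?sqr_ge0// ltW.
    apply: (@le_trans _ _ (CC * @resol R d l * K)); first by rewrite ler_wpM2r.
    have -> : CC * @resol R d l * K = k0 * CC * E * c ^+ 4 / 12 *
       (n%:R ^+ 2 * p2 ^+ 2 / @resol R d l).
      by rewrite /K NE k0E; field; rewrite gt_eqF.
    have h1 : n%:R ^+ 2 * p2 ^+ 2 / @resol R d l <= 1 by rewrite ler_pdivrMr// mul1r.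
    rewrite -[leRHS]mulr1; apply: ler_pM.
    - by apply: divr_ge0 => //; apply: mulr_ge0; [exact: ltW t2|exact: exprn_ge0 (ltW c0)].
    - by rewrite divr_ge0 ?(ltW r0)// mulr_ge0 ?sqr_ge0.
    - by rewrite ler_pdivrMr// mulVf.
    - exact: h1.
  apply: ler_sum => j _.
  set q := Ex (unif d) (fun x => (f j x != 0)%:R : R).
  set rho := Ex (unif d) (fun x => f j x ^+ 2).
  have q0 : 0 <= q by apply: Ex_ge0 => x; exact: ler0n.
  have qB : q <= B / @resol R d l.
    apply: (hq j); first exact: bm_neq0.
    move=> x; rewrite /f; case: (j \in A); last by rewrite mul0r eqxx.
    by rewrite mul1r.
  have rho0 : 0 <= rho by apply: Ex_ge0 => x; exact: sqr_ge0.
  have rho1 : rho <= 1.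
    have bps := bm_psi hW i0 j hl.
    rewrite -[leRHS](_ : dot (psi W l i0 j) (psi W l i0 j) = 1); last by rewrite (psi_on hW)// !eqxx.
    apply: Ex_le => [||x]; [exact: bmX|exact: bmM|].
    rewrite /f exprMn expr2 -expr2 -expr2; case: (j \in A); last by rewrite expr0n mul0r sqr_ge0.
    by rewrite expr1n mul1r.
  have := @Ex_cell_dist R d _ f e1 e2 bf N j q rho erefl erefl.
  move/le_trans; apply.
  have s1 := esq alpha (ltW alpha0); have s2 := esq beta (ltW beta0).
  rewrite -/e1 -/e2 in s1 s2.
  have x0 : 0 <= e1 ^+ 2 + e2 ^+ 2 by rewrite addr_ge0 ?sqr_ge0.
  have N2 : 0 <= 2 * N%:R ^+ 2 :> R by apply: mulr_ge0 => //; exact: sqr_ge0.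
  have z0 : 0 <= 1 + q + 2 * rho * (e1 ^+ 2 + e2 ^+ 2).
    by apply: addr_ge0; [exact: addr_ge0|apply: mulr_ge0 => //; exact: mulr_ge0].
  rewrite /K; apply: ler_pM.
  - by apply: mulr_ge0 => //; apply: mulr_ge0 => //; exact: sqr_ge0.
  - exact: exprn_ge0.
  - apply: ler_wpM2l => //; apply: ler_wpM2l => //; rewrite -mulrA exprMn e12.
    by rewrite ler_piMl ?sqr_ge0// exprn_ile1.
  have h2 : 1 + q + 2 * rho * (e1 ^+ 2 + e2 ^+ 2) <= expR ((B + 4) / @resol R d l).
    apply: le_trans (expR_ge1Dx _).
    rewrite (_ : (B + 4) / @resol R d l = B / @resol R d l + 4 * (@resol R d l)^-1); last by ring.
    have : rho * (e1 ^+ 2 + e2 ^+ 2) <= (@resol R d l)^-1 + (@resol R d l)^-1.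
      apply: (@le_trans _ _ (1 * (e1 ^+ 2 + e2 ^+ 2))); first by rewrite ler_wpM2r.
      by rewrite mul1r lerD.
    move: qB; clear; lra.
  apply: (@le_trans _ _ (expR ((B + 4) / @resol R d l) ^+ N)).
    by apply: lerXn2r; rewrite ?nnegrE ?expR_ge0.
  rewrite -expRM_natl ler_expR NE mulrA ler_pdivrMr//.
  rewrite (_ : 3 * n%:R * (B + 4) = 3 * (B + 4) * n%:R); last by ring.
  by rewrite ler_wpM2l// mulr_ge0// addr_ge0// ltW.
have pos s D' : 0 <= mixture f e1 e2 s D' :> R.
  by apply: prodr_ge0 => j _; rewrite ltW// (cell_gt0 e10 e20 small).
have ov : 4^-1 <= Ex (iid base_law (n + n + n))
    (fun D => Num.min (mixture f e1 e2 true D) (mixture f e1 e2 false D)).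
  by apply: le_trans (mixture_overlap bf e10 e20 disj small (n + n + n)); clear -KL; lra.
have LC := (le_cam ms mT (bm_mixture e1 e2 bf (n + n + n) true)
  (bm_mixture e1 e2 bf (n + n + n) false) (pos _ true) (pos _ false) (risk true) (risk false) ov).
apply: le_trans LC; rewrite lee_fin.
rewrite (_ : 4^-1 * _ / 4 = (th / 2) ^+ 2); last by rewrite /sg; field.
have am := @amp_amp R d alpha beta l.
rewrite ler_pXn2r ?nnegrE.
- rewrite /th -am /e1 /e2.
  rewrite (_ : dl ^+ 2 * c ^+ 2 * cA / 2 * _ = dl ^+ 2 * c ^+ 2 * (@amp R d alpha l * @amp R d beta l) / 2 *
     (cA * @resol R d l)); last by field.
  rewrite (_ : dl ^+ 2 * _ / 2 = dl ^+ 2 * c ^+ 2 * (@amp R d alpha l * @amp R d beta l) / 2 *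
     #|A|%:R); last by field.
  by rewrite ler_wpM2l// divr_ge0// mulr_ge0 ?mulr_ge0 ?sqr_ge0// ltW.
- by [].
- apply: mulr_ge0; last exact: powR_ge0.
  apply: divr_ge0 => //; apply: mulr_ge0; last exact: ltW.
  by apply: mulr_ge0; exact: sqr_ge0.
- apply: divr_ge0 => //; apply: mulr_ge0; first exact: sqr_ge0.
  by apply: mulr_ge0 => //; exact: mulr_ge0.
Qed.

End nonparametric_rate.

(** * Upper bounds over the class *)

Section risk_upper_bounds.
Context {R : realType} {d J0 S : nat} (W : wavelets R d).
Hypothesis hW : cdv_basis W J0 S.
Variables (C1 C2 alpha beta M : R).
Hypotheses (alpha0 : 0 < alpha) (beta0 : 0 < beta) (M0 : 0 < M).
Local Notation Pm := (model W J0 C1 C2 alpha beta M).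
Local Notation Cm := (clbound C1 C2).

Lemma resol_ge1 j : 1 <= @resol R d j.
Proof. by rewrite /resol exprn_ege1// ler1n. Qed.

Lemma max_risk_le n (T : data R d n -> R) (B : R) : measurable_fun setT T ->
  bm (fun D => T (kap3 C1 C2 D)) ->
  (forall P p b, law_spec C1 C2 P p b -> coef_bound J0 W M alpha p -> coef_bound J0 W M beta b ->
    Ex (data_law P n) (fun D => (T (kap3 C1 C2 D) - psi_fun P) ^+ 2) <= B) ->
  (max_risk Pm T <= B%:E)%E.
Proof.
move=> mT bT hB; apply: ge_ereal_sup => _ [P hP <-].
have [p [b [sP cp cb]]] := model_spec hW hP.
by rewrite (mse_clamp sP _ mT bT) lee_fin; exact: hB cp cb.
Qed.

(** The bound [a * n] on the resolution is what [psi_MC_mse] needs. *)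
Lemma risk_le_plugin (a : R) : 0 < a -> exists2 C : R, 0 < C & forall n j,
  (0 < n)%N -> (J0 <= j)%N -> @resol R d j <= a * n%:R ->
  let hi := ((C * (n%:R^-1 + (@resol R d j / n%:R) ^+ 2 +
    (2 `^ (- (j%:R * (alpha + beta)))) ^+ 2))%:E : \bar R) in
  (max_risk Pm (psi_INT W j j (n := n)) <= hi)%E /\
  (max_risk Pm (psi_MC W j j (n := n)) <= hi)%E.
Proof.
move=> a0; have [Bk [Bk0 hBk]] := kernel_bounds hW.
have [T [T0 hT]] := dot_tail hW alpha0 beta0 M0.
have Cm0 : 0 <= Cm := Cm_ge0 C1 C2.
pose B1 := Bk * (a + 1); have B10 : 0 < B1 by rewrite mulr_gt0// addr_gt0.
pose G := 4 ^+ 4 * (2 * (Cm * B1 + 1)) ^+ 4 * expR 2 : R.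
have G0 : 0 <= G.
  apply: mulr_ge0 (expR_ge0 _); apply: mulr_ge0; apply: exprn_ge0 => //.
  by apply: mulr_ge0 => //; apply: addr_ge0 => //; apply: mulr_ge0 => //; exact: ltW.
pose V1 := 2 * (Cm ^+ 2 * (Bk + 1)) : R.
have V10 : 0 <= V1.
  by apply: mulr_ge0 => //; apply: mulr_ge0 (sqr_ge0 _) _; apply: addr_ge0 => //; exact: ltW.
exists (36 * Cm ^+ 4 + 2 * G + 48 * V1 ^+ 2 + 16 * T ^+ 2).
  apply: ltr_wpDl; last by apply: mulr_gt0 => //; exact: exprn_gt0.
  apply: addr_ge0; last by apply: mulr_ge0 => //; exact: sqr_ge0.
  by apply: addr_ge0; apply: mulr_ge0 => //; exact: exprn_ge0.
move=> n j n0 hj hja /=; have n0' : 0 < n%:R :> R by rewrite ltr0n.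
have ni0 : 0 <= n%:R^-1 :> R by rewrite invr_ge0.
have [k1 k2] := hBk j hj; have r1 := resol_ge1 j.
set dj := 2 `^ _; set k := @resol R d j in hja r1 k1 *.
have dj0 : 0 <= dj by exact: powR_ge0.
have V_le : 2 * (Cm ^+ 2 * (Bk * k + 1)) / n%:R <= V1 * (k / n%:R).
  rewrite [leRHS]mulrA ler_pM2r ?invr_gt0//.
  rewrite (_ : V1 * k = 2 * (Cm ^+ 2 * (Bk * k + k))); last by rewrite /V1; ring.
  by apply: ler_wpM2l => //; apply: ler_wpM2l (sqr_ge0 _) _ _ _; rewrite lerD2l.
have V_ge0 : 0 <= 2 * (Cm ^+ 2 * (Bk * k + 1)) / n%:R.
  apply: divr_ge0 => //; apply: mulr_ge0 => //; apply: mulr_ge0 (sqr_ge0 _) _.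
  by apply: addr_ge0 => //; apply: mulr_ge0; [exact: ltW|exact: le_trans r1].
have kn0 : 0 <= k / n%:R by rewrite divr_ge0// (le_trans ler01).
have V2 : (2 * (Cm ^+ 2 * (Bk * k + 1)) / n%:R) ^+ 2 <= V1 ^+ 2 * (k / n%:R) ^+ 2.
  by rewrite -exprMn; apply: lerXn2r => //; rewrite nnegrE// mulr_ge0.
have c4 : 0 <= Cm ^+ 4 by rewrite exprn_ge0.
have t2 : 0 <= T ^+ 2 by exact: sqr_ge0.
have v2 : 0 <= V1 ^+ 2 by exact: sqr_ge0.
have fin (X Y Z : R) : 0 <= X -> 0 <= Y -> 0 <= Z ->
   2 * (18 * (X * Cm ^+ 4) + 24 * (V1 ^+ 2 * Y) + 8 * (T ^+ 2 * Z)) + 2 * (X * G) <=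
   (36 * Cm ^+ 4 + 2 * G + 48 * V1 ^+ 2 + 16 * T ^+ 2) * (X + Y + Z).
  move=> X0 Y0 Z0.
  rewrite -subr_ge0 (_ : _ - _ = (36 * Cm ^+ 4 + 2 * G) * (Y + Z) + 48 * V1 ^+ 2 * (X + Z) +
    16 * T ^+ 2 * (X + Y)); last by ring.
  by apply: addr_ge0; [apply: addr_ge0|]; apply: mulr_ge0; try exact: addr_ge0;
    [apply: addr_ge0; exact: mulr_ge0|exact: mulr_ge0|exact: mulr_ge0].
have k20 := sqr_ge0 (k / n%:R); have dj20 := sqr_ge0 dj.
have key := fin _ _ _ ni0 k20 dj20.
have tail p b : bm p -> bm b -> coef_bound J0 W M alpha p -> coef_bound J0 W M beta b ->
    `|dot p b - dot p (wproj W j b)| <= T * dj by move=> ? ? ? ?; exact: hT.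
have hBB : Bk * k <= n%:R * B1.
  rewrite /B1 mulrCA ler_pM2l// mulrC mulrDl mul1r; lra.
have hB1 x : Ex (unif d) (fun y => `|Defs.kernel W j x y|) <= B1.
  by rewrite (le_trans (k2 x))// /B1 ler_peMr ?(ltW Bk0)//; lra.
have mI := measurable_psi_INT hW hj hj (n := n); have mC := measurable_psi_MC hW hj hj (n := n).
have bI := bm_psi_INT hW n hj hj C1 C2; have bC := bm_psi_MC hW n hj hj C1 C2.
have GX0 : 0 <= n%:R^-1 * G by rewrite mulr_ge0.
have exT : (T * dj) ^+ 2 = T ^+ 2 * dj ^+ 2 by rewrite exprMn.
split; apply: max_risk_le => // P p b sP cp cb; (apply: le_trans key).
- apply: (le_trans (psi_INT_mse hW sP n0 hj k1 (tail p b (ls_p sP) (ls_b sP) cp cb))).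
  rewrite exT; have x1 : 0 <= n%:R^-1 * Cm ^+ 4 by rewrite mulr_ge0.
  have x2 : 0 <= V1 ^+ 2 * (k / n%:R) ^+ 2 by rewrite mulr_ge0.
  have x3 : 0 <= T ^+ 2 * dj ^+ 2 by rewrite mulr_ge0.
  lra.
- apply: (le_trans (psi_MC_mse hW sP n0 hj k1 (tail p b (ls_p sP) (ls_b sP) cp cb) B10 hBB hB1)).
  rewrite exT -/G; lra.
Qed.

Lemma risk_le_IF : exists2 C : R, 0 < C & forall n j,
  (0 < n)%N -> (J0 <= j)%N ->
  (max_risk Pm (psi_IF W J0 j (n := n)) <= (C * (n%:R^-1 + @resol R d j / n%:R ^+ 2 +
    (2 `^ (- (j%:R * (alpha + beta)))) ^+ 2))%:E)%E.
Proof.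
have [Bk [Bk0 hBk]] := kernel_bounds hW.
have [T [T0 hT]] := dot_tail hW alpha0 beta0 M0.
have [cc [CC [cc0 CC0 hcard]]] := cdv_card hW.
have Cm0 : 0 <= Cm := Cm_ge0 C1 C2.
have rJ := resol_ge1 J0.
pose B0 := Bk * @resol R d J0; have B00 : 0 < B0 by rewrite mulr_gt0// (lt_le_trans ltr01).
pose a := 3 * Cm ^+ 4 + 3 * ((Cm * B0) ^+ 2 * (2 * (Cm ^+ 2 * (B0 + 1)))) +
  (Cm + Cm * B0) ^+ 2 * (2 * (Cm ^+ 2 + Cm ^+ 2)).
pose b' := (Cm + Cm * B0) ^+ 2 * (2 * (Cm ^+ 2 * CC)).
have a0 : 0 <= a.
  have h1 : 0 <= Cm ^+ 2 * (B0 + 1).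
    by apply: mulr_ge0 (sqr_ge0 _) _; apply: addr_ge0 => //; exact: ltW.
  have h2 : 0 <= Cm ^+ 2 + Cm ^+ 2 by apply: addr_ge0; exact: sqr_ge0.
  apply: addr_ge0; last by apply: mulr_ge0 (sqr_ge0 _) _; exact: mulr_ge0.
  apply: addr_ge0; first by apply: mulr_ge0 => //; exact: exprn_ge0.
  by apply: mulr_ge0 => //; apply: mulr_ge0 (sqr_ge0 _) _; exact: mulr_ge0.
have b0 : 0 <= b'.
  apply: mulr_ge0 (sqr_ge0 _) _; apply: mulr_ge0 => //.
  by apply: mulr_ge0 (sqr_ge0 _) _; exact: ltW.
exists (a + b' + 3 * T ^+ 2).
  by apply: ltr_wpDl; [exact: addr_ge0|apply: mulr_gt0 => //; exact: exprn_gt0].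
move=> n j n0 hj; have n0' : 0 < n%:R :> R by rewrite ltr0n.
have ni0 : 0 <= n%:R^-1 :> R by rewrite invr_ge0.
set dj := 2 `^ _; set k := @resol R d j.
have k0 : 0 <= k by apply: le_trans (resol_ge1 j).
have mF := measurable_psi_IF hW (leqnn J0) hj (n := n).
have bF := bm_psi_IF hW n (leqnn J0) hj C1 C2.
have [k1 _] := hBk J0 (leqnn J0); have [_ hCk] := andP (hcard j hj).
apply: max_risk_le => // P p b sP cp cb.
have tail : `|dot p b - dot p (wproj W j b)| <= T * dj.
  by apply: hT => //; [exact: ls_p sP|exact: ls_b sP].
apply: (le_trans (psi_IF_mse hW sP n0 (leqnn J0) hj B00 k1 hCk tail)).
have Y0 : 0 <= k / n%:R ^+ 2 by rewrite divr_ge0// sqr_ge0.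
have Z0 : 0 <= dj ^+ 2 by exact: sqr_ge0.
apply: (@le_trans _ _ (a * n%:R^-1 + b' * (k / n%:R ^+ 2) + 3 * T ^+ 2 * dj ^+ 2)).
  rewrite le_eqVlt; apply/orP; left; apply/eqP; rewrite /a /b' /B0 /k /dj; field.
  by rewrite gt_eqF.
have t2 : 0 <= 3 * T ^+ 2 by rewrite mulr_ge0// sqr_ge0.
rewrite -subr_ge0 (_ : _ - _ = a * (k / n%:R ^+ 2 + dj ^+ 2) + b' * (n%:R^-1 + dj ^+ 2) +
  3 * T ^+ 2 * (n%:R^-1 + k / n%:R ^+ 2)); last by ring.
by apply: addr_ge0; [apply: addr_ge0|]; apply: mulr_ge0 => //; exact: addr_ge0.
Qed.

End risk_upper_bounds.

(** * Powers of the sample size and resolutions *)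

Section powers.
Context {R : realType}.
Implicit Types (x y s t e a b c : R) (n : nat).

Lemma powR_addn n s t : (0 < n)%N -> n%:R `^ s * n%:R `^ t = n%:R `^ (s + t) :> R.
Proof. by move=> n0; rewrite powRD// pnatr_eq0 -lt0n n0 implybT. Qed.

Lemma powR_le n s t : (0 < n)%N -> s <= t -> n%:R `^ s <= n%:R `^ t :> R.
Proof. by move=> n0; apply: ler_powR; rewrite ler1n. Qed.

Lemma powR_natV n : (n%:R : R)^-1 = n%:R `^ (-1).
Proof. by rewrite powR_inv1. Qed.

Lemma powR_nat1 n : (n%:R : R) = n%:R `^ 1.
Proof. by rewrite powRr1. Qed.

Lemma powR_mono s x y : 0 <= s -> 0 <= x -> x <= y -> x `^ s <= y `^ s.
Proof. by move=> s0 x0 xy; apply: ge0_ler_powR; rewrite ?nnegrE// (le_trans x0). Qed.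

Lemma powRK x s t : 0 <= x -> s * t = 1 -> (x `^ s) `^ t = x.
Proof. by move=> x0 st; rewrite -powRrM st powRr1. Qed.

Lemma cvg_pinfty_powR (f : nat -> R) c e n0 : 0 < c -> 0 < e ->
  (forall n, (n0 <= n)%N -> (0 < n)%N -> c * n%:R `^ e <= f n) -> f n @[n --> \oo] --> +oo.
Proof.
move=> c0 e0 hf; apply/cvgryPge => A.
pose m := (Num.truncn ((`|A| / c) `^ e^-1)).+1.
have Ac : 0 <= `|A| / c by rewrite divr_ge0// ltW.
near=> n; have mn : (m <= n)%N by near: n; exact: nbhs_infty_ge.
have nn : (n0 <= n)%N by near: n; exact: nbhs_infty_ge.
apply: le_trans (hf n nn (leq_trans (ltn0Sn _) mn)).
apply: (le_trans (ler_norm A)); rewrite -ler_pdivrMl// mulrC.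
rewrite -[leLHS](@powRK _ e^-1 e) ?mulVf ?gt_eqF//.
apply: powR_mono; [exact: ltW|exact: powR_ge0|].
apply: (le_trans (ltW (truncnS_gt _))); by rewrite ler_nat.
Unshelve. all: by end_near. Qed.

End powers.

Section levels.
Context {R : realType} {d J0 : nat}.
Hypothesis hd : (1 <= d)%N.
Local Notation k := (@resol R d).
Let d0 : 0 < d%:R :> R. Proof. by rewrite ltr0n. Qed.

Definition level_gap : R := 2 ^+ d * k J0.

Lemma level_gap_gt0 : 0 < level_gap.
Proof. by rewrite mulr_gt0 ?exprn_gt0. Qed.

(** Consecutive resolutions differ by the factor [2 ^ d]. *)
Lemma exists_level x : 1 <= x -> exists j, [/\ (J0 <= j)%N, x <= k j & k j <= level_gap * x].
Proof.
move=> x1; have x0 : 0 < x := lt_le_trans ltr01 x1.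
have ex : exists j, (J0 <= j)%N && (x <= k j).
  exists (J0 + (Num.truncn x).+1)%N; rewrite leq_addr/=.
  apply: (le_trans (ltW (truncnS_gt x))); rewrite /resol -natrX ler_nat.
  apply: leq_trans (ltnW (ltn_expl _ (ltnSn 1))) _; rewrite leq_exp2l//.
  by rewrite (leq_trans (leq_addl J0 _))// leq_pmulr.
case: (ex_minnP ex) => j /andP[hj xj] hmin; exists j; split => //.
have [Jj|Jj] := ltnP J0 j; last first.
  have -> : j = J0 by apply/eqP; rewrite eqn_leq Jj hj.
  have kJ : 0 <= k J0 by rewrite ltW// resol_gt0.
  have p2 : 1 <= 2 ^+ d * x.
    by rewrite -[leLHS]mulr1; apply: ler_pM => //; rewrite exprn_ege1// ler1n.
  by rewrite /level_gap mulrAC; exact: ler_peMl.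
case: j => // j in hj xj hmin Jj *.
have kj : k j < x.
  by rewrite ltNge; apply/negP => h; have := hmin j; rewrite -ltnS Jj h ltnn => /(_ isT).
have -> : k j.+1 = 2 ^+ d * k j by rewrite /resol mulSn exprD.
rewrite /level_gap -mulrA ler_wpM2l ?exprn_ge0//.
by apply: (le_trans (ltW kj)); rewrite ler_peMl ?(ltW x0)//; exact: resol_ge1.
Qed.

Lemma bias_resol j (g : R) : 2 `^ (- (j%:R * g)) = k j `^ (- (g / d%:R)).
Proof. by rewrite resol_powR -powRrM; congr (_ `^ _); field; rewrite gt_eqF. Qed.

Lemma sqr_bias_resol j (g : R) :
  (2 `^ (- (j%:R * g))) ^+ 2 = (k j `^ (2 * g / d%:R))^-1.
Proof.
rewrite bias_resol powRN -powR_mulrn ?invr_ge0 ?powR_ge0// -powRN -powRrM -powRN.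
by congr (_ `^ _); field; rewrite gt_eqF.
Qed.

Lemma sqr_bias_le j (g x : R) : 0 <= g -> 0 < x -> x <= k j ->
  (2 `^ (- (j%:R * g))) ^+ 2 <= x `^ (- (2 * g / d%:R)).
Proof.
move=> g0 x0 xk; rewrite sqr_bias_resol powRN lef_pV2 ?posrE ?powR_gt0 ?resol_gt0//.
by apply: powR_mono => //; [rewrite divr_ge0 ?mulr_ge0// ltW|exact: ltW].
Qed.

Lemma sqr_bias_ge j (g x : R) : 0 <= g -> k j <= x ->
  x `^ (- (2 * g / d%:R)) <= (2 `^ (- (j%:R * g))) ^+ 2.
Proof.
move=> g0 xk; have k0 := @resol_gt0 R d j; have x0 := lt_le_trans k0 xk.
rewrite sqr_bias_resol powRN lef_pV2 ?posrE ?powR_gt0//.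
by apply: powR_mono => //; [rewrite divr_ge0 ?mulr_ge0// ltW|exact: ltW].
Qed.

(** Solve the bound on the bias, a power of the resolution, for the resolution. *)
Lemma resol_ge_of_bias (c C g rho : R) : 0 < c -> 0 < C -> 0 < g -> exists2 c' : R, 0 < c' &
  forall n j, (0 < n)%N -> (c * 2 `^ (- (j%:R * g))) ^+ 2 <= C * n%:R `^ (- rho) ->
  c' * n%:R `^ (rho * d%:R / (2 * g)) <= k j.
Proof.
move=> c0 C0 g0; exists ((c ^+ 2 / C) `^ (d%:R / (2 * g))).
  by rewrite powR_gt0// divr_gt0// exprn_gt0.
move=> n j n0; have k0 := @resol_gt0 R d j; have n0' : 0 < n%:R :> R by rewrite ltr0n.
rewrite exprMn sqr_bias_resol powRN => h.
have q0 : 0 <= c ^+ 2 / C by rewrite divr_ge0 ?sqr_ge0// ltW.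
have -> : rho * d%:R / (2 * g) = rho * (d%:R / (2 * g)) by rewrite mulrA.
rewrite powRrM -powRM ?powR_ge0//.
rewrite -[leRHS](@powRK _ _ (2 * g / d%:R) (d%:R / (2 * g))) ?(ltW k0)//; last first.
  by field; rewrite !gt_eqF.
apply: powR_mono; [by rewrite divr_ge0 ?(ltW d0)// mulr_ge0// ltW|by rewrite mulr_ge0 ?powR_ge0|].
move: h; rewrite ler_pdivrMr ?powR_gt0// mulrAC ler_pdivlMr ?powR_gt0// => h.
by rewrite mulrAC ler_pdivrMr// [leRHS]mulrC.
Qed.

(** A small diagonal term forces a small resolution. *)
Lemma resol_le_of_diag (c C rho : R) : 0 < c -> 0 < C -> exists2 C' : R, 0 < C' &
  forall n j, (0 < n)%N -> (c * (k j / n%:R)) ^+ 2 <= C * n%:R `^ (- rho) ->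
  k j <= C' * n%:R `^ (1 - rho / 2).
Proof.
move=> c0 C0; have q0 : 0 < C / c ^+ 2 by rewrite divr_gt0// exprn_gt0.
exists ((C / c ^+ 2) `^ (2^-1)); first by rewrite powR_gt0.
move=> n j n0 h; have k0 := @resol_gt0 R d j; have n0' : 0 < n%:R :> R by rewrite ltr0n.
have -> : 1 - rho / 2 = (2 - rho) * 2^-1 :> R by field.
rewrite powRrM -powRM ?powR_ge0 ?(ltW q0)//.
have E : k j = (k j ^+ 2) `^ (2^-1).
  by rewrite -powR_mulrn ?(ltW k0)// powRK ?(ltW k0)// divff.
rewrite E; apply: powR_mono; [by rewrite invr_ge0|exact: sqr_ge0|].
have n2 : n%:R `^ (2 - rho) = n%:R ^+ 2 * n%:R `^ (- rho) :> R.
  by rewrite -powR_addn// powR_mulrn.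
rewrite n2 mulrAC ler_pdivlMr ?exprn_gt0//.
move: h; rewrite exprMn exprMn exprVn mulrA ler_pdivrMr ?exprn_gt0// => h.
by rewrite [leLHS]mulrC; apply: (le_trans h); rewrite -mulrA (mulrC (n%:R `^ _)).
Qed.

End levels.

(** * Rates and undersmoothing *)

Section asymptotic_order.
Context {R : realType}.

Lemma lesssim_ge (rk : nat -> \bar R) (r : nat -> R) c : 0 < c ->
  (forall n, (0 < n)%N -> ((c * r n)%:E <= rk n)%E) -> lesssim (EFin \o r) rk.
Proof.
move=> c0 h; exists c^-1; split; first by rewrite invr_gt0.
by exists 1%N => n n0; rewrite lee_pdivlMl//; exact: h.
Qed.

Lemma lesssim_le (rk : nat -> \bar R) (r : nat -> R) C : 0 < C ->
  (forall n, (0 < n)%N -> (rk n <= (C * r n)%:E)%E) -> lesssim rk (EFin \o r).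
Proof. by move=> C0 h; exists C; split => //; exists 1%N. Qed.

End asymptotic_order.

Section exponents.
Context {R : realType} (d : nat) (alpha beta : R).
Hypotheses (hd : (1 <= d)%N) (alpha0 : 0 < alpha) (beta0 : 0 < beta).
Let d0 : 0 < d%:R :> R. Proof. by rewrite ltr0n. Qed.

Definition e_plugin : R := (2 * alpha + 2 * beta) / (alpha + beta + d%:R).
Definition e_IF : R := (4 * alpha + 4 * beta) / (2 * alpha + 2 * beta + d%:R).

Lemma rate_pluginE n : (0 < n)%N ->
  rate_plugin (d := d) alpha beta n = n%:R `^ (- Num.min 1 e_plugin).
Proof.
move=> n0; rewrite /rate_plugin; have D0 : 0 < alpha + beta + d%:R by rewrite !addr_gt0.
case: ifPn => [h|]; last rewrite -ltNge => h.
  by rewrite powR_natV (min_idPl _)// /e_plugin ler_pdivlMr// mul1r; lra.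
by rewrite (min_idPr _)// /e_plugin ler_pdivrMr// mul1r; lra.
Qed.

Lemma rate_IFE n : (0 < n)%N ->
  rate_IF (d := d) alpha beta n = n%:R `^ (- Num.min 1 e_IF).
Proof.
move=> n0; rewrite /rate_IF; have D0 : 0 < 2 * alpha + 2 * beta + d%:R by rewrite !addr_gt0// mulr_gt0.
case: ifPn => [h|]; last rewrite -ltNge => h.
  by rewrite powR_natV (min_idPl _)// /e_IF ler_pdivlMr// mul1r; lra.
by rewrite (min_idPr _)// /e_IF ler_pdivrMr// mul1r; lra.
Qed.

End exponents.

Section plugin_rates.
Context {R : realType} {d J0 : nat} (alpha beta : R).
Hypotheses (hd : (1 <= d)%N) (alpha0 : 0 < alpha) (beta0 : 0 < beta).
Let d0 : 0 < d%:R :> R. Proof. by rewrite ltr0n. Qed.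
Local Notation k := (@resol R d).
Local Notation g := (alpha + beta).
Local Notation rho := (Num.min 1 (e_plugin d alpha beta)).
Local Notation r := (rate_plugin (d := d) alpha beta).
Let g0 : 0 < g. Proof. exact: addr_gt0. Qed.
Let gd0 : 0 < g + d%:R. Proof. exact: addr_gt0. Qed.

(* the risk as a function of the sample size and of the two levels *)
Variable rk : nat -> nat -> nat -> \bar R.

(** If the resolution is below [n ^ (d / (alpha + beta + d))] the bias is too large, and
    above it the diagonal term is. *)
Lemma plugin_lower (c1 c2 c3 : R) : 0 < c1 -> 0 < c2 -> 0 < c3 ->
  (forall n j1 j2, (0 < n)%N -> (J0 <= j1)%N -> (J0 <= j2)%N ->
     (((c1 * 2 `^ (- ((minn j1 j2)%:R * g))) ^+ 2)%:E <= rk n j1 j2)%E) ->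
  (forall n j1 j2, (0 < n)%N -> (J0 <= j1)%N -> (J0 <= j2)%N ->
     (((c2 * (k (minn j1 j2) / n%:R)) ^+ 2)%:E <= rk n j1 j2)%E) ->
  (forall n j1 j2, (0 < n)%N -> (J0 <= j1)%N -> (J0 <= j2)%N ->
     ((c3 / n%:R)%:E <= rk n j1 j2)%E) ->
  forall j1 j2, levels J0 j1 -> levels J0 j2 ->
  lesssim (EFin \o r) (fun n => rk n (j1 n) (j2 n)).
Proof.
move=> c10 c20 c30 h1 h2 h3 j1 j2 l1 l2.
pose c := Num.min c3 (Num.min (c1 ^+ 2) (c2 ^+ 2)).
have c0 : 0 < c by rewrite !lt_min c30 !exprn_gt0.
have cc3 : c <= c3 by rewrite ge_min lexx.
have cc1 : c <= c1 ^+ 2 by rewrite !ge_min lexx orbT.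
have cc2 : c <= c2 ^+ 2 by rewrite !ge_min lexx !orbT.
apply: (lesssim_ge c0) => n n0; rewrite rate_pluginE//.
have n0' : 0 < n%:R :> R by rewrite ltr0n.
have [e1|e1] := leP 1 (e_plugin d alpha beta).
  apply: le_trans (h3 n (j1 n) (j2 n) n0 (l1 n) (l2 n)); rewrite lee_fin.
  by rewrite -powR_natV ler_wpM2r// invr_ge0 ltW.
set j := minn (j1 n) (j2 n).
pose x : R := n%:R `^ (d%:R / (g + d%:R)).
have [kx|kx] := leP (k j) x.
  apply: le_trans (h1 n (j1 n) (j2 n) n0 (l1 n) (l2 n)); rewrite lee_fin exprMn.
  apply: ler_pM => //; [exact: ltW|].
  apply: le_trans (sqr_bias_ge hd (ltW g0) kx); rewrite /x -powRrM.
  rewrite le_eqVlt; apply/orP; left; apply/eqP; congr (_ `^ _).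
  by rewrite /e_plugin; field; rewrite !gt_eqF.
apply: le_trans (h2 n (j1 n) (j2 n) n0 (l1 n) (l2 n)); rewrite lee_fin exprMn.
apply: ler_pM => //; [exact: ltW|].
apply: (@le_trans _ _ ((x / n%:R) ^+ 2)).
  rewrite powR_natV /x powR_addn// -powR_mulrn ?powR_ge0// -powRrM.
  rewrite le_eqVlt; apply/orP; left; apply/eqP; congr (_ `^ _).
  by rewrite /e_plugin; field; rewrite !gt_eqF.
have kj0 := @resol_gt0 R d j; apply: lerXn2r.
- by rewrite nnegrE divr_ge0// powR_ge0.
- by rewrite nnegrE divr_ge0// ltW.
- by apply: ler_wpM2r; [rewrite invr_ge0|exact: ltW].
Qed.

(** With [s = alpha + beta - a] the hypotheses are [s < a] and [2 s < d]: they say that the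
    exponent of the least admissible resolution exceeds that of the prediction-optimal
    one when the rate is nonparametric and when it is parametric. *)
Lemma plugin_undersmoothing (c1 cp : R) : 0 < c1 -> 0 < cp ->
  (forall n j1 j2, (0 < n)%N -> (J0 <= j1)%N -> (J0 <= j2)%N ->
     (((c1 * 2 `^ (- ((minn j1 j2)%:R * g))) ^+ 2)%:E <= rk n j1 j2)%E) ->
  forall j1 j2 j a, levels J0 j1 -> levels J0 j2 ->
  lesssim (fun n => rk n (j1 n) (j2 n)) (EFin \o r) ->
  (forall n, (minn (j1 n) (j2 n) <= j n)%N) -> 0 < a -> g < a + a -> 2 * (g - a) < d%:R ->
  muchgreater (@k_seq R d j) (@k_pred R d cp a).
Proof.
move=> c10 cp0 h1 j1 j2 j a l1 l2 [C [C0 [n1 hC]]] hj a0 ga gd.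
have [c' c'0 hc'] := resol_ge_of_bias hd rho c10 C0 g0.
pose e := rho * d%:R / (2 * g) - d%:R / (2 * a + d%:R).
have ad0 : 0 < 2 * a + d%:R by rewrite addr_gt0// mulr_gt0.
have e0 : 0 < e.
  rewrite /e subr_gt0 ltr_pdivrMr// mulrAC ltr_pdivlMr ?mulr_gt0//.
  rewrite [rho * _]mulrC -!mulrA ltr_pM2l// -ltr_pdivrMr// lt_min; apply/andP; split.
    by rewrite ltr_pdivrMr// mul1r; lra.
  rewrite /e_plugin ltr_pdivrMr// mulrAC ltr_pdivlMr//.
  rewrite -subr_gt0 (_ : _ - _ = 2 * g * (a + a - g)); last by ring.
  by rewrite mulr_gt0 ?mulr_gt0// subr_gt0.
have c0 : 0 < c' / cp by rewrite divr_gt0.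
apply: (cvg_pinfty_powR (n0 := n1) c0 e0) => n nn n0.
have n0' : 0 < n%:R :> R by rewrite ltr0n.
have hmin : c' * n%:R `^ (rho * d%:R / (2 * g)) <= k (minn (j1 n) (j2 n)).
  apply: hc' => //; rewrite -lee_fin -rate_pluginE//.
  by apply: (le_trans (h1 n _ _ n0 (l1 n) (l2 n))); exact: hC.
have hk : k (minn (j1 n) (j2 n)) <= k (j n).
  by rewrite /resol ler_eXn2l ?ltr1n// leq_mul2r hj orbT.
rewrite /k_seq /k_pred; have p0 : 0 < n%:R `^ (d%:R / (2 * a + d%:R)) :> R by exact: powR_gt0.
rewrite ler_pdivlMr ?mulr_gt0// (le_trans _ hk)// (le_trans _ hmin)//.
by rewrite mulrACA divfK ?gt_eqF// powR_addn// /e subrK.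
Qed.

End plugin_rates.

Section IF_rates.
Context {R : realType} {d J0 : nat} (alpha beta : R).
Hypotheses (hd : (1 <= d)%N) (alpha0 : 0 < alpha) (beta0 : 0 < beta).
Let d0 : 0 < d%:R :> R. Proof. by rewrite ltr0n. Qed.
Local Notation k := (@resol R d).
Local Notation g := (alpha + beta).
Local Notation rho := (Num.min 1 (e_IF d alpha beta)).
Local Notation r := (rate_IF (d := d) alpha beta).
Let g0 : 0 < g. Proof. exact: addr_gt0. Qed.
Let gd0 : 0 < 2 * alpha + 2 * beta + d%:R. Proof. by rewrite !addr_gt0// mulr_gt0. Qed.
Variable rk : nat -> nat -> nat -> \bar R.

(** The bias bounds the larger resolution from below and the diagonal term
    bounds the smaller one from above, by powers of [n] on the two sides of both
    prediction-optimal resolutions. *)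
Lemma IF_under_over (c1 c2 cp1 cp2 : R) : 0 < c1 -> 0 < c2 -> 0 < cp1 -> 0 < cp2 ->
  (forall n j1 j2, (0 < n)%N -> (J0 <= j1)%N -> (J0 <= j2)%N ->
     (((c1 * 2 `^ (- ((maxn j1 j2)%:R * g))) ^+ 2)%:E <= rk n j1 j2)%E) ->
  (forall n j1 j2, (0 < n)%N -> (J0 <= j1)%N -> (J0 <= j2)%N ->
     (((c2 * (k (minn j1 j2) / n%:R)) ^+ 2)%:E <= rk n j1 j2)%E) ->
  2 * alpha < d%:R -> 2 * beta < d%:R ->
  forall j1 j2, levels J0 j1 -> levels J0 j2 ->
  lesssim (fun n => rk n (j1 n) (j2 n)) (EFin \o r) ->
  Num.max (Num.min (@k_seq R d j1 n / @k_pred R d cp1 alpha n) (@k_pred R d cp2 beta n / @k_seq R d j2 n))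
          (Num.min (@k_seq R d j2 n / @k_pred R d cp2 beta n) (@k_pred R d cp1 alpha n / @k_seq R d j1 n))
      @[n --> \oo] --> +oo.
Proof.
move=> c10 c20 cp10 cp20 h1 h2 ad bd j1 j2 l1 l2 [C [C0 [n1 hC]]].
have [c' c'0 hc'] := resol_ge_of_bias hd rho c10 C0 g0.
have [C' C'0 hC'] := resol_le_of_diag (d := d) rho c20 C0.
pose a := rho * d%:R / (2 * g); pose b := 1 - rho / 2.
pose pa := d%:R / (2 * alpha + d%:R); pose pb := d%:R / (2 * beta + d%:R).
have rho_le : rho <= 1 by rewrite ge_min lexx.
have pred s : 0 < s -> s < g -> 2 * s < d%:R -> 2 * (g - s) < d%:R ->
    d%:R / (2 * s + d%:R) < a /\ b < d%:R / (2 * s + d%:R).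
  move=> s0 sg sd gsd; have D0 : 0 < 2 * s + d%:R by rewrite addr_gt0// mulr_gt0.
  split.
    rewrite /a ltr_pdivrMr// mulrAC ltr_pdivlMr ?mulr_gt0//.
    rewrite [rho * _]mulrC -!mulrA ltr_pM2l// -ltr_pdivrMr// lt_min; apply/andP; split.
      by rewrite ltr_pdivrMr// mul1r; lra.
    rewrite /e_IF ltr_pdivrMr// mulrAC ltr_pdivlMr//.
    rewrite -subr_gt0 (_ : _ - _ = 2 * g * (2 * s + (d%:R - 2 * (g - s)))); last by ring.
    by rewrite mulr_gt0 ?mulr_gt0// addr_gt0 ?mulr_gt0// subr_gt0.
  rewrite /b ltr_pdivlMr//.
  suff : 4 * s < rho * (2 * s + d%:R) by move: rho => x hx; nra.
  rewrite -ltr_pdivrMr// lt_min; apply/andP; split.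
    by rewrite ltr_pdivrMr// mul1r; lra.
  rewrite /e_IF ltr_pdivrMr// mulrAC ltr_pdivlMr//.
  rewrite -subr_gt0 (_ : _ - _ = 4 * d%:R * (g - s)); last by ring.
  by rewrite mulr_gt0 ?mulr_gt0// subr_gt0.
have [pa1 pa2] : pa < a /\ b < pa.
  by apply: pred => //; rewrite ?ltrDl// addrAC subrr add0r.
have [pb1 pb2] : pb < a /\ b < pb.
  by apply: pred => //; rewrite ?ltrDr// addrK.
pose e := Num.min (Num.min (a - pa) (a - pb)) (Num.min (pa - b) (pb - b)).
have e0 : 0 < e by rewrite !lt_min !subr_gt0 pa1 pb1 pa2.
pose c := Num.min (Num.min (c' / cp1) (c' / cp2)) (Num.min (cp1 / C') (cp2 / C')).
have c0 : 0 < c by rewrite !lt_min !divr_gt0.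
apply: (cvg_pinfty_powR (n0 := n1) c0 e0) => n nn n0.
have n0' : 0 < n%:R :> R by rewrite ltr0n.
have hr := hC n nn.
have hmax : c' * n%:R `^ a <= k (maxn (j1 n) (j2 n)).
  apply: hc' => //; rewrite -lee_fin -rate_IFE//.
  exact: (le_trans (h1 n _ _ n0 (l1 n) (l2 n))).
have hmin : k (minn (j1 n) (j2 n)) <= C' * n%:R `^ b.
  apply: hC' => //; rewrite -lee_fin -rate_IFE//.
  exact: (le_trans (h2 n _ _ n0 (l1 n) (l2 n))).
have pw s : 0 < n%:R `^ s :> R by exact: powR_gt0.
have up (cp p : R) : 0 < cp -> c <= c' / cp -> e <= a - p ->
    c * n%:R `^ e <= k (maxn (j1 n) (j2 n)) / (cp * n%:R `^ p).
  move=> cp0 cc ee; rewrite ler_pdivlMr ?mulr_gt0//; apply: le_trans hmax.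
  rewrite mulrACA powR_addn//; apply: ler_pM; rewrite ?powR_ge0 ?mulr_ge0 ?(ltW c0) ?(ltW cp0)//.
    by rewrite -ler_pdivlMr.
  by apply: powR_le => //; lra.
have dn (cp p : R) : 0 < cp -> c <= cp / C' -> e <= p - b ->
    c * n%:R `^ e <= cp * n%:R `^ p / k (minn (j1 n) (j2 n)).
  move=> cp0 cc ee; rewrite ler_pdivlMr ?resol_gt0//.
  apply: (@le_trans _ _ (c * n%:R `^ e * (C' * n%:R `^ b))).
    by rewrite ler_wpM2l// mulr_ge0 ?powR_ge0// ltW.
  rewrite mulrACA powR_addn//; apply: ler_pM; rewrite ?powR_ge0 ?mulr_ge0 ?(ltW c0) ?(ltW C'0)//.
    by rewrite -ler_pdivlMr.
  by apply: powR_le => //; lra.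
have u1 := up cp1 pa cp10; have u2 := up cp2 pb cp20.
have w1 := dn cp1 pa cp10; have w2 := dn cp2 pb cp20.
rewrite /k_seq /k_pred -/pa -/pb le_max.
case/orP: (leq_total (j1 n) (j2 n)) => jj.
  rewrite (maxn_idPr jj) in u1 u2; rewrite (minn_idPl jj) in w1 w2.
  apply/orP; right; rewrite le_min u2 ?w1//; by rewrite !ge_min lexx ?orbT.
rewrite (maxn_idPl jj) in u1 u2; rewrite (minn_idPr jj) in w1 w2.
apply/orP; left; rewrite le_min u1 ?w2//; by rewrite !ge_min lexx ?orbT.
Qed.

End IF_rates.

(** * The attained rates and the minimax rate *)

Section attained_rates.
Context {R : realType} {d J0 S : nat} (W : wavelets R d).
Hypotheses (hW : cdv_basis W J0 S) (hd : (1 <= d)%N).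
Variables (C1 C2 alpha beta M : R).
Hypotheses (alpha0 : 0 < alpha) (beta0 : 0 < beta) (M0 : 0 < M).
Local Notation Pm := (model W J0 C1 C2 alpha beta M).
Local Notation k := (@resol R d).
Local Notation g := (alpha + beta).
Let d0 : 0 < d%:R :> R. Proof. by rewrite ltr0n. Qed.
Let g0 : 0 < g. Proof. exact: addr_gt0. Qed.

Lemma choose_levels (x : nat -> R) : (forall n, (0 < n)%N -> 1 <= x n) ->
  exists j : nat -> nat, levels J0 j /\
    forall n, (0 < n)%N -> x n <= k (j n) <= @level_gap R d J0 * x n.
Proof.
move=> hx; have h n : exists j, (J0 <= j)%N /\
    ((0 < n)%N -> x n <= k j <= @level_gap R d J0 * x n).
  have [->|n0] := posnP n; first by exists J0.
  by have [j [hj h1 h2]] := exists_level (J0 := J0) hd (hx n n0); exists j; rewrite h1 h2.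
have [j hj] := choice h; exists j; split => n; first by case: (hj n).
by case: (hj n).
Qed.

Lemma plugin_achieves : exists j, [/\ levels J0 j,
  achieves Pm (psi_INT W) (rate_plugin (d := d) alpha beta) j j &
  achieves Pm (psi_MC W) (rate_plugin (d := d) alpha beta) j j].
Proof.
have gap0 := level_gap_gt0 (R := R) (d := d) (J0 := J0); set L := @level_gap R d J0 in gap0.
have [C C0 hC] := risk_le_plugin hW C1 C2 alpha0 beta0 M0 gap0.
have gd0 : 0 < g + d%:R by rewrite addr_gt0.
(* the resolution at which the bias and the diagonal term have the same order *)
pose x n : R := n%:R `^ (d%:R / (g + d%:R)).
have x1 n : (0 < n)%N -> 1 <= x n.
  by move=> n0; rewrite -[leLHS](powRr0 (n%:R : R)); apply: powR_le => //; rewrite divr_ge0// ltW.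
have [j [hj kj]] := choose_levels x1; exists j.
have main n : (0 < n)%N -> [/\ k (j n) <= L * n%:R,
    n%:R^-1 <= rate_plugin (d := d) alpha beta n,
    (k (j n) / n%:R) ^+ 2 <= L ^+ 2 * rate_plugin (d := d) alpha beta n &
    (2 `^ (- ((j n)%:R * g))) ^+ 2 <= rate_plugin (d := d) alpha beta n].
  move=> n0; have /andP[k1 k2] := kj n n0; rewrite rate_pluginE//.
  have n0' : 0 < n%:R :> R by rewrite ltr0n.
  set rho := Num.min _ _; have rho1 : rho <= 1 by rewrite ge_min lexx.
  have rhoe : rho <= e_plugin d alpha beta by rewrite ge_min lexx orbT.
  split.
  - apply: (le_trans k2); rewrite ler_pM2l// [leRHS]powR_nat1; apply: powR_le => //.
    by rewrite ler_pdivrMr// mul1r lerDr ltW.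
  - by rewrite powR_natV; apply: powR_le => //; rewrite lerN2.
  - apply: (@le_trans _ _ ((L * (x n / n%:R)) ^+ 2)).
      apply: lerXn2r; rewrite ?nnegrE.
      + by rewrite divr_ge0// ltW// resol_gt0.
      + by rewrite mulr_ge0 ?(ltW gap0)// divr_ge0// powR_ge0.
      + by rewrite mulrA ler_wpM2r// invr_ge0.
    rewrite exprMn ler_wpM2l ?sqr_ge0// /x powR_natV powR_addn//.
    rewrite -powR_mulrn ?powR_ge0// -powRrM; apply: powR_le => //.
    rewrite (_ : _ * _ = - e_plugin d alpha beta) ?lerN2//.
    by rewrite /e_plugin; field; rewrite gt_eqF.
  - apply: (le_trans (sqr_bias_le hd (ltW g0) (lt_le_trans ltr01 (x1 n n0)) k1)).
    rewrite /x -powRrM; apply: powR_le => //.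
    rewrite (_ : _ * _ = - e_plugin d alpha beta) ?lerN2//.
    by rewrite /e_plugin; field; rewrite !gt_eqF.
have Q0 : 0 < C * (2 + L ^+ 2) by rewrite mulr_gt0// addr_gt0// exprn_gt0.
have fin n : (0 < n)%N -> C * (n%:R^-1 + (k (j n) / n%:R) ^+ 2 +
    (2 `^ (- ((j n)%:R * g))) ^+ 2) <= C * (2 + L ^+ 2) * rate_plugin (d := d) alpha beta n.
  move=> n0; have [_ h1 h2 h3] := main n n0.
  move: h1 h2 h3; set rr := rate_plugin _ _ _ => h1 h2 h3.
  rewrite -mulrA ler_pM2l// (_ : (2 + L ^+ 2) * rr = rr + L ^+ 2 * rr + rr); last by ring.
  by apply: lerD => //; exact: lerD.
split => //; apply: (lesssim_le Q0) => n n0; have [h _ _ _] := main n n0;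
  have [u1 u2] := hC n (j n) n0 (hj n) h.
- by apply: (le_trans u1); rewrite lee_fin; exact: fin.
- by apply: (le_trans u2); rewrite lee_fin; exact: fin.
Qed.

(** The larger resolution is at least [n], so that the approximation error is negligible,
    and larger when the nonparametric rate requires it. *)
Lemma IF_achieves : exists j1 j2, [/\ levels J0 j1, levels J0 j2 &
  achieves Pm (psi_IF W) (rate_IF (d := d) alpha beta) j1 j2].
Proof.
have gap0 := level_gap_gt0 (R := R) (d := d) (J0 := J0); set L := @level_gap R d J0 in gap0.
have [C C0 hC] := risk_le_IF hW C1 C2 alpha0 beta0 M0.
have gd0 : 0 < 2 * alpha + 2 * beta + d%:R by rewrite !addr_gt0// mulr_gt0.
(* resol l = n ^ s balances the squared bias with resol l / n ^ 2 *)
pose s : R := 2 * d%:R / (2 * alpha + 2 * beta + d%:R).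
pose t := Num.max 1 s; pose x n : R := n%:R `^ t.
have t1 : 1 <= t by rewrite le_max lexx.
have ts : s <= t by rewrite le_max lexx orbT.
have x1 n : (0 < n)%N -> 1 <= x n.
  by move=> n0; rewrite -[leLHS](powRr0 (n%:R : R)); apply: powR_le => //; lra.
have [j [hj kj]] := choose_levels x1; exists (fun=> J0), j; split => //.
have Q0 : 0 < C * (2 + L) by rewrite mulr_gt0// addr_gt0.
apply: (lesssim_le Q0) => n n0; apply: (le_trans (hC n (j n) n0 (hj n))); rewrite lee_fin.
have /andP[k1 k2] := kj n n0; rewrite rate_IFE//.
have n0' : 0 < n%:R :> R by rewrite ltr0n.
set rho := Num.min _ _; have rho1 : rho <= 1 by rewrite ge_min lexx.
have rhoe : rho <= e_IF d alpha beta by rewrite ge_min lexx orbT.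
have es : e_IF d alpha beta = 2 - s by rewrite /e_IF /s; field; rewrite gt_eqF.
have h1 : n%:R^-1 <= n%:R `^ (- rho) :> R.
  by rewrite powR_natV; apply: powR_le => //; rewrite lerN2.
have h2 : k (j n) / n%:R ^+ 2 <= L * n%:R `^ (- rho).
  rewrite ler_pdivrMr ?exprn_gt0//; apply: (le_trans k2); rewrite -(mulrA L) ler_pM2l//.
  rewrite -powR_mulrn ?(ltW n0')// powR_addn//; apply: powR_le => //.
  by rewrite /t ge_max; apply/andP; split; lra.
have h3 : (2 `^ (- ((j n)%:R * g))) ^+ 2 <= n%:R `^ (- rho).
  apply: (le_trans (sqr_bias_le hd (ltW g0) (lt_le_trans ltr01 (x1 n n0)) k1)).
  rewrite /x -powRrM; apply: powR_le => //; rewrite mulrN lerN2.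
  apply: (le_trans rhoe); apply: (@le_trans _ _ (s * (2 * g / d%:R))).
    by rewrite le_eqVlt; apply/orP; left; apply/eqP; rewrite /e_IF /s; field; rewrite !gt_eqF.
  by rewrite ler_wpM2r// divr_ge0 ?mulr_ge0// ltW.
move: h1 h2 h3; set rr := n%:R `^ (- rho) => h1 h2 h3.
rewrite -mulrA ler_pM2l// (_ : (2 + L) * rr = rr + L * rr + rr); last by ring.
by apply: lerD => //; exact: lerD.
Qed.

Variables (dl gam : R) (P0 B0 p0 b0 : d.-tuple R -> R).
Hypothesis hbase : @base_point R d J0 W C1 C2 alpha beta M dl gam P0 B0 p0 b0.

(** Beyond the parametric rate, the least favourable resolution is the one at
    which the mixtures stop being distinguishable. *)
Lemma minimax_lower : exists2 c : R, 0 < c & forall n (T : data R d n -> R),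
  (0 < n)%N -> measurable_fun setT T ->
  ((c * rate_IF (d := d) alpha beta n)%:E <= max_risk Pm T)%E.
Proof.
have [ca ca0 ha] := minimax_parametric hW hd hbase.
have [cb cb0 hb] := minimax_mixture hW hd alpha0 beta0 hbase.
have gap0 := level_gap_gt0 (R := R) (d := d) (J0 := J0); set L := @level_gap R d J0 in gap0.
have gd0 : 0 < 2 * alpha + 2 * beta + d%:R by rewrite !addr_gt0// mulr_gt0.
pose q := L `^ (- (2 * g / d%:R)); have q0 : 0 < q by exact: powR_gt0.
pose c := Num.min ca (cb ^+ 2 * q).
have c0 : 0 < c by rewrite lt_min ca0 mulr_gt0// exprn_gt0.
exists c => // n T n0 mT; rewrite rate_IFE//; have n0' : 0 < n%:R :> R by rewrite ltr0n.
have [e1|e1] := leP 1 (e_IF d alpha beta).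
  apply: le_trans (ha n T n0 mT); rewrite lee_fin -powR_natV ler_wpM2r ?invr_ge0//.
  by rewrite ge_min lexx.
pose s : R := 2 * d%:R / (2 * alpha + 2 * beta + d%:R).
have es : e_IF d alpha beta = 2 - s by rewrite /e_IF /s; field; rewrite gt_eqF.
have s1 : 1 <= s by lra.
have x1 : 1 <= n%:R `^ s :> R.
  by rewrite -[leLHS](powRr0 (n%:R : R)); apply: powR_le => //; lra.
have [l [hl k1 k2]] := exists_level (J0 := J0) hd x1.
have sg : s * (2 * g / d%:R) = e_IF d alpha beta.
  by rewrite /e_IF /s; field; rewrite !gt_eqF.
have nk : n%:R <= k l.
  by apply: le_trans k1; rewrite -[leLHS]powRr1//; exact: (powR_le n0 s1).
have hn2 : n%:R ^+ 2 * (2 `^ (- (l%:R * g))) ^+ 2 <= k l.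
  apply: (le_trans _ k1).
  apply: (@le_trans _ _ (n%:R ^+ 2 * (n%:R `^ s) `^ (- (2 * g / d%:R)))).
    rewrite ler_wpM2l ?sqr_ge0//; apply: (sqr_bias_le hd (ltW g0) _ k1).
    exact: lt_le_trans x1.
  rewrite -powR_mulrn ?(ltW n0')// -powRrM powR_addn//; apply: powR_le => //.
  by rewrite mulrN sg es; lra.
apply: le_trans (hb n l T n0 hl mT nk hn2); rewrite lee_fin exprMn.
apply: (@le_trans _ _ (cb ^+ 2 * q * n%:R `^ (- e_IF d alpha beta))).
  by rewrite ler_wpM2r ?powR_ge0// ge_min lexx orbT.
rewrite -mulrA ler_wpM2l ?sqr_ge0//; apply: le_trans (sqr_bias_ge hd (ltW g0) k2).
by rewrite powRM ?powR_ge0 ?(ltW gap0)// -powRrM mulrN sg.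
Qed.

End attained_rates.

Theorem corollary6 (R : realType) (d J0 S : nat) (W : wavelets R d)
    (C1 C2 alpha beta M c1 c2 : R)
    (hd : (1 <= d)%N) (hS : (1 <= S)%N) (hJ0 : (S <= 2 ^ J0)%N)
    (hSab : Num.max alpha beta < S%:R) (hW : cdv_basis W J0 S)
    (halpha : 0 < alpha) (hbeta : 0 < beta) (hM : 0 < M)
    (hnd : nondegenerate_class W J0 C1 C2 alpha beta M)
    (hc1 : 0 < c1) (hc2 : 0 < c2) :
  let Pm := model W J0 C1 C2 alpha beta M in
  let r := rate_plugin (d := d) alpha beta in
  let rIF := rate_IF (d := d) alpha beta in
  [/\ [/\ best_rate J0 Pm (psi_INT W) r,
          beta < Num.min alpha (d%:R / 2) ->
            requires_undersmoothing1 J0 Pm (psi_INT W) r c1 alpha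
        & alpha < Num.min beta (d%:R / 2) ->
            requires_undersmoothing2 J0 Pm (psi_INT W) r c2 beta],
      [/\ best_rate J0 Pm (psi_MC W) r,
          beta < Num.min alpha (d%:R / 2) ->
            requires_undersmoothing1 J0 Pm (psi_MC W) r c1 alpha
        & alpha < Num.min beta (d%:R / 2) ->
            requires_undersmoothing2 J0 Pm (psi_MC W) r c2 beta]
    & [/\ best_rate J0 Pm (psi_IF W) rIF,
          minimax_rate Pm rIF
        & Num.max alpha beta < d%:R / 2 ->
            requires_under_and_oversmoothing J0 Pm (psi_IF W) rIF
              c1 alpha c2 beta]].

Proof.
move=> Pm r rIF.
have [dl [gam [P0 [B0 [p0 [b0 hbase]]]]]] := exists_base_point hW hS hnd.
have [cb cb0 hb] := risk_ge_bias hW hd halpha hbeta hbase.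
have [cd cd0 hcd] := risk_ge_diag hW hd hbase.
have [cp cp0 hp] := minimax_parametric hW hd hbase.
have [cm cm0 hm] := minimax_lower hW hd halpha hbeta hbase.
have [jp [ljp ai am]] := plugin_achieves hW hd C1 C2 halpha hbeta hM.
have [i1 [i2 [li1 li2 aF]]] := IF_achieves hW hd C1 C2 halpha hbeta hM.
pose rkI n j1 j2 := max_risk Pm (psi_INT W j1 j2 (n := n)).
pose rkM n j1 j2 := max_risk Pm (psi_MC W j1 j2 (n := n)).
pose rkF n j1 j2 := max_risk Pm (psi_IF W j1 j2 (n := n)).
have mI n j1 j2 h1 h2 := @measurable_psi_INT R d J0 S W hW j1 j2 n h1 h2.
have mM n j1 j2 h1 h2 := @measurable_psi_MC R d J0 S W hW j1 j2 n h1 h2.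
have mF n j1 j2 h1 h2 := @measurable_psi_IF R d J0 S W hW j1 j2 n h1 h2.
have bI n j1 j2 : (0 < n)%N -> (J0 <= j1)%N -> (J0 <= j2)%N ->
    (((cb * 2 `^ (- ((minn j1 j2)%:R * (alpha + beta)))) ^+ 2)%:E <= rkI n j1 j2)%E.
  by move=> n0 h1 h2; case: (hb n j1 j2 n0 h1 h2).
have bM n j1 j2 : (0 < n)%N -> (J0 <= j1)%N -> (J0 <= j2)%N ->
    (((cb * 2 `^ (- ((minn j1 j2)%:R * (alpha + beta)))) ^+ 2)%:E <= rkM n j1 j2)%E.
  by move=> n0 h1 h2; case: (hb n j1 j2 n0 h1 h2).
have bF n j1 j2 : (0 < n)%N -> (J0 <= j1)%N -> (J0 <= j2)%N ->
    (((cb * 2 `^ (- ((maxn j1 j2)%:R * (alpha + beta)))) ^+ 2)%:E <= rkF n j1 j2)%E.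
  by move=> n0 h1 h2; case: (hb n j1 j2 n0 h1 h2).
have dI n j1 j2 : (0 < n)%N -> (J0 <= j1)%N -> (J0 <= j2)%N ->
    (((cd * (@resol R d (minn j1 j2) / n%:R)) ^+ 2)%:E <= rkI n j1 j2)%E.
  by move=> n0 h1 h2; case: (hcd n j1 j2 n0 h1 h2).
have dM n j1 j2 : (0 < n)%N -> (J0 <= j1)%N -> (J0 <= j2)%N ->
    (((cd * (@resol R d (minn j1 j2) / n%:R)) ^+ 2)%:E <= rkM n j1 j2)%E.
  by move=> n0 h1 h2; case: (hcd n j1 j2 n0 h1 h2).
have dF n j1 j2 : (0 < n)%N -> (J0 <= j1)%N -> (J0 <= j2)%N ->
    (((cd * (@resol R d (minn j1 j2) / n%:R)) ^+ 2)%:E <= rkF n j1 j2)%E.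
  by move=> n0 h1 h2; case: (hcd n j1 j2 n0 h1 h2).
have pI n j1 j2 : (0 < n)%N -> (J0 <= j1)%N -> (J0 <= j2)%N ->
    ((cp / n%:R)%:E <= rkI n j1 j2)%E.
  by move=> n0 h1 h2; exact: hp n0 (mI n j1 j2 h1 h2).
have pM n j1 j2 : (0 < n)%N -> (J0 <= j1)%N -> (J0 <= j2)%N ->
    ((cp / n%:R)%:E <= rkM n j1 j2)%E.
  by move=> n0 h1 h2; exact: hp n0 (mM n j1 j2 h1 h2).
have g1 : beta < alpha -> alpha + beta < alpha + alpha by move=> ?; rewrite ltrD2l.
have g2 : alpha < beta -> alpha + beta < beta + beta by move=> ?; rewrite ltrD2r.
have half (x : R) : x < d%:R / 2 -> 2 * x < d%:R by lra.
have geml (j1 j2 : nat -> nat) n : (minn (j1 n) (j2 n) <= j1 n)%N by exact: geq_minl.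
have gemr (j1 j2 : nat -> nat) n : (minn (j1 n) (j2 n) <= j2 n)%N by exact: geq_minr.
split.
- split.
  + split; first by exists jp, jp.
    exact: (plugin_lower hd halpha hbeta cb0 cd0 cp0 bI dI pI).
  + rewrite lt_min => /andP[h1 h2] j1 j2 l1 l2 ach.
    apply: (plugin_undersmoothing hd halpha hbeta cb0 hc1 bI l1 l2 ach (geml j1 j2) halpha (g1 h1)).
    by rewrite addrAC subrr add0r; exact: half.
  + rewrite lt_min => /andP[h1 h2] j1 j2 l1 l2 ach.
    apply: (plugin_undersmoothing hd halpha hbeta cb0 hc2 bI l1 l2 ach (gemr j1 j2) hbeta (g2 h1)).
    by rewrite addrK; exact: half.
- split.
  + split; first by exists jp, jp.
    exact: (plugin_lower hd halpha hbeta cb0 cd0 cp0 bM dM pM).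
  + rewrite lt_min => /andP[h1 h2] j1 j2 l1 l2 ach.
    apply: (plugin_undersmoothing hd halpha hbeta cb0 hc1 bM l1 l2 ach (geml j1 j2) halpha (g1 h1)).
    by rewrite addrAC subrr add0r; exact: half.
  + rewrite lt_min => /andP[h1 h2] j1 j2 l1 l2 ach.
    apply: (plugin_undersmoothing hd halpha hbeta cb0 hc2 bM l1 l2 ach (gemr j1 j2) hbeta (g2 h1)).
    by rewrite addrK; exact: half.
- split.
  + split; first by exists i1, i2.
    by move=> j1 j2 l1 l2; apply: (lesssim_ge cm0) => n n0; exact: hm (mF n _ _ (l1 n) (l2 n)).
  + split.
      have [C [C0 [n1 hC]]] := aF; exists C; split => //; exists n1 => n nn.
      apply: le_trans (hC n nn); apply: ereal_inf_lbound.
      by exists (psi_IF W (i1 n) (i2 n) (n := n)) => //; exact: mF.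
    apply: (lesssim_ge cm0) => n n0; apply: le_ereal_inf_tmp => _ [T mT <-].
    exact: hm.
  + rewrite gt_max => /andP[h1 h2] j1 j2 l1 l2 ach.
    exact: (IF_under_over hd halpha hbeta cb0 cd0 hc1 hc2 bF dF (half _ h1) (half _ h2) l1 l2 ach).
Qed.
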